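(* Suppose $n\ge 1$. Let $\mathcal{Q}\subseteq H^2(\mathbb{B}^n)$ be a finite-dimensional quotient module and let $X\in\mathcal{B}_1(\mathcal{Q})$ be a nonconstant module map. Let $\psi=X(P_{\mathcal{Q}}1)$ and let $X_{\mathcal{Q}}:(\mathcal{M}_{\mathcal{Q}},\|\cdot\|_1)\to\mathbb{C}$ be the functional $X_{\mathcal{Q}}f=\int_{\mathbb{S}^n}\psi f\,d\sigma$. The following are equivalent: (1) $X$ admits a norm-preserving lift, i.e. there exists $\varphi\in\mathcal{S}(\mathbb{B}^n)$ with $X=S_\varphi$ and $\|X\|=\|\varphi\|_\infty$. (2) $\|X\|=\|X_{\mathcal{Q}}\|$. (3) $n=1$.
   Context: $\mathbb{B}^n$ is the open unit ball of $\mathbb{C}^n$, $\mathbb{S}^n=\partial\mathbb{B}^n$, $\sigma$ the normalized surface measure on $\mathbb{S}^n$. $H^\infty(\mathbb{B}^n)$: bounded analytic functions on $\mathbb{B}^n$ with sup norm $\|\cdot\|_\infty$; $\mathcal{S}(\mathbb{B}^n)$: its closed unit ball. $H^2(\mathbb{B}^n)$: the Hardy space of analytic $f$ on $\mathbb{B}^n$ with $\|f\|^2=\sup_{0<r<1}\int_{\mathbb{S}^n}|f(r\zeta)|^2d\sigma(\zeta)<\infty$. Via boundary values ($K$-limits, a.e. equal to radial limits), $H^2(\mathbb{B}^n)$ is identified unitarily with $H^2(\mathbb{S}^n)=\overline{\mathbb{C}[z_1,\dots,z_n]}^{L^2(\mathbb{S}^n)}$. For $\varphi\in H^\infty(\mathbb{B}^n)$,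 $T_\varphi f=\varphi f$ on $H^2(\mathbb{B}^n)$. A quotient module is a nonzero closed subspace $\mathcal{Q}\subseteq H^2(\mathbb{B}^n)$ with $T_{z_i}^*\mathcal{Q}\subseteq\mathcal{Q}$ for all $i=1,\dots,n$; $P_{\mathcal{Q}}$ is the orthogonal projection onto $\mathcal{Q}$ and $S_\varphi=P_{\mathcal{Q}}T_\varphi|_{\mathcal{Q}}$. $\mathcal{B}_1(\mathcal{Q})$: bounded operators on $\mathcal{Q}$ of norm at most $1$. A bounded operator $X$ on $\mathcal{Q}$ is a module map if $XS_{z_i}=S_{z_i}X$ for all $i$; it is nonconstant if it is not a scalar multiple of the identity. For $S\subseteq L^2(\mathbb{S}^n)$, $S^{conj}=\{\overline f:f\in S\}$. $\mathcal{M}(\mathbb{S}^n)=L^2(\mathbb{S}^n)\ominus[H^2(\mathbb{S}^n)+H^2(\mathbb{S}^n)^{conj}]$; $H^2_0(\mathbb{S}^n)=H^2(\mathbb{S}^n)\ominus\{1\}$. $\mathcal{M}_{\mathcal{Q}}=\mathcal{Q}^{conj}\dot+[\mathcal{M}(\mathbb{S}^n)\dot+H^2_0(\mathbb{S}^n)]$ ($\dot+$ = algebraic direct sum), viewed as a subspace of $L^1(\mathbb{S}^n)$ with the $L^1$ norm $\|\cdot\|_1$. $\|X_{\mathcal{Q}}\|$ is the norm of $X_{\mathcal{Q}}$ as a linear functional on $(\mathcal{M}_{\mathcal{Q}},\|\cdot\|_1)$. *)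

(* Defs.v *)
From HB Require Import structures.
From mathcomp Require Import all_boot all_order all_algebra.
From mathcomp Require Import all_classical all_reals all_analysis.
From mathcomp Require Import measurable_realfun.
From mathcomp Require Import complex ring lra.
From mathcomp Require mpoly.

Set Implicit Arguments.
Unset Strict Implicit.
Unset Printing Implicit Defensive.
Import Order.TTheory GRing.Theory Num.Theory.
Import numFieldNormedType.Exports.
Local Open Scope classical_set_scope.
Local Open Scope ring_scope.
Local Open Scope complex_scope.

(* R[i] is the field of complex numbers over R, normed over
   itself; differentiability over R[i] is complex differentiability. *)
HB.instance Definition _ (R : rcfType) := NormedModule.copy R[i] R[i]^o.

Section borel_complex.
Context {R : realType}.
Local Notation C := R[i].

(* The Borel sigma-algebras of C and C^n, generated by the coordinates. *)
Definition complex_measurable : set (set C) :=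
  g_sigma_preimageU (@complex.Re R) (@complex.Im R).

HB.instance Definition _ := @isMeasurable.Build default_measure_display
  R[i] complex_measurable (@sigma_algebra0 _ setT _)
  (@sigma_algebraC _ _) (@sigma_algebra_bigcup _ setT _).

Lemma measurable_Re : measurable_fun [set: C] (@complex.Re R).
Proof.
move=> _ Y mY; apply: sub_sigma_algebra; left.
by exists Y.
Qed.

Lemma measurable_Im : measurable_fun [set: C] (@complex.Im R).
Proof.
move=> _ Y mY; apply: sub_sigma_algebra; right.
by exists Y.
Qed.

Lemma measurable_fun_complex d (T : measurableType d) (f : T -> C) :
  measurable_fun setT (@complex.Re R \o f) ->
  measurable_fun setT (@complex.Im R \o f) ->
  measurable_fun setT f.
Proof.
move=> mRe mIm.
apply: (@measurability _ _ _ _ setT f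
  (preimage_set_system setT (@complex.Re R) measurable `|`
   preimage_set_system setT (@complex.Im R) measurable)) => //.
move=> _ [_ [[Y mY <-]|[Y mY <-]] <-]; rewrite !setTI -comp_preimage.
- by rewrite -[X in measurable X]setTI; exact: mRe.
- by rewrite -[X in measurable X]setTI; exact: mIm.
Qed.

Definition rowC_measurable n : set (set 'rV[C]_n) :=
  g_sigma_preimage (fun (i : 'I_n) (v : 'rV[C]_n) => v ord0 i).

HB.instance Definition _ n := @isMeasurable.Build default_measure_display
  'rV[R[i]]_n (rowC_measurable (n := n)) (@sigma_algebra0 _ setT _)
  (@sigma_algebraC _ _) (@sigma_algebra_bigcup _ setT _).

Lemma measurable_coord n (i : 'I_n) :
  measurable_fun [set: 'rV[C]_n] (fun v : 'rV[C]_n => v ord0 i).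
Proof.
move=> _ Y mY; rewrite setTI; apply: sub_sigma_algebra => /=.
rewrite -bigcup_seq/=; exists i => /=; first by rewrite mem_index_enum.
by exists Y => //; rewrite setTI.
Qed.

Lemma measurable_fun_row d (T : measurableType d) n (f : T -> 'rV[C]_n) :
  (forall i, measurable_fun [set: T] (fun x => f x ord0 i)) ->
  measurable_fun [set: T] f.
Proof.
move=> mf.
apply: (@measurability _ _ _ _ setT f
  (\big[setU/set0]_(i < n) preimage_set_system setT
     (fun v : 'rV[C]_n => v ord0 i) measurable)) => //.
move=> _ [B + <-]; rewrite -bigcup_seq => -[i /= _ [Y mY <-]].
rewrite setTI setTI -comp_preimage -[X in measurable X]setTI.
exact: mf.
Qed.

End borel_complex.

Section lebesgue_complex.
Context {R : realType}.
Local Notation C := R[i].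

Lemma sigma_finite_product_measure d1 d2 (T1 : measurableType d1)
    (T2 : measurableType d2) (m1 : {sigma_finite_measure set T1 -> \bar R})
    (m2 : {sigma_finite_measure set T2 -> \bar R}) :
  sigma_finite setT (m1 \x m2)%E.
Proof.
have /sigma_finiteP[F [TF ndF Foo]] := sigma_finiteT m1.
have /sigma_finiteP[G [TG ndG Goo]] := sigma_finiteT m2.
exists (fun n => F n `*` G n).
  rewrite -setXTT TF TG predeqE => -[x y]; split.
    move=> [/= [n _ Fnx] [k _ Gky]]; exists (maxn n k) => //; split.
    - by move: x Fnx; exact/subsetPset/ndF/leq_maxl.
    - by move: y Gky; exact/subsetPset/ndG/leq_maxr.
  by move=> [n _ []/= ? ?]; split; exists n.
move=> k; have [? ?] := Foo k; have [? ?] := Goo k.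
split; first exact: measurableX.
by rewrite product_measure1E// lte_mul_pinfty// ge0_fin_numE.
Qed.

Lemma sigma_finite_pushforward d1 d2 (T1 : measurableType d1)
    (T2 : measurableType d2) (m : set T1 -> \bar R) (f : T1 -> T2)
    (g : T2 -> T1) :
  measurable_fun setT g -> cancel f g -> sigma_finite setT m ->
  sigma_finite setT (pushforward m f).
Proof.
move=> mg fK [F TF Foo]; exists (fun n => g @^-1` F n).
  by rewrite -preimage_bigcup -TF preimage_setT.
move=> n; have [mF Fn] := Foo n; split.
  by rewrite -[X in measurable X]setTI; exact: mg.
rewrite /pushforward -comp_preimage (_ : g \o f = id) ?preimage_id//.
by apply/funext => x /=; rewrite fK.
Qed.

Definition pair_complex (p : measurableTypeR R * measurableTypeR R) : C :=
  p.1 +i* p.2.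

Lemma measurable_pair_complex : measurable_fun setT pair_complex.
Proof.
by apply: measurable_fun_complex; [exact: measurable_fst|exact: measurable_snd].
Qed.

Definition lebesgue_complex : set C -> \bar R :=
  pushforward (lebesgue_measure \x lebesgue_measure)%E pair_complex.

Let lebesgue_complex0 : lebesgue_complex set0 = 0%E.
Proof. by rewrite /lebesgue_complex /pushforward preimage_set0 measure0. Qed.

Let lebesgue_complex_ge0 A : (0 <= lebesgue_complex A)%E.
Proof. exact: (@measure_ge0 _ _ _ (lebesgue_measure \x lebesgue_measure)%E). Qed.

Let lebesgue_complex_sigma_additive : semi_sigma_additive lebesgue_complex.
Proof.
apply: measure_semi_sigma_additive; exact: measurable_pair_complex.
Qed.

HB.instance Definition _ := isMeasure.Build _ _ _ lebesgue_complex
  lebesgue_complex0 lebesgue_complex_ge0 lebesgue_complex_sigma_additive.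

Let lebesgue_complex_sigma_finite : sigma_finite setT lebesgue_complex.
Proof.
apply: (@sigma_finite_pushforward _ _ _ _ _ _
  (fun z : C => (complex.Re z, complex.Im z) : measurableTypeR R * measurableTypeR R)).
- by apply: measurable_fun_pair; [exact: measurable_Re|exact: measurable_Im].
- by case.
- exact: sigma_finite_product_measure.
Qed.

HB.instance Definition _ := Measure_isSigmaFinite.Build _ _ _ lebesgue_complex
  lebesgue_complex_sigma_finite.

Definition cons_row n (p : C * 'rV[C]_n) : 'rV[C]_n.+1 :=
  \row_i oapp (p.2 ord0) p.1 (unlift ord0 i).

Lemma cons_row0 n (p : C * 'rV[C]_n) : cons_row p ord0 ord0 = p.1.
Proof. by rewrite mxE unlift_none. Qed.

Lemma cons_rowS n (p : C * 'rV[C]_n) j :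
  cons_row p ord0 (lift ord0 j) = p.2 ord0 j.
Proof. by rewrite mxE liftK. Qed.

Lemma measurable_cons_row n : measurable_fun setT (@cons_row n).
Proof.
apply: measurable_fun_row => i; case: (unliftP ord0 i) => [j|] ->.
  under eq_fun do rewrite cons_rowS.
  by apply: (measurableT_comp (measurable_coord j)); exact: measurable_snd.
by under eq_fun do rewrite cons_row0; exact: measurable_fst.
Qed.

Section cons_measure.
Variables (n : nat) (m1 : {sigma_finite_measure set C -> \bar R})
  (m2 : {sigma_finite_measure set 'rV[C]_n -> \bar R}).

Definition cons_measure : set 'rV[C]_n.+1 -> \bar R :=
  pushforward (m1 \x m2)%E (@cons_row n).

Let cons_measure0 : cons_measure set0 = 0%E.
Proof. by rewrite /cons_measure /pushforward preimage_set0 measure0. Qed.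

Let cons_measure_ge0 A : (0 <= cons_measure A)%E.
Proof. exact: (@measure_ge0 _ _ _ (m1 \x m2)%E). Qed.

Let cons_measure_sigma_additive : semi_sigma_additive cons_measure.
Proof.
apply: measure_semi_sigma_additive; exact: measurable_cons_row.
Qed.

HB.instance Definition _ := isMeasure.Build _ _ _ cons_measure
  cons_measure0 cons_measure_ge0 cons_measure_sigma_additive.

Let cons_measure_sigma_finite : sigma_finite setT cons_measure.
Proof.
apply: (@sigma_finite_pushforward _ _ _ _ _ _
  (fun v : 'rV[C]_n.+1 => (v ord0 ord0, \row_j v ord0 (lift ord0 j)))).
- apply: measurable_fun_pair; first exact: measurable_coord.
  apply: measurable_fun_row => i; under eq_fun do rewrite mxE.
  exact: measurable_coord.
- move=> [a v]; rewrite cons_row0; congr pair.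
  by apply/rowP => j; rewrite mxE cons_rowS.
- exact: sigma_finite_product_measure.
Qed.

HB.instance Definition _ := Measure_isSigmaFinite.Build _ _ _ cons_measure
  cons_measure_sigma_finite.

End cons_measure.

Fixpoint lebesgue_Cn n : {sigma_finite_measure set 'rV[C]_n -> \bar R} :=
  match n return {sigma_finite_measure set 'rV[C]_n -> \bar R} with
  | 0 => dirac (0 : 'rV[C]_0)
  | n'.+1 => cons_measure lebesgue_complex (lebesgue_Cn n')
  end.

End lebesgue_complex.

Section sphere.
Context {R : realType}.
Variable n : nat.
Local Notation C := R[i].
Local Notation Cn := 'rV[R[i]]_n.

Definition eucl_norm (z : Cn) : R :=
  Num.sqrt (\sum_(i < n) Normc.normc (z ord0 i) ^+ 2).

Definition radial_proj (z : Cn) : Cn := (eucl_norm z)^-1%:C *: z.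

Lemma normc2E (z : C) :
  Normc.normc z ^+ 2 = complex.Re z ^+ 2 + complex.Im z ^+ 2.
Proof. by case: z => a b /=; rewrite sqr_sqrtr// addr_ge0// sqr_ge0. Qed.

Lemma measurable_eucl_sqr : measurable_fun setT
  (fun z : Cn => \sum_(i < n) Normc.normc (z ord0 i) ^+ 2).
Proof.
apply: measurable_sum => i.
rewrite (_ : (fun _ => _) = fun z : Cn =>
  complex.Re (z ord0 i) ^+ 2 + complex.Im (z ord0 i) ^+ 2); last first.
  by apply/funext => z; rewrite normc2E.
by apply: measurable_funD; apply: measurable_funX;
  apply: measurableT_comp (measurable_coord i);
  [exact: measurable_Re | exact: measurable_Im].
Qed.

Lemma eucl_norm_powR z :
  eucl_norm z = (\sum_(i < n) Normc.normc (z ord0 i) ^+ 2) `^ 2^-1.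
Proof. by rewrite powR12_sqrt// sumr_ge0// => i _; exact: sqr_ge0. Qed.

Lemma measurable_eucl_norm : measurable_fun setT eucl_norm.
Proof.
rewrite (_ : eucl_norm = (fun s => s `^ 2^-1) \o
    (fun z : Cn => \sum_(i < n) Normc.normc (z ord0 i) ^+ 2)); last first.
  by apply/funext => z; exact: eucl_norm_powR.
by apply: measurableT_comp; [exact: measurable_powR|exact: measurable_eucl_sqr].
Qed.

Lemma measurable_radial_proj : measurable_fun setT radial_proj.
Proof.
have mV : measurable_fun setT (fun z => (eucl_norm z)^-1).
  rewrite (_ : (fun _ => _) = (fun s => s `^ (- 1)) \o eucl_norm); last first.
    by apply/funext => z /=; rewrite powR_inv1// sqrtr_ge0.
  by apply: measurableT_comp; [exact: measurable_powR|exact: measurable_eucl_norm].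
apply: measurable_fun_row => i; apply: measurable_fun_complex.
- rewrite (_ : _ \o _ = fun z : Cn => (eucl_norm z)^-1 * complex.Re (z ord0 i)).
    apply: measurable_funM => //.
    by apply: measurableT_comp (measurable_coord i); exact: measurable_Re.
  apply/funext => z /=; rewrite mxE; case: (z ord0 i) => a b /=.
  by rewrite mul0r subr0.
- rewrite (_ : _ \o _ = fun z : Cn => (eucl_norm z)^-1 * complex.Im (z ord0 i)).
    apply: measurable_funM => //.
    by apply: measurableT_comp (measurable_coord i); exact: measurable_Im.
  apply/funext => z /=; rewrite mxE; case: (z ord0 i) => a b /=.
  by rewrite mul0r addr0.
Qed.

Definition ball_set : set Cn := [set z | eucl_norm z < 1].

Lemma measurable_ball_set : measurable ball_set.
Proof.
rewrite (_ : ball_set = eucl_norm @^-1` `]-oo, 1[%classic).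
  by rewrite -[X in measurable X]setTI; exact: measurable_eucl_norm.
by apply/seteqP; split => z /=; rewrite in_itv.
Qed.

Lemma ball_volume_ge0 : 0 <= (fine (lebesgue_Cn n ball_set))^-1.
Proof. by rewrite invr_ge0 fine_ge0. Qed.

(* Normalized surface measure, as the cone measure
   sigma A = vol {z in the ball | z / |z| in A} / vol (ball).
   It is a measure on C^n carried by the unit sphere: a function on the sphere
   is represented by a function on C^n, whose values off the sphere are
   irrelevant. *)
Definition sphere_measure : set Cn -> \bar R :=
  pushforward (mscale (NngNum ball_volume_ge0)
                 (mrestr (lebesgue_Cn n) measurable_ball_set)) radial_proj.

Let sphere_measure0 : sphere_measure set0 = 0%E.
Proof. by rewrite /sphere_measure /pushforward preimage_set0 measure0. Qed.

Let sphere_measure_ge0 A : (0 <= sphere_measure A)%E.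
Proof. exact: (measure_ge0 (mscale _ _)). Qed.

Let sphere_measure_sigma_additive : semi_sigma_additive sphere_measure.
Proof.
apply: measure_semi_sigma_additive; exact: measurable_radial_proj.
Qed.

HB.instance Definition _ := isMeasure.Build _ _ _ sphere_measure
  sphere_measure0 sphere_measure_ge0 sphere_measure_sigma_additive.


Definition polydisc (s : R) : set Cn := [set z | forall i : 'I_n,
  `|complex.Re (z ord0 i)| <= s /\ `|complex.Im (z ord0 i)| <= s].
End sphere.

Section volume.
Context {R : realType}.
Local Notation C := R[i].

Lemma lebesgue_Cn_polydisc n (s : R) : 0 < s ->
  measurable (@polydisc R n s) /\
  (0 < lebesgue_Cn n (@polydisc R n s) < +oo)%E.
Proof.
move=> s0; elim: n => [|n [mP /andP[P0 Poo]]].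
  have -> : @polydisc R 0 s = setT by apply/seteqP; split => // z _ [].
  by split; [exact: measurableT|rewrite /= diracT lte01 ltry].
pose I : set (measurableTypeR R) := `[- s, s]%classic.
have mI : measurable I by exact: measurable_itv.
have lI : lebesgue_measure I = (s + s)%:E.
  by rewrite lebesgue_measure_itv/= lte_fin gtrN// -EFinD opprK.
pose S := [set z : C | `|complex.Re z| <= s /\ `|complex.Im z| <= s].
have preS : pair_complex @^-1` S = I `*` I.
  by apply/seteqP; split => -[a b]; rewrite /S /I /= !in_itv /= !ler_norml.
have mS : measurable S.
  rewrite (_ : S = (@complex.Re R) @^-1` I `&` (@complex.Im R) @^-1` I).
    apply: measurableI; rewrite -[X in measurable X]setTI;
    [exact: measurable_Re|exact: measurable_Im].
  by apply/seteqP; split => -[a b]; rewrite /S /I /= !in_itv /= !ler_norml.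
have lS : lebesgue_complex S = ((s + s) ^+ 2)%:E.
  rewrite /lebesgue_complex /pushforward preS.
  transitivity (lebesgue_measure I * lebesgue_measure I)%E.
    exact: product_measure1E.
  by rewrite lI -EFinM expr2.
have preP : @cons_row R n @^-1` (@polydisc R n.+1 s) = S `*` @polydisc R n s.
  apply/seteqP; split => p /=.
    by move=> H; split; [have := H ord0; rewrite cons_row0
      | move=> i; have := H (lift ord0 i); rewrite cons_rowS].
  by move=> [Sp Pp] i; case: (unliftP ord0 i) => [j|] ->;
    rewrite ?cons_row0// cons_rowS.
split.
  rewrite (_ : polydisc s = \bigcap_(i in [set: 'I_n.+1])
    ((fun z : 'rV[C]_n.+1 => z ord0 i) @^-1` S)); last first.
    by apply/seteqP; split => z /= H i; [move=> _; exact: H|exact: (H i Logic.I)].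
  apply: fin_bigcap_measurable => // i _.
  by rewrite -[X in measurable X]setTI; exact: measurable_coord.
rewrite /= /cons_measure /pushforward preP product_measure1E//.
have s2 : 0 < (s + s) ^+ 2 by rewrite exprn_gt0// addr_gt0.
by rewrite [X in (_ < X * _)%E]lS [X in (X * _ < _)%E]lS mule_gt0 ?lte_fin//
  lte_mul_pinfty ?lee_fin ?ltW.
Qed.

Lemma ball_volume n : (0 < lebesgue_Cn n (@ball_set R n) < +oo)%E.
Proof.
have sumE (z : 'rV[C]_n) : 0 <= \sum_(i < n) Normc.normc (z ord0 i) ^+ 2.
  by apply: sumr_ge0 => i _; exact: sqr_ge0.
have [m1 /andP[_ fin1]] := lebesgue_Cn_polydisc n (@ltr01 R).
pose s : R := (n.+1%:R *+ 2)^-1.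
have s0 : 0 < s by rewrite invr_gt0 pmulrn_lgt0.
have [m2 /andP[pos2 _]] := lebesgue_Cn_polydisc n s0.
apply/andP; split.
  apply: (lt_le_trans pos2); apply: le_measure; rewrite ?inE//.
    exact: measurable_ball_set.
  move=> z Pz; rewrite /ball_set /= /eucl_norm.
  rewrite -[ltRHS]sqrtr1 ltr_sqrt//.
  apply: (@le_lt_trans _ _ (\sum_(i < n) (s ^+ 2 *+ 2))).
    apply: ler_sum => i _; rewrite normc2E mulr2n; have [a b] := Pz i.
    by rewrite lerD// -real_normK ?num_real// lerXn2r ?nnegrE// ltW.
  rewrite sumr_const card_ord -[ltLHS]mulr_natr -[_ *+ 2]mulr_natr.
  have sn : s * (n%:R + 1) * 2 = 1.
    by rewrite /s -mulrA -natr1 mulr_natr mulVf// lt0r_neq0// pmulrn_lgt0 ?natr1.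
  nra.
apply: (le_lt_trans _ fin1); apply: le_measure; rewrite ?inE//.
  exact: measurable_ball_set.
move=> z; rewrite /ball_set /= /eucl_norm => z1 i.
have {}z1 : \sum_(i < n) Normc.normc (z ord0 i) ^+ 2 < 1.
  by move: z1; rewrite -[ltRHS]sqrtr1 ltr_sqrt.
have : Normc.normc (z ord0 i) ^+ 2 <= 1.
  rewrite (le_trans _ (ltW z1))// (bigD1 i)//= lerDl sumr_ge0// => j _.
  exact: sqr_ge0.
rewrite normc2E => ab1.
rewrite -!(@ler_sqr _ `|_| 1) ?nnegrE// expr1n !real_normK ?num_real//.
by split; apply: le_trans ab1; rewrite ?lerDl ?lerDr sqr_ge0.
Qed.

Lemma sphere_measure_setT n : @sphere_measure R n setT = 1%E.
Proof.
have /andP[v0 voo] := ball_volume n.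
rewrite /sphere_measure /pushforward /mscale /mrestr preimage_setT.
transitivity ((fine (lebesgue_Cn n (@ball_set R n)))^-1%:E *
    lebesgue_Cn n (@ball_set R n))%E.
  by congr (_ * lebesgue_Cn n _)%E; exact: setTI.
rewrite -[X in (_ * X)%E]fineK ?ge0_fin_numE ?measure_ge0//.
by rewrite -EFinM mulVf// gt_eqF// fine_gt0// v0.
Qed.


HB.instance Definition _ n := Measure_isProbability.Build _ _ _
  (@sphere_measure R n) (sphere_measure_setT n).

End volume.

Definition unit_ball (R : realType) (n : nat) : Type :=
  {z : 'rV[R[i]]_n | eucl_norm z < 1}.
HB.instance Definition _ (R : realType) (n : nat) :=
  [isSub of unit_ball R n for sval].

Section hardy.
Context {R : realType} {n : nat}.
Local Notation C := R[i].
Local Notation Cn := 'rV[R[i]]_n.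
Local Notation sigma := (@sphere_measure R n).
Local Notation Bn := (unit_ball R n).
Local Notation "`| x |c" := (Normc.normc x) (format "`| x |c").
Implicit Types (f g h phi : Bn -> C) (F G : Cn -> C) (Q : set (Bn -> C)).

Definition zero_ext f (z : Cn) : C := oapp f 0 (insub z : option Bn).

Definition analytic f := forall z : Bn, differentiable (zero_ext f) (val z).

Definition hardy_sqnorm f : \bar R :=
  ereal_sup [set (\int[sigma]_z (`|zero_ext f (r%:C *: z)|c ^+ 2)%:E)%E
            | r in [set r : R | 0 < r < 1]].

Definition H2 : set (Bn -> C) :=
  [set f | analytic f /\ (hardy_sqnorm f < +oo)%E].

Definition H2norm f : R := Num.sqrt (fine (hardy_sqnorm f)).

(* The inner product of the Hilbert norm H2norm, linear in the first argument,
   recovered by polarization. *)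
Definition H2dot f g : C :=
  4^-1 * \sum_(k < 4) 'i ^+ k * (H2norm (f + 'i ^+ k *: g) ^+ 2)%:C.

Definition sup_norm phi : \bar R :=
  ereal_sup [set (`|phi z|c)%:E | z in [set: Bn]].

(* The closed unit ball of H^oo. *)
Definition schur_class : set (Bn -> C) :=
  [set phi | analytic phi /\ (sup_norm phi <= 1)%E].

Definition mult phi f : Bn -> C := fun z => phi z * f z.

Definition coord_fun (i : 'I_n) : Bn -> C := fun z => val z ord0 i.

(* g = T^* f *)
Definition adjoint_eq (T : (Bn -> C) -> (Bn -> C)) f g :=
  H2 g /\ forall h, H2 h -> H2dot (T h) f = H2dot h g.

Record quotient_module Q : Prop := QuotientModule {
  qm_sub : Q `<=` H2 ;
  qm_zero : Q 0 ;
  qm_linear : forall (a : C) f g, Q f -> Q g -> Q (a *: f + g) ;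
  qm_nonzero : exists2 f, Q f & f <> 0 ;
  qm_closed : forall f, H2 f ->
    (forall e : R, 0 < e -> exists2 g, Q g & H2norm (f - g) < e) -> Q f ;
  qm_invariant : forall (i : 'I_n) f, Q f ->
    exists2 g, Q g & adjoint_eq (mult (coord_fun i)) f g }.

Definition finite_dimensional Q := exists (m : nat) (b : 'I_m -> Bn -> C),
  (forall k, Q (b k)) /\
  forall f, Q f -> exists c : 'I_m -> C, f = \sum_k c k *: b k.

(* Orthogonal projection onto Q: the g in Q with f - g orthogonal to Q (and the
   default value 0 if there is none). *)
Definition proj Q f : Bn -> C :=
  xget 0 [set g | Q g /\ forall h, Q h -> H2dot (f - g) h = 0].

Definition compression Q phi f : Bn -> C := proj Q (mult phi f).

Implicit Types X : (Bn -> C) -> (Bn -> C).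

(* Operators on Q are functions on all of Bn -> C of which only the restriction
   to Q is ever used. *)
Definition op_norm Q X : \bar R :=
  ereal_sup [set (H2norm (X f))%:E | f in [set f | Q f /\ H2norm f <= 1]].

Record bounded_operator Q X : Prop := BoundedOperator {
  bo_stable : forall f, Q f -> Q (X f) ;
  bo_linear : forall (a : C) f g, Q f -> Q g ->
    X (a *: f + g) = a *: X f + X g ;
  bo_bounded : (op_norm Q X < +oo)%E }.

Definition operator_ball Q X := bounded_operator Q X /\ (op_norm Q X <= 1)%E.

Definition module_map Q X := bounded_operator Q X /\
  forall (i : 'I_n) f, Q f ->
    X (compression Q (coord_fun i) f) = compression Q (coord_fun i) (X f).

Definition nonconstant Q X := ~ exists c : C, forall f, Q f -> X f = c *: f.

(* Radial boundary values; `lim` is a junk value where the limit fails to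
   exist. *)
Definition boundary f : Cn -> C :=
  fun z => lim (zero_ext f (r%:C *: z) @[r --> (1 : R)^'-]).

Definition cint F : C :=
  (\int[sigma]_z complex.Re (F z)) +i* (\int[sigma]_z complex.Im (F z)).

Definition cLnorm (p : \bar R) F : \bar R :=
  Lnorm sigma p (fun z => (`|F z|c)%:E).

(* The subspaces of L^2 of the sphere are sets of functions, not of classes,
   closed under sigma-a.e. equality. *)
Definition L2 : set (Cn -> C) :=
  [set F | measurable_fun [set: Cn] F /\ (cLnorm 2%:E F < +oo)%E].

Definition L2dot F G : C := cint (fun z => F z * (G z)^*).

Definition poly_fun (p : mpoly.mpoly n C) : Cn -> C :=
  fun z => mpoly.meval (fun i => z ord0 i) p.

Definition H2S : set (Cn -> C) :=
  [set F | L2 F /\ forall e : R, 0 < e ->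
     exists p : mpoly.mpoly n C, (cLnorm 2%:E (F - poly_fun p)%R < e%:E)%E].

Definition H2S0 : set (Cn -> C) := [set F | H2S F /\ L2dot F (cst 1) = 0].

Definition conj_set (S : set (Cn -> C)) : set (Cn -> C) :=
  [set (fun z => (F z)^*) | F in S].

Definition add_set (S T : set (Cn -> C)) : set (Cn -> C) :=
  [set F + G | F in S & G in T].

(* The orthocomplement of H^2 + conj H^2 in L^2. *)
Definition MS : set (Cn -> C) :=
  [set F | L2 F /\ forall G, add_set H2S (conj_set H2S) G -> L2dot F G = 0].

(* Q seen inside L^2 of the sphere. *)
Definition boundary_set Q : set (Cn -> C) :=
  [set F | L2 F /\
     exists2 f, Q f & {ae sigma, forall z, F z = boundary f z}].

Definition MQ Q : set (Cn -> C) :=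
  add_set (conj_set (boundary_set Q)) (add_set MS H2S0).

Definition XQ Q X F : C :=
  cint (fun z => boundary (X (proj Q (cst 1))) z * F z).

Definition functional_norm (S : set (Cn -> C)) (L : (Cn -> C) -> C) : \bar R :=
  ereal_sup [set (`|L F|c)%:E | F in [set F | S F /\ (cLnorm 1 F <= 1)%E]].

End hardy.

(* Main.v *)
(** Write s for the norm of X.

    (1) => (2).  If X is the compression of phi, then X_Q F is the limit of the
    integrals of phi(r .) F, so |X_Q F| <= s ||F||_1; conversely f conj(X f) lies
    in M_Q, and testing on it for f in Q with ||X f|| = s ||f|| gives s <= ||X_Q||.

    (2) => (3).  The backward shifts on a finite-dimensional Q have spectral radius
    less than 1, so the functions of Q extend continuously to the closed ball.
    If f attains the norm of X and g = X f, then testing X_Q on f conj(g) forces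
    |g| = s |f| on the sphere.  For n >= 2 a point of the ball near the sphere is
    the centre of small discs with boundary on the sphere, and the maximum principle
    for f/g and g/f on them gives g = c f.  The v in Q with <X h, v> = c <h, v> for
    all h form a module, which contains a joint eigenvector
    v = v(0) (1 - sum_i a_i z_i)^(-n) of the backward shifts.  As v has no zeros on
    the sphere, a first variation of X_Q at |v|^2 in the direction of conj(q), q in
    Q, gives psi = c P_Q 1, so X = c: a contradiction.

    (3) => (1).  For n = 1, the vectors attaining the norm of X form a subspace E;
    let e represent the evaluation at 0 on E.  A zero of e in the disc could be
    divided out by a Blaschke factor, leaving a vector of E with the same norm but
    a larger value at 0, so e has no zeros.  Again |X e| = s |e| on the circle, and
    phi = (X e)/e is a rational function bounded by s; it lifts X because the
    compression of e to Q is injective. *)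

Require Import Defs.
From HB Require Import structures.
From mathcomp Require Import all_boot all_order all_algebra.
From mathcomp Require Import all_classical all_reals all_analysis.
From mathcomp Require Import measurable_realfun.
From mathcomp Require Import complex ring lra.
From mathcomp Require mpoly.

Set Implicit Arguments.
Unset Strict Implicit.
Unset Printing Implicit Defensive.
Import Order.TTheory GRing.Theory Num.Theory.
Import numFieldNormedType.Exports.
Local Open Scope classical_set_scope.
Local Open Scope ring_scope.
Local Open Scope complex_scope.

(** The Hardy norm is a supremum of means over spheres, and its inner product is recovered from it
    by polarization. A general element of H^2, or a bounded analytic multiplier, is therefore only
    ever integrated at a radius r < 1, with r sent to 1; genuine boundary values are reserved for
    the ball algebra. Finite dimension makes this enough: multiplication by the N-th power of a
    linear form raises degrees by N, so its adjoint on Q sees only the Taylor tails of finitely many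
    basis vectors and has norm at most 1/2 for some N, uniformly over unit forms. Hence the
    homogeneous components of the functions of Q decay geometrically.

    The test functions f conj(g) + conj(q) lie in M_Q because adjoints of ball algebra multipliers
    preserve Q: up to a constant, the analytic and antianalytic parts of f conj(g) are T_g^* f and
    conj(T_f^* g).

    On the disc the extremal vector may still vanish on the circle, where the quotient is undefined.
    The functions of Q are rational, so such zeros are cancelled algebraically before the maximum
    principle is applied. *)

Local Notation en := eucl_norm.
Local Notation ext := zero_ext.
Local Notation bd := boundary.
Local Notation proj := Defs.proj.

(** * Cauchy's formula and Taylor expansions *)

Section one_complex_variable.
Context {R : realType}.
Local Notation C := R[i].
Local Notation nc := (@Normc.normc R).
Local Notation Re := (@complex.Re R).
Local Notation Im := (@complex.Im R).

(** * Modulus, conjugation, real and imaginary parts *)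

Section modulus.
Implicit Types x y z : C.
Lemma nc_ge0 z : 0 <= nc z.
Proof. by case: z => a b; exact: sqrtr_ge0. Qed.
Lemma nc0 : nc 0 = 0. Proof. exact: Normc.normc0. Qed.
Lemma nc1 : nc 1 = 1. Proof. exact: Normc.normc1. Qed.
Lemma ncM x y : nc (x * y) = nc x * nc y. Proof. exact: Normc.normcM. Qed.
Lemma ncV x : nc x^-1 = (nc x)^-1. Proof. exact: Normc.normcV. Qed.
Lemma ncN x : nc (- x) = nc x. Proof. exact: normcN. Qed.
Lemma ncD x y : nc (x + y) <= nc x + nc y. Proof. exact: le_normcD. Qed.
Lemma ncB x y : nc (x - y) <= nc x + nc y. Proof. by rewrite -(ncN y) ncD. Qed.
Lemma ncBC x y : nc (x - y) = nc (y - x). Proof. by rewrite -ncN opprB. Qed.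
Lemma ncX x k : nc (x ^+ k) = nc x ^+ k.
Proof. by elim: k => [|k ih]; rewrite ?expr0 ?nc1// !exprS ncM ih. Qed.
Lemma nc_eq0 z : (nc z == 0) = (z == 0).
Proof. by apply/eqP/eqP => [/Normc.eq0_normc//|->]; exact: nc0. Qed.
Lemma nc_gt0 z : (0 < nc z) = (z != 0).
Proof. by rewrite lt_neqAle nc_ge0 andbT eq_sym nc_eq0. Qed.
Lemma nc_real (a : R) : nc a%:C = `|a|.
Proof. by rewrite /= expr0n /= addr0 sqrtr_sqr. Qed.
Definition cj z : C := conjc z.
Lemma conjcE z : conjc z = cj z. Proof. by []. Qed.
Lemma nc_cj z : nc (cj z) = nc z.
Proof. by case: z => a b; rewrite /cj /Normc.normc /= sqrrN. Qed.
Lemma nc_i : nc 'i%C = 1 :> R. Proof. by rewrite /= expr0n /= expr1n add0r sqrtr1. Qed.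
Lemma nc_Re z : `|Re z| <= nc z.
Proof.
by rewrite -ler_sqr ?nnegrE ?nc_ge0// real_normK ?num_real// normc2E lerDl sqr_ge0.
Qed.
Lemma nc_Im z : `|Im z| <= nc z.
Proof.
by rewrite -ler_sqr ?nnegrE ?nc_ge0// real_normK ?num_real// normc2E lerDr sqr_ge0.
Qed.
Lemma Re_le_nc z : Re z <= nc z.
Proof. exact: le_trans (ler_norm _) (nc_Re z). Qed.
Lemma nc_le_ReIm z : nc z <= `|Re z| + `|Im z|.
Proof.
rewrite -ler_sqr ?nnegrE ?nc_ge0 ?addr_ge0// sqrrD !real_normK ?num_real// normc2E.
by rewrite addrAC lerDl mulrn_wge0// mulr_ge0.
Qed.
Lemma mulcJ z : z * cj z = (nc z ^+ 2)%:C.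
Proof. by rewrite normc2E; case: z => a b; rewrite /cj; simpc; congr (_ +i* _); ring. Qed.
Lemma nc_sum (I : Type) (s : seq I) (P : pred I) (F : I -> C) :
  nc (\sum_(i <- s | P i) F i) <= \sum_(i <- s | P i) nc (F i).
Proof.
elim/big_ind2 : _ => [|x a y b xa yb|i _]//; first by rewrite nc0.
by apply: le_trans (ncD _ _) _; rewrite lerD.
Qed.
Lemma ncB_ge x y : nc x - nc y <= nc (x - y).
Proof. by rewrite lerBlDr -[X in nc X <= _](subrK y) ncD. Qed.
Lemma nc_dist x y : `|nc x - nc y| <= nc (x - y).
Proof. by rewrite ler_norml ncB_ge andbT lerNl opprB ncBC ncB_ge. Qed.

Lemma cReD x y : Re (x + y) = Re x + Re y. Proof. by case: x y => [a b] [c d]. Qed.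
Lemma cImD x y : Im (x + y) = Im x + Im y. Proof. by case: x y => [a b] [c d]. Qed.
Lemma cReN x : Re (- x) = - Re x. Proof. by case: x. Qed.
Lemma cImN x : Im (- x) = - Im x. Proof. by case: x. Qed.
Lemma cReM x y : Re (x * y) = Re x * Re y - Im x * Im y.
Proof. by case: x y => [a b] [c d]. Qed.
Lemma cImM x y : Im (x * y) = Re x * Im y + Im x * Re y.
Proof. by case: x y => [a b] [c d]. Qed.
Lemma cRe_cj x : Re (cj x) = Re x. Proof. by case: x. Qed.
Lemma cIm_cj x : Im (cj x) = - Im x. Proof. by case: x. Qed.
Lemma cjK x : cj (cj x) = x. Proof. exact: conjcK. Qed.
Lemma cj0 : cj 0 = 0. Proof. exact: conjc0. Qed.
Lemma cj1 : cj 1 = 1. Proof. exact: conjc1. Qed.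
Lemma cj_real (a : R) : cj a%:C = a%:C. Proof. exact: conjc_real. Qed.
Lemma cjD x y : cj (x + y) = cj x + cj y. Proof. exact: rmorphD. Qed.
Lemma cjB x y : cj (x - y) = cj x - cj y. Proof. exact: rmorphB. Qed.
Lemma cjN x : cj (- x) = - cj x. Proof. exact: rmorphN. Qed.
Lemma cjM x y : cj (x * y) = cj x * cj y. Proof. exact: rmorphM. Qed.
Lemma cjV x : cj (x^-1) = (cj x)^-1. Proof. exact: fmorphV. Qed.
Lemma cjX x k : cj (x ^+ k) = cj x ^+ k. Proof. exact: rmorphXn. Qed.
Lemma cj_eq0 x : (cj x == 0) = (x == 0). Proof. exact: conjc_eq0. Qed.
Lemma cj_sum (I : Type) (s : seq I) (P : pred I) (F : I -> C) :
  cj (\sum_(i <- s | P i) F i) = \sum_(i <- s | P i) cj (F i).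
Proof. exact: rmorph_sum. Qed.
Lemma real_complexM (a b : R) : (a * b)%:C = a%:C * b%:C.
Proof. exact: rmorphM. Qed.
Lemma real_complexD (a b : R) : (a + b)%:C = a%:C + b%:C.
Proof. exact: rmorphD. Qed.
Lemma real_complexX (a : R) k : (a ^+ k)%:C = a%:C ^+ k.
Proof. exact: rmorphXn. Qed.

Lemma nc_le_eq0 z : (forall e : R, 0 < e -> nc z <= e) -> z = 0.
Proof.
move=> h; apply/eqP; rewrite -nc_eq0 eq_le nc_ge0 andbT.
by apply/ler_addgt0Pr => e e0; rewrite add0r h.
Qed.

Lemma nc_sqrD x y : nc (x + y) ^+ 2 = nc x ^+ 2 + nc y ^+ 2 + 2 * Re (x * cj y).
Proof. by rewrite !normc2E cReM cReD cImD cRe_cj cIm_cj; ring. Qed.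

End modulus.

Arguments Normc.normc : simpl never.
Arguments cj : simpl never.

(** * Integrals of complex-valued functions *)

Section cintegral.
Context d (T : measurableType d).
Variables (mu : {measure set T -> \bar R}) (D : set T).
Hypothesis mD : measurable D.
Implicit Types F G : T -> C.

Definition cintegral F : C :=
  (\int[mu]_(x in D) Re (F x)) +i* (\int[mu]_(x in D) Im (F x)).

Definition cintegrable F := mu.-integrable D (EFin \o (Re \o F)) /\
  mu.-integrable D (EFin \o (Im \o F)).

Arguments cintegral : simpl never.

Lemma eq_cintegral F G : (forall x, D x -> F x = G x) -> cintegral F = cintegral G.
Proof.
by move=> FG; congr (_ +i* _); apply: eq_Rintegral => x /set_mem xD; rewrite FG.
Qed.

Lemma eq_cintegrable F G : (forall x, D x -> F x = G x) -> cintegrable F -> cintegrable G.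
Proof.
move=> FG [iR iI]; split; [apply: eq_integrable iR|apply: eq_integrable iI] => //;
by move=> x /set_mem xD /=; rewrite FG.
Qed.

Lemma integrableRD (f g : T -> R) : mu.-integrable D (EFin \o f) ->
  mu.-integrable D (EFin \o g) -> mu.-integrable D (EFin \o (fun x => f x + g x)).
Proof. by move=> fi gi; exact: (@integrableD _ _ _ mu D mD _ _ fi gi). Qed.

Lemma integrableRZ (a : R) (f : T -> R) : mu.-integrable D (EFin \o f) ->
  mu.-integrable D (EFin \o (fun x => a * f x)).
Proof. by move=> fi; exact: (@integrableZl _ _ _ mu D mD a _ fi). Qed.

Lemma integrableRB (f g : T -> R) : mu.-integrable D (EFin \o f) ->
  mu.-integrable D (EFin \o g) -> mu.-integrable D (EFin \o (fun x => f x - g x)).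
Proof. by move=> fi gi; exact: (@integrableB _ _ _ mu D mD _ _ fi gi). Qed.

Lemma cintegrableD F G : cintegrable F -> cintegrable G ->
  cintegrable (fun x => F x + G x).
Proof.
move=> [F1 F2] [G1 G2]; split.
- by rewrite (_ : Re \o _ = fun x => Re (F x) + Re (G x)); [exact: integrableRD|
    apply/funext => x /=; rewrite cReD].
- by rewrite (_ : Im \o _ = fun x => Im (F x) + Im (G x)); [exact: integrableRD|
    apply/funext => x /=; rewrite cImD].
Qed.

Lemma cintegrableZ (c : C) F : cintegrable F -> cintegrable (fun x => c * F x).
Proof.
move=> [F1 F2]; split.
- rewrite (_ : Re \o _ = fun x => Re c * Re (F x) - Im c * Im (F x)); last first.
    by apply/funext => x /=; rewrite cReM.
  by apply: integrableRB; exact: integrableRZ.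
- rewrite (_ : Im \o _ = fun x => Re c * Im (F x) + Im c * Re (F x)); last first.
    by apply/funext => x /=; rewrite cImM.
  by apply: integrableRD; exact: integrableRZ.
Qed.

Lemma cintegrableN F : cintegrable F -> cintegrable (fun x => - F x).
Proof.
move=> /(cintegrableZ (-1)); apply: eq_cintegrable => x _; by rewrite mulN1r.
Qed.

Lemma cintegrable_cj F : cintegrable F -> cintegrable (fun x => cj (F x)).
Proof.
move=> [F1 F2]; split.
  by rewrite (_ : _ \o _ = Re \o F)//; apply/funext => x /=; rewrite cRe_cj.
rewrite (_ : _ \o _ = fun x => -1 * Im (F x)); first exact: integrableRZ.
by apply/funext => x /=; rewrite cIm_cj mulN1r.
Qed.

Lemma cintegralD F G : cintegrable F -> cintegrable G ->
  cintegral (fun x => F x + G x) = cintegral F + cintegral G.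
Proof.
move=> [F1 F2] [G1 G2]; rewrite /cintegral; simpc; congr (_ +i* _).
- by under eq_Rintegral do rewrite cReD; rewrite RintegralD.
- by under eq_Rintegral do rewrite cImD; rewrite RintegralD.
Qed.

Lemma cintegralZ (c : C) F : cintegrable F ->
  cintegral (fun x => c * F x) = c * cintegral F.
Proof.
move=> [F1 F2]; apply/eqP; rewrite eq_complex cReM cImM /=; apply/andP; split; apply/eqP.
- under eq_Rintegral do rewrite cReM.
  by rewrite RintegralB ?RintegralZl//; exact: integrableRZ.
- under eq_Rintegral do rewrite cImM.
  by rewrite RintegralD ?RintegralZl//; exact: integrableRZ.
Qed.

Lemma cintegralN F : cintegrable F -> cintegral (fun x => - F x) = - cintegral F.
Proof.
move=> iF; rewrite -mulN1r -cintegralZ//; apply: eq_cintegral => x _.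
by rewrite mulN1r.
Qed.

Lemma cintegralB F G : cintegrable F -> cintegrable G ->
  cintegral (fun x => F x - G x) = cintegral F - cintegral G.
Proof. by move=> iF iG; rewrite cintegralD ?cintegralN//; exact: cintegrableN. Qed.

Lemma cintegral_cj F : cintegrable F ->
  cintegral (fun x => cj (F x)) = cj (cintegral F).
Proof.
move=> [F1 F2]; rewrite /cintegral; congr (_ +i* _).
- by apply: eq_Rintegral => x _; rewrite cRe_cj.
- transitivity (-1 * \int[mu]_(x in D) Im (F x)); last by rewrite mulN1r.
  rewrite -RintegralZl//; apply: eq_Rintegral => x _.
  by rewrite cIm_cj mulN1r.
Qed.

Lemma cintegral0 : cintegral (fun=> 0) = 0.
Proof. by rewrite /cintegral /= !Rintegral_cst// !mul0r. Qed.

Lemma cintegrable0 : cintegrable (fun=> 0).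
Proof. by split; exact: integrable0. Qed.

Lemma cintegrable_sum (I : Type) (s : seq I) (P : pred I) (F : I -> T -> C) :
  (forall i, P i -> cintegrable (F i)) ->
  cintegrable (fun x => \sum_(i <- s | P i) F i x).
Proof.
move=> iF; elim: s => [|i s ih].
  by under eq_fun do rewrite big_nil; exact: cintegrable0.
under eq_fun do rewrite big_cons.
by case: (boolP (P i)) => // Pi; apply: cintegrableD => //; exact: iF.
Qed.

Lemma cintegral_sum (I : Type) (s : seq I) (P : pred I) (F : I -> T -> C) :
  (forall i, P i -> cintegrable (F i)) ->
  cintegral (fun x => \sum_(i <- s | P i) F i x) = \sum_(i <- s | P i) cintegral (F i).
Proof.
move=> iF; elim: s => [|i s ih].
  by rewrite big_nil; under eq_fun do rewrite big_nil; exact: cintegral0.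
rewrite big_cons; under eq_fun do rewrite big_cons.
case: (boolP (P i)) => // Pi; rewrite cintegralD ?ih//; first exact: iF.
exact: cintegrable_sum.
Qed.

Lemma measurable_nc F : measurable_fun D (Re \o F) -> measurable_fun D (Im \o F) ->
  measurable_fun D (fun x => nc (F x)).
Proof.
move=> mR mI.
rewrite (_ : (fun _ => _) = (fun s => s `^ 2^-1) \o
    (fun x => Re (F x) ^+ 2 + Im (F x) ^+ 2)); last first.
  apply/funext => x /=; rewrite powR12_sqrt ?addr_ge0 ?sqr_ge0// -normc2E.
  by rewrite sqrtr_sqr ger0_norm ?nc_ge0.
apply: measurableT_comp; first exact: measurable_powR.
by apply: measurable_funD; exact: measurable_funX.
Qed.

Lemma cintegrable_nc F : cintegrable F -> mu.-integrable D (EFin \o (nc \o F)).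
Proof.
move=> [F1 F2].
have i1 := integrable_norm F1; have i2 := integrable_norm F2.
apply: (le_integrable mD _ _ (integrableD mD i1 i2)).
- apply/measurable_EFinP; apply: measurable_nc; apply/measurable_EFinP;
  [exact: (measurable_int mu F1)|exact: (measurable_int mu F2)].
- move=> x _ /=; rewrite lee_fin ger0_norm ?nc_ge0// ger0_norm ?addr_ge0//.
  exact: nc_le_ReIm.
Qed.

Lemma cintegrable_le F (g : T -> R) : measurable_fun D (Re \o F) ->
  measurable_fun D (Im \o F) -> mu.-integrable D (EFin \o g) ->
  (forall x, D x -> nc (F x) <= g x) -> cintegrable F.
Proof.
move=> mR mI ig Fg; split; apply: (le_integrable mD _ _ ig) => //.
- exact/measurable_EFinP.
- move=> x Dx /=; rewrite lee_fin (le_trans (nc_Re _))// (le_trans (Fg _ Dx))//.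
  exact: ler_norm.
- exact/measurable_EFinP.
- move=> x Dx /=; rewrite lee_fin (le_trans (nc_Im _))// (le_trans (Fg _ Dx))//.
  exact: ler_norm.
Qed.

(** With I the integral, |I|^2 is the real part of the integral of conj(I) F, which is at most |I|
    times the integral of |F|. *)
Lemma nc_cintegral F : cintegrable F ->
  nc (cintegral F) <= \int[mu]_(x in D) nc (F x).
Proof.
move=> iF; set I := cintegral F.
have nF := cintegrable_nc iF.
have [->|I0] := eqVneq I 0.
  by rewrite nc0 Rintegral_ge0// => x _; exact: nc_ge0.
have nI : 0 < nc I by rewrite nc_gt0.
rewrite -(ler_pM2l nI) -RintegralZl// -expr2.
have -> : nc I ^+ 2 = Re (cintegral (fun x => (cj I) * F x)).
  by rewrite cintegralZ// mulrC mulcJ.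
apply: le_Rintegral => //; first by have [] := cintegrableZ (cj I) iF.
  exact: integrableRZ.
by move=> x _ /=; rewrite (le_trans (Re_le_nc _))// ncM nc_cj.
Qed.

Lemma nc_cintegral_le F (g : T -> R) : cintegrable F -> mu.-integrable D (EFin \o g) ->
  (forall x, D x -> nc (F x) <= g x) -> nc (cintegral F) <= \int[mu]_(x in D) g x.
Proof.
move=> iF ig Fg; apply: le_trans (nc_cintegral iF) _.
by apply: le_Rintegral => //; exact: cintegrable_nc.
Qed.

End cintegral.

Arguments cintegral : simpl never.

(** * Continuity and complex differentiability *)

Section complex_continuity.

Lemma cvgC_lt (T : Type) (F : set_system T) {FF : Filter F} (f : T -> C) (l : C) :
  f @ F --> l -> forall e : R, 0 < e -> \forall x \near F, nc (f x - l) < e.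
Proof.
move=> /cvgrPdist_lt h e e0.
have := h e%:C; rewrite ltcR => /(_ e0); apply: filterS => x hx.
have : (nc (l - f x))%:C < e%:C by exact: hx.
by rewrite ltcR ncBC.
Qed.

Lemma cvgC_intro (T : Type) (F : set_system T) {FF : Filter F} (f : T -> C) (l : C) :
  (forall e : R, 0 < e -> \forall x \near F, nc (f x - l) < e) -> f @ F --> l.
Proof.
move=> h; apply/cvgrPdist_lt => e; rewrite ltcE /= => /andP[/eqP Ie e0].
have := h _ e0; apply: filterS => x hx.
suff : (nc (l - f x))%:C < e by [].
by rewrite ltcE /= Ie eqxx /= ncBC.
Qed.

Lemma near_nc (z : C) (e : R) : 0 < e -> \forall t \near z, nc (t - z) < e.
Proof. exact: (@cvgC_lt C (nbhs z) _ id z cvg_id e). Qed.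

Lemma nbhs_ncP (z : C) (P : set C) : nbhs z P ->
  exists2 d : R, 0 < d & forall t, nc (t - z) < d -> P t.
Proof.
move=> /nbhs_ballP[d /= d0 dP]; move: d0; rewrite ltcE /= => /andP[/eqP Id d0].
exists (Re d) => // t td; apply: dP; rewrite -ball_normE /=.
suff : (nc (z - t))%:C < d by [].
by rewrite ltcE /= Id eqxx /= ncBC.
Qed.

Lemma continuous_Re : continuous (Re : C -> R).
Proof.
move=> z; apply/(@cvgrPdist_lt _ _ _ (nbhs z) (nbhs_filter z)) => e e0.
apply: (filterS _ (near_nc z e0)) => t.
by apply: le_lt_trans; rewrite ncBC -cReN -cReD nc_Re.
Qed.

Lemma continuous_Im : continuous (Im : C -> R).
Proof.
move=> z; apply/(@cvgrPdist_lt _ _ _ (nbhs z) (nbhs_filter z)) => e e0.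
apply: (filterS _ (near_nc z e0)) => t.
by apply: le_lt_trans; rewrite ncBC -cImN -cImD nc_Im.
Qed.

Lemma continuous_complexP (T : topologicalType) (f g : T -> R) (x : T) :
  {for x, continuous f} -> {for x, continuous g} ->
  {for x, continuous (fun t => f t +i* g t)}.
Proof.
move=> cf cg; apply: cvgC_intro => e e0.
have e2 : 0 < e / 2 by rewrite divr_gt0.
have /cvgrPdistC_lt/(_ _ e2) nf := cf; have /cvgrPdistC_lt/(_ _ e2) ng := cg.
apply: filterS2 nf ng => t tf tg.
by apply: le_lt_trans (nc_le_ReIm _) _ => /=; rewrite (splitr e) ltrD.
Qed.

(** Differentiability as a first-order expansion with remainder, without a quotient: this is the
    form that Goursat's argument consumes. *)
Definition cdiff (u : C -> C) (z : C) := exists d : C, forall e : R, 0 < e ->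
  exists2 del : R, 0 < del & forall h, nc h < del ->
    nc (u (z + h) - u z - d * h) <= e * nc h.

Lemma cdiff_continuous u z : cdiff u z -> {for z, continuous u}.
Proof.
move=> [d ud]; apply: (@cvgC_intro _ (nbhs z) (nbhs_filter z)) => e e0; have [del del0 udel] := ud 1 ltr01.
have K0 : 0 < 1 + nc d by rewrite ltr_wpDr ?nc_ge0.
have e1 : 0 < e / (1 + nc d) by rewrite divr_gt0.
apply: filterS2 (near_nc z del0) (near_nc z e1) => t td te.
have := udel _ td; rewrite [z + _]addrC subrK mul1r => h.
rewrite ltr_pdivlMr// in te; apply: le_lt_trans te.
rewrite -[u t - u z](subrK (d * (t - z))).
by apply: le_trans (ncD _ _) _; rewrite ncM [leRHS]mulrDr mulr1 lerD// mulrC.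
Qed.

Lemma geo_small (q : R) : 0 <= q -> q < 1 -> forall e : R, 0 < e ->
  exists N, forall k, (N <= k)%N -> q ^+ k < e.
Proof.
move=> q0 q1 e e0.
have /cvg_expr/cvgrPdist_lt/(_ _ e0)[N _ hN] : `|q| < 1 by rewrite ger0_norm.
exists N => k Nk; have := hN k Nk.
by rewrite sub0r normrN ger0_norm// exprn_ge0.
Qed.

End complex_continuity.

(** * Integrals of continuous functions over intervals *)

Section interval_integral.
Local Notation mu := (@lebesgue_measure R).
Implicit Types f g : R -> C.

Definition cI (a b : R) f : C := cintegral mu `[a, b] f.

Lemma cintegrable_itv a b f : continuous f -> cintegrable mu `[a, b] f.
Proof.
move=> cf; split; apply: continuous_compact_integrable;
  (try exact: segment_compact); apply: continuous_subspaceT => x.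
- by apply: continuous_comp; [exact: cf|exact: continuous_Re].
- by apply: continuous_comp; [exact: cf|exact: continuous_Im].
Qed.
Local Hint Resolve cintegrable_itv : core.

Lemma cI_split a b c f : continuous f -> a <= c -> c <= b ->
  cI a b f = cI a c f + cI c b f.
Proof.
move=> cf ac cb; rewrite /cI /cintegral; have [i1 i2] := cintegrable_itv a b cf.
have [j1 j2] := cintegrable_itv c b cf.
have sub (g : R -> R) : mu.-integrable `[a, b] (EFin \o g) ->
    mu.-integrable `[c, b] (EFin \o g) ->
    \int[mu]_(x in `[a, b]) g x = \int[mu]_(x in `[a, c]) g x + \int[mu]_(x in `[c, b]) g x.
  move=> ig jg; rewrite -[in RHS](@Rintegral_itv_obnd_cbnd _ c) ; last first.
    by apply: integrableS jg => //; exact: subset_itv_oc_cc.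
  by rewrite -(@Rintegral_itvB _ g (BLeft a) (BRight b) c) ?bnd_simp// addrC subrK.
by simpc; congr (_ +i* _); apply: sub.
Qed.

Lemma cI_bound a b f (M : R) : continuous f -> a <= b ->
  (forall s, a <= s <= b -> nc (f s) <= M) -> nc (cI a b f) <= M * (b - a).
Proof.
move=> cf ab fM.
have -> : M * (b - a) = \int[mu]_(x in `[a, b]) M.
  rewrite Rintegral_cst//; congr (_ * _).
  have /= -> := @lebesgue_measure_itv R `[a, b]%R; rewrite lte_fin; case: ltP => //= ba.
  by apply/eqP; rewrite subr_eq0 eq_le ba ab.
apply: nc_cintegral_le; [exact: measurable_itv|exact: cintegrable_itv| |by move=> x /=; rewrite in_itv /=; exact: fM].
apply: continuous_compact_integrable; first exact: segment_compact.
  by apply: continuous_subspaceT => x; exact: cvg_cst.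
Qed.

Lemma cI_cst a b (c : C) : a <= b -> cI a b (fun=> c) = (b - a)%:C * c.
Proof.
move=> ab; rewrite /cI /cintegral !Rintegral_cst//.
have -> : fine (mu `[a, b]%classic) = b - a.
  have /= -> := @lebesgue_measure_itv R `[a, b]%R; rewrite lte_fin; case: ltP => //= ba.
  by apply/eqP; rewrite eq_sym subr_eq0 eq_le ba ab.
by case: c => x y; simpc; congr (_ +i* _); rewrite mulrC.
Qed.

Lemma cIZ a b c f : continuous f -> cI a b (fun s => c * f s) = c * cI a b f.
Proof. by move=> cf; apply: cintegralZ => //; exact: cintegrable_itv. Qed.

Lemma cID a b f g : continuous f -> continuous g ->
  cI a b (fun s => f s + g s) = cI a b f + cI a b g.
Proof. by move=> cf cg; apply: cintegralD => //; exact: cintegrable_itv. Qed.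

Lemma cIB a b f g : continuous f -> continuous g ->
  cI a b (fun s => f s - g s) = cI a b f - cI a b g.
Proof. by move=> cf cg; apply: cintegralB => //; exact: cintegrable_itv. Qed.

Lemma eq_cI a b f g : (forall s, a <= s <= b -> f s = g s) -> cI a b f = cI a b g.
Proof. by move=> fg; apply: eq_cintegral => x /=; rewrite in_itv /=; exact: fg. Qed.

End interval_integral.

Section continuous_ops.

Lemma continuous_realC (f : R -> R) : continuous f -> continuous (fun x => (f x)%:C : C).
Proof. by move=> cf x; apply: continuous_complexP; [exact: cf|exact: cvg_cst]. Qed.

Lemma continuousD_fun (f g : R -> C) : continuous f -> continuous g ->
  continuous (fun s => f s + g s).
Proof. by move=> cf cg x; apply: cvgD; [exact: cf|exact: cg]. Qed.

Lemma continuous_cstC (c : C) : continuous (fun _ : R => c).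
Proof. by move=> x; exact: (@cvg_cst C^o). Qed.

Lemma continuousV_fun (f : R -> C) : continuous f -> (forall s, f s != 0) ->
  continuous (fun s => (f s)^-1).
Proof. by move=> cf f0 x; apply: cvgV; [exact: f0|exact: cf]. Qed.

Lemma continuousZ_fun (c : C) (f : R -> C) : continuous f ->
  continuous (fun s => c * f s).
Proof. by move=> cf x; apply: (@cvgM _ _ _ _ (fun=> c)); [exact: (@cvg_cst C^o)|exact: cf]. Qed.

Lemma continuousM_fun (f g : R -> C) : continuous f -> continuous g ->
  continuous (fun s => f s * g s).
Proof. by move=> cf cg x; apply: cvgM; [exact: cf|exact: cg]. Qed.

Lemma continuousX_fun (f : R -> C) k : continuous f -> continuous (fun s => f s ^+ k).
Proof.
move=> cf; elim: k => [|k ih]; first exact: continuous_cstC.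
by under eq_fun do rewrite exprS; exact: continuousM_fun.
Qed.

Lemma continuousB_fun (f g : R -> C) : continuous f -> continuous g ->
  continuous (fun s => f s - g s).
Proof. by move=> cf cg x; apply: cvgB; [exact: cf|exact: cg]. Qed.

End continuous_ops.

(** The common point is the supremum of the left ends: these increase, and the right ends decrease
    because each interval lies in the preceding one, being half as long. *)
Lemma nested_intervals (s hk : nat -> R) : (forall k, 0 < hk k) ->
  (forall k, hk k = hk k.+1 + hk k.+1) -> (forall k, s k <= s k.+1 <= s k + hk k.+1) ->
  exists l, forall k, s k <= l <= s k + hk k.
Proof.
move=> hk0 hkS sm.
have sle k j : s k <= s (k + j)%N.
  elim: j => [|j ih]; first by rewrite addn0.
  by rewrite addnS (le_trans ih)//; have /andP[] := sm (k + j)%N.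
have sub k j : s (k + j)%N + hk (k + j)%N <= s k + hk k.
  elim: j => [|j ih]; first by rewrite addn0.
  rewrite addnS; apply: le_trans ih; rewrite (hkS (k + j)%N) addrA lerD2r.
  by have /andP[] := sm (k + j)%N.
have ub j k : s j <= s k + hk k.
  have [/subnK jk|/ltnW/subnK kj] := leqP j k.
    by rewrite (le_trans (sle j (k - j)%N))// addnC jk lerDl ltW.
  by have := sub k (j - k)%N; rewrite addnC kj; apply: le_trans; rewrite lerDl ltW.
have hs : has_sup (range s).
  by split; [exists (s 0%N), 0%N|exists (s 0%N + hk 0%N) => _ [j _ <-]].
exists (sup (range s)) => k; apply/andP; split.
  by apply: ub_le_sup; [case: hs|exists k].
by apply: ge_sup; [case: hs|move=> _ [j _ <-]].
Qed.

(** * Goursat's theorem on a square, relative to a parametrization H *)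

Section goursat.
Variables (kap bet : R -> C) (H : R -> R -> C).
Hypotheses (ckap : continuous kap) (cbet : continuous bet).
Hypotheses (cH1 : forall y, continuous (H^~ y)) (cH2 : forall x, continuous (H x)).
Variable K : R.
Hypotheses (kapK : forall s : R, 0 <= s <= 1 -> nc (kap s) <= K)
  (betK : forall s : R, 0 <= s <= 1 -> nc (bet s) <= K).

(* The integral of v (kap dx + bet dy) along the boundary of the square
   [x, x + h] * [y, y + h]. *)
Definition square_int (v : R -> R -> C) x y h : C :=
  cI x (x + h) (fun s => kap s * (v s y - v s (y + h))) +
  cI y (y + h) (fun s => bet s * (v (x + h) s - v x s)).

Hypothesis HJ : forall x y h : R, 0 <= x -> 0 <= y -> 0 <= h -> x + h <= 1 -> y + h <= 1 ->
  square_int H x y h = 0.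

Variable v : R -> R -> C.
Hypotheses (cv1 : forall y, continuous (v^~ y)) (cv2 : forall x, continuous (v x)).

Hypothesis v_approx : forall x y : R, 0 <= x <= 1 -> 0 <= y <= 1 ->
  exists d : C, forall e : R, 0 < e -> exists2 del : R, 0 < del &
    forall x' y' : R, 0 <= x' <= 1 -> 0 <= y' <= 1 ->
      `|x' - x| < del -> `|y' - y| < del ->
      nc (v x' y' - v x y - d * (H x' y' - H x y)) <= e * (`|x' - x| + `|y' - y|).

Lemma square_int_bound (w : R -> R -> C) (x y h M : R) :
  (forall y, continuous (w^~ y)) -> (forall x, continuous (w x)) ->
  0 <= x -> 0 <= y -> 0 <= h -> x + h <= 1 -> y + h <= 1 ->
  (forall x' y' : R, x <= x' <= x + h -> y <= y' <= y + h -> nc (w x' y') <= M) ->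
  nc (square_int w x y h) <= 4 * K * M * h.
Proof.
move=> cw1 cw2 x0 y0 h0 xh yh wM.
have bd (k : R -> C) (f g : R -> C) (z : R) : continuous k -> continuous f -> continuous g ->
    (forall s : R, 0 <= s <= 1 -> nc (k s) <= K) -> 0 <= z -> z + h <= 1 ->
    (forall s : R, z <= s <= z + h -> nc (f s) <= M) ->
    (forall s : R, z <= s <= z + h -> nc (g s) <= M) ->
    nc (cI z (z + h) (fun s => k s * (f s - g s))) <= K * (M + M) * h.
  move=> ck cf cg kK z0 zh fM gM.
  have -> : h = z + h - z by rewrite addrAC subrr add0r.
  rewrite [X in cI _ X _](_ : _ = z + h); last by ring.
  apply: cI_bound; [|by rewrite lerDl|].
    exact: (continuousM_fun ck (continuousB_fun cf cg)).
  move=> s /andP[zs sz]; rewrite ncM ler_pM ?nc_ge0//.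
    by apply: kK; rewrite (le_trans z0)//= (le_trans sz).
  by apply: le_trans (ncB _ _) _; rewrite lerD ?fM ?gM ?zs ?sz.
apply: le_trans (ncD _ _) _.
have -> : 4 * K * M * h = K * (M + M) * h + K * (M + M) * h by ring.
apply: lerD; [apply: (bd _ _ _ _ ckap (@cw1 _) (@cw1 _))|
  apply: (bd _ _ _ _ cbet (@cw2 _) (@cw2 _))] => // s sx; apply: wM; lra.
Qed.

(** Constants drop out since [kap] depends on the first variable only and [bet] on the second, and
    multiples of [H] drop out by [HJ]. So the first-order part of [v] at a point may be subtracted
    for free. *)
Lemma square_int_lin (d c : C) (x y h : R) :
  0 <= x -> 0 <= y -> 0 <= h -> x + h <= 1 -> y + h <= 1 ->
  square_int (fun s t => v s t - (c + d * H s t)) x y h = square_int v x y h.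
Proof.
move=> x0 y0 h0 xh yh.
have lin (k f g p q : R -> C) a b : continuous k -> continuous f -> continuous g ->
   continuous p -> continuous q ->
   cI a b (fun s => k s * ((f s - (c + d * p s)) - (g s - (c + d * q s)))) =
   cI a b (fun s => k s * (f s - g s)) - d * cI a b (fun s => k s * (p s - q s)).
  move=> ck cf cg cp cq; rewrite -cIZ; last first.
    exact: (continuousM_fun ck (continuousB_fun cp cq)).
  rewrite -cIB; last 2 first.
  - exact: (continuousM_fun ck (continuousB_fun cf cg)).
  - exact: (continuousZ_fun (continuousM_fun ck (continuousB_fun cp cq))).
  by apply: eq_cI => s _; ring.
rewrite /square_int (lin _ _ _ _ _ _ _ ckap (@cv1 _) (@cv1 _) (@cH1 _) (@cH1 _)) (lin _ _ _ _ _ _ _ cbet (@cv2 _) (@cv2 _) (@cH2 _) (@cH2 _)).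
have := HJ x0 y0 h0 xh yh; rewrite /square_int => hj.
transitivity (cI x (x + h) (fun s => kap s * (v s y - v s (y + h))) +
  cI y (y + h) (fun s => bet s * (v (x + h) s - v x s)) -
  d * (cI x (x + h) (fun s => kap s * (H s y - H s (y + h))) +
  cI y (y + h) (fun s => bet s * (H (x + h) s - H x s)))); first by ring.
by rewrite hj mulr0 subr0.
Qed.

Lemma square_int_split (x y h : R) : 0 <= h ->
  square_int v x y (h + h) = square_int v x y h + square_int v (x + h) y h +
    square_int v x (y + h) h + square_int v (x + h) (y + h) h.
Proof.
move=> h0; rewrite /square_int.
have sp (k f g : R -> C) z : continuous k -> continuous f -> continuous g ->
    cI z (z + (h + h)) (fun s => k s * (f s - g s)) =
    cI z (z + h) (fun s => k s * (f s - g s)) +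
    cI (z + h) (z + h + h) (fun s => k s * (f s - g s)).
  move=> ck cf cg; rewrite addrA; apply: cI_split; [|by rewrite lerDl|by rewrite lerDl].
  exact: (continuousM_fun ck (continuousB_fun cf cg)).
have ch (k f g p : R -> C) a b : continuous k -> continuous f -> continuous g ->
   continuous p -> cI a b (fun s => k s * (f s - g s)) =
   cI a b (fun s => k s * (f s - p s)) + cI a b (fun s => k s * (p s - g s)).
  move=> ck cf cg cp; rewrite -cID; last 2 first.
  - exact: (continuousM_fun ck (continuousB_fun cf cp)).
  - exact: (continuousM_fun ck (continuousB_fun cp cg)).
  by apply: eq_cI => s _; ring.
rewrite (sp _ _ _ x ckap (@cv1 _) (@cv1 _)) (sp _ _ _ y cbet (@cv2 _) (@cv2 _)) !addrA.
rewrite (ch _ (v^~ y) (v^~ (y + h + h)) (v^~ (y + h)) x (x + h) ckap (@cv1 _) (@cv1 _) (@cv1 _)).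
rewrite (ch _ (v^~ y) (v^~ (y + h + h)) (v^~ (y + h)) (x + h) (x + h + h) ckap (@cv1 _) (@cv1 _) (@cv1 _)).
rewrite (ch _ (v (x + h + h)) (v x) (v (x + h)) y (y + h) cbet (@cv2 _) (@cv2 _) (@cv2 _)).
rewrite (ch _ (v (x + h + h)) (v x) (v (x + h)) (y + h) (y + h + h) cbet (@cv2 _) (@cv2 _) (@cv2 _)).
ring.
Qed.

(** Quartering keeps a square of side h whose integral is at least A h^2. At the limit point [v] is
    affine in [H] up to e times the distance, which bounds that integral by 8 K e h^2. *)
Lemma goursat : square_int v 0 0 1 = 0.
Proof.
apply/eqP; rewrite -nc_eq0; apply/negPn/negP => J0.
have {J0} : 0 < nc (square_int v 0 0 1) by rewrite lt_neqAle nc_ge0 andbT eq_sym.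
set A := nc _ => A0.
pose hk k : R := 2^-1 ^+ k.
have hk0 k : 0 < hk k by rewrite exprn_gt0// invr_gt0.
have hkS k : hk k = hk k.+1 + hk k.+1.
  by rewrite /hk exprS; lra.
pose bad k (p : R * R) := [/\ 0 <= p.1 <= 1 - hk k, 0 <= p.2 <= 1 - hk k &
  A * hk k ^+ 2 <= nc (square_int v p.1 p.2 (hk k))].
(* The existential stands outside the implication so that choice gives a total map; (0, 0) is a
   dummy for squares that are not bad. *)
have step k p : exists q, bad k p -> bad k.+1 q /\
    (p.1 <= q.1 <= p.1 + hk k.+1 /\ p.2 <= q.2 <= p.2 + hk k.+1).
  have [badp|] := pselect (bad k p); last by exists (0, 0).
  move: p badp => [x y] -[] /= /andP[x0 x1] /andP[y0 y1] big.
  apply: contrapT => /forallNP no.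
  have sm a b : x <= a <= x + hk k.+1 -> y <= b <= y + hk k.+1 ->
      nc (square_int v a b (hk k.+1)) < A * hk k.+1 ^+ 2.
    move=> /andP[xa ax] /andP[yb by_]; rewrite ltNge; apply/negP => hab.
    apply: (no (a, b)) => _; split => /=; last by rewrite xa ax yb by_.
    have := hkS k; have := hk0 k.+1.
    by split => //=; apply/andP; split; lra.
  have hp := hk0 k.+1.
  move: big; rewrite hkS square_int_split ?(ltW hp)// => big.
  have s1 : nc (square_int v x y (hk k.+1)) < A * hk k.+1 ^+ 2.
    by apply: sm; apply/andP; split; lra.
  have s2 : nc (square_int v (x + hk k.+1) y (hk k.+1)) < A * hk k.+1 ^+ 2.
    by apply: sm; apply/andP; split; lra.
  have s3 : nc (square_int v x (y + hk k.+1) (hk k.+1)) < A * hk k.+1 ^+ 2.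
    by apply: sm; apply/andP; split; lra.
  have s4 : nc (square_int v (x + hk k.+1) (y + hk k.+1) (hk k.+1)) < A * hk k.+1 ^+ 2.
    by apply: sm; apply/andP; split; lra.
  have := ncD (square_int v x y (hk k.+1) + square_int v (x + hk k.+1) y (hk k.+1) +
    square_int v x (y + hk k.+1) (hk k.+1))
    (square_int v (x + hk k.+1) (y + hk k.+1) (hk k.+1)).
  have := ncD (square_int v x y (hk k.+1) + square_int v (x + hk k.+1) y (hk k.+1))
    (square_int v x (y + hk k.+1) (hk k.+1)).
  have := ncD (square_int v x y (hk k.+1)) (square_int v (x + hk k.+1) y (hk k.+1)).
  have e4 : A * (hk k.+1 + hk k.+1) ^+ 2 = 4 * (A * hk k.+1 ^+ 2) by ring.
  rewrite e4 in big; lra.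
have [st stP] := choice (fun kp : nat * (R * R) => step kp.1 kp.2).
pose p := fix p k := if k is k'.+1 then st (k', p k') else (0, 0).
have badp k : bad k (p k).
  elim: k => [|k /(stP (k, p k))[]//].
  by split => /=; rewrite /hk ?expr0 ?subrr ?lexx// expr1n mulr1.
have mono k : (p k).1 <= (p k.+1).1 <= (p k).1 + hk k.+1 /\
    (p k).2 <= (p k.+1).2 <= (p k).2 + hk k.+1.
  by have [_ ] := stP (k, p k) (badp k).
have [x xP] := nested_intervals hk0 hkS (s := fun k => (p k).1) (fun k => (mono k).1).
have [y yP] := nested_intervals hk0 hkS (s := fun k => (p k).2) (fun k => (mono k).2).
have in01 (s : R) (f : nat -> R) : (forall k, f k <= s <= f k + hk k) ->
    (0 <= f 0%N <= 1 - hk 0%N) -> 0 <= s <= 1.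
  by move=> /(_ 0%N)/andP[] ? ? /andP[] ? ?; apply/andP; split; lra.
have [[x01 y01 _]] := badp 0%N.
have x1 := in01 _ _ xP x01; have y1 := in01 _ _ yP y01.
have [d dP] := v_approx x1 y1.
have K0 : 0 <= K by apply: le_trans (kapK x1); exact: nc_ge0.
(* Any e with 8 K e < A would do; the summand 16 keeps the denominator positive when K = 0. *)
pose e := A / (16 * K + 16).
have e0 : 0 < e by rewrite divr_gt0// ltr_wpDl// mulr_ge0.
have [del del0 delP] := dP e e0.
have [k kP] : exists k, hk k < del.
  by have [N /(_ N (leqnn _)) hN] := @geo_small (2^-1 : R) ltac:(lra) ltac:(lra) _ del0;
     exists N.
have [/andP[a0 a1] /andP[b0 b1] big] := badp k.
have xk := xP k; have yk := yP k; have hkk := hk0 k.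
have := square_int_lin d (v x y - d * H x y) a0 b0 (ltW hkk) ltac:(lra) ltac:(lra).
move=> Jlin.
have : nc (square_int v (p k).1 (p k).2 (hk k)) <= 4 * K * (e * (hk k + hk k)) * hk k.
  rewrite -Jlin; apply: square_int_bound.
  - move=> t; exact: (continuousB_fun (@cv1 _) (continuousD_fun (@continuous_cstC _) (continuousZ_fun (@cH1 _)))).
  - move=> t; exact: (continuousB_fun (@cv2 _) (continuousD_fun (@continuous_cstC _) (continuousZ_fun (@cH2 _)))).
  - by [].
  - by [].
  - exact: ltW.
  - lra.
  - lra.
  move=> s t /andP[s0 s1] /andP[t0 t1].
  have -> : v s t - (v x y - d * H x y + d * H s t) =
    v s t - v x y - d * (H s t - H x y) by ring.
  have ds : `|s - x| <= hk k by rewrite ler_norml; lra.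
  have dt : `|t - y| <= hk k by rewrite ler_norml; lra.
  apply: le_trans (delP s t _ _ _ _) _; try lra.
  by rewrite ler_wpM2l ?lerD// ltW.
have eK : e * (16 * K + 16) = A.
  by rewrite /e mulfVK// gt_eqF// ltr_wpDl// mulr_ge0.
move: big; rewrite -eK => big up.
have h2 : 0 < hk k ^+ 2 by rewrite exprn_gt0.
have eh : 0 < e * hk k ^+ 2 by rewrite mulr_gt0.
have Keh : 0 <= K * (e * hk k ^+ 2) by rewrite mulr_ge0// ltW.
have := le_trans big up.
have -> : e * (16 * K + 16) * hk k ^+ 2 = 16 * (K * (e * hk k ^+ 2)) + 16 * (e * hk k ^+ 2) by ring.
have -> : 4 * K * (e * (hk k + hk k)) * hk k = 8 * (K * (e * hk k ^+ 2)) by ring.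
lra.
Qed.

End goursat.

(** * Cauchy's formula on circles and Taylor expansions on discs *)

Section cauchy.

Definition cis (y : R) : C := cos (2 * pi * y) +i* sin (2 * pi * y).

Lemma nc_cis y : nc (cis y) = 1.
Proof.
have : nc (cis y) ^+ 2 = 1 ^+ 2 by rewrite normc2E /= cos2Dsin2 expr1n.
by move=> /eqP; rewrite eqrXn2 ?nc_ge0// => /eqP.
Qed.

Lemma cis_neq0 y : cis y != 0.
Proof. by rewrite -nc_eq0 nc_cis oner_eq0. Qed.

Lemma cis01 : cis 0 = cis 1.
Proof.
have e2 : 2 * pi = pi *+ 2 :> R by rewrite mulr_natl.
by rewrite /cis mulr1 mulr0 cos0 sin0 e2 cos2pi sin2pi.
Qed.

Let continuous_mul (c : R) : continuous (fun y : R => c * y).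
Proof. by move=> y; apply: cvgM; [exact: cvg_cst|exact: cvg_id]. Qed.

Let continuous_cosM (c : R) : continuous (fun y => cos (c * y)).
Proof. by move=> y; apply: (continuous_comp (@continuous_mul c y)); exact: continuous_cos. Qed.

Let continuous_sinM (c : R) : continuous (fun y => sin (c * y)).
Proof. by move=> y; apply: (continuous_comp (@continuous_mul c y)); exact: continuous_sin. Qed.

Lemma continuous_cis : continuous cis.
Proof.
move=> y; apply: continuous_complexP; [exact: continuous_cosM|exact: continuous_sinM].
Qed.

Lemma cI_cis (a b : R) : a <= b ->
  cI a b (fun s => (2 * pi)%:C * 'i * cis s) = cis b - cis a.
Proof.
rewrite le_eqVlt => /predU1P[->|ab].
  rewrite subrr; apply/eqP; rewrite -nc_eq0 eq_le nc_ge0 andbT.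
  have := @cI_bound b b (fun s => (2 * pi)%:C * 'i * cis s) (nc ((2 * pi)%:C * 'i)).
  rewrite subrr mulr0; apply => //; first exact/continuousZ_fun/continuous_cis.
  by move=> s _; rewrite ncM nc_cis mulr1.
have dl (x : R) : is_derive x (1 : R) (fun y : R => 2 * pi * y) (2 * pi).
  have -> : (fun y : R => 2 * pi * y) = (2 * pi) \*: id.
    by apply/funext => y.
  by apply: is_derive_eq; rewrite /GRing.scale /= mulr1.
have dc (x : R) : is_derive x (1 : R) (fun y : R => cos (2 * pi * y)) (- sin (2 * pi * x) * (2 * pi)).
  exact: (@is_derive1_comp _ cos (fun y => 2 * pi * y)).
have ds (x : R) : is_derive x (1 : R) (fun y : R => sin (2 * pi * y)) (cos (2 * pi * x) * (2 * pi)).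
  exact: (@is_derive1_comp _ sin (fun y => 2 * pi * y)).
have ftc (F f : R -> R) : (forall x : R, is_derive x (1 : R) F (f x)) -> continuous f ->
    \int[lebesgue_measure]_(x in `[a, b]) f x = F b - F a.
  move=> dF cf; have cF : continuous F.
    by move=> x; apply/differentiable_continuous/derivable1_diffP; have [] := dF x.
  rewrite /Rintegral (@continuous_FTC2 _ f F)//.
  - exact: continuous_subspaceT.
  - split => [x _||]; first by have [] := dF x.
    + by apply: cvg_at_right_filter; exact: cF.
    + by apply: cvg_at_left_filter; exact: cF.
  - by move=> x _; rewrite derive1E; have [] := dF x.
have eR x : Re ((2 * pi)%:C * 'i * cis x) = - sin (2 * pi * x) * (2 * pi).
  by rewrite /cis cReM cReM cImM /=; ring.
have eI x : Im ((2 * pi)%:C * 'i * cis x) = cos (2 * pi * x) * (2 * pi).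
  by rewrite /cis cImM cReM cImM /=; ring.
have hR : \int[lebesgue_measure]_(x in `[a, b]) Re ((2 * pi)%:C * 'i * cis x) =
    cos (2 * pi * b) - cos (2 * pi * a).
  rewrite -(ftc _ _ dc); last first.
    by move=> x; apply: cvgM; [apply: cvgN; exact: continuous_sinM|exact: cvg_cst].
  by apply: eq_Rintegral => x _; rewrite eR.
have hI : \int[lebesgue_measure]_(x in `[a, b]) Im ((2 * pi)%:C * 'i * cis x) =
    sin (2 * pi * b) - sin (2 * pi * a).
  rewrite -(ftc _ _ ds); last first.
    by move=> x; apply: cvgM; [exact: continuous_cosM|exact: cvg_cst].
  by apply: eq_Rintegral => x _; rewrite eI.
by rewrite /cI /cintegral hR hI.
Qed.

Lemma cis_lipschitz (a b : R) : nc (cis b - cis a) <= 2 * pi * `|b - a|.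
Proof.
wlog ab : a b / a <= b.
  move=> h; have [|/ltW] := leP a b; first exact: h.
  by rewrite ncBC distrC; exact: h.
rewrite -cI_cis// (ger0_norm (_ : 0 <= b - a)) ?subr_ge0//.
apply: cI_bound => //; first exact/continuousZ_fun/continuous_cis.
move=> s _; rewrite !ncM nc_cis nc_i !mulr1 nc_real ger0_norm//.
by rewrite mulr_ge0// pi_ge0.
Qed.

(** The truncation of x to [0, 1], written so that continuity is immediate. It extends the
    parametrization below continuously to the whole line, where [goursat] wants it continuous. *)
Definition clamp (x : R) : R := (`|x| - `|x - 1| + 1) / 2.

Lemma clampE x : 0 <= x <= 1 -> clamp x = x.
Proof.
move=> /andP[x0 x1]; rewrite /clamp ger0_norm// ler0_norm ?subr_le0//.
by field.
Qed.

Lemma clamp01 x : 0 <= clamp x <= 1.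
Proof.
rewrite /clamp.
have h1 : `|x - 1| <= `|x| + 1 by rewrite (le_trans (ler_normB _ _))// normr1.
have h2 : `|x| <= `|x - 1| + 1.
  by rewrite -{1}(subrK 1 x) (le_trans (ler_normD _ _))// normr1.
lra.
Qed.

Lemma continuous_clamp : continuous clamp.
Proof.
move=> x; apply: cvgM; last exact: cvg_cst.
apply: cvgD; last exact: cvg_cst.
apply: cvgB; first exact: norm_continuous.
apply: cvg_norm; apply: cvgB; [exact: cvg_id|exact: cvg_cst].
Qed.

Section formula.
Variables (u : C -> C) (rho r : R) (w : C).
Hypothesis du : forall z, nc z < rho -> cdiff u z.
Hypotheses (wr : nc w < r) (rrho : r < rho).

Let r0 : 0 < r. Proof. exact: le_lt_trans (nc_ge0 _) wr. Qed.

Let rcw s : r - nc w <= nc (r%:C * cis s - w).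
Proof.
apply: le_trans (ncB_ge _ _); rewrite ncM nc_cis mulr1 nc_real.
by rewrite lerD2r ger0_norm// ltW.
Qed.

Lemma rcw_neq0 s : r%:C * cis s - w != 0.
Proof. by rewrite -nc_gt0 (lt_le_trans _ (rcw s))// subr_gt0. Qed.

Let bet (s : R) : C := (2 * pi)%:C * 'i * (r%:C * cis s * (r%:C * cis s - w)^-1).

Let crc : continuous (fun s => r%:C * cis s).
Proof. exact/continuousZ_fun/continuous_cis. Qed.

Let crcw : continuous (fun s => r%:C * cis s - w).
Proof. apply: continuousB_fun; [exact: crc|exact: continuous_cstC]. Qed.

Let cbet : continuous bet.
Proof.
apply/continuousZ_fun/continuousM_fun; first exact: crc.
by apply: continuousV_fun; [exact: crcw|exact: rcw_neq0].
Qed.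

Let uc (g : R -> C) : continuous g -> (forall s, nc (g s) < rho) ->
  continuous (fun s => u (g s)).
Proof.
move=> cg gr s; apply: (@continuous_comp _ _ _ g u); first exact: cg.
exact/cdiff_continuous/du.
Qed.

Section step.
Variable t0 : R.
Hypothesis t01 : 0 < t0 < 1.

(** [Hh] maps the unit square onto the region between the circle of radius r and its contraction by
    t0 towards w. Inside the square, [kap] dx + [bet] dy is the pullback of dz / (z - w). *)
Let chi (x : R) := t0 + (1 - t0) * clamp x.
Let Hh (x y : R) : C := w + (chi x)%:C * (r%:C * cis y - w).
Let kap (x : R) : C := ((1 - t0) / chi x)%:C.

Let chi01 x : t0 <= chi x <= 1.
Proof.
have /andP[c0 c1] := clamp01 x; have /andP[t00 t1] := t01.
rewrite /chi; apply/andP; split; first by rewrite lerDl mulr_ge0//; lra.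
by nra.
Qed.

Let cchi : continuous chi.
Proof.
move=> x; apply: cvgD; first exact: cvg_cst.
by apply: cvgM; [exact: cvg_cst|exact: continuous_clamp].
Qed.

Let Hr x y : nc (Hh x y) < rho.
Proof.
have /andP[c0 c1] := chi01 x; apply: le_lt_trans rrho.
have -> : Hh x y = (1 - chi x)%:C * w + (chi x * r)%:C * cis y.
  by rewrite /Hh rmorphB rmorphM /=; ring.
apply: le_trans (ncD _ _) _; rewrite !ncM nc_cis !nc_real mulr1.
have /andP[t00 t1] := t01; have r00 := r0.
have p1 : 0 <= 1 - chi x by lra.
have p2 : 0 <= chi x * r by rewrite mulr_ge0//; lra.
rewrite (ger0_norm p1) (ger0_norm p2).
have : (1 - chi x) * nc w <= (1 - chi x) * r by rewrite ler_wpM2l// ltW.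
by nra.
Qed.

Let cH1 y : continuous (Hh^~ y).
Proof.
apply: continuousD_fun; first exact: continuous_cstC.
apply: continuousM_fun; first exact: continuous_realC.
exact: continuous_cstC.
Qed.

Let cH2 x : continuous (Hh x).
Proof.
apply: continuousD_fun; first exact: continuous_cstC.
exact/continuousZ_fun/crcw.
Qed.

Let chi_neq0 x : chi x != 0.
Proof. by have /andP[c0 c1] := chi01 x; have /andP[t00 t1] := t01; rewrite gt_eqF//; lra. Qed.

Let ckap : continuous kap.
Proof.
apply: continuous_realC => x; apply: cvgM; first exact: cvg_cst.
by apply: cvgV; [exact: chi_neq0|exact: cchi].
Qed.

Let HJ (x y h : R) : 0 <= x -> 0 <= y -> 0 <= h -> x + h <= 1 -> y + h <= 1 ->
  square_int kap bet Hh x y h = 0.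
Proof.
move=> x0 y0 h0 xh yh; rewrite /square_int.
rewrite (@eq_cI x _ _ (fun=> (1 - t0)%:C * (r%:C * (cis y - cis (y + h))))); last first.
  move=> s _; rewrite /Hh /kap.
  have : (chi s)%:C != 0 :> C by rewrite (inj_eq (@complexI _)) chi_neq0.
  by move=> c0; rewrite rmorphM /= fmorphV; field.
rewrite cI_cst ?lerDl// (@eq_cI y _ _ (fun s => (h * (1 - t0) * r)%:C *
    ((2 * pi)%:C * 'i * cis s))); last first.
  move=> s _; rewrite /Hh /bet /chi !clampE; [|lra|lra].
  have := rcw_neq0 s; rewrite !(rmorphM, rmorphD, rmorphB) /= => n0.
  by field.
rewrite cIZ; last exact/continuousZ_fun/continuous_cis.
rewrite cI_cis ?lerDl// addrAC subrr add0r !rmorphM /=; ring.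
Qed.

Let K := t0^-1 + 2 * pi * r / (r - nc w).

Let kapK (s : R) : 0 <= s <= 1 -> nc (kap s) <= K.
Proof.
move=> _; have /andP[c0 c1] := chi01 s; have /andP[t00 t1] := t01.
have cp : 0 < chi s by lra.
rewrite /kap nc_real ger0_norm; last by rewrite divr_ge0//; lra.
apply: (@le_trans _ _ t0^-1).
  rewrite -[leRHS]mul1r ler_pM//; [lra|by rewrite invr_ge0 ltW|lra|].
  by rewrite lef_pV2.
by rewrite lerDl !mulr_ge0 ?pi_ge0 ?invr_ge0 ?subr_ge0// ?ltW// r0.
Qed.

Let betK (s : R) : 0 <= s <= 1 -> nc (bet s) <= K.
Proof.
move=> _; have /andP[t00 t1] := t01.
apply: (@le_trans _ _ (2 * pi * r / (r - nc w))); last by rewrite lerDr invr_ge0 ltW.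
rewrite /bet !ncM nc_i ncV nc_cis !nc_real !mulr1 !ger0_norm ?mulr_ge0 ?pi_ge0 ?(ltW r0)//.
rewrite -mulrA ler_wpM2l ?mulr_ge0 ?pi_ge0// ler_wpM2l ?(ltW r0)//.
by rewrite lef_pV2 ?posrE ?subr_gt0// (lt_le_trans _ (rcw s))// subr_gt0.
Qed.

Let v_approx (x y : R) : 0 <= x <= 1 -> 0 <= y <= 1 ->
  exists d : C, forall e : R, 0 < e -> exists2 del : R, 0 < del &
    forall x' y' : R, 0 <= x' <= 1 -> 0 <= y' <= 1 ->
      `|x' - x| < del -> `|y' - y| < del ->
      nc (u (Hh x' y') - u (Hh x y) - d * (Hh x' y' - Hh x y)) <=
        e * (`|x' - x| + `|y' - y|).
Proof.
move=> x01 y01; have [d dP] := du (Hr x y); exists d => e e0.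
pose L := 1 + 2 * r + 2 * pi * r.
have pr : 0 <= 2 * pi * r by rewrite !mulr_ge0 ?pi_ge0// ltW// r0.
have L0 : 0 < L by rewrite /L; have := r0; lra.
have lip x' y' : 0 <= x' <= 1 -> nc (Hh x' y' - Hh x y) <= L * (`|x' - x| + `|y' - y|).
  move=> x'01.
  have -> : Hh x' y' - Hh x y = ((1 - t0) * (x' - x))%:C * (r%:C * cis y' - w) +
      (chi x * r)%:C * (cis y' - cis y).
    by rewrite /Hh /chi !clampE// !(rmorphM, rmorphD, rmorphB) /=; ring.
  apply: le_trans (ncD _ _) _; rewrite !ncM !nc_real !normrM.
  have /andP[t00 t1] := t01; have /andP[c0 c1] := chi01 x.
  have a1 : nc (r%:C * cis y' - w) <= 2 * r.
    apply: le_trans (ncB _ _) _; rewrite ncM nc_cis nc_real mulr1 ger0_norm ?(ltW r0)//.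
    by have := wr; lra.
  have a2 := cis_lipschitz y y'.
  have q1 : 0 <= 1 - t0 by lra.
  have q2 : 0 <= chi x by lra.
  rewrite (ger0_norm q1) (ger0_norm q2) (ger0_norm (ltW r0)).
  have nx := normr_ge0 (x' - x); have ny := normr_ge0 (y' - y).
  have n1 := nc_ge0 (r%:C * cis y' - w); have n2 := nc_ge0 (cis y' - cis y).
  have b1 : (1 - t0) * `|x' - x| * nc (r%:C * cis y' - w) <= `|x' - x| * (2 * r).
    apply: ler_pM => //; first by rewrite mulr_ge0//; lra.
    by rewrite -[leRHS]mul1r ler_wpM2r//; lra.
  have b2 : chi x * r * nc (cis y' - cis y) <= r * (2 * pi * `|y' - y|).
    apply: ler_pM => //; first by rewrite mulr_ge0 ?(ltW r0)//; lra.
    by rewrite -[leRHS]mul1r ler_wpM2r ?(ltW r0).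
  have := r0; rewrite /L => r0'.
  have c3 : 0 <= 2 * r * `|y' - y| by rewrite !mulr_ge0// ltW.
  have c4 : 0 <= 2 * pi * r * `|x' - x| by rewrite mulr_ge0.
  have -> : (1 + 2 * r + 2 * pi * r) * (`|x' - x| + `|y' - y|) =
    `|x' - x| * (2 * r) + r * (2 * pi * `|y' - y|) + (`|x' - x| + `|y' - y|)
     + 2 * r * `|y' - y| + 2 * pi * r * `|x' - x| by ring.
  by lra.
have [del del0 delP] := dP (e / L) (divr_gt0 e0 L0).
exists (del / (L *+ 2)); first by rewrite divr_gt0// mulrn_wgt0.
move=> x' y' x'01 y'01 hx hy.
have l1 := lip x' y' x'01.
have : nc (Hh x' y' - Hh x y) < del.
  apply: le_lt_trans l1 _.
  have : `|x' - x| + `|y' - y| < del / L.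
    by move: hx hy; rewrite -mulr_natr invfM mulrA => hx hy; lra.
  by rewrite ltr_pdivlMr// mulrC.
move=> /delP; rewrite [Hh x y + _]addrC subrK => h; apply: le_trans h _.
rewrite -[e in leRHS](divfK (lt0r_neq0 L0)) -[leRHS]mulrA.
by rewrite ler_wpM2l// divr_ge0// ltW.
Qed.

(** The edges y = 0 and y = 1 of the square have the same image since [cis] has period 1, so only
    the outer and the contracted circle remain in [goursat]. *)
Lemma cauchy_step : cI 0 1 (fun s => bet s * (u (r%:C * cis s) -
  u (w + t0%:C * (r%:C * cis s - w)))) = 0.
Proof.
have cv1 y : continuous (fun x => u (Hh x y)).
  by apply: uc; [exact: cH1|move=> s; exact: Hr].
have cv2 x : continuous (fun y => u (Hh x y)).
  by apply: uc; [exact: cH2|move=> s; exact: Hr].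
have := @goursat kap bet Hh ckap cbet cH1 cH2 K kapK betK HJ (fun x y => u (Hh x y))
   cv1 cv2 v_approx.
rewrite /square_int !add0r.
rewrite (@eq_cI 0 1 _ (fun=> 0)); last first.
  by move=> s _; rewrite /Hh cis01 subrr mulr0.
rewrite cI_cst// mulr0 add0r => h; rewrite -[RHS]h; apply: eq_cI => s _.
rewrite /Hh /chi !clampE ?lexx ?ler01//; congr (_ * (u _ - u _)).
- by rewrite mulr1 (addrC t0) subrK rmorph1; ring.
- by rewrite mulr0 addr0.
Qed.

End step.

Lemma continuous_circle : continuous (fun s => u (r%:C * cis s)).
Proof.
apply: uc; first exact: crc.
by move=> s; rewrite ncM nc_cis mulr1 nc_real ger0_norm ?(ltW r0).
Qed.

(** As t0 tends to 0 the contracted circle shrinks to w, where u is continuous. *)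
Lemma cauchy_bet : cI 0 1 (fun s => bet s * (u (r%:C * cis s) - u w)) = 0.
Proof.
apply: nc_le_eq0 => e e0.
pose B := 2 * pi * r / (r - nc w).
have B0 : 0 < B by rewrite divr_gt0 ?subr_gt0 ?mulr_gt0 ?pi_gt0// r0.
have betB s : nc (bet s) <= B.
  rewrite /bet !ncM nc_i ncV nc_cis !nc_real !mulr1 !ger0_norm ?mulr_ge0 ?pi_ge0 ?(ltW r0)//.
  rewrite /B -[leRHS]mulrA ler_wpM2l ?mulr_ge0 ?pi_ge0// ler_wpM2l ?(ltW r0)//.
  by rewrite lef_pV2 ?posrE ?subr_gt0// (lt_le_trans _ (rcw s))// subr_gt0.
have cuw : {for w, continuous u}.
  by apply/cdiff_continuous/du; exact: lt_trans rrho.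
have [d d0 dP] := nbhs_ncP (cvgC_lt cuw (divr_gt0 e0 B0)).
pose t0 := Num.min (2^-1) (d / (4 * r)).
have t00 : 0 < t0 by rewrite lt_min invr_gt0 ltr0n/= divr_gt0// mulr_gt0// r0.
have t01 : t0 < 1 by rewrite gt_min; apply/orP; left; lra.
have t0d : t0 * (2 * r) < d.
  have : t0 <= d / (4 * r) by rewrite ge_min lexx orbT.
  have r4 : 0 < 4 * r by rewrite mulr_gt0// r0.
  by rewrite ler_pdivlMr// => h; move: d0 => /=; have := r0; nra.
have tr s : nc (w + t0%:C * (r%:C * cis s - w) - w) < d.
  apply: le_lt_trans t0d; rewrite addrAC subrr add0r ncM nc_real ger0_norm ?ltW//.
  rewrite ltr_pM2l//; apply: le_lt_trans (ncB _ _) _.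
  rewrite ncM nc_cis nc_real mulr1 ger0_norm ?(ltW r0)//.
  by have := wr; lra.
have near s : nc (u (w + t0%:C * (r%:C * cis s - w)) - u w) < e / B.
  exact/dP/tr.
have ctu : continuous (fun s => u (w + t0%:C * (r%:C * cis s - w))).
  apply: uc.
    by apply: continuousD_fun; [exact: continuous_cstC|exact/continuousZ_fun/crcw].
  move=> s; apply: le_lt_trans rrho.
  have -> : w + t0%:C * (r%:C * cis s - w) = (1 - t0)%:C * w + (t0 * r)%:C * cis s.
    by rewrite rmorphB rmorphM /=; ring.
  apply: le_trans (ncD _ _) _; rewrite !ncM nc_cis !nc_real mulr1.
  have := nc_ge0 w; rewrite ger0_norm; last by lra.
  rewrite ger0_norm; last by rewrite mulr_ge0 ?ltW// r0.
  by have := wr; nra.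
have -> : cI 0 1 (fun s => bet s * (u (r%:C * cis s) - u w)) =
    cI 0 1 (fun s => bet s * (u (r%:C * cis s) - u (w + t0%:C * (r%:C * cis s - w)))) +
    cI 0 1 (fun s => bet s * (u (w + t0%:C * (r%:C * cis s - w)) - u w)).
  rewrite -cID; first by apply: eq_cI => s _; ring.
    exact: (continuousM_fun cbet (continuousB_fun continuous_circle ctu)).
  exact: (continuousM_fun cbet (continuousB_fun ctu (@continuous_cstC _))).
rewrite cauchy_step ?t00// add0r.
have -> : e = B * (e / B) * (1 - 0) by rewrite subr0 mulr1 mulrC divfK// gt_eqF.
apply: cI_bound; [|exact: ler01|].
  exact: (continuousM_fun cbet (continuousB_fun ctu (@continuous_cstC _))).
by move=> s _; rewrite ncM ler_pM ?nc_ge0// ltW.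
Qed.

(** The Cauchy kernel z / (z - w), taken against the normalized arc length dz / (2 pi i z). *)
Definition cker (s : R) : C := r%:C * cis s * (r%:C * cis s - w)^-1.

Lemma continuous_cker : continuous cker.
Proof.
apply: continuousM_fun; first exact: crc.
by apply: continuousV_fun; [exact: crcw|exact: rcw_neq0].
Qed.

Lemma nc_cker s : nc (cker s) <= r / (r - nc w).
Proof.
rewrite /cker !ncM ncV nc_cis nc_real mulr1 ger0_norm ?(ltW r0)//.
rewrite ler_wpM2l ?(ltW r0)//.
by rewrite lef_pV2 ?posrE ?subr_gt0// (lt_le_trans _ (rcw s))// subr_gt0.
Qed.

Lemma cauchy_cker : cI 0 1 (fun s => cker s * u (r%:C * cis s)) = u w * cI 0 1 cker.
Proof.
have := cauchy_bet.
rewrite (@eq_cI _ _ _ (fun s => (2 * pi)%:C * 'i * (cker s * (u (r%:C * cis s) - u w)))); last first.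
  by move=> s _; rewrite /bet /cker; ring.
rewrite cIZ; last first.
  exact: (continuousM_fun continuous_cker (continuousB_fun continuous_circle (@continuous_cstC _))).
move=> /eqP; rewrite !mulf_eq0 => /orP[/orP[]|].
- by rewrite (inj_eq (@complexI _)) gt_eqF// mulr_gt0// pi_gt0.
- by rewrite -nc_eq0 nc_i oner_eq0.
- move=> /eqP h; apply/eqP; rewrite -subr_eq0 -[X in _ == X]h; apply/eqP.
  rewrite -(cIZ _ _ _ continuous_cker).
  have c1 := continuousM_fun continuous_cker continuous_circle.
  have c2 := @continuousZ_fun (u w) _ continuous_cker.
  by rewrite -(cIB _ _ c1 c2); apply: eq_cI => s _; ring.
Qed.

End formula.

Lemma derivable_cdiff (V : normedModType C) (f : V -> C) (a b : V) (l : C) :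
  derivable f (a + l *: b) b -> cdiff (fun t => f (a + t *: b)) l.
Proof.
move=> /cvg_ex[/= d hd]; exists d => e e0.
have [del del0 delP] := nbhs_ncP (cvgC_lt hd e0).
exists del => // h hdel.
have [->|h0] := eqVneq h 0; first by rewrite addr0 subrr mulr0 subr0 nc0 mulr0.
have := delP h; rewrite subr0 => /(_ hdel h0) /=.
move=> /ltW hle.
have -> : f (a + (l + h) *: b) - f (a + l *: b) - d * h =
    h * (h^-1 *: (f (h *: b + (a + l *: b)) - f (a + l *: b)) - d).
  rewrite mulrBr; congr (_ - _); last by rewrite mulrC.
  rewrite -[h^-1 *: _]/(h^-1 * _) mulrA mulfV// mul1r; congr (f _ - _).
  by rewrite scalerDl addrA addrC.
by rewrite ncM mulrC ler_wpM2r ?nc_ge0.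
Qed.

Lemma derivable1_cdiff (f : C -> C) (l : C) : derivable f l 1 -> cdiff f l.
Proof.
move=> df; have := @derivable_cdiff _ f 0 1 l.
have -> : 0 + l *: (1 : C) = l by rewrite add0r -[_ *: _]/(_ * _) mulr1.
move=> /(_ df); rewrite (_ : (fun t => f _) = f)//.
by apply/funext => t; rewrite add0r -[_ *: _]/(_ * _) mulr1.
Qed.

(** On the circle conj(z) = r^2 / z, so the conjugate of the kernel is 1 / (1 - b z) with b =
    conj(w) / r^2. This is analytic on a larger disc, and Cauchy's formula at the centre, where the
    kernel is 1, gives its value at 0. *)
Lemma cker_int (r : R) (w : C) : nc w < r -> cI 0 1 (cker r w) = 1.
Proof.
move=> wr; have r0 : 0 < r by exact: le_lt_trans (nc_ge0 _) wr.
apply: (can_inj (@cjK)); rewrite cj1.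
have cc := @continuous_cker r w wr.
rewrite /cI -cintegral_cj; [|exact: measurable_itv|exact: cintegrable_itv].
pose b := cj w * ((r ^+ 2)^-1)%:C.
have b1 z : nc z <= r -> 1 - b * z != 0.
  move=> zr; rewrite -nc_gt0; apply: lt_le_trans (ncB_ge _ _).
  rewrite nc1 subr_gt0 !ncM nc_cj nc_real ger0_norm ?invr_ge0 ?sqr_ge0//.
  rewrite mulrAC ltr_pdivrMr ?exprn_gt0// mul1r expr2.
  by apply: (@le_lt_trans _ _ (nc w * r)); [rewrite ler_wpM2l ?nc_ge0|rewrite ltr_pM2r].
(* The radius 2r - |w| works because |w| (2r - |w|) < r^2, which is (r - |w|)^2 > 0. *)
have [rho' rrho nz] : exists2 rho, r < rho & forall z, nc z < rho -> 1 - b * z != 0.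
  exists (r + (r - nc w)) => [|z zr]; first by rewrite ltrDl subr_gt0.
   rewrite -nc_gt0; apply: lt_le_trans (ncB_ge _ _).
  rewrite nc1 subr_gt0 !ncM nc_cj nc_real ger0_norm ?invr_ge0 ?sqr_ge0//.
  rewrite mulrAC ltr_pdivrMr ?exprn_gt0// mul1r.
  have := nc_ge0 w; have := nc_ge0 z => z0 w0.
  apply: (@le_lt_trans _ _ (nc w * (r + (r - nc w)))); first by rewrite ler_wpM2l// ltW.
  nra.
have du z : nc z < rho' -> cdiff (fun z => (1 - b * z)^-1) z.
  move=> /nz bz; apply: derivable1_cdiff.
  by apply: derivableV => //.
have n0 : nc 0 < r by rewrite nc0.
have := @cauchy_cker _ rho' r 0 du n0 rrho.
have c0 s : cker r 0 s = 1.
  rewrite /cker subr0 mulfV// mulf_neq0 ?cis_neq0//.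
  by rewrite (inj_eq (@complexI _)) gt_eqF.
have k1 : cI 0 1 (cker r 0) = 1.
  rewrite (@eq_cI _ _ _ (fun=> 1)) => [|s _]; last exact: c0.
  by rewrite cI_cst ?ler01// subr0 mulr1.
rewrite mulr0 subr0 invr1 mul1r k1 => h; rewrite -[RHS]h.
apply: eq_cintegral => s _; rewrite c0 mul1r /cker.
have k0 := rcw_neq0 wr s.
rewrite cjM cjV cjB !cjM cj_real.
have ccis : cj (cis s) = (cis s)^-1.
  apply: (mulfI (cis_neq0 s)); rewrite mulcJ nc_cis expr1n mulfV ?cis_neq0//.
rewrite ccis /b.
have rr0 : r%:C != 0 :> C by rewrite (inj_eq (@complexI _)) gt_eqF.
have k3 : r%:C * (cis s)^-1 - cj w != 0.
  by rewrite -ccis -(cj_real r) -cjM -cjB cj_eq0.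
have k2 := b1 (r%:C * cis s); rewrite ncM nc_cis nc_real mulr1 ger0_norm ?(ltW r0)// in k2.
have {k2} := k2 (lexx _); rewrite /b => k2.
rewrite fmorphV rmorphXn /= in k2 *.
have cs0 := cis_neq0 s.
have A0 : r%:C / cis s != 0 by rewrite mulf_neq0// invr_neq0.
have -> : 1 - cj w / r%:C ^+ 2 * (r%:C * cis s) =
    (r%:C / cis s - cj w) / (r%:C / cis s) by field; rewrite cs0 rr0.
by rewrite invf_div.
Qed.

Lemma geo_expand (x : C) N : 1 - x != 0 ->
  (1 - x)^-1 = \sum_(k < N) x ^+ k + x ^+ N * (1 - x)^-1.
Proof.
move=> x1; apply: (mulfI x1); rewrite mulfV// mulrDr mulrCA mulfV// mulr1.
have := subrX1 x N => /(congr1 -%R); rewrite opprB -mulNr opprB => <-.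
by rewrite subrK.
Qed.

Definition tcoef (u : C -> C) (r : R) (k : nat) : C :=
  cI 0 1 (fun s => (r%:C * cis s) ^- k * u (r%:C * cis s)).

(** The kernel is 1 / (1 - w / z); its finite geometric expansion has the exact remainder (w / z)^N
    times the kernel, and the kernel is at most r / (r - |w|). *)
Lemma tcoef_expand (u : C -> C) (rho r M : R) (w : C) N :
  (forall z, nc z < rho -> cdiff u z) -> nc w < r -> r < rho ->
  (forall s, 0 <= s <= 1 -> nc (u (r%:C * cis s)) <= M) ->
  nc (u w - \sum_(k < N) tcoef u r k * w ^+ k) <= M * (nc w / r) ^+ N * (r / (r - nc w)).
Proof.
move=> du wr rrho uM; have r0 : 0 < r by exact: le_lt_trans (nc_ge0 _) wr.
have cu := continuous_circle du wr rrho.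
have ck := @continuous_cker r w wr.
have z0 s : r%:C * cis s != 0.
  by rewrite mulf_neq0 ?cis_neq0// (inj_eq (@complexI _)) gt_eqF.
have cz : continuous (fun s => r%:C * cis s) by exact/continuousZ_fun/continuous_cis.
have cV k : continuous (fun s => (r%:C * cis s) ^- k).
  by apply: continuousV_fun; [exact: continuousX_fun|move=> s; rewrite expf_neq0].
have ct k : continuous (fun s => (r%:C * cis s) ^- k * u (r%:C * cis s)).
  exact: continuousM_fun (cV k) cu.
have cR : continuous (fun s => w ^+ N * ((r%:C * cis s) ^- N * (cker r w s * u (r%:C * cis s)))).
  by apply/continuousZ_fun/continuousM_fun; [exact: cV|exact: continuousM_fun ck cu].
have -> : u w - \sum_(k < N) tcoef u r k * w ^+ k =
    cI 0 1 (fun s => w ^+ N * ((r%:C * cis s) ^- N * (cker r w s * u (r%:C * cis s)))).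
  have := cauchy_cker du wr rrho; rewrite cker_int// mulr1 => <-.
  have -> : \sum_(k < N) tcoef u r k * w ^+ k =
      cI 0 1 (fun s => \sum_(k < N) w ^+ k * ((r%:C * cis s) ^- k * u (r%:C * cis s))).
    rewrite /cI cintegral_sum; [|exact: measurable_itv|]; last first.
      by move=> k _; apply/cintegrable_itv/continuousZ_fun/ct.
    by apply: eq_bigr => k _; rewrite mulrC /tcoef; exact: (esym (cIZ _ _ _ (ct k))).
  apply/eqP; rewrite subr_eq; apply/eqP; rewrite addrC /cI -cintegralD; [|exact: measurable_itv| |]; last 2 first.
  - apply: cintegrable_sum; first exact: measurable_itv.
    by move=> k _; apply/cintegrable_itv/continuousZ_fun/ct.
  - exact: cintegrable_itv.
  apply: eq_cintegral => s _; rewrite /cker.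
  have k0 := rcw_neq0 wr s.
  have xE : 1 - w / (r%:C * cis s) = (r%:C * cis s - w) / (r%:C * cis s).
    by rewrite mulrBl mulfV.
  have x1 : 1 - w / (r%:C * cis s) != 0 by rewrite xE mulf_neq0// invr_eq0.
  have ek : r%:C * cis s / (r%:C * cis s - w) = (1 - w / (r%:C * cis s))^-1.
    by rewrite xE invf_div.
  rewrite ek {1}(geo_expand N x1) mulrDl mulr_suml; congr (_ + _).
    by apply: eq_bigr => k _; rewrite expr_div_n mulrA.
  by rewrite expr_div_n !mulrA.
have -> : M * (nc w / r) ^+ N * (r / (r - nc w)) = M * (nc w / r) ^+ N * (r / (r - nc w)) * (1 - 0).
  by rewrite subr0 mulr1.
apply: cI_bound; [exact: cR|exact: ler01|] => s s01.
have uMs := uM _ s01; have kb := @nc_cker r w wr s.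
move: (cker r w s) kb => ckv kb.
rewrite !ncM ncV !ncX ncM nc_cis nc_real mulr1 ger0_norm ?(ltW r0)//.
rewrite expr_div_n.
have -> : M * (nc w ^+ N / r ^+ N) * (r / (r - nc w)) =
   nc w ^+ N * ((r ^+ N)^-1 * (r / (r - nc w) * M)) by ring.
rewrite ler_wpM2l ?exprn_ge0 ?nc_ge0// ler_wpM2l ?invr_ge0 ?exprn_ge0 ?(ltW r0)//.
by apply: ler_pM => //; rewrite nc_ge0.
Qed.

Lemma tcoef_bound (u : C -> C) (rho r M : R) k :
  (forall z, nc z < rho -> cdiff u z) -> 0 < r -> r < rho ->
  (forall s, 0 <= s <= 1 -> nc (u (r%:C * cis s)) <= M) -> nc (tcoef u r k) <= M / r ^+ k.
Proof.
move=> du r0 rrho uM; have n0 : nc 0 < r by rewrite nc0.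
have cu := continuous_circle du n0 rrho.
have z0 s : r%:C * cis s != 0.
  by rewrite mulf_neq0 ?cis_neq0// (inj_eq (@complexI _)) gt_eqF.
have ct : continuous (fun s => (r%:C * cis s) ^- k * u (r%:C * cis s)).
  apply: continuousM_fun cu; apply: continuousV_fun.
    exact/continuousX_fun/continuousZ_fun/continuous_cis.
  by move=> s; rewrite expf_neq0.
rewrite -[leRHS]mulr1 -[X in _ * X](subr0 1); apply: cI_bound; [exact: ct|exact: ler01|] => s s01.
rewrite ncM ncV ncX ncM nc_cis nc_real mulr1 ger0_norm ?(ltW r0)// mulrC.
rewrite ler_wpM2r ?invr_ge0 ?exprn_ge0 ?(ltW r0)//.
exact: uM.
Qed.

(** Induction on the index: once the lower coefficients agree, the difference of the two expansions
    at a small real w = t gives |a_k - b_k| t^k = O(t^(k+1)). *)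
Lemma expansion_unique (u : C -> C) (a b : nat -> C) (del : R) (Ca Cb : nat -> R) :
  0 < del ->
  (forall N w, nc w < del -> nc (u w - \sum_(k < N) a k * w ^+ k) <= Ca N * nc w ^+ N) ->
  (forall N w, nc w < del -> nc (u w - \sum_(k < N) b k * w ^+ k) <= Cb N * nc w ^+ N) ->
  a =1 b.
Proof.
move=> del0 ha hb k; elim/ltn_ind: k => k ih.
apply/eqP; rewrite -subr_eq0; apply/eqP/nc_le_eq0 => e e0.
pose K := `|Ca k.+1| + `|Cb k.+1| + 1.
have K0 : 0 < K by rewrite ltr_wpDl ?addr_ge0.
pose t := Num.min (del / 2) (e / K).
have t0 : 0 < t by rewrite lt_min !divr_gt0.
have td : t < del by rewrite gt_min; apply/orP; left; lra.
have te : t * K <= e by rewrite -ler_pdivlMr// ge_min lexx orbT.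
have nt : nc t%:C = t by rewrite nc_real gtr0_norm.
have := ha k.+1 t%:C; have := hb k.+1 t%:C; rewrite nt => /(_ td) h2 /(_ td) h1.
have : nc ((a k - b k) * t%:C ^+ k) <= K * t ^+ k.+1.
  have -> : (a k - b k) * t%:C ^+ k = (u t%:C - \sum_(j < k.+1) b j * t%:C ^+ j) -
      (u t%:C - \sum_(j < k.+1) a j * t%:C ^+ j).
    have S : \sum_(j < k) a j * t%:C ^+ j = \sum_(j < k) b j * t%:C ^+ j.
      by apply: eq_bigr => j _; rewrite ih.
    by rewrite !big_ord_recr /= S; ring.
  apply: le_trans (ncB _ _) _; apply: le_trans (lerD h2 h1) _.
  rewrite -mulrDl ler_wpM2r ?exprn_ge0 ?(ltW t0)// /K.
  by have := ler_norm (Ca k.+1); have := ler_norm (Cb k.+1); lra.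
rewrite ncM ncX nt exprSr mulrCA mulrC ler_pM2l ?exprn_gt0// => h.
by apply: le_trans h _; rewrite mulrC.
Qed.

(** The coefficients computed at radius rho / 2 agree with those of any other radius by uniqueness,
    so a single sequence satisfies the Cauchy estimates of all radii. *)
Theorem taylor_disc (u : C -> C) (rho : R) : (forall z, nc z < rho -> cdiff u z) ->
  0 < rho -> exists a : nat -> C, forall r M, 0 < r -> r < rho ->
    (forall z, nc z = r -> nc (u z) <= M) ->
    (forall k, nc (a k) <= M / r ^+ k) /\
    forall N w, nc w < r ->
      nc (u w - \sum_(k < N) a k * w ^+ k) <= M * (nc w / r) ^+ N * (r / (r - nc w)).
Proof.
move=> du rho0; exists (tcoef u (rho / 2)) => r M r0 rrho uM.
have bdd r' : 0 < r' -> r' < rho ->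
    exists M', forall s, 0 <= s <= 1 -> nc (u (r'%:C * cis s)) <= M'.
  move=> r'0 r'rho; have n0 : nc 0 < r' by rewrite nc0.
  have cu := continuous_circle du n0 r'rho.
  have cn : continuous (fun s => nc (u (r'%:C * cis s))).
    move=> s; apply/cvgrPdistC_lt => e e0.
    apply: filterS (cvgC_lt (cu s) e0) => t /=; apply: le_lt_trans.
    exact: nc_dist.
  have [c _ cP] := @EVT_max R _ 0 1 ler01 (continuous_subspaceT cn).
  by exists (nc (u (r'%:C * cis c))) => s s01; apply: cP; rewrite in_itv.
have uMs s : 0 <= s <= 1 -> nc (u (r%:C * cis s)) <= M.
  by move=> _; apply: uM; rewrite ncM nc_cis nc_real mulr1 ger0_norm ?(ltW r0).
have E : tcoef u (rho / 2) =1 tcoef u r.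
  have h0 : 0 < rho / 2 by rewrite divr_gt0.
  have h1 : rho / 2 < rho by lra.
  have [M' uM'] := bdd _ h0 h1.
  (* Below half of each radius q the factor q / (q - |w|) is at most 2, so both remainders have the
     form required by [expansion_unique]. *)
  pose del := Num.min (r / 2) (rho / 4).
  have del0 : 0 < del by rewrite lt_min !divr_gt0.
  have d1 : del <= r / 2 by rewrite ge_min lexx.
  have d2 : del <= rho / 4 by rewrite ge_min lexx orbT.
  have M0 : 0 <= M.
    by apply: le_trans (uMs 0 _); [exact: nc_ge0|rewrite lexx ler01].
  have M'0 : 0 <= M'.
    by apply: le_trans (uM' 0 _); [exact: nc_ge0|rewrite lexx ler01].
  have est q K N (w : C) : 0 < q -> 0 <= K -> nc w < q / 2 ->
      K * (nc w / q) ^+ N * (q / (q - nc w)) <= (K * (q ^+ N)^-1 * 2) * nc w ^+ N.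
    move=> q0 K0 wq; rewrite expr_div_n.
    have -> : K * (nc w ^+ N / q ^+ N) * (q / (q - nc w)) =
      K * (q ^+ N)^-1 * (q / (q - nc w)) * nc w ^+ N by ring.
    rewrite ler_wpM2r ?exprn_ge0 ?nc_ge0// ler_wpM2l//.
      by rewrite mulr_ge0// invr_ge0 exprn_ge0// ltW.
    rewrite ler_pdivrMr; [lra|]; by rewrite subr_gt0; lra.
  apply: (@expansion_unique u _ _ del (fun N => M' * ((rho / 2) ^+ N)^-1 * 2)
     (fun N => M * (r ^+ N)^-1 * 2)) => // N w wd.
  - apply: le_trans (tcoef_expand (r := rho / 2) N du _ h1 uM') (est _ _ _ _ _ _ _) => //; lra.
  - apply: le_trans (tcoef_expand (r := r) N du _ rrho uMs) (est _ _ _ _ _ _ _) => //; lra.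
split => [k|N w wr].
  rewrite E; exact: tcoef_bound du r0 rrho uMs.
under eq_bigr do rewrite E.
exact: tcoef_expand du wr rrho uMs.
Qed.

End cauchy.

End one_complex_variable.

(** * Unitary invariance of the surface measure *)

Section complex_measurable.
Context {R : realType} d (T : measurableType d).
Local Notation C := R[i].
Local Notation nc := (@Normc.normc R).
Local Notation Re := (@complex.Re R).
Local Notation Im := (@complex.Im R).
Implicit Types F G : T -> C.

Lemma measurable_ReC F : measurable_fun setT F -> measurable_fun setT (Re \o F).
Proof. by move=> mF; apply: measurableT_comp mF; exact: measurable_Re. Qed.

Lemma measurable_ImC F : measurable_fun setT F -> measurable_fun setT (Im \o F).
Proof. by move=> mF; apply: measurableT_comp mF; exact: measurable_Im. Qed.

Lemma measurable_funCD F G : measurable_fun setT F -> measurable_fun setT G ->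
  measurable_fun setT (fun x => F x + G x).
Proof.
move=> mF mG; apply: measurable_fun_complex.
- rewrite (_ : _ \o _ = fun x => Re (F x) + Re (G x)); last first.
    by apply/funext => x /=; rewrite cReD.
  by apply: measurable_funD; exact: measurable_ReC.
- rewrite (_ : _ \o _ = fun x => Im (F x) + Im (G x)); last first.
    by apply/funext => x /=; rewrite cImD.
  by apply: measurable_funD; exact: measurable_ImC.
Qed.

Lemma measurable_funCM F G : measurable_fun setT F -> measurable_fun setT G ->
  measurable_fun setT (fun x => F x * G x).
Proof.
move=> mF mG.
have [F1 F2] := (measurable_ReC mF, measurable_ImC mF).
have [G1 G2] := (measurable_ReC mG, measurable_ImC mG).
apply: measurable_fun_complex.
- rewrite (_ : _ \o _ = fun x => Re (F x) * Re (G x) - Im (F x) * Im (G x)); last first.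
    by apply/funext => x /=; rewrite cReM.
  by apply: measurable_funB; exact: measurable_funM.
- rewrite (_ : _ \o _ = fun x => Re (F x) * Im (G x) + Im (F x) * Re (G x)); last first.
    by apply/funext => x /=; rewrite cImM.
  by apply: measurable_funD; exact: measurable_funM.
Qed.

Lemma measurable_funC_cj F : measurable_fun setT F ->
  measurable_fun setT (fun x => cj (F x)).
Proof.
move=> mF; apply: measurable_fun_complex.
- by rewrite (_ : _ \o _ = Re \o F); [exact: measurable_ReC|apply/funext => x /=; rewrite cRe_cj].
- rewrite (_ : _ \o _ = fun x => - Im (F x)); last by apply/funext => x /=; rewrite cIm_cj.
  by apply: measurableT_comp; [exact: oppr_measurable|exact: measurable_ImC].
Qed.

Lemma measurable_funCB F G : measurable_fun setT F -> measurable_fun setT G ->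
  measurable_fun setT (fun x => F x - G x).
Proof.
move=> mF mG; rewrite (_ : (fun _ => _) = fun x => F x + (-1) * G x).
  by apply/measurable_funCD/measurable_funCM => //; exact: measurable_cst.
by apply/funext => x; rewrite mulN1r.
Qed.

Lemma measurable_funC_sum (I : Type) (s : seq I) (F : I -> T -> C) :
  (forall i, measurable_fun setT (F i)) ->
  measurable_fun setT (fun x => \sum_(i <- s) F i x).
Proof.
move=> mF; elim: s => [|i s ih].
  by under eq_fun do rewrite big_nil; exact: measurable_cst.
by under eq_fun do rewrite big_cons; exact: measurable_funCD.
Qed.

Lemma measurable_funC_lim (F_ : nat -> T -> C) F : (forall k, measurable_fun setT (F_ k)) ->
  (forall x, F_ ^~ x @ \oo --> F x) -> measurable_fun setT F.
Proof.
move=> mF cF; apply: measurable_fun_complex.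
- apply: (@measurable_fun_cvg _ _ _ _ (fun k => Re \o F_ k)); first by move=> k; exact: measurable_ReC.
  by move=> x _; apply: (@cvg_comp _ _ _ (F_^~ x) Re _ (nbhs (F x))); [exact: cF|exact: continuous_Re].
- apply: (@measurable_fun_cvg _ _ _ _ (fun k => Im \o F_ k)); first by move=> k; exact: measurable_ImC.
  by move=> x _; apply: (@cvg_comp _ _ _ (F_^~ x) Im _ (nbhs (F x))); [exact: cF|exact: continuous_Im].
Qed.

Lemma measurable_fun_nc F : measurable_fun setT F -> measurable_fun setT (fun x => nc (F x)).
Proof. by move=> mF; apply: measurable_nc; [exact: measurable_ReC|exact: measurable_ImC]. Qed.

End complex_measurable.

(** * Translation invariance of Lebesgue measure on C^n *)

Section translation.
Context {R : realType}.
Local Notation C := R[i].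

Definition translation_invariant d (T : measurableType d) (add : T -> T -> T)
  (m : set T -> \bar R) :=
  forall a A, measurable A -> m ((add ^~ a) @^-1` A) = m A.

Lemma preimage_measurable d1 d2 (T1 : measurableType d1) (T2 : measurableType d2)
  (f : T1 -> T2) A : measurable_fun setT f -> measurable A -> measurable (f @^-1` A).
Proof. by move=> mf mA; rewrite -[X in measurable X]setTI; exact: mf. Qed.

Lemma lebesgue_measure_translation :
  @translation_invariant _ (measurableTypeR R) (fun x y : R => x + y) lebesgue_measure.
Proof.
move=> a A mA.
have mf : measurable_fun setT ((fun x : R => x + a) : measurableTypeR R -> measurableTypeR R).
  by apply: measurable_funD; [exact: measurable_id|exact: measurable_cst].
symmetry; pose m := (pushforward lebesgue_measure ((fun x : R => x + a) :
  measurableTypeR R -> measurableTypeR R)).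
pose m' : {measure set (measurableTypeR R) -> \bar R} :=
  measure_function_pushforward__canonical__measure_function_Measure lebesgue_measure mf.
apply: (@lebesgue_measure_unique R m') => // _ [[x y] _ <-] /=.
rewrite /pushforward.
have -> : (fun z : R => z + a) @^-1` `]x, y]%classic = `]x - a, y - a]%classic.
  by apply/seteqP; split => z /=; rewrite !in_itv/= ltrBlDr lerBrDr.
have /= -> := @lebesgue_measure_itv R `]x, y]%R.
have /= -> := @lebesgue_measure_itv R `]x - a, y - a]%R.
by rewrite !lte_fin ltrD2r; case: ifP => // _; rewrite -!EFinB; congr EFin; ring.
Qed.

Section product.
Context d1 d2 (T1 : measurableType d1) (T2 : measurableType d2).
Variables (m1 : {sigma_finite_measure set T1 -> \bar R})
  (m2 : {sigma_finite_measure set T2 -> \bar R}).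
Variables (add1 : T1 -> T1 -> T1) (add2 : T2 -> T2 -> T2).
Hypotheses (t1 : translation_invariant add1 m1) (t2 : translation_invariant add2 m2).
Hypotheses (ma1 : forall a, measurable_fun setT (add1 ^~ a))
  (ma2 : forall a, measurable_fun setT (add2 ^~ a)).

Lemma product_translation_invariant : @translation_invariant _ (T1 * T2)%type
  (fun p q => (add1 p.1 q.1, add2 p.2 q.2)) (m1 \x m2)%E.
Proof.
move=> [a b] A mA /=.
pose f (p : T1 * T2) := (add1 p.1 a, add2 p.2 b).
have mf : measurable_fun setT f.
  by apply: measurable_fun_pair; [apply: measurableT_comp (ma1 a) _|
    apply: measurableT_comp (ma2 b) _]; [exact: measurable_fst|exact: measurable_snd].
pose m' : {measure set (T1 * T2) -> \bar R} :=
  measure_function_pushforward__canonical__measure_function_Measure (m1 \x m2)%E mf.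
symmetry; apply: (product_measure_unique (m' := m')) => // B D mB mD.
rewrite /m' /= /pushforward.
have -> : f @^-1` (B `*` D) = (add1 ^~ a @^-1` B) `*` (add2 ^~ b @^-1` D) by [].
have mB' := preimage_measurable (ma1 a) mB; have mD' := preimage_measurable (ma2 b) mD.
transitivity (m1 (add1 ^~ a @^-1` B) * m2 (add2 ^~ b @^-1` D))%E.
  exact: product_measure1E.
by congr (_ * _)%E; [exact: t1|exact: t2].
Qed.

End product.

Lemma measurable_cadd (a : C) : measurable_fun setT (fun z : C => z + a).
Proof. by apply: measurable_funCD; [exact: measurable_id|exact: measurable_cst]. Qed.

Lemma lebesgue_complex_translation :
  @translation_invariant _ C (fun x y => x + y) (@lebesgue_complex R).
Proof.
move=> a A mA; rewrite /lebesgue_complex /pushforward.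
have mp := @measurable_pair_complex R.
rewrite -[RHS](@product_translation_invariant _ _ _ _ lebesgue_measure lebesgue_measure
   (fun x y : R => x + y) (fun x y : R => x + y) _ _ _ _ (complex.Re a, complex.Im a)).
- by congr product_measure1; apply/seteqP; split => -[x y] /=; rewrite /pair_complex;
    case: a => a1 a2 /=; simpc.
- exact: lebesgue_measure_translation.
- exact: lebesgue_measure_translation.
- by move=> b; apply: measurable_funD; [exact: measurable_id|exact: measurable_cst].
- by move=> b; apply: measurable_funD; [exact: measurable_id|exact: measurable_cst].
- exact: preimage_measurable.
Qed.

Lemma measurable_rowadd n (a : 'rV[C]_n) : measurable_fun setT (fun z : 'rV[C]_n => z + a).
Proof.
apply: measurable_fun_row => i; under eq_fun do rewrite mxE.
by apply: measurable_funCD; [exact: measurable_coord|exact: measurable_cst].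
Qed.

Lemma lebesgue_Cn_translation n :
  @translation_invariant _ 'rV[C]_n (fun x y => x + y) (@lebesgue_Cn R n).
Proof.
elim: n => [|n ih] a A mA.
  rewrite (_ : _ @^-1` _ = A)//; apply/seteqP; split => x /=;
  by rewrite (_ : x + a = x)//; apply/rowP => -[].
rewrite /= /cons_measure /pushforward.
rewrite -[RHS](@product_translation_invariant _ _ _ _ lebesgue_complex (lebesgue_Cn n)
   (fun x y : C => x + y) (fun x y : 'rV[C]_n => x + y) _ ih _ _
   (a ord0 ord0, \row_j a ord0 (lift ord0 j))).
- congr product_measure1; apply/seteqP; split => -[x y] /=;
  rewrite (_ : cons_row (x, y) + a = cons_row (x + a ord0 ord0, y + \row_j a ord0 (lift ord0 j)))//;
  apply/rowP => i; rewrite [LHS]mxE; case: (unliftP ord0 i) => [j|] ->;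
  by rewrite ?cons_row0 ?cons_rowS /= ?mxE.
- exact: lebesgue_complex_translation.
- by move=> b; exact: measurable_cadd.
- by move=> b; exact: measurable_rowadd.
- by apply: preimage_measurable => //; exact: measurable_cons_row.
Qed.

End translation.

(** * Comparison of translation-invariant measures *)

Section haar.
Context {R : realType} (n : nat).
Local Notation C := R[i].
Local Notation V := 'rV[C]_n.
Variables mu nu : {sigma_finite_measure set V -> \bar R}.
Hypothesis tmu : translation_invariant (fun x y : V => x + y) mu.
Hypothesis tnu : translation_invariant (fun x y : V => x + y) nu.

Lemma measurable_rowD : measurable_fun setT (fun p : V * V => p.1 + p.2).
Proof.
apply: measurable_fun_row => i; under eq_fun do rewrite mxE.
by apply: measurable_funCD; apply: (measurableT_comp (measurable_coord i));
  [exact: measurable_fst|exact: measurable_snd].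
Qed.

Lemma measurable_rowB : measurable_fun setT (fun p : V * V => p.1 - p.2).
Proof.
apply: measurable_fun_row => i; under eq_fun do rewrite !mxE.
by apply: measurable_funCB; apply: (measurableT_comp (measurable_coord i));
  [exact: measurable_fst|exact: measurable_snd].
Qed.

(* Both sides are the product measure of {(x, y) | x in A, x + y in B}. *)
Lemma haar_exchange A B : measurable A -> measurable B ->
  (mu A * nu B = mu B * nu ((fun x : V => (- x)%R) @^-1` A))%E.
Proof.
move=> mA mB.
have swap (S : set (V * V)) : measurable S ->
    (\int[mu]_x nu (xsection S x) = \int[nu]_y mu (ysection S y))%E.
  move=> mS; transitivity ((mu \x nu)%E S) => //.
  transitivity ((mu \x^ nu)%E S) => //.
  by apply: product_measure_unique => //= ? ? ? ?; rewrite product_measure2E.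
have integ (m : {measure set V -> \bar R}) D c : measurable D -> (0 <= c)%E ->
    (\int[m]_x ((\1_D x)%:E * c) = m D * c)%E.
  move=> mD c0; rewrite ge0_integralZr ?integral_indic ?setIT//.
  exact/measurable_EFinP/measurable_indic.
pose S1 : set (V * V) := [set p | A p.1 /\ B (p.1 + p.2)].
pose S2 : set (V * V) := [set p | A (p.1 - p.2) /\ B p.1].
have mS1 : measurable S1.
  apply: measurableI; first by apply: (preimage_measurable (f := fst)) => //; exact: measurable_fst.
  exact: (preimage_measurable measurable_rowD mB).
have mS2 : measurable S2.
  apply: measurableI; first exact: (preimage_measurable measurable_rowB mA).
  by apply: (preimage_measurable (f := fst)) => //; exact: measurable_fst.
transitivity (\int[mu]_x nu (xsection S1 x))%E.
  rewrite -integ//; apply: eq_integral => x _; rewrite indicE.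
  case: (boolP (x \in A)) => xA.
    rewrite mul1e -(tnu x mB); congr (nu _); apply/seteqP; split => y /=.
      by move=> By; rewrite /xsection /= inE /S1 /= addrC; split => //; exact: set_mem.
    by rewrite /xsection /= inE /S1 /= addrC => -[].
  rewrite mul0e (_ : xsection S1 x = set0) ?measure0//.
  apply/seteqP; split => y //=; rewrite /xsection /= inE /S1 /= => -[Ax _].
  by move/negP: xA; apply; exact/mem_set.
rewrite swap//.
transitivity (\int[nu]_y mu (ysection S2 y))%E.
  apply: eq_integral => y _; rewrite -(tmu y (measurable_ysection y mS2)).
  by congr (mu _); apply/seteqP; split => x /=; rewrite /ysection /= !inE /S1 /S2 /= addrK.
rewrite -swap//.
transitivity (\int[mu]_x ((\1_B x)%:E * nu ((fun x : V => (- x)%R) @^-1` A)))%E; last by rewrite integ.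
apply: eq_integral => x _; rewrite indicE.
case: (boolP (x \in B)) => xB.
  rewrite mul1e -(tnu x (measurable_xsection x mS2)).
  congr (nu _); apply/seteqP; split => y /=; rewrite /xsection /= inE /S2 /=
    opprD addrCA subrr addr0.
    by case.
  by move=> Ay; split => //; exact: set_mem.
rewrite mul0e (_ : xsection S2 x = set0) ?measure0//.
apply/seteqP; split => y //=; rewrite /xsection /= inE /S2 /= => -[_ Bx].
by move/negP: xB; apply; exact/mem_set.
Qed.

End haar.

(** * Hermitian form, unitary maps and rotations *)

Section unitary_invariance.
Context {R : realType} {n : nat}.
Local Notation C := R[i].
Local Notation Cn := 'rV[R[i]]_n.
Local Notation nc := (@Normc.normc R).
Local Notation sigma := (@sphere_measure R n).

Section hermitian.
Implicit Types z w e : Cn.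

Definition ip z w : C := \sum_(i < n) z ord0 i * cj (w ord0 i).

Lemma ipE z w : ip z w = \sum_i z ord0 i * cj (w ord0 i). Proof. by []. Qed.
Lemma ipDl z z' w : ip (z + z') w = ip z w + ip z' w.
Proof. by rewrite /ip -big_split; apply: eq_bigr => i _; rewrite mxE mulrDl. Qed.
Lemma ipZl (c : C) z w : ip (c *: z) w = c * ip z w.
Proof. by rewrite /ip mulr_sumr; apply: eq_bigr => i _; rewrite mxE mulrA. Qed.
Lemma ip_cj z w : cj (ip z w) = ip w z.
Proof. by rewrite /ip cj_sum; apply: eq_bigr => i _; rewrite cjM cjK mulrC. Qed.
Lemma ipDr z w w' : ip z (w + w') = ip z w + ip z w'.
Proof. by rewrite -[LHS]cjK ip_cj ipDl cjD !ip_cj. Qed.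
Lemma ipZr (c : C) z w : ip z (c *: w) = cj c * ip z w.
Proof. by rewrite -[LHS]cjK ip_cj ipZl cjM !ip_cj. Qed.
Lemma ip_norm z : ip z z = (en z ^+ 2)%:C.
Proof.
rewrite /en sqr_sqrtr; last by apply: sumr_ge0 => i _; exact: sqr_ge0.
by rewrite raddf_sum; apply: eq_bigr => i _; rewrite mulcJ.
Qed.
Lemma eucl_norm_ge0 z : 0 <= en z. Proof. exact: sqrtr_ge0. Qed.
Lemma eucl_norm_eq0 z : (en z == 0) = (z == 0).
Proof.
apply/eqP/eqP => [|->]; last first.
  by rewrite /en big1 ?sqrtr0// => i _; rewrite mxE nc0 expr0n.
move=> z0; apply/rowP => i; rewrite mxE; apply/eqP; rewrite -nc_eq0 -sqrf_eq0.
have : en z ^+ 2 = 0 by rewrite z0 expr0n.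
rewrite /en sqr_sqrtr; last by apply: sumr_ge0 => j _; exact: sqr_ge0.
by move=> /psumr_eq0P => -> // j _; exact: sqr_ge0.
Qed.
Lemma eucl_norm0 : en (0 : Cn) = 0. Proof. by apply/eqP; rewrite eucl_norm_eq0. Qed.

Lemma eucl_normZ (c : C) z : en (c *: z) = nc c * en z.
Proof.
apply/eqP; rewrite -(@eqrXn2 _ 2)// ?mulr_ge0 ?nc_ge0 ?eucl_norm_ge0//; apply/eqP.
by apply: complexI; rewrite -ip_norm ipZl ipZr ip_norm mulrA mulcJ exprMn -real_complexM.
Qed.

Lemma nc_coord z i : nc (z ord0 i) <= en z.
Proof.
rewrite -(@ler_pXn2r _ 2)// ?nnegrE ?nc_ge0 ?eucl_norm_ge0//.
rewrite /en sqr_sqrtr; last by apply: sumr_ge0 => j _; exact: sqr_ge0.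
by rewrite (bigD1 i)//= lerDl sumr_ge0// => j _; exact: sqr_ge0.
Qed.

Lemma cauchy_schwarz_ip z w : nc (ip z w) <= en z * en w.
Proof.
have [->|w0] := eqVneq w 0.
  by rewrite eucl_norm0 mulr0 /ip big1 ?nc0// => i _; rewrite mxE cj0 mulr0.
have nw : 0 < en w by rewrite lt_neqAle eucl_norm_ge0 andbT eq_sym eucl_norm_eq0.
(* [y] is |w|^2 times the component of z orthogonal to w; its squared norm is the asserted
   difference times |w|^2. *)
pose y := (en w ^+ 2)%:C *: z - ip z w *: w.
have h : ip y y = (en w ^+ 2)%:C *
    ((en w ^+ 2)%:C * (en z ^+ 2)%:C - ip z w * cj (ip z w)).
  by rewrite /y -scaleNr ipDl !ipDr !ipZl !ipZr !ip_norm cj_real cjN ip_cj; ring.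
have : 0 <= en w ^+ 2 * en z ^+ 2 - nc (ip z w) ^+ 2.
  have : 0 <= en w ^+ 2 * (en w ^+ 2 * en z ^+ 2 - nc (ip z w) ^+ 2).
    suff -> : en w ^+ 2 * (en w ^+ 2 * en z ^+ 2 - nc (ip z w) ^+ 2) =
      en y ^+ 2 by exact: sqr_ge0.
    apply: complexI; rewrite -[RHS]ip_norm h mulcJ.
    by rewrite -[in RHS]real_complexM -[in RHS]rmorphB -[in RHS]real_complexM.
  by rewrite pmulr_rge0// exprn_gt0.
rewrite subr_ge0 -exprMn ler_pXn2r ?nnegrE ?nc_ge0 ?mulr_ge0 ?eucl_norm_ge0//.
by rewrite mulrC.
Qed.

Lemma eucl_normD z w : en (z + w) <= en z + en w.
Proof.
rewrite -(@ler_pXn2r _ 2)// ?nnegrE ?addr_ge0 ?eucl_norm_ge0//.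
have -> : en (z + w) ^+ 2 = en z ^+ 2 + en w ^+ 2 + 2 * complex.Re (ip z w).
  apply: complexI; rewrite -ip_norm ipDl !ipDr !ip_norm -(ip_cj z w).
  rewrite !real_complexD real_complexM.
  have -> : (2 : R)%:C = 2 by exact: rmorph_nat.
  by rewrite -(addcJ (ip z w)) conjcE; ring.
have := le_trans (Re_le_nc _) (cauchy_schwarz_ip z w); nra.
Qed.

Lemma eucl_normN z : en (- z) = en z.
Proof. by rewrite -scaleN1r eucl_normZ ncN nc1 mul1r. Qed.

Lemma eucl_norm_le_sum z : en z <= \sum_i nc (z ord0 i).
Proof.
have S0 : 0 <= \sum_i nc (z ord0 i) by apply: sumr_ge0 => i _; exact: nc_ge0.
rewrite -(@ler_pXn2r _ 2)// ?nnegrE ?eucl_norm_ge0//.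
rewrite /en sqr_sqrtr; last by apply: sumr_ge0 => j _; exact: sqr_ge0.
rewrite expr2 mulr_suml; apply: ler_sum => i _; rewrite expr2 ler_wpM2l ?nc_ge0//.
by rewrite (bigD1 i)//= lerDl sumr_ge0// => j _; exact: nc_ge0.
Qed.

End hermitian.

Section unitary.
Variables U U' : 'M[C]_n.
Hypotheses (UU' : U *m U' = 1%:M) (U'U : U' *m U = 1%:M).
Hypothesis Unorm : forall z : Cn, en (z *m U) = en z.

Lemma measurable_mulmx (M : 'M[C]_n) : measurable_fun setT (fun z : Cn => z *m M).
Proof.
apply: measurable_fun_row => i; under eq_fun do rewrite mxE.
apply: measurable_funC_sum => j.
by apply: measurable_funCM; [exact: measurable_coord|exact: measurable_cst].
Qed.

Definition lebesgue_image : set Cn -> \bar R :=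
  pushforward (lebesgue_Cn n) (fun z => z *m U).

Let image0 : lebesgue_image set0 = 0%E.
Proof. by rewrite /lebesgue_image /pushforward preimage_set0 measure0. Qed.
Let image_ge0 A : (0 <= lebesgue_image A)%E.
Proof. exact: (@measure_ge0 _ _ _ (lebesgue_Cn n)). Qed.
Let image_sigma_additive : semi_sigma_additive lebesgue_image.
Proof. by apply: measure_semi_sigma_additive; exact: measurable_mulmx. Qed.
HB.instance Definition _ := isMeasure.Build _ _ _ lebesgue_image
  image0 image_ge0 image_sigma_additive.
Let image_sigma_finite : sigma_finite setT lebesgue_image.
Proof.
apply: (@sigma_finite_pushforward R _ _ Cn Cn (lebesgue_Cn n) (fun z : Cn => z *m U)
  (fun z : Cn => z *m U')).
- exact: measurable_mulmx.
- by move=> z; rewrite -mulmxA UU' mulmx1.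
- exact: sigma_finiteT.
Qed.
HB.instance Definition _ := Measure_isSigmaFinite.Build _ _ _ lebesgue_image
  image_sigma_finite.

Lemma lebesgue_image_translation :
  translation_invariant (fun x y : Cn => x + y) lebesgue_image.
Proof.
move=> a A mA; rewrite /lebesgue_image /pushforward.
rewrite -[RHS](@lebesgue_Cn_translation R n (a *m U')).
  congr (lebesgue_Cn n _); apply/seteqP; split => z /=;
  by rewrite mulmxDl -mulmxA U'U mulmx1.
exact: (preimage_measurable (measurable_mulmx U)).
Qed.

Lemma lebesgue_unitary A : measurable A -> lebesgue_Cn n ((fun z => z *m U) @^-1` A) = lebesgue_Cn n A.
Proof.
move=> mA; have mb := @measurable_ball_set R n.
have /andP[b0 bfin] := @ball_volume R n.
have h1 := haar_exchange lebesgue_image_translation (@lebesgue_Cn_translation R n) mA mb.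
have h2 := haar_exchange (@lebesgue_Cn_translation R n) (@lebesgue_Cn_translation R n) mA mb.
have e : lebesgue_image (@ball_set R n) = lebesgue_Cn n (@ball_set R n).
  rewrite /lebesgue_image /pushforward; congr (lebesgue_Cn n _).
  by apply/seteqP; split => z; rewrite /ball_set /= Unorm.
have : (lebesgue_image A * lebesgue_Cn n (@ball_set R n) =
   lebesgue_Cn n A * lebesgue_Cn n (@ball_set R n))%E.
  by rewrite h2; exact: etrans h1 (congr1 (fun x => x * _)%E e).
have bf : lebesgue_Cn n (@ball_set R n) \is a fin_num by rewrite ge0_fin_numE ?measure_ge0.
move: b0; rewrite -(fineK bf) lte_fin => b0.
move=> /(congr1 (fun x => (x * ((fine (lebesgue_Cn n (@ball_set R n)))^-1)%:E)%E)).
by rewrite -!muleA -EFinM mulfV ?gt_eqF// !mule1.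
Qed.

Lemma radial_proj_mulmx z : radial_proj (z *m U) = radial_proj z *m U.
Proof. by rewrite /radial_proj Unorm scalemxAl. Qed.

Lemma sphere_unitary A : measurable A -> sigma ((fun z => z *m U) @^-1` A) = sigma A.
Proof.
move=> mA; rewrite /sphere_measure /pushforward /mscale /mrestr /=; congr (_ * _)%E.
rewrite -[RHS]lebesgue_unitary; last first.
  apply: measurableI; last exact: measurable_ball_set.
  exact: (preimage_measurable (@measurable_radial_proj R n)).
congr (lebesgue_Cn n _); apply/seteqP; split => z /=;
by rewrite radial_proj_mulmx /ball_set /= Unorm.
Qed.

Lemma Rintegral_unitary (f : Cn -> R) : measurable_fun setT f ->
  sigma.-integrable setT (EFin \o f) ->
  \int[sigma]_z f (z *m U) = \int[sigma]_z f z.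
Proof.
move=> mf ifz.
have mU := measurable_mulmx U.
pose m' : {measure set Cn -> \bar R} :=
  measure_function_pushforward__canonical__measure_function_Measure sigma mU.
have E : (\int[sigma]_z (f z)%:E = \int[m']_z (f z)%:E)%E.
  by apply: eq_measure_integral => A mA _; rewrite /m' /= /pushforward sphere_unitary.
have mfe : measurable_fun setT (EFin \o f) by exact/measurable_EFinP.
rewrite /Rintegral E /m'; congr fine; symmetry.
apply: (@integral_pushforward _ _ _ _ _ _ mU sigma setT (EFin \o f) mfe) => //.
rewrite preimage_setT; apply/integrableP; split.
  by apply: measurableT_comp => //.
have /integrableP[_] := ifz.
have -> : (\int[sigma]_x `|(EFin \o f) x| = \int[m']_x `|(EFin \o f) x|)%E.
  by apply: eq_measure_integral => A mA _; rewrite /m' /= /pushforward sphere_unitary.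
rewrite (@ge0_integral_pushforward _ _ _ _ _ _ mU sigma setT (fun x => `|(EFin \o f) x|%E))//.
by apply: measurableT_comp.
Qed.

Lemma cint_unitary (F : Cn -> C) : measurable_fun setT F ->
  cintegrable sigma setT F -> cint (fun z => F (z *m U)) = cint F.
Proof.
move=> mF [i1 i2]; rewrite /cint; congr (_ +i* _).
- exact: (Rintegral_unitary (measurable_ReC mF) i1).
- exact: (Rintegral_unitary (measurable_ImC mF) i2).
Qed.

End unitary.

Section rotation.

(* z = a e + z' with z' orthogonal to the unit vector e is sent to
   v (a e + w z'). *)
Definition rot (e : Cn) (v w : C) : 'M[C]_n :=
  v *: (w%:M + (1 - w) *: ((\col_i cj (e ord0 i)) *m e)).

Lemma rotE e v w z : z *m rot e v w = v *: (w *: z + ((1 - w) * ip z e) *: e).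
Proof.
rewrite /rot -scalemxAr mulmxDr mul_mx_scalar -scalemxAr mulmxA; congr (_ *: (_ + _)).
rewrite -scalerA; congr (_ *: _); apply/rowP => j; rewrite !mxE big_ord1 !mxE.
by congr (_ * _); apply: eq_bigr => i _; rewrite !mxE.
Qed.

Lemma rotK e (v w : C) : en e = 1 -> v != 0 -> w != 0 ->
  rot e v w *m rot e v^-1 w^-1 = 1%:M.
Proof.
move=> e1 v0 w0; apply/row_matrixP => i; rewrite [LHS]rowE [RHS]rowE mulmx1 mulmxA.
set d := delta_mx _ _.
rewrite rotE rotE ipZl ipDl !ipZl ip_norm e1 expr1n rmorph1 mulr1.
rewrite !scalerDr !scalerA -addrA -scalerDl.
have -> : v^-1 * w^-1 * v * w = 1 by field; rewrite v0 w0.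
rewrite scale1r; set s := (X in d + X *: e).
have -> : s = 0 by rewrite /s; field; rewrite v0 w0.
by rewrite scale0r addr0.
Qed.

Lemma rot_norm e v w z : en e = 1 -> nc v = 1 -> nc w = 1 ->
  en (z *m rot e v w) = en z.
Proof.
move=> e1 v1 w1; rewrite rotE eucl_normZ v1 mul1r.
apply/eqP; rewrite -(@eqrXn2 _ 2)// ?eucl_norm_ge0//; apply/eqP; apply: complexI.
have ww : cj w * w = 1 by rewrite mulrC mulcJ w1 expr1n.
rewrite -!ip_norm ipDl !ipDr !ipZl !ipZr [ip e e]ip_norm e1 expr1n rmorph1.
rewrite cjM cjB cj1 -(ip_cj z e); set a := ip z e; set b := ip z z.
have -> : w * (cj w * b) = b by rewrite mulrA [w * _]mulrC ww mul1r.
transitivity (b + a * cj a * (1 - cj w * w)); first by ring.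
by rewrite ww subrr mulr0 addr0.
Qed.

Lemma cint_rot e v w (F : Cn -> C) : en e = 1 -> nc v = 1 -> nc w = 1 ->
  measurable_fun setT F -> cintegrable sigma setT F ->
  cint (fun z => F (v *: (w *: z + ((1 - w) * ip z e) *: e))) = cint F.
Proof.
move=> e1 v1 w1 mF iF.
have v0 : v != 0 by rewrite -nc_eq0 v1 oner_eq0.
have w0 : w != 0 by rewrite -nc_eq0 w1 oner_eq0.
rewrite -(@cint_unitary (rot e v w) (rot e v^-1 w^-1) _ _ _ F)//.
- by congr cint; apply/funext => z; rewrite rotE.
- exact: rotK.
- by rewrite -{2}(invrK v) -{2}(invrK w) rotK// invr_neq0.
- by move=> z; exact: rot_norm.
Qed.

Lemma cint_rotate (v : C) (F : Cn -> C) : (0 < n)%N -> nc v = 1 ->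
  measurable_fun setT F -> cintegrable sigma setT F ->
  cint (fun z => F (v *: z)) = cint F.
Proof.
move=> n0 v1 mF iF.
pose e : Cn := delta_mx ord0 (Ordinal n0).
have e1 : en e = 1.
  rewrite /en (bigD1 (Ordinal n0))//= big1 => [|i ni].
    by rewrite mxE !eqxx nc1 expr1n addr0 sqrtr1.
  by rewrite mxE eqxx/= (negbTE ni) nc0 expr0n.
rewrite -[RHS](cint_rot e1 v1 (@nc1 R) mF iF).
by congr cint; apply/funext => z; rewrite subrr mul0r scale0r addr0 scale1r.
Qed.

End rotation.

End unitary_invariance.

(** * The topology of C^n in terms of the Euclidean norm *)

Section eucl_topology.
Context {R : realType} {n : nat}.
Local Notation C := R[i].
Local Notation Cn := 'rV[R[i]]_n.
Local Notation nc := (@Normc.normc R).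
Implicit Types (z w : Cn) (F : Cn -> C).

Lemma nbhs_eucl z (P : set Cn) : nbhs z P ->
  exists2 d : R, 0 < d & forall w, en (w - z) < d -> P w.
Proof.
case=> Q nQ sub.
have /choice[d dP] : forall j : 'I_n, exists d : R, 0 < d /\
    forall t, nc (t - z ord0 j) < d -> Q ord0 j t.
  by move=> j; have [d d0 h] := nbhs_ncP (nQ ord0 j); exists d.
have S0 : 0 <= \sum_j (d j)^-1 by apply: sumr_ge0 => j _; rewrite invr_ge0 ltW//; case: (dP j).
exists (1 + \sum_j (d j)^-1)^-1; first by rewrite invr_gt0 ltr_wpDr.
move=> w wz; apply: sub => i j; rewrite (ord1 i); have [dj0 h] := dP j; apply: h.
have -> : w ord0 j - z ord0 j = (w - z) ord0 j by rewrite !mxE.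
apply: le_lt_trans (nc_coord _ _) (lt_le_trans wz _).
rewrite -[leRHS]invrK lef_pV2 ?posrE ?invr_gt0// ?ltr_wpDr//.
by rewrite (bigD1 j)//= addrCA lerDl addr_ge0// sumr_ge0// => k _; rewrite invr_ge0 ltW//; case: (dP k).
Qed.

Lemma eucl_nbhs z (d : R) : 0 < d -> nbhs z [set w | en (w - z) < d].
Proof.
move=> d0; have e0 : 0 < d / n.+1%:R by rewrite divr_gt0.
exists (fun i j => [set t | nc (t - z i j) < d / n.+1%:R]).
  by move=> i j; exact: near_nc.
move=> w /= h; apply: le_lt_trans (eucl_norm_le_sum _) _.
apply: (@le_lt_trans _ _ (\sum_(i < n) d / n.+1%:R)).
  by apply: ler_sum => i _; rewrite !mxE ltW// h.
rewrite sumr_const card_ord -[ltLHS]mulr_natr mulrAC ltr_pdivrMr ?ltr0n//.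
by rewrite ltr_pM2l// ltr_nat.
Qed.

Definition econt F z := forall e : R, 0 < e ->
  exists2 d : R, 0 < d & forall w, en (w - z) < d -> nc (F w - F z) < e.

Lemma continuous_econt F z : {for z, continuous F} -> econt F z.
Proof. by move=> cF e e0; exact: (nbhs_eucl (cvgC_lt cF e0)). Qed.

Lemma closed_eucl (K : set Cn) :
  (forall z, ~ K z -> exists2 d : R, 0 < d & forall w, en (w - z) < d -> ~ K w) ->
  closed K.
Proof.
move=> h; rewrite -[K]setCK; apply: open_closedC; rewrite openE => z /h[d d0 dK].
by apply: (filterS _ (eucl_nbhs z d0)) => w; exact: dK.
Qed.

Lemma complex_square_compact (r : R) :
  compact [set z : C | `|complex.Re z| <= r /\ `|complex.Im z| <= r].
Proof.
have -> : [set z : C | `|complex.Re z| <= r /\ `|complex.Im z| <= r] =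
    (fun p : R * R => p.1 +i* p.2) @` (`[- r, r]%classic `*` `[- r, r]%classic).
  apply/seteqP; split => [z /= [h1 h2]|_ [[a b] /= [h1 h2] <-]] /=.
    exists (complex.Re z, complex.Im z); last by case: z {h1 h2}.
    by rewrite /= !in_itv/= -!ler_norml.
  by move: h1 h2; rewrite !in_itv/= -!ler_norml.
apply: continuous_compact; last by apply: compact_setX; exact: segment_compact.
apply: continuous_subspaceT => p; apply: continuous_complexP; [exact: cvg_fst|exact: cvg_snd].
Qed.

Lemma eucl_compact (K : set Cn) (r : R) : closed K -> (forall z, K z -> en z <= r) ->
  compact K.
Proof.
move=> cK Kr.
have hc := @rV_compact _ n (fun=> [set z : C | `|complex.Re z| <= r /\ `|complex.Im z| <= r])
  (fun=> @complex_square_compact r).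
apply: (subclosed_compact cK hc) => z /Kr zr i /=.
by split; [apply: le_trans (nc_Re _) _|apply: le_trans (nc_Im _) _];
  apply: le_trans (nc_coord _ _) zr.
Qed.

Lemma eucl_compact_max (K : set Cn) (r : R) (G : Cn -> R) : K !=set0 -> closed K ->
  (forall z, K z -> en z <= r) ->
  (forall z, K z -> forall e : R, 0 < e -> exists2 d : R, 0 < d &
    forall w, K w -> en (w - z) < d -> `|G w - G z| < e) ->
  exists2 c, K c & forall t, K t -> G t <= G c.
Proof.
move=> K0 cK Kr cG.
have [|c cc cP] := @compact_EVT_max _ R G K K0 (eucl_compact cK Kr).
- apply/subspace_continuousP => z Kz; apply/cvgrPdist_lt => e e0.
  have [d d0 h] := cG z Kz e e0; rewrite near_withinE.
  by apply: (filterS _ (eucl_nbhs z d0)) => w wd Kw; rewrite distrC h.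
- by exists c; [exact/set_mem|move=> t Kt; apply: cP; exact/mem_set].
Qed.

Lemma eucl_normB_lip z w : `|en z - en w| <= en (z - w).
Proof.
have h x y : en x - en y <= en (x - y).
  by rewrite lerBlDr -[X in en X <= _](subrK y) eucl_normD.
by rewrite ler_norml h andbT lerNl opprB -[leRHS]eucl_normN opprB h.
Qed.

Lemma closed_ball_eucl (r : R) : closed [set z : Cn | en z <= r].
Proof.
apply: closed_eucl => z /= /negP; rewrite -ltNge => zr.
exists (en z - r); first by rewrite subr_gt0.
move=> w wz /= wr; have := eucl_normB_lip w z; rewrite distrC => /(le_trans (ler_norm _)); lra.
Qed.

Lemma closed_sphere_eucl (r : R) : closed [set z : Cn | en z = r].
Proof.
apply: closed_eucl => z /= /eqP zr.
exists `|en z - r|; first by rewrite normr_gt0 subr_eq0.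
move=> w wz wr; have := eucl_normB_lip w z; rewrite wr distrC => h.
by move: (le_lt_trans h wz); rewrite ltxx.
Qed.

End eucl_topology.

(** * The Hardy space of the ball *)

Section hardy_space.
Context {R : realType} {n : nat}.
Hypothesis n0 : (0 < n)%N.
Local Notation C := R[i].
Local Notation Cn := 'rV[R[i]]_n.
Local Notation nc := (@Normc.normc R).
Local Notation Re := (@complex.Re R).
Local Notation Im := (@complex.Im R).
Local Notation sigma := (@sphere_measure R n).
Local Notation Bn := (unit_ball R n).

(** * Analytic functions on the ball, extended by zero *)

Section zero_ext.
Implicit Types (f g : Bn -> C) (z w : Cn).

Lemma zero_ext_val f (z : Bn) : ext f (val z) = f z.
Proof. by rewrite /ext valK. Qed.

Lemma zero_ext_in f z (zB : en z < 1) : ext f z = f (Sub z zB).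
Proof. by rewrite -[RHS]zero_ext_val SubK. Qed.

Lemma zero_ext_out f z : 1 <= en z -> ext f z = 0.
Proof. by move=> h; rewrite /ext insubF//; apply/negbTE; rewrite -leNgt. Qed.

Lemma zero_extP f g : (forall z, en z < 1 -> ext f z = ext g z) -> f = g.
Proof. by move=> h; apply/funext => z; rewrite -!zero_ext_val h//; exact: (valP z). Qed.

Lemma zero_extD f g z : ext (f + g) z = ext f z + ext g z.
Proof. by rewrite /ext; case: insub => //=; rewrite addr0. Qed.

Lemma zero_extZ (a : C) f z : ext (a *: f) z = a * ext f z.
Proof. by rewrite /ext; case: insub => //=; rewrite mulr0. Qed.

Lemma zero_ext0 z : ext (0 : Bn -> C) z = 0.
Proof. by rewrite /ext; case: insub. Qed.

Lemma zero_extN f z : ext (- f) z = - ext f z.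
Proof. by rewrite /ext; case: insub => //=; rewrite oppr0. Qed.

Lemma zero_extB f g z : ext (f - g) z = ext f z - ext g z.
Proof. by rewrite zero_extD zero_extN. Qed.

Lemma zero_extM f g z : ext (mult f g) z = ext f z * ext g z.
Proof. by rewrite /ext; case: insub => //=; rewrite mulr0. Qed.

Lemma zero_ext_cst (c : C) z : en z < 1 -> ext (cst c : Bn -> C) z = c.
Proof. by move=> h; rewrite zero_ext_in. Qed.

Lemma zero_ext_coord i z : en z < 1 -> ext (coord_fun i : Bn -> C) z = z ord0 i.
Proof. by move=> h; rewrite zero_ext_in. Qed.

Lemma zero_ext_sum (I : Type) (s : seq I) (F : I -> Bn -> C) z :
  ext (\sum_(i <- s) F i) z = \sum_(i <- s) ext (F i) z.
Proof.
by elim: s => [|i s ih]; rewrite ?big_nil ?zero_ext0// !big_cons zero_extD ih.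
Qed.

Lemma eucl_ball_in z : en z < 1 -> forall w, en (w - z) < 1 - en z ->
  en w < 1.
Proof. by move=> z1 w; have := eucl_normB_lip w z => /(le_trans (ler_norm _)); lra. Qed.

Lemma analyticP f : analytic f <-> forall z, en z < 1 -> differentiable (ext f) z.
Proof.
by split => [h z zB|h z]; [have := h (Sub z zB); rewrite SubK|apply: h; exact: (valP z)].
Qed.

(** The zero extension of a constant jumps at the sphere, so its derivative has to be found locally.
    Multiplication by the extension of 1 then serves as the cutoff that makes other functions
    extensions by zero. *)
Lemma analytic_cst (c : C) : analytic (cst c : Bn -> C).
Proof.
apply/analyticP => z z1.
have H : ext (cst c : Bn -> C) \o shift z = cst (ext (cst c : Bn -> C) z) + \0 +o_ (0 : Cn) id.
  apply/eqaddoP => e e0.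
  have d0 : 0 < 1 - en z by rewrite subr_gt0.
  apply: (filterS _ (eucl_nbhs 0 d0)) => h /=; rewrite subr0 => hd.
  rewrite !fctE /= (zero_ext_cst c z1) zero_ext_cst; last first.
    by apply: (eucl_ball_in z1); rewrite addrK.
  by rewrite addr0 subrr normr0 mulr_ge0// ltW.
have c0 : continuous (\0 : Cn -> C) by exact: (@cst_continuous Cn C 0).
have e0 := diff_unique c0 H.
by apply/diff_locallyP; rewrite e0; split.
Qed.

Lemma analyticD f g : analytic f -> analytic g -> analytic (f + g).
Proof.
move=> af ag z; rewrite (_ : ext (f + g) = ext f + ext g).
  exact: differentiableD (af z) (ag z).
by apply/funext => w; rewrite zero_extD.
Qed.

Lemma analyticM f g : analytic f -> analytic g -> analytic (mult f g).
Proof.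
move=> af ag z; rewrite (_ : ext (mult f g) = ext f * ext g).
  exact: differentiableM (af z) (ag z).
by apply/funext => w; rewrite zero_extM.
Qed.

Lemma analyticZ (a : C) f : analytic f -> analytic (a *: f).
Proof.
move=> af; rewrite (_ : a *: f = mult (cst a) f)//.
by apply: analyticM => //; exact: analytic_cst.
Qed.

Lemma analytic0 : analytic (0 : Bn -> C).
Proof. exact: analytic_cst. Qed.

Lemma analytic_coord i : analytic (coord_fun i : Bn -> C).
Proof.
move=> z.
rewrite (_ : ext (coord_fun i) = (fun w : Cn => w ord0 i) * ext (cst 1 : Bn -> C)).
  exact: differentiableM (differentiable_coord _ _ _) (analytic_cst 1 z).
apply/funext => w; rewrite fctE; have [h|h] := ltP (en w) 1.
  by rewrite zero_ext_coord// zero_ext_cst// mulr1.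
by rewrite !zero_ext_out// mulr0.
Qed.

Lemma analytic_sum (I : Type) (s : seq I) (F : I -> Bn -> C) :
  (forall i, analytic (F i)) -> analytic (\sum_(i <- s) F i).
Proof.
move=> aF; elim: s => [|i s ih]; rewrite ?big_nil ?big_cons; first exact: analytic0.
exact: analyticD.
Qed.

Lemma analytic_econt f z : analytic f -> en z < 1 -> econt (ext f) z.
Proof. by move=> /analyticP af zB; apply/continuous_econt/differentiable_continuous/af. Qed.

Lemma analytic_slice f (a b : Cn) t : analytic f -> en (a + t *: b) < 1 ->
  cdiff (fun t => ext f (a + t *: b)) t.
Proof. by move=> /analyticP af h; apply/derivable_cdiff/diff_derivable/af. Qed.

Lemma analytic_slice0 f (b : Cn) t : analytic f -> nc t * en b < 1 ->
  cdiff (fun t => ext f (t *: b)) t.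
Proof.
move=> af h; have := @analytic_slice f 0 b t af.
have e : (fun s : C => ext f (0 + s *: b)) = (fun s => ext f (s *: b)).
  by apply/funext => s; rewrite add0r.
by rewrite e add0r eucl_normZ => /(_ h).
Qed.

Lemma analytic_bounded f (r : R) : analytic f -> r < 1 ->
  exists2 M : R, 0 <= M & forall z, en z <= r -> nc (ext f z) <= M.
Proof.
move=> af r1; have [r0|r0] := ltP r 0.
  by exists 0 => // z zr; move: (eucl_norm_ge0 z); lra.
have [||||c cr cP] := @eucl_compact_max R n [set z | en z <= r] r (nc \o ext f).
- by exists 0; rewrite /= eucl_norm0.
- exact: closed_ball_eucl.
- by [].
- move=> z /= zr e e0; have [d d0 h] := analytic_econt af (le_lt_trans zr r1) e0.
  by exists d => // w _ wz; apply: le_lt_trans (nc_dist _ _) _; exact: h.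
by exists (nc (ext f c)); [exact: nc_ge0|exact: cP].
Qed.

End zero_ext.

(** * Integration over the sphere *)

Section sphere_integral.
Implicit Types (z w : Cn) (F G : Cn -> C).

Let S : set Cn := [set z | en z = 1].

Lemma measurable_set0C : measurable [set 0 : C].
Proof.
rewrite (_ : [set 0] = Re @^-1` [set 0] `&` Im @^-1` [set 0]).
  by apply: measurableI; apply: preimage_measurable => //; [exact: measurable_Re|exact: measurable_Im].
by apply/seteqP; split => [z /= ->//|[a b] /= [-> ->]].
Qed.

Lemma lebesgue_complex0 : lebesgue_complex [set 0 : C] = 0%E.
Proof.
rewrite /lebesgue_complex /pushforward.
rewrite (_ : _ @^-1` _ = [set 0 : measurableTypeR R] `*` [set 0 : measurableTypeR R]).
  transitivity (@lebesgue_measure R [set 0%R] * @lebesgue_measure R [set 0%R])%E.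
    by apply: product_measure1E.
  by rewrite lebesgue_measure_set1 mul0e.
by apply/seteqP; split => [[a b] /= [-> ->]|[a b] /= [-> ->]].
Qed.

Lemma measurable_row_set0 k : measurable [set 0 : 'rV[C]_k].
Proof.
rewrite (_ : [set 0] = (@eucl_norm R k) @^-1` [set 0]).
  by apply: preimage_measurable => //; exact: measurable_eucl_norm.
by apply/seteqP; split => [z /= ->|z /= /eqP]; [exact: eucl_norm0|rewrite eucl_norm_eq0 => /eqP].
Qed.

Lemma lebesgue_Cn0 : lebesgue_Cn n [set 0 : Cn] = 0%E.
Proof.
case: n n0 => [//|m] _; rewrite /= /cons_measure /pushforward.
rewrite (_ : _ @^-1` _ = [set 0 : C] `*` [set 0 : 'rV[C]_m]).
  rewrite product_measure1E; [|exact: measurable_set0C|exact: measurable_row_set0].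
  by rewrite [X in (X * _)%E]lebesgue_complex0 mul0e.
apply/seteqP; split => [[a b] /= h|[a b] /= [-> ->]].
  by split; [have := cons_row0 (a, b)|apply/rowP => j; have := cons_rowS (a, b) j]; rewrite h !mxE /=.
by apply/rowP => i; case: (unliftP ord0 i) => [j|] ->; rewrite ?cons_row0 ?cons_rowS /= !mxE.
Qed.

Lemma measurable_sphere : measurable S.
Proof. exact: (preimage_measurable (@measurable_eucl_norm R n) (measurable_set1 (1 : R))). Qed.

(** Only the origin is projected off the sphere, to itself, and a point is a null set as n > 0. *)
Lemma sphere_measure_off : sigma (~` S) = 0%E.
Proof.
apply/eqP; rewrite eq_le measure_ge0 andbT.
rewrite /sphere_measure /pushforward /mscale /mrestr /=.
have -> : mrestr (lebesgue_Cn n) (@measurable_ball_set R n) (@radial_proj R n @^-1` (~` S)) =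
    lebesgue_Cn n [set 0 : Cn]; last by rewrite lebesgue_Cn0 mule0.
congr (lebesgue_Cn n _).
apply/seteqP; split => [z /= [h _]|z /= ->].
  apply/eqP; rewrite -eucl_norm_eq0; apply/negPn/negP => z0; apply: h.
  rewrite /S /= /radial_proj eucl_normZ nc_real ger0_norm ?invr_ge0 ?eucl_norm_ge0//.
  by rewrite mulVf.
rewrite /S /radial_proj /ball_set /= scaler0 eucl_norm0 ltr01; split => // /eqP.
by rewrite eq_sym oner_eq0.
Qed.

Lemma sphere_integrable (f : Cn -> R) (M : R) : measurable_fun setT f ->
  (forall z, en z = 1 -> `|f z| <= M) -> sigma.-integrable setT (EFin \o f).
Proof.
move=> mf fM; have mS := measurable_sphere.
apply/(negligible_integrable (measurableC mS) _ _ sphere_measure_off) => //.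
  exact/measurable_EFinP.
rewrite setDE setCK setTI; apply: measurable_bounded_integrable => //.
- apply: le_lt_trans (ltry 1); rewrite -(@sphere_measure_setT R n).
  by apply: le_measure; rewrite ?inE.
- exact: measurable_funS mf.
- exists M; split; first exact: num_real.
  by move=> x Mx z /= zS; apply: le_trans (fM _ zS) (ltW Mx).
Qed.

Lemma Rintegral_eqS (f g : Cn -> R) : measurable_fun setT f -> measurable_fun setT g ->
  (forall z, en z = 1 -> f z = g z) -> \int[sigma]_z f z = \int[sigma]_z g z.
Proof.
move=> mf mg fg; rewrite /Rintegral; congr fine; apply: ae_eq_integral => //.
- exact/measurable_EFinP.
- exact/measurable_EFinP.
- exists (~` S); split; [exact: (measurableC measurable_sphere)|exact: sphere_measure_off|].
  move=> z /= h zS; apply: h => _; congr EFin; exact: fg.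
Qed.

(** Integrands that are measurable and bounded on the sphere. The class is closed under the
    algebraic operations and all its members are integrable, which disposes of the side conditions
    of linearity. *)
Definition sbm F := measurable_fun setT F /\
  exists M : R, forall z, en z = 1 -> nc (F z) <= M.

Lemma sbm_cintegrable F : sbm F -> cintegrable sigma setT F.
Proof.
move=> [mF [M FM]]; split; apply: (@sphere_integrable _ M).
- exact: measurable_ReC.
- by move=> z zS; apply: le_trans (nc_Re _) (FM _ zS).
- exact: measurable_ImC.
- by move=> z zS; apply: le_trans (nc_Im _) (FM _ zS).
Qed.

Lemma cint_eqS F G : measurable_fun setT F -> measurable_fun setT G ->
  (forall z, en z = 1 -> F z = G z) -> cint F = cint G.
Proof.
move=> mF mG FG; rewrite /cint; congr (_ +i* _); apply: Rintegral_eqS;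
  [exact: measurable_ReC|exact: measurable_ReC|by move=> z /FG /= ->|
   exact: measurable_ImC|exact: measurable_ImC|by move=> z /FG /= ->].
Qed.

Lemma sbm_cst (c : C) : sbm (cst c).
Proof. by split; [exact: measurable_cst|exists (nc c)]. Qed.

Lemma sbmD F G : sbm F -> sbm G -> sbm (fun z => F z + G z).
Proof.
move=> [mF [M FM]] [mG [N GN]]; split; first exact: measurable_funCD.
by exists (M + N) => z zS; rewrite (le_trans (ncD _ _))// lerD ?FM ?GN.
Qed.

Lemma sbmM F G : sbm F -> sbm G -> sbm (fun z => F z * G z).
Proof.
move=> [mF [M FM]] [mG [N GN]]; split; first exact: measurable_funCM.
by exists (M * N) => z zS; rewrite ncM ler_pM ?nc_ge0 ?FM ?GN.
Qed.

Lemma sbmZ (c : C) F : sbm F -> sbm (fun z => c * F z).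
Proof. by apply: sbmM; exact: sbm_cst. Qed.

Lemma sbmB F G : sbm F -> sbm G -> sbm (fun z => F z - G z).
Proof.
move=> sF sG; rewrite (_ : (fun _ => _) = (fun z => F z + (-1) * G z)).
  by apply: sbmD => //; exact: sbmZ.
by apply/funext => z; rewrite mulN1r.
Qed.

Lemma sbm_cj F : sbm F -> sbm (fun z => cj (F z)).
Proof.
by move=> [mF [M FM]]; split; [exact: measurable_funC_cj|exists M => z zS; rewrite nc_cj FM].
Qed.

Lemma sbmX F k : sbm F -> sbm (fun z => F z ^+ k).
Proof.
move=> sF; elim: k => [|k ih]; first by under eq_fun do rewrite expr0; exact: sbm_cst.
by under eq_fun do rewrite exprS; exact: sbmM.
Qed.

Lemma sbm_coord i : sbm (fun z => z ord0 i).
Proof. by split; [exact: measurable_coord|exists 1 => z <-; exact: nc_coord]. Qed.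

Lemma sbm_sum (I : Type) (s : seq I) (F : I -> Cn -> C) : (forall i, sbm (F i)) ->
  sbm (fun z => \sum_(i <- s) F i z).
Proof.
move=> mF; elim: s => [|i s ih]; first by under eq_fun do rewrite big_nil; exact: sbm_cst.
by under eq_fun do rewrite big_cons; exact: sbmD.
Qed.

Lemma sbm_ip w : sbm (fun z => ip z w).
Proof.
apply: sbm_sum => i; under eq_fun do rewrite mulrC; exact/sbmZ/sbm_coord.
Qed.

Lemma sbm_ip_cj w k : sbm (fun z => cj (ip z w) ^+ k).
Proof. by apply: sbmX; apply: sbm_cj; exact: sbm_ip. Qed.

Lemma cintD F G : sbm F -> sbm G -> cint (fun z => F z + G z) = cint F + cint G.
Proof. by move=> sF sG; apply: cintegralD => //; exact: sbm_cintegrable. Qed.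
Lemma cintB F G : sbm F -> sbm G -> cint (fun z => F z - G z) = cint F - cint G.
Proof. by move=> sF sG; apply: cintegralB => //; exact: sbm_cintegrable. Qed.
Lemma cintZ (c : C) F : sbm F -> cint (fun z => c * F z) = c * cint F.
Proof. by move=> sF; apply: cintegralZ => //; exact: sbm_cintegrable. Qed.
Lemma cint_cj F : sbm F -> cint (fun z => cj (F z)) = cj (cint F).
Proof. by move=> sF; apply: cintegral_cj => //; exact: sbm_cintegrable. Qed.
Lemma cint_sum (I : Type) (s : seq I) (F : I -> Cn -> C) : (forall i, sbm (F i)) ->
  cint (fun z => \sum_(i <- s) F i z) = \sum_(i <- s) cint (F i).
Proof. by move=> sF; apply: cintegral_sum => // i _; exact: sbm_cintegrable. Qed.
Lemma cint_cst (c : C) : cint (fun _ : Cn => c) = c.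
Proof.
rewrite /cint !Rintegral_cst// (_ : fine (sigma setT) = 1); last by rewrite sphere_measure_setT.
by rewrite !mulr1; case: c.
Qed.

Lemma cint_le F (M : R) : sbm F -> (forall z, en z = 1 -> nc (F z) <= M) ->
  nc (cint F) <= M.
Proof.
move=> sF FM; have [mF _] := sF.
apply: le_trans (nc_cintegral _ (sbm_cintegrable sF)) _ => //.
have -> : M = \int[sigma]_z M.
  by rewrite Rintegral_cst// (_ : fine (sigma setT) = 1) ?mulr1// sphere_measure_setT.
(* The bound holds on the sphere only; truncation at M makes it hold everywhere and leaves the
   integral unchanged. *)
rewrite (@Rintegral_eqS (nc \o F) (fun z => Num.min (nc (F z)) M)).
- apply: le_Rintegral => //.
  + apply: (@sphere_integrable _ `|M|); last by move=> z zS; rewrite min_l ?FM// ger0_norm ?nc_ge0// (le_trans (FM _ zS))// ler_norm.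
    by apply: measurable_minr; [exact: measurable_fun_nc|exact: measurable_cst].
  + by apply: (@sphere_integrable _ `|M|) => //.
  + by move=> z _; rewrite ge_min lexx orbT.
- exact: measurable_fun_nc.
- by apply: measurable_minr; [exact: measurable_fun_nc|exact: measurable_cst].
- by move=> z zS /=; rewrite min_l ?FM.
Qed.

Lemma Rintegral_ge0S (f : Cn -> R) : measurable_fun setT f ->
  (forall z, en z = 1 -> 0 <= f z) -> 0 <= \int[sigma]_z f z.
Proof.
move=> mf f0; rewrite (@Rintegral_eqS f (fun z => `|f z|)) //.
- by apply: Rintegral_ge0.
- by apply: measurableT_comp mf.
- by move=> z zS /=; rewrite ger0_norm ?f0.
Qed.

Lemma cint_ge0 F : measurable_fun setT F -> (forall z, en z = 1 -> 0 <= F z) ->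
  0 <= cint F.
Proof.
move=> mF F0; rewrite lecE /cint /=; apply/andP; split.
  rewrite (@Rintegral_eqS (Im \o F) (cst 0)) ?Rintegral_cst ?mul0r//.
    exact: measurable_ImC.
  by move=> z /F0; rewrite lecE /= => /andP[/eqP].
apply: Rintegral_ge0S; first exact: measurable_ReC.
by move=> z /F0; rewrite lecE /= => /andP[].
Qed.

(** A small polydisc about z / 2 lies in the ball and is projected radially into the cap, and its
    volume is positive by translation invariance. *)
Lemma cap_pos z (d : R) : en z = 1 -> 0 < d ->
  (0 < sigma [set w | (en (w - z)%R < d)%R])%E.
Proof.
move=> z1 d0.
(* The polydisc has Euclidean radius at most q = 2 (n+1) e, and 8 q (4 + d) = d. Hence q < 1/8, and
   the projected points deviate from z by less than d. *)
pose e : R := d / (n.+1%:R * (4 + d) * 16).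
have D0 : 0 < n.+1%:R * (4 + d) * 16 :> R by rewrite !mulr_gt0 ?ltr0n// ltr_wpDl ?ltW.
have e0 : 0 < e by rewrite divr_gt0.
have [mP /andP[P0 _]] := @lebesgue_Cn_polydisc R n e e0.
have /andP[b0 bfin] := @ball_volume R n.
rewrite /sphere_measure /pushforward /mscale /mrestr /=; apply: mule_gt0.
  by rewrite lte_fin invr_gt0 fine_gt0// b0.
pose a : Cn := - ((2^-1 : R)%:C *: z).
apply: (@lt_le_trans _ _ (lebesgue_Cn n ((fun w => w + a) @^-1` @polydisc R n e))).
  by rewrite lebesgue_Cn_translation.
apply: le_measure; rewrite ?inE.
- exact: (preimage_measurable (measurable_rowadd a)).
- apply: measurableI; last exact: measurable_ball_set.
  apply: (preimage_measurable (@measurable_radial_proj R n)).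
  apply: (preimage_measurable (f := fun w : Cn => en (w - z)) (A := `]-oo, d[%classic)) => //.
  by apply: measurableT_comp; [exact: measurable_eucl_norm|exact: measurable_rowadd].
move=> w /= wP.
have eD : e * (n.+1%:R * (4 + d) * 16) = d by rewrite /e mulfVK// gt_eqF.
have n1 : 1 <= n.+1%:R :> R by rewrite ler1n.
have wa : en (w + a) <= 2 * n.+1%:R * e.
  apply: le_trans (eucl_norm_le_sum _) _.
  apply: (@le_trans _ _ (\sum_(i < n) (2 * e))).
    apply: ler_sum => i _; apply: le_trans (nc_le_ReIm _) _.
    by have [? ?] := wP i; lra.
  rewrite sumr_const card_ord -mulr_natr -natr1 mulrAC; nra.
set q := 2 * n.+1%:R * e in wa.
have qd : q * (4 + d) * 8 = d by rewrite -[RHS]eD /q; ring.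
have q0 : 0 < q by apply: mulr_gt0 e0; lra.
have aE : en a = 2^-1 by rewrite eucl_normN eucl_normZ z1 mulr1 nc_real ger0_norm// invr_ge0.
have wlo : `|en w - 2^-1| <= q.
  by rewrite -aE -(eucl_normN a); apply: le_trans (eucl_normB_lip _ _) _; rewrite opprK.
have q8 : q < 8^-1.
  rewrite ltNge; apply/negP => h; nra.
move: wlo; rewrite ler_norml => /andP[wl wh].
have w0 : 0 < en w by lra.
split; last by rewrite /ball_set /=; lra.
have wE : radial_proj w - z = (en w)^-1%:C *: ((w + a) + (2^-1 - en w)%:C *: z).
  rewrite /radial_proj /a -addrA -scaleNr -scalerDl.
  rewrite (_ : - (2^-1)%:C + (2^-1 - en w)%:C = - (en w)%:C); last first.
    by rewrite rmorphB /=; ring.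
  rewrite scalerDr scalerA mulrN -real_complexM mulVf ?gt_eqF// scaleN1r.
  by [].
rewrite wE eucl_normZ nc_real ger0_norm ?invr_ge0 ?eucl_norm_ge0//.
rewrite mulrC ltr_pdivrMr//; apply: le_lt_trans (eucl_normD _ _) _.
rewrite eucl_normZ z1 mulr1 nc_real.
have : `|2^-1 - en w| <= q by rewrite ler_norml; lra.
by move=> h; nra.
Qed.

(** If F(z) were positive, F would be at least F(z) / 2 on a cap of positive measure. Continuity is
    needed at z only, and only along the sphere. *)
Lemma cint_eq0 F z : sbm F -> (forall w, en w = 1 -> 0 <= F w) -> cint F = 0 ->
  en z = 1 ->
  (forall e : R, 0 < e -> exists2 d : R, 0 < d &
     forall w, en w = 1 -> en (w - z) < d -> nc (F w - F z) < e) -> F z = 0.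
Proof.
move=> sF F0 I0 z1 cF; have := F0 z z1; rewrite lecE /= => /andP[/eqP Iz Rz].
apply/eqP; rewrite eq_complex Iz eqxx andbT; apply/negPn/negP => Rz0.
have {Rz Rz0} a0 : 0 < Re (F z) by rewrite lt_neqAle eq_sym Rz0.
set a := Re (F z) in a0.
have a2 : 0 < a / 2 by rewrite divr_gt0.
have [d d0 dP] := cF _ a2; set cap := [set w : Cn | en (w - z) < d].
have mcap : measurable cap.
  apply: (preimage_measurable (f := fun w : Cn => en (w - z)) (A := `]-oo, d[%classic)) => //.
  by apply: measurableT_comp; [exact: measurable_eucl_norm|exact: measurable_rowadd].
have [mF _] := sF.
have ii : sigma.-integrable setT (EFin \o (fun w => (a / 2) * \1_cap w)).
  apply: (@sphere_integrable _ (a / 2)); first by apply: measurable_funM => //; exact: measurable_indic.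
  move=> w _; rewrite indicE; case: (_ \in _); rewrite ?mulr1 ?mulr0 ?normr0 ?(ltW a2)//.
  by rewrite ger0_norm ?(ltW a2).
have [iF _] := sbm_cintegrable sF.
have : 0 <= \int[sigma]_w (Re (F w) - (a / 2) * \1_cap w).
  apply: Rintegral_ge0S.
    apply: measurable_funB; first exact: measurable_ReC.
    by apply: measurable_funM => //; exact: measurable_indic.
  move=> w w1; rewrite indicE; case: (boolP (w \in cap)) => wc.
    rewrite mulr1; have := dP w w1 (set_mem wc) => /(le_lt_trans (nc_Re _)).
    rewrite cReD cReN -/a ltr_norml; lra.
  by rewrite mulr0 subr0; have := F0 w w1; rewrite lecE /= => /andP[].
rewrite RintegralB//; last first.
have -> : \int[sigma]_w Re (F w) = 0 by move: I0 => /(congr1 Re).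
rewrite RintegralZl//; last first.
  apply: (@sphere_integrable _ 1); first exact: measurable_indic.
  by move=> w _; rewrite indicE; case: (_ \in _); rewrite ?normr1 ?normr0.
have -> : \int[sigma]_w \1_cap w = fine (sigma cap) by rewrite /Rintegral integral_indic// setIT.
have c0 := cap_pos z1 d0.
have : 0 < fine (sigma cap).
  apply: fine_gt0; rewrite c0/=; apply: le_lt_trans (ltry 1).
  by rewrite -(@sphere_measure_setT R n); apply: le_measure; rewrite ?inE.
nra.
Qed.

End sphere_integral.

(** * Measurability of analytic functions *)

Section zero_ext_measurable.
Implicit Types (z w : Cn) (G : Cn -> C).

(** The sigma-algebra of C^n is generated by the coordinates rather than by the open sets. A
    function of the nearby grid point takes countably many values, each on a measurable cell, and
    such functions converge to a continuous one as the grid is refined. *)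
Definition grid_code (k : nat) z : {ffun 'I_n -> int * int} :=
  [ffun i => (Num.floor (k.+1%:R * Re (z ord0 i)), Num.floor (k.+1%:R * Im (z ord0 i)))].
Definition grid_point (k : nat) (c : {ffun 'I_n -> int * int}) : Cn :=
  \row_i (((c i).1%:~R / k.+1%:R) +i* ((c i).2%:~R / k.+1%:R)).

Lemma grid_close k z : en (grid_point k (grid_code k z) - z) <= 2 * n%:R / k.+1%:R.
Proof.
apply: le_trans (eucl_norm_le_sum _) _.
apply: (@le_trans _ _ (\sum_(i < n) (2 / k.+1%:R))); last first.
  by rewrite sumr_const card_ord -mulr_natr; rewrite le_eqVlt; apply/orP; left; apply/eqP; ring.
have k0 : 0 < k.+1%:R :> R by rewrite ltr0n.
have fl (x : R) : `|(Num.floor (k.+1%:R * x))%:~R / k.+1%:R - x| <= k.+1%:R^-1.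
  have /andP[h1 h2] := floor_itv (k.+1%:R * x).
  rewrite -[X in _ - X](mulfK (lt0r_neq0 k0)) -mulrBl normrM (ger0_norm (_ : 0 <= k.+1%:R^-1)) ?invr_ge0 ?ler0n//.
  rewrite ler_piMl ?invr_ge0 ?ler0n// ler_norml; move: h2; rewrite intrD mulr1z.
  by rewrite (mulrC x); lra.
apply: ler_sum => i _; apply: le_trans (nc_le_ReIm _) _.
have E : (grid_point k (grid_code k z) - z) ord0 i = grid_point k (grid_code k z) ord0 i - z ord0 i.
  by rewrite !mxE.
have pR : Re (grid_point k (grid_code k z) ord0 i) = (Num.floor (k.+1%:R * Re (z ord0 i)))%:~R / k.+1%:R.
  by rewrite mxE ffunE.
have pI : Im (grid_point k (grid_code k z) ord0 i) = (Num.floor (k.+1%:R * Im (z ord0 i)))%:~R / k.+1%:R.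
  by rewrite mxE ffunE.
rewrite E cReD cReN cImD cImN pR pI; apply: le_trans (lerD (fl _) (fl _)) _.
by rewrite [leRHS]mulr_natl mulr2n.
Qed.

Lemma measurable_floor_eq (k : nat) (j : int) (f : Cn -> R) : measurable_fun setT f ->
  measurable [set z | Num.floor (k.+1%:R * f z) = j].
Proof.
move=> mf.
rewrite (_ : [set _ | _] = (fun z => k.+1%:R * f z) @^-1` `[j%:~R, (j + 1)%:~R[%classic).
  by apply: preimage_measurable => //; apply: measurable_funM.
apply/seteqP; split => z /=; rewrite in_itv/=; last exact: floor_def.
by move=> <-; exact: floor_itv.
Qed.

Lemma measurable_grid k G : measurable_fun setT (fun z => G (grid_point k (grid_code k z))).
Proof.
move=> _ Y mY; rewrite setTI.
rewrite (_ : _ @^-1` _ = \bigcup_(c : {ffun 'I_n -> int * int})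
    [set z | Y (G (grid_point k c)) /\ grid_code k z = c]); last first.
  apply/seteqP; split => [z /= Yz|z [c _ /= [Yc zc]]].
    by exists (grid_code k z).
  by rewrite zc.
apply: countable_bigcupT_measurable; first exact: countableP.
move=> c; have [Yc|Yc] := pselect (Y (G (grid_point k c))); last first.
  by rewrite (_ : [set _ | _] = set0)//; apply/seteqP; split => z //= [].
rewrite (_ : [set _ | _] = \bigcap_(i in [set: 'I_n])
   ([set z : Cn | Num.floor (k.+1%:R * Re (z ord0 i)) = (c i).1] `&`
    [set z : Cn | Num.floor (k.+1%:R * Im (z ord0 i)) = (c i).2])).
  apply: fin_bigcap_measurable => // i _; apply: measurableI; apply: measurable_floor_eq.
  - exact: (measurable_ReC (measurable_coord i)).
  - exact: (measurable_ImC (measurable_coord i)).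
apply/seteqP; split => [z /= [_ <-] i _|z /= h].
  by rewrite /= ffunE.
split=> //; apply/ffunP => i; rewrite ffunE; have [/= -> ->] := h i Logic.I.
by case: (c i).
Qed.

Lemma measurable_zero_ext (f : unit_ball R n -> C) : analytic f ->
  measurable_fun setT (ext f).
Proof.
move=> af; pose B := @ball_set R n.
(* The indicator of the ball forces the limit 0 outside, where grid points may still fall inside the
   ball. *)
apply: (@measurable_funC_lim _ _ _ (fun k z => (\1_B z)%:C * ext f (grid_point k (grid_code k z)))).
  move=> k; apply: measurable_funCM; last exact: measurable_grid.
  apply: measurable_fun_complex => /=; last exact: measurable_cst.
  by apply: measurable_indic; exact: measurable_ball_set.
move=> z; have [z1|z1] := ltP (en z) 1; last first.
  rewrite zero_ext_out// indicE memNset; last by rewrite /B /ball_set /= ltNge z1.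
  by under eq_cvg do rewrite mul0r; exact: (@cvg_cst C).
rewrite indicE mem_set// [X in fun=> X * _](_ : _ = 1)//.
under eq_cvg do rewrite mul1r.
apply: cvgC_intro => e e0; have [d d0 h] := analytic_econt af z1 e0.
have c : (2 * n%:R / k.+1%:R : R) @[k --> \oo] --> 0.
  rewrite -[X in _ --> X](mulr0 (2 * n%:R)); apply: cvgM; first exact: cvg_cst.
  exact: cvg_harmonic.
have /cvgrPdist_lt/(_ _ d0) := c; apply: filterS => k hk; apply: h.
apply: le_lt_trans (grid_close k z) _; move: hk; rewrite sub0r normrN ger0_norm//.
Qed.

End zero_ext_measurable.

(** * Roots of unity *)

Section roots_of_unity.

Lemma cisD (x y : R) : cis (x + y) = cis x * cis y.
Proof. by rewrite /cis mulrDr cosD sinD; simpc; congr (_ +i* _); ring. Qed.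

Lemma cis_0 : cis 0 = 1 :> C.
Proof. by rewrite /cis mulr0 cos0 sin0. Qed.

Lemma cis_X (x : R) k : cis x ^+ k = cis (k%:R * x).
Proof.
elim: k => [|k ih]; first by rewrite expr0 mul0r cis_0.
by rewrite exprSr ih -cisD -natr1 mulrDl mul1r.
Qed.

Lemma cis_eq1 (x : R) : 0 < x < 1 -> cis x != 1.
Proof.
move=> /andP[x0 x1]; apply/eqP => /(congr1 (@complex.Re R)) /= h.
have pi0 := pi_gt0 R.
have E (y : R) : 0 < y -> y <= 2^-1 -> cos (2 * pi * y) = 1 -> False.
  move=> y0 y2 hy; have {}hy : cos (2 * pi * y) = cos 0 by rewrite cos0.
  have yin : 2 * pi * y \in `[0, (pi : R)].
    by rewrite in_itv/=; apply/andP; split; nra.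
  have zin : (0 : R) \in `[0, (pi : R)] by rewrite in_itv/= lexx ltW.
  by have /eqP := cos_inj yin zin hy; rewrite !mulf_eq0 pnatr_eq0/= !gt_eqF.
have [x2|x2] := leP x 2^-1; first exact: (E x).
apply: (E (1 - x)); [lra|lra|].
have -> : 2 * pi * (1 - x) = - (2 * pi * x) + pi *+ 2 by rewrite -mulr_natl; ring.
by rewrite cosD2pi cosN.
Qed.

Lemma cis_prim (N j : nat) : (0 < j < N)%N -> cis (N%:R^-1 : R) ^+ j != 1.
Proof.
move=> /andP[j0 jN]; rewrite cis_X; apply: cis_eq1.
have N0 : 0 < N%:R :> R by rewrite ltr0n (leq_ltn_trans _ jN).
apply/andP; split; first by apply: divr_gt0 => //; rewrite ltr0n.
by rewrite ltr_pdivrMr// mul1r ltr_nat.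
Qed.

Lemma cis_primN (N : nat) : (0 < N)%N -> cis (N%:R^-1 : R) ^+ N = 1.
Proof. by move=> N0; rewrite cis_X mulfV ?pnatr_eq0 -?lt0n// -cis01 cis_0. Qed.

(** The mean over the N-th roots of unity retains the constant term of a polynomial of degree less
    than N. This finite mean takes the place of integration over a group of rotations. *)
Lemma root_average (N : nat) (b : nat -> C) : (0 < N)%N ->
  \sum_(l < N) \sum_(j < N) b j * (cis N%:R^-1 ^+ l) ^+ j = N%:R * b 0%N.
Proof.
move=> N0; rewrite exchange_big /= (bigD1 (Ordinal N0))//= [X in _ + X]big1 ?addr0.
  under eq_bigr do rewrite expr0 mulr1.
  by rewrite sumr_const card_ord mulr_natl.
move=> j j0; rewrite -mulr_sumr.
set w := cis _; have w1 : w ^+ j != 1.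
  by apply: cis_prim; rewrite ltn_ord andbT lt0n; apply: contraNneq j0 => j0; apply/eqP/val_inj.
have h : (w ^+ j - 1) * \sum_(l < N) (w ^+ j) ^+ l = 0.
  by rewrite -subrX1 -exprM mulnC exprM cis_primN// expr1n subrr.
move/eqP: h; rewrite mulf_eq0 subr_eq0 (negbTE w1)/= => /eqP h.
by under eq_bigr do rewrite exprAC; rewrite h mulr0.
Qed.

End roots_of_unity.

(** * Reduction of integrals to slices, and the reproducing formula *)

Section slices.
Implicit Types (z w e : Cn) (f g : Bn -> C) (F G : Cn -> C).

Lemma real_complexB (a b : R) : (a - b)%:C = a%:C - b%:C.
Proof. exact: rmorphB. Qed.

Lemma measurable_rowZ (c : C) : measurable_fun setT (fun z : Cn => c *: z).
Proof.
apply: measurable_fun_row => i; under eq_fun do rewrite mxE.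
by apply: measurable_funCM; [exact: measurable_cst|exact: measurable_coord].
Qed.

Lemma sbm_zero_ext f (h : Cn -> Cn) (r : R) : analytic f -> measurable_fun setT h -> r < 1 ->
  (forall z, en z = 1 -> en (h z) <= r) -> sbm (fun z => ext f (h z)).
Proof.
move=> af mh r1 hr; split; first by apply: measurableT_comp mh; exact: measurable_zero_ext.
by have [M _ fM] := analytic_bounded af r1; exists M => z /hr; exact: fM.
Qed.

Lemma eucl_normZr (r : R) z : 0 <= r -> en (r%:C *: z) = r * en z.
Proof. by move=> r0; rewrite eucl_normZ nc_real ger0_norm. Qed.

Lemma sbm_dilation f (r : R) : analytic f -> 0 <= r < 1 -> sbm (fun z => ext f (r%:C *: z)).
Proof.
move=> af /andP[r0 r1]; apply: (sbm_zero_ext af _ r1); first exact: measurable_rowZ.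
by move=> z z1; rewrite eucl_normZr// z1 mulr1.
Qed.

Lemma pythagoras e z (t : C) : en e = 1 ->
  en (ip z e *: e + t *: (z - ip z e *: e)) ^+ 2 =
  nc (ip z e) ^+ 2 + nc t ^+ 2 * (en z ^+ 2 - nc (ip z e) ^+ 2).
Proof.
move=> e1; apply: complexI; rewrite -ip_norm -scaleNr ipDl !ipDr !ipZl !ipZr !ipDl !ipDr !ipZl !ipZr.
rewrite -(ip_cj z e) [ip e e]ip_norm [ip z z]ip_norm e1 expr1n rmorph1.
rewrite real_complexD [in X in _ = _ + X]real_complexM real_complexB -!mulcJ cjN; ring.
Qed.

Lemma near_equal (x y : C) (K q : R) : 0 <= q < 1 -> (forall N, (0 < N)%N -> nc (x - y) <= K * q ^+ N) -> x = y.
Proof.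
move=> /andP[q0 q1] h; apply/eqP; rewrite -subr_eq0; apply/eqP/nc_le_eq0 => e e0.
have K0 : 0 < `|K| + 1 by rewrite ltr_wpDl.
have [N hN] := geo_small q0 q1 (divr_gt0 e0 K0).
apply: le_trans (h N.+1 _) _ => //.
have := hN N.+1 (leqnSn _); rewrite ltr_pdivlMr// => /ltW; apply: le_trans.
by rewrite mulrC ler_wpM2l ?exprn_ge0// (le_trans (ler_norm K))// lerDl.
Qed.

Lemma measurable_slice e (c : C) : measurable_fun setT (fun z : Cn => c *: (ip z e *: e)).
Proof.
apply: measurableT_comp; first exact: measurable_rowZ.
apply: measurable_fun_row => i; under eq_fun do rewrite mxE.
by apply: measurable_funCM; [exact: (sbm_ip e).1|exact: measurable_cst].
Qed.

Section rep.
Variables (f : Bn -> C) (e : Cn) (k : nat) (r : R).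
Hypotheses (af : analytic f) (e1 : en e = 1) (r01 : 0 < r < 1).

(** Write z = a e + z' with z' orthogonal to e. The function t -> f(r (a e + t z')) is analytic on
    the disc of radius [R1] > 1, so its Taylor tail at |t| = 1 is exponentially small in N, and
    averaging the Taylor polynomial over the N-th roots of unity leaves its value at t = 0. *)
Let slice_avg : exists K q : R, [/\ 0 <= q < 1 & forall N z, (0 < N)%N -> en z = 1 ->
  nc (N%:R^-1 * \sum_(l < N) ext f (r%:C *: (cis N%:R^-1 ^+ l *: z +
      ((1 - cis N%:R^-1 ^+ l) * ip z e) *: e)) - ext f (r%:C *: (ip z e *: e))) <= K * q ^+ N].
Proof.
have /andP[r0 r1] := r01.
pose p := (1 + r) / 2; have p1 : p < 1 by rewrite /p; lra.
have rp : r < p by rewrite /p; lra.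
have [M M0 fM] := analytic_bounded af p1.
pose R1 := p / r; have R11 : 1 < R1 by rewrite /R1 ltr_pdivlMr// mul1r.
pose R2 := (1 + R1) / 2; have R21 : 1 < R2 by rewrite /R2; lra.
have R2R1 : R2 < R1 by rewrite /R2; lra.
have R20 : 0 < R2 by lra.
exists (M * (R2 / (R2 - 1))), (R2^-1); split.
  by rewrite invr_ge0 ltW//= invf_lt1.
move=> N z N0 z1; pose a := ip z e; pose z' := z - a *: e.
pose u t := ext f (r%:C *: (a *: e + t *: z')).
have a1 : nc a <= 1 by have := cauchy_schwarz_ip z e; rewrite z1 e1 mulr1.
have zb t : nc t <= R1 -> en (r%:C *: (a *: e + t *: z')) <= p.
  move=> tR; rewrite eucl_normZr ?(ltW r0)// mulrC -ler_pdivlMr// -/R1.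
  rewrite -(@ler_pXn2r _ 2)// ?nnegrE ?eucl_norm_ge0//; last by lra.
  rewrite pythagoras// z1 expr1n.
  have h1 : nc a ^+ 2 <= 1 by rewrite expr_le1 ?nc_ge0.
  have h2 : nc t ^+ 2 <= R1 ^+ 2 by rewrite ler_pXn2r ?nnegrE ?nc_ge0//; lra.
  have h3 : 1 <= R1 ^+ 2 by rewrite expr_ge1 ?ltW//; lra.
  rewrite -/a; nra.
have du t : nc t < R1 -> cdiff u t.
  move=> tR; rewrite (_ : u = fun t => ext f (r%:C *: (a *: e) + t *: (r%:C *: z'))).
    apply: (analytic_slice af); 
    have -> : r%:C *: (a *: e) + t *: (r%:C *: z') = r%:C *: (a *: e + t *: z').
      by rewrite [RHS]scalerDr !scalerA (mulrC t).
    exact: le_lt_trans (zb _ (ltW tR)) p1.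
  by apply/funext => s; rewrite /u scalerDr !scalerA (mulrC s).
have R10 : 0 < R1 by lra.
have [b bP] := taylor_disc du R10.
have Mb t : nc t = R2 -> nc (u t) <= M by move=> tR; apply/fM/zb; rewrite tR ltW.
have [_ hb] := bP R2 M R20 R2R1 Mb.
have b0 : u 0 = b 0%N.
  have := hb 1%N 0; rewrite nc0 mul0r expr1 mulr0 mul0r big_ord1 expr0 mulr1 => /(_ R20).
  by move=> h; apply/eqP; rewrite -subr_eq0 -nc_eq0 eq_le h nc_ge0.
have N0' : N%:R != 0 :> C by rewrite pnatr_eq0 -lt0n.
have -> : ext f (r%:C *: (a *: e)) = N%:R^-1 * \sum_(l < N) \sum_(j < N) b j * (cis N%:R^-1 ^+ l) ^+ j.
  rewrite root_average// mulrA mulVf// mul1r -b0 /u scale0r addr0//.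
rewrite -mulrBr -sumrB ncM ncV.
have -> : nc (N%:R : C) = N%:R.
  by rewrite (_ : N%:R = (N%:R : R)%:C) ?nc_real ?normr_nat//; rewrite rmorph_nat.
rewrite mulrC ler_pdivrMr ?ltr0n//; apply: le_trans (nc_sum _ _ _) _.
rewrite (_ : _ * N%:R = \sum_(l < N) M * (R2 / (R2 - 1)) * R2^-1 ^+ N); last first.
  by rewrite sumr_const card_ord -[RHS]mulr_natr.
apply: ler_sum => l _; set c := cis _ ^+ l.
have c1 : nc c = 1 by rewrite ncX nc_cis expr1n.
have := hb N c; rewrite c1 => /(_ R21) h.
rewrite (_ : ext f _ = u c); first by rewrite (le_trans h)// div1r mulrAC.
rewrite /u /z' -/a; congr (ext f (_ *: _)).
by rewrite scalerBr addrCA; congr (_ + _); rewrite mulrBl mul1r scalerBl scalerA.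
Qed.

(** The rotations that fix e preserve the measure and the factor <z, e>. Averaging over N of them
    changes f(r z) into its value on the slice, up to an error exponentially small in N. *)
Lemma mean_slice : cint (fun z => ext f (r%:C *: z) * cj (ip z e) ^+ k) =
  cint (fun z => ext f (r%:C *: (ip z e *: e)) * cj (ip z e) ^+ k).
Proof.
have /andP[r0 r1] := r01.
have r01' : 0 <= r < 1 by rewrite ltW.
have [K [q [q01 hK]]] := slice_avg.
have mip := measurable_slice e r%:C.
pose F (z : Cn) := ext f (r%:C *: z) * cj (ip z e) ^+ k.
have sF : sbm F by apply: sbmM; [exact: sbm_dilation|exact: sbm_ip_cj].
have ip1 z : en z = 1 -> nc (ip z e) <= 1.
  by move=> z1; have := cauchy_schwarz_ip z e; rewrite z1 e1 mulr1.
have sH : sbm (fun z => ext f (r%:C *: (ip z e *: e)) * cj (ip z e) ^+ k).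
  apply: sbmM; last exact: sbm_ip_cj.
  apply: (sbm_zero_ext af mip r1) => z z1.
  by rewrite eucl_normZr ?(ltW r0)// eucl_normZ e1 mulr1 ler_piMr ?(ltW r0)// ip1.
apply: (@near_equal _ _ K q q01) => N N0.
pose rr l z : Cn := 1 *: ((cis N%:R^-1 ^+ l) *: z + ((1 - cis N%:R^-1 ^+ l) * ip z e) *: e).
have rot_sbm (l : 'I_N) : sbm (fun z => F (rr l z)).
  split.
    apply: (measurableT_comp sF.1); apply: measurable_fun_row => i.
    under eq_fun do rewrite !mxE mul1r.
    apply: measurable_funCD; (apply: measurable_funCM; last by [exact: measurable_cst|exact: measurable_coord]).
      exact: measurable_cst.
    by apply: measurable_funCM; [exact: measurable_cst|exact: (sbm_ip e).1].
  have [M MF] := sF.2; exists M => z z1; apply: MF.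
  by rewrite /rr -rotE rot_norm// ?nc1// ncX nc_cis expr1n.
have -> : cint (fun z => ext f (r%:C *: z) * cj (ip z e) ^+ k) =
    cint (fun z => N%:R^-1 * \sum_(l < N) F (rr l z)).
  rewrite cintZ//; last exact: sbm_sum.
  rewrite cint_sum//.
  have hl (l : 'I_N) : cint (fun z => F (rr l z)) = cint F.
    apply: (cint_rot (F := F) e1); rewrite ?nc1// ?ncX ?nc_cis ?expr1n//; first exact: sF.1.
    exact: sbm_cintegrable.
  under eq_bigr do rewrite hl.
  by rewrite sumr_const card_ord -[cint F *+ N]mulr_natl mulrA mulVf ?mul1r// pnatr_eq0 -lt0n.
rewrite -cintB//; last by apply: sbmZ => //; exact: sbm_sum.
apply: cint_le => //; first by apply: sbmB => //; apply: sbmZ => //; exact: sbm_sum.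
move=> z z1; apply: le_trans (hK N z N0 z1).
have -> : N%:R^-1 * \sum_(l < N) F (rr l z) = (N%:R^-1 * \sum_(l < N) ext f (r%:C *:
   (cis N%:R^-1 ^+ l *: z + ((1 - cis N%:R^-1 ^+ l) * ip z e) *: e))) * cj (ip z e) ^+ k.
  rewrite -mulrA mulr_suml; congr (_ * _); apply: eq_bigr => l _; rewrite /F /rr scale1r.
  rewrite ipDl !ipZl ip_norm e1 expr1n rmorph1 mulr1; congr (_ * cj _ ^+ k); ring.
rewrite -mulrBl ncM ler_piMr ?nc_ge0// ncX nc_cj exprn_ile1 ?nc_ge0//.
exact: ip1.
Qed.

End rep.

Lemma cint_orth F (v c : C) : nc v = 1 -> c != 1 -> sbm F ->
  (forall z, F (v *: z) = c * F z) -> cint F = 0.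
Proof.
move=> v1 c1 sF Fv; have := cint_rotate n0 v1 sF.1 (sbm_cintegrable sF).
under [X in cint X]eq_fun do rewrite Fv.
rewrite cintZ// => /eqP; rewrite -subr_eq0 -[X in _ - X]mul1r -mulrBl mulf_eq0 subr_eq0.
by rewrite (negbTE c1) => /eqP.
Qed.

(* The phases of two homogeneous functions of distinct degrees rotate apart. *)
Lemma cint_orth_deg F G (j k : nat) : j != k -> sbm F -> sbm G ->
  (forall (v : C) z, F (v *: z) = v ^+ j * F z) -> (forall (v : C) z, G (v *: z) = v ^+ k * G z) ->
  cint (fun z => F z * cj (G z)) = 0.
Proof.
wlog jk : F G j k / (k < j)%N.
  move=> h; case: (ltngtP k j) => // jk _ sF sG hF hG.
    by apply: (h F G j k) => //; rewrite gtn_eqF.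
  rewrite -[LHS]cjK -cint_cj//; last by apply: sbmM => //; exact: sbm_cj.
  under [X in cint X]eq_fun do rewrite cjM cjK mulrC.
  by rewrite (h G F k j)// ?cj0// gtn_eqF.
move=> _ sF sG hF hG; pose v : C := cis (j.+1%:R^-1).
have v1 : nc v = 1 := nc_cis _.
have vv : v * cj v = 1 by rewrite mulcJ v1 expr1n.
apply: (cint_orth (v := v) (c := v ^+ (j - k))) => //.
- by apply: cis_prim; rewrite subn_gt0 jk/= ltnS leq_subr.
- by apply: sbmM => //; exact: sbm_cj.
- move=> z; rewrite hF hG cjM cjX.
  rewrite -[in LHS](subnK (ltnW jk)) exprD -!mulrA; congr (_ * _).
  have e : v ^+ k * cj v ^+ k = 1 by rewrite -exprMn vv expr1n.
  by rewrite -[RHS]mul1r -e; ring.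
Qed.

Definition ip_moment k e : C := cint (fun z : Cn => ip z e ^+ k * cj (ip z e) ^+ k).

(** By homogeneity P(<z, e> e) = <z, e>^k P(e), so the slice formula turns the integral into P(e)
    times a moment. The radius 1/2 is arbitrary and its power cancels. *)
Lemma hom_rep_unit (P : Cn -> C) k e : analytic (fun z : Bn => P (val z)) -> sbm P ->
  (forall (v : C) z, P (v *: z) = v ^+ k * P z) -> en e = 1 ->
  cint (fun z => P z * cj (ip z e) ^+ k) = P e * ip_moment k e.
Proof.
move=> aP sP hP e1.
have h01 : 0 < (2^-1 : R) < 1 by rewrite invr_gt0 ltr0n/= invf_lt1// ltr1n.
have /andP[h0 h1] := h01.
have c0 : (2^-1 : R)%:C ^+ k != 0 :> C by rewrite expf_neq0// eq_complex /= negb_and gt_eqF.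
have zE z : en z <= 1 -> ext (fun z : Bn => P (val z)) ((2^-1 : R)%:C *: z) = (2^-1 : R)%:C ^+ k * P z.
  move=> z1; have zB : en ((2^-1 : R)%:C *: z) < 1.
    by rewrite eucl_normZr ?(ltW h0)//; have := eucl_norm_ge0 z; nra.
  by rewrite (zero_ext_in _ zB) /= hP.
have ip1 z : en z = 1 -> en (ip z e *: e) <= 1.
  by move=> z1; rewrite eucl_normZ e1 mulr1; have := cauchy_schwarz_ip z e; rewrite z1 e1 mulr1.
pose p (z : Bn) := P (val z).
have E1 : cint (fun z => ext p ((2^-1 : R)%:C *: z) * cj (ip z e) ^+ k) = (2^-1 : R)%:C ^+ k * cint (fun z => P z * cj (ip z e) ^+ k).
  have s1 : sbm (fun z => P z * cj (ip z e) ^+ k) := sbmM sP (sbm_ip_cj e k).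
  rewrite -(cintZ _ s1); apply: cint_eqS.
  - by apply: (sbmM _ (sbm_ip_cj e k)).1; apply: sbm_dilation => //; rewrite h1 ltW.
  - exact: (sbmZ _ s1).1.
  - by move=> z z1; rewrite zE ?z1// mulrA.
have s2 : sbm (fun z : Cn => ip z e ^+ k * cj (ip z e) ^+ k) := sbmM (sbmX k (sbm_ip e)) (sbm_ip_cj e k).
have E2 : cint (fun z => ext p ((2^-1 : R)%:C *: (ip z e *: e)) * cj (ip z e) ^+ k) = (2^-1 : R)%:C ^+ k * (P e * ip_moment k e).
  rewrite /ip_moment -(cintZ _ s2) -(cintZ _ (sbmZ _ s2)).
  apply: cint_eqS.
  - apply: measurable_funCM; last exact: (sbm_ip_cj e k).1.
    by apply: measurableT_comp; [exact: measurable_zero_ext|exact: measurable_slice].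
  - exact: (sbmZ _ (sbmZ _ s2)).1.
  - by move=> z z1; rewrite zE ?ip1// hP; ring.
by have := mean_slice k aP e1 h01; rewrite E1 E2 => /(mulfI c0).
Qed.

Lemma analytic_ip w k : analytic (fun z : Bn => ip (val z) w ^+ k).
Proof.
have a1 : analytic (fun z : Bn => ip (val z) w).
  rewrite (_ : (fun _ => _) = \sum_(i < n) cj (w ord0 i) *: (coord_fun i : Bn -> C)).
    by apply: analytic_sum => i; apply: analyticZ; exact: analytic_coord.
  by apply/funext => z; rewrite fct_sumE; apply: eq_bigr => i _; rewrite mulrC.
elim: k => [|k ih]; first exact: analytic_cst.
by have := analyticM a1 ih; congr analytic; apply/funext => z; rewrite /mult exprS.
Qed.

Lemma sbm_ipX w k : sbm (fun z : Cn => ip z w ^+ k).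
Proof. by apply: sbmX; exact: sbm_ip. Qed.

Lemma ip_homX w k (v : C) z : ip (v *: z) w ^+ k = v ^+ k * ip z w ^+ k.
Proof. by rewrite ipZl exprMn. Qed.

Lemma ip_moment_real k e : cj (ip_moment k e) = ip_moment k e.
Proof.
rewrite /ip_moment -cint_cj//; last by apply: sbmM; [exact: sbm_ipX|exact: sbm_ip_cj].
by congr cint; apply/funext => z; rewrite cjM !cjX cjK mulrC.
Qed.

(** The reproducing formula for <., y>^k at x and for <., x>^k at y computes conjugate integrals,
    and comparison cancels <x, y>^k. Orthogonal vectors are linked through their normalized sum. *)
Lemma ip_moment_indep k e e' : en e = 1 -> en e' = 1 ->
  ip_moment k e = ip_moment k e'.
Proof.
have ind x y : en x = 1 -> en y = 1 -> ip x y != 0 -> ip_moment k x = ip_moment k y.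
  move=> x1 y1 xy0.
  have h1 := hom_rep_unit (analytic_ip y k) (sbm_ipX y k) (ip_homX y k) x1.
  have h2 := hom_rep_unit (analytic_ip x k) (sbm_ipX x k) (ip_homX x k) y1.
  have : cj (cint (fun z => ip z x ^+ k * cj (ip z y) ^+ k)) = cint (fun z => ip z y ^+ k * cj (ip z x) ^+ k).
    rewrite -cint_cj//; last by apply: sbmM; [exact: sbm_ipX|exact: sbm_ip_cj].
    by congr cint; apply/funext => z; rewrite cjM !cjX cjK mulrC.
  rewrite h2 h1 cjM cjX ip_cj ip_moment_real => h.
  by symmetry; exact: (mulfI (expf_neq0 k xy0) h).
move=> e1 e'1; have [oe|] := eqVneq (ip e e') 0; last exact: ind.
have o' : ip e' e = 0 by rewrite -ip_cj oe cj0.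
have s0 : 0 < en (e + e').
  rewrite lt_neqAle eucl_norm_ge0 andbT eq_sym eucl_norm_eq0; apply/eqP => h.
  have := congr1 (fun z => ip z e) h; rewrite ipDl o' addr0 ip_norm e1 expr1n.
  rewrite (_ : ip 0 e = 0) => [/eqP|]; last by rewrite -(scale0r e) ipZl mul0r.
  by rewrite eq_complex /= oner_eq0.
pose m := (en (e + e'))^-1%:C *: (e + e').
have c0 : (en (e + e'))^-1%:C != 0 :> C by rewrite eq_complex /= negb_and invr_eq0 gt_eqF.
have m1 : en m = 1 by rewrite eucl_normZr ?invr_ge0 ?eucl_norm_ge0// mulVf// gt_eqF.
have e11 : ip e e = 1 by rewrite ip_norm e1 expr1n.
have e11' : ip e' e' = 1 by rewrite ip_norm e'1 expr1n.
rewrite (ind e m) ?(ind m e')//.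
- by rewrite ipZl ipDl oe add0r e11' mulr1.
- by rewrite ipZr ipDr oe addr0 e11 mulr1 cj_eq0.
Qed.

Definition moment k : C := ip_moment k (delta_mx ord0 (Ordinal n0)).

Lemma eucl_norm_delta (i : 'I_n) : en (delta_mx ord0 i : Cn) = 1.
Proof.
rewrite /en (bigD1 i)//= big1 => [|j ji].
  by rewrite mxE !eqxx nc1 expr1n addr0 sqrtr1.
by rewrite mxE eqxx/= (negbTE ji) nc0 expr0n.
Qed.

Lemma momentE k e : en e = 1 -> ip_moment k e = moment k.
Proof. by move=> e1; apply: ip_moment_indep => //; exact: eucl_norm_delta. Qed.

Lemma hom_rep (P : Cn -> C) k w : analytic (fun z : Bn => P (val z)) -> sbm P ->
  (forall (v : C) z, P (v *: z) = v ^+ k * P z) -> w != 0 ->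
  cint (fun z => P z * cj (ip z w) ^+ k) = P w * moment k.
Proof.
move=> aP sP hP w0.
have s0 : 0 < en w by rewrite lt_neqAle eucl_norm_ge0 andbT eq_sym eucl_norm_eq0.
pose e := (en w)^-1%:C *: w.
have e1 : en e = 1 by rewrite eucl_normZr ?invr_ge0 ?eucl_norm_ge0// mulVf// gt_eqF.
have -> : w = (en w)%:C *: e.
  by rewrite /e scalerA -real_complexM mulfV ?gt_eqF// scale1r.
rewrite hP -(momentE k e1) -mulrA -(hom_rep_unit aP sP hP e1) -cintZ//; last first.
  by apply: sbmM => //; exact: sbm_ip_cj.
congr cint; apply/funext => z; rewrite ipZr cj_real cjM cj_real exprMn; ring.
Qed.

End slices.

(** * Moments and homogeneous components *)

Section components.
Implicit Types (z w e : Cn) (f g : Bn -> C) (F G : Cn -> C).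

Lemma cint_orth_rot G e (w c : C) : en e = 1 -> nc w = 1 -> c != 1 -> sbm G ->
  (forall z, G (w *: z + ((1 - w) * ip z e) *: e) = c * G z) -> cint G = 0.
Proof.
move=> e1 w1 c1 sG Gw.
have := cint_rot e1 (@nc1 R) w1 sG.1 (sbm_cintegrable sG).
under [X in cint X]eq_fun do rewrite scale1r Gw.
rewrite (cintZ c sG) => /eqP; rewrite -subr_eq0 -[X in _ - X]mul1r -mulrBl mulf_eq0 subr_eq0.
by rewrite (negbTE c1) => /eqP.
Qed.

Lemma ip_delta z (i : 'I_n) : ip z (delta_mx ord0 i) = z ord0 i.
Proof.
rewrite /ip (bigD1 i)//= mxE !eqxx cj1 mulr1 big1 ?addr0// => j ji.
by rewrite mxE eqxx (negbTE ji) cj0 mulr0.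
Qed.

Definition mixed k (i j : 'I_n) z : C :=
  z ord0 i ^+ k * z ord0 j * (cj (z ord0 i) ^+ k * cj (z ord0 j)).

Lemma sbm_cjX F k : sbm F -> sbm (fun z => cj (F z) ^+ k).
Proof. by move=> sF; exact: (sbmX k (sbm_cj sF)). Qed.

(** The reproducing formula for P = z_i^k z_j at w = e_i + e_j, where P(w) = 1. In the expansion of
    conj(z_i + z_j)^(k+1), multiplying the coordinates other than the i-th by a phase kills every
    term but the one linear in conj(z_j), whose binomial coefficient is k + 1. *)
Lemma mixed_moment k (i j : 'I_n) : i != j -> k.+1%:R * cint (mixed k i j) = moment k.+1.
Proof.
move=> ij; pose w : Cn := delta_mx ord0 i + delta_mx ord0 j.
pose P z : C := z ord0 i ^+ k * z ord0 j.
have sci : sbm (fun z : Cn => z ord0 i) by exact: sbm_coord.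
have scj : sbm (fun z : Cn => z ord0 j) by exact: sbm_coord.
have sP : sbm P := sbmM (sbmX k sci) scj.
have aP : analytic (fun z : Bn => P (val z)).
  apply: (@analyticM (fun z : Bn => (val z) ord0 i ^+ k) (coord_fun j)); last exact: analytic_coord.
  rewrite (_ : (fun _ => _) = (fun z : Bn => ip (val z) (delta_mx ord0 i) ^+ k)).
    exact: analytic_ip.
  by apply/funext => z; rewrite ip_delta.
have hP (v : C) z : P (v *: z) = v ^+ k.+1 * P z.
  by rewrite /P !mxE exprMn exprS; ring.
have wi : w ord0 i = 1 by rewrite /w !mxE !eqxx/= (negbTE ij) addr0.
have wj : w ord0 j = 1 by rewrite /w !mxE !eqxx/= eq_sym (negbTE ij) add0r.
have w0 : w != 0.
  by apply/eqP => /rowP/(_ i); rewrite wi mxE => /eqP; rewrite oner_eq0.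
have := hom_rep aP sP hP w0.
have -> : P w = 1 by rewrite /P wi wj expr1n mulr1.
rewrite mul1r => <-.
pose G (l : nat) z : C := P z * (cj (z ord0 i) ^+ (k.+1 - l) * cj (z ord0 j) ^+ l).
have sG l : sbm (G l) := sbmM sP (sbmM (sbm_cjX _ sci) (sbm_cjX l scj)).
have E z : P z * cj (ip z w) ^+ k.+1 = \sum_(l < k.+2) 'C(k.+1, l)%:R * G l z.
  rewrite ipDr !ip_delta cjD exprDn mulr_sumr; apply: eq_bigr => l _.
  by rewrite /G -mulr_natl; ring.
under eq_fun do rewrite E.
rewrite cint_sum//; last by move=> l; exact: sbmZ (sG l).
pose l1 : 'I_k.+2 := Ordinal (isT : (1 < k.+2)%N).
rewrite (bigD1 l1)//= [X in _ + X]big1 ?addr0; last first.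
  move=> l ll1; rewrite (cintZ _ (sG l)).
  suff -> : cint (G l) = 0 by rewrite mulr0.
  have l1' : (l : nat) != 1%N by apply: contra ll1 => /eqP ll; apply/eqP/val_inj.
  (* The term acquires the factor v conj(v)^l, which is v = -1 for l = 0 and conj(v)^(l-1) for l >
     1. Order l + 2 makes it differ from 1 in both cases. *)
  pose v : C := cis (l.+2%:R^-1).
  have v1 : nc v = 1 := nc_cis _.
  have vv : v * cj v = 1 by rewrite mulcJ v1 expr1n.
  have c1 : v * cj v ^+ l != 1.
    case: (posnP l) => [lz|lp].
      by rewrite /v lz expr0 mulr1 -[X in X != _]expr1; exact: (@cis_prim 2 1 isT).
    rewrite -(prednK lp) exprS mulrA vv mul1r -cjX; apply/eqP => /(congr1 cj); rewrite cjK cj1.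
    apply/eqP; apply: cis_prim.
    by move: lp l1'; case: (nat_of_ord l) => [//|[//|m]] _ _ /=; rewrite !ltnS; apply: leqW; apply: leqW.
  apply: (cint_orth_rot (eucl_norm_delta i) v1 c1 (sG l)) => z.
  have zi : (v *: z + ((1 - v) * ip z (delta_mx ord0 i)) *: delta_mx ord0 i) ord0 i = z ord0 i.
    by rewrite ip_delta !mxE !eqxx /= mulr1 mulrBl mul1r addrC subrK.
  have zj : (v *: z + ((1 - v) * ip z (delta_mx ord0 i)) *: delta_mx ord0 i) ord0 j = v * z ord0 j.
    by rewrite !mxE !eqxx/= eq_sym (negbTE ij) mulr0 addr0.
  by rewrite /G /P zi zj !cjM exprMn; ring.
rewrite bin1 (cintZ _ (sG 1%N)); congr (_ * cint _).
by apply/funext => z; rewrite /G /P /mixed expr1 subn1.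
Qed.

Lemma sbm_mixed k i j : sbm (mixed k i j).
Proof.
have sci : sbm (fun z : Cn => z ord0 i) by exact: sbm_coord.
have scj : sbm (fun z : Cn => z ord0 j) by exact: sbm_coord.
exact: sbmM (sbmM (sbmX k sci) scj) (sbmM (sbm_cjX _ sci) (sbm_cj scj)).
Qed.

(** Insert 1 = sum_j |z_j|^2: the term j = i is the next moment, and each of the n - 1 others is the
    next moment divided by k + 1. *)
Lemma moment_rec k : k.+1%:R * moment k = (n + k)%:R * moment k.+1.
Proof.
pose i := Ordinal n0.
have E : moment k = \sum_(j < n) cint (mixed k i j).
  rewrite -cint_sum//; last by move=> j; exact: sbm_mixed.
  apply: cint_eqS.
  - exact: (sbmM (sbm_ipX _ _) (sbm_ip_cj _ _)).1.
  - by apply: (sbm_sum _ _).1 => j; exact: sbm_mixed.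
  move=> z z1; rewrite ip_delta.
  have mE j : mixed k i j z = (z ord0 i ^+ k * cj (z ord0 i) ^+ k) * (z ord0 j * cj (z ord0 j)).
    by rewrite /mixed; ring.
  under eq_bigr do rewrite mE.
  by rewrite -mulr_sumr -/(ip z z) ip_norm z1 expr1n mulr1.
rewrite E mulr_sumr (bigD1 i)//=.
have -> : cint (mixed k i i) = moment k.+1.
  by congr cint; apply/funext => z; rewrite /mixed ip_delta !exprS; ring.
rewrite (eq_bigr (fun=> moment k.+1)); last by move=> j ij; rewrite mixed_moment// eq_sym.
rewrite sumr_const cardC1 card_ord -[_ *+ n.-1]mulr_natl -mulrDl -natrD.
by rewrite addSnnS prednK// addnC.
Qed.

Lemma moment_binom k : 'C((n + k).-1, k)%:R * moment k = 1.
Proof.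
elim: k => [|k ih].
  rewrite bin0 mul1r /moment /ip_moment.
  under eq_fun do rewrite !expr0 mulr1.
  by rewrite cint_cst.
have k0 : (k.+1%:R : C) != 0 by rewrite pnatr_eq0.
apply: (mulfI k0); rewrite mulr1 mulrA -natrM addnS /= -mul_bin_diag natrM.
by rewrite mulrAC -moment_rec -mulrA [moment k * _]mulrC ih mulr1.
Qed.

Definition hom_dim k : nat := 'C((n + k).-1, k).
(* The homogeneous component of degree k of f, by the reproducing formula on the
   sphere of radius 1/2; hom_dim k is the dimension of the space of such polynomials. *)
Definition hc f k w : C := (hom_dim k)%:R * 2 ^+ k *
  cint (fun z => ext f ((2^-1 : R)%:C *: z) * cj (ip z w) ^+ k).

Let half01 : 0 < (2^-1 : R) < 1.
Proof. by rewrite invr_gt0 ltr0n/= invf_lt1// ltr1n. Qed.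
Let half01' : 0 <= (2^-1 : R) < 1.
Proof. by have /andP[/ltW -> ->] := half01. Qed.

Lemma sbm_rep f w k (r : R) : analytic f -> 0 <= r < 1 ->
  sbm (fun z => ext f (r%:C *: z) * cj (ip z w) ^+ k).
Proof. by move=> af r01; exact: sbmM (sbm_dilation af r01) (sbm_ip_cj w k). Qed.

Lemma hc_hom f k (v : C) w : analytic f -> hc f k (v *: w) = v ^+ k * hc f k w.
Proof.
move=> af; rewrite /hc mulrCA; congr (_ * _).
rewrite -(cintZ _ (sbm_rep w k af half01')); congr cint.
by apply/funext => z; rewrite ipZr cjM cjK exprMn mulrCA.
Qed.

Definition ispoly F := exists p : mpoly.mpoly n C, F = poly_fun p.

Lemma ispoly_cst (c : C) : ispoly (fun=> c).
Proof. by exists (mpoly.mpolyC n c); apply/funext => z; rewrite /poly_fun mpoly.mevalC. Qed.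
Lemma ispolyD F G : ispoly F -> ispoly G -> ispoly (fun z => F z + G z).
Proof.
by move=> [p ->] [q ->]; eexists; apply/funext => z; rewrite /poly_fun -mpoly.mevalD; reflexivity.
Qed.
Lemma ispolyM F G : ispoly F -> ispoly G -> ispoly (fun z => F z * G z).
Proof.
by move=> [p ->] [q ->]; eexists; apply/funext => z; rewrite /poly_fun -mpoly.mevalM; reflexivity.
Qed.
Lemma ispoly_coord i : ispoly (fun z => z ord0 i).
Proof.
by exists (mpoly.mpolyX C (mpoly.mnm1 i)); apply/funext => z; rewrite /poly_fun mpoly.mevalXU.
Qed.
Lemma ispoly_sum (I : Type) (s : seq I) (F : I -> Cn -> C) : (forall i, ispoly (F i)) ->
  ispoly (fun z => \sum_(i <- s) F i z).
Proof.
move=> pF; elim: s => [|i s ih]; first by under eq_fun do rewrite big_nil; exact: ispoly_cst.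
by under eq_fun do rewrite big_cons; exact: ispolyD.
Qed.

Lemma ispoly_cint G k : sbm G -> ispoly (fun w => cint (fun z => G z * cj (ip z w) ^+ k)).
Proof.
elim: k G => [|k ih] G sG.
  by under eq_fun do under [X in cint X]eq_fun do rewrite expr0; exact: ispoly_cst.
have E w : cint (fun z => G z * cj (ip z w) ^+ k.+1) =
    \sum_(i < n) w ord0 i * cint (fun z => G z * cj (z ord0 i) * cj (ip z w) ^+ k).
  have si i : sbm (fun z => G z * cj (z ord0 i) * cj (ip z w) ^+ k) :=
    sbmM (sbmM sG (sbm_cj (sbm_coord i))) (sbm_ip_cj w k).
  under eq_bigr do rewrite -(cintZ _ (si _)).
  rewrite -cint_sum//; last by move=> i; exact: sbmZ (si i).
  congr cint; apply/funext => z; rewrite exprS {1}/ip cj_sum mulr_suml mulr_sumr.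
  by apply: eq_bigr => i _; rewrite cjM cjK; ring.
under eq_fun do rewrite E.
apply: ispoly_sum => i; apply: ispolyM; first exact: ispoly_coord.
exact: ih (sbmM sG (sbm_cj (sbm_coord i))).
Qed.

Lemma hc_poly f k : analytic f -> ispoly (hc f k).
Proof.
move=> af; apply: ispolyM; first exact: ispoly_cst.
exact: ispoly_cint (sbm_dilation af half01').
Qed.

Lemma mpoly_ind_closed (P : (Cn -> C) -> Prop) :
  (forall c : C, P (fun=> c)) -> (forall i, P (fun z => z ord0 i)) ->
  (forall F G, P F -> P G -> P (fun z => F z + G z)) ->
  (forall F G, P F -> P G -> P (fun z => F z * G z)) ->
  forall F, ispoly F -> P F.
Proof.
move=> Pc Px PD PM F [p ->].
elim/mpoly.mpolyind : p => [|c m p _ _ ih].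
  by rewrite (_ : poly_fun _ = fun=> 0); [exact: Pc|apply/funext => z; rewrite /poly_fun mpoly.meval0].
rewrite (_ : poly_fun _ = fun z => c * (\prod_(i < n) z ord0 i ^+ mpoly.fun_of_multinom m i) + poly_fun p z); last first.
  by apply/funext => z; rewrite /poly_fun mpoly.mevalD mpoly.mevalZ mpoly.mevalX.
apply: (PD (fun z => c * _)) => //; apply: (PM (fun=> c)) => //.
have PX k (F' : Cn -> C) : P F' -> P (fun z => F' z ^+ k).
  move=> PF; elim: k => [|k ihk]; first by under eq_fun do rewrite expr0; exact: Pc.
  by under eq_fun do rewrite exprS; exact: PM.
have : forall s : seq 'I_n, P (fun z => \prod_(i <- s) z ord0 i ^+ mpoly.fun_of_multinom m i).
  elim=> [|i s ihs]; first by under eq_fun do rewrite big_nil; exact: Pc.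
  under eq_fun do rewrite big_cons; apply: PM => //; exact: PX.
exact.
Qed.

Lemma ispoly_sbm F : ispoly F -> sbm F.
Proof.
by apply: mpoly_ind_closed; [exact: sbm_cst|exact: sbm_coord|exact: sbmD|exact: sbmM].
Qed.

Lemma sbm_hc f k : analytic f -> sbm (hc f k).
Proof. by move=> af; exact/ispoly_sbm/hc_poly. Qed.

Lemma pow_div_le (a b s : R) N : 0 <= a -> a <= b -> 0 < s -> (a / s) ^+ N <= (b / s) ^+ N.
Proof.
move=> a0 ab s0; apply: lerXn2r; rewrite ?nnegrE ?divr_ge0 ?(ltW s0)//.
  exact: le_trans ab.
by rewrite ler_pM2r// invr_gt0.
Qed.

Lemma sum_hom_orth F (a : nat -> C) e k (r : R) N : (k < N)%N -> en e = 1 ->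
  cint (fun z => (\sum_(j < N) a j * (r%:C * ip z e) ^+ j) * cj (ip z e) ^+ k) =
  r%:C ^+ k * a k * moment k.
Proof.
move=> kN e1.
pose Fj j (z : Cn) : C := ip z e ^+ j * cj (ip z e) ^+ k.
have sF j : sbm (Fj j) := sbmM (sbm_ipX e j) (sbm_ip_cj e k).
transitivity (cint (fun z => \sum_(j < N) (a j * r%:C ^+ j) * Fj j z)).
  congr cint; apply/funext => z; rewrite mulr_suml; apply: eq_bigr => j _.
  by rewrite exprMn /Fj; ring.
rewrite cint_sum//; last by move=> j; exact: sbmZ (sF j).
rewrite (bigD1 (Ordinal kN))//= [X in _ + X]big1 ?addr0.
  by rewrite (cintZ _ (sF k)) -(momentE k e1) [a k * _]mulrC.
move=> j jk; rewrite (cintZ _ (sF j)).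
suff -> : cint (Fj j) = 0 by rewrite mulr0.
have jk' : (j : nat) != k by apply: contra jk => /eqP h; apply/eqP/val_inj.
have := cint_orth_deg jk' (sbm_ipX e j) (sbm_ipX e k) (ip_homX e j) (ip_homX e k).
by move=> <-; congr cint; apply/funext => z; rewrite cjX.
Qed.

(** After [mean_slice], the slice expansion is integrated term by term; powers of <z, e> of distinct
    degrees are orthogonal and the tail is exponentially small. The coefficients enter only through
    the expansion they satisfy, so the result serves both to identify them with [hc] and to evaluate
    integrals of [hc] at any radius. *)
Lemma slice_rep f (a : nat -> C) e k (r : R) : analytic f -> en e = 1 -> 0 < r < 1 ->
  (forall s M : R, 0 < s -> s < 1 -> (forall z : C, nc z = s -> nc (ext f (z *: e)) <= M) ->
     forall N (w : C), nc w < s -> nc (ext f (w *: e) - \sum_(k < N) a k * w ^+ k) <=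
       M * (nc w / s) ^+ N * (s / (s - nc w))) ->
  cint (fun z => ext f (r%:C *: z) * cj (ip z e) ^+ k) = r%:C ^+ k * a k * moment k.
Proof.
move=> af e1 r01 ha; have /andP[r0 r1] := r01.
rewrite (mean_slice k af e1 r01).
pose s := (1 + r) / 2; have s1 : s < 1 by rewrite /s; lra.
have rs : r < s by rewrite /s; lra.
have s0 : 0 < s by lra.
have [M M0 fM] := analytic_bounded af s1.
have hM (z : C) : nc z = s -> nc (ext f (z *: e)) <= M.
  by move=> zs; apply: fM; rewrite eucl_normZ e1 mulr1 zs.
have {ha hM} ha := ha s M s0 s1 hM.
have q01 : 0 <= r / s < 1.
  by rewrite ltr_pdivrMr// mul1r rs andbT divr_ge0 ?ltW.
have ip1 z : en z = 1 -> nc (ip z e) <= 1.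
  by move=> z1; have := cauchy_schwarz_ip z e; rewrite z1 e1 mulr1.
have mH : sbm (fun z => ext f (r%:C *: (ip z e *: e))).
  apply: (sbm_zero_ext af _ r1) => [|z z1].
    exact: measurable_slice.
  by rewrite eucl_normZr ?(ltW r0)// eucl_normZ e1 mulr1 ler_piMr ?(ltW r0)// ip1.
apply: (@near_equal _ _ (M * (s / (s - r))) (r / s) q01) => N N0.
pose T z : C := \sum_(j < N + k) a j * (r%:C * ip z e) ^+ j.
have sT : sbm T.
  apply: sbm_sum => j; apply: sbmZ; apply: sbmX; apply: sbmZ; exact: sbm_ip.
have kN : (k < N + k)%N by rewrite -[X in (X < _)%N]add0n ltn_add2r.
rewrite -(sum_hom_orth (fun=> 0) a r kN e1) -(cintB (sbmM mH (sbm_ip_cj e k)) (sbmM sT (sbm_ip_cj e k))).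
apply: cint_le => [|z z1]; first exact: sbmB (sbmM mH (sbm_ip_cj e k)) (sbmM sT (sbm_ip_cj e k)).
rewrite -mulrBl ncM; apply: (@le_trans _ _ (nc (ext f (r%:C *: (ip z e *: e)) - T z))).
  by rewrite ler_piMr ?nc_ge0// ncX nc_cj exprn_ile1 ?nc_ge0 ?ip1.
have wr : nc (r%:C * ip z e) <= r.
  by rewrite ncM nc_real ger0_norm ?(ltW r0)// ler_piMr ?(ltW r0)// ip1.
have := ha (N + k)%N (r%:C * ip z e) (le_lt_trans wr rs).
rewrite scalerA => h; apply: le_trans h _.
rewrite [leRHS]mulrAC; have /andP[q0 q1] := q01.
have sw : s - r <= s - nc (r%:C * ip z e) by rewrite lerD2l lerN2.
have sr : 0 < s - r by rewrite subr_gt0.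
apply: ler_pM.
- by rewrite mulr_ge0// exprn_ge0// divr_ge0 ?nc_ge0 ?ltW.
- by rewrite divr_ge0 ?ltW// (lt_le_trans sr).
- rewrite ler_wpM2l//; apply: (@le_trans _ _ ((r / s) ^+ (N + k))).
    by rewrite pow_div_le ?nc_ge0.
  by rewrite exprD ler_piMr ?exprn_ge0// exprn_ile1// ltW.
- by rewrite ler_pM2l// lef_pV2 ?posrE// (lt_le_trans sr).
Qed.

Lemma hom_dimE k : (hom_dim k)%:R * moment k = 1.
Proof. exact: moment_binom. Qed.

Lemma two_halfX k : (2 : C) ^+ k * (2^-1 : R)%:C ^+ k = 1.
Proof.
rewrite -exprMn (_ : (2 : C) = (2 : R)%:C); last by rewrite rmorph_nat.
by rewrite -real_complexM mulfV// rmorph1 expr1n.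
Qed.

(** The Taylor coefficients of the slice t -> f(t e) are the values [hc f k e]: at radius 1/2 the
    powers of 2 cancel, and [hom_dim k] times the moment is 1. *)
Lemma hc_taylor_unit f e : analytic f -> en e = 1 ->
  forall s M : R, 0 < s -> s < 1 -> (forall z : C, nc z = s -> nc (ext f (z *: e)) <= M) ->
  (forall k, nc (hc f k e) <= M / s ^+ k) /\
  forall N (w : C), nc w < s -> nc (ext f (w *: e) - \sum_(k < N) hc f k e * w ^+ k) <=
       M * (nc w / s) ^+ N * (s / (s - nc w)).
Proof.
move=> af e1.
have du t : nc t < 1 -> cdiff (fun t => ext f (t *: e)) t.
  by move=> t1; apply: analytic_slice0 => //; rewrite e1 mulr1.
have [a ha] := taylor_disc du ltr01.
have aE k : a k = hc f k e.
  rewrite /hc (@slice_rep f a e k)//; last by move=> s M s0 s1 hM N w ws; exact: (ha s M s0 s1 hM).2.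
  transitivity ((2 ^+ k * (2^-1 : R)%:C ^+ k) * ((hom_dim k)%:R * moment k) * a k); last by ring.
  by rewrite two_halfX hom_dimE !mul1r.
move=> s M s0 s1 hM; have [h1 h2] := ha s M s0 s1 hM.
split=> [k|N w ws]; first by rewrite -aE.
by under eq_bigr do rewrite -aE; exact: h2.
Qed.

Lemma hc_rep f e k (r : R) : analytic f -> en e = 1 -> 0 < r < 1 ->
  (hom_dim k)%:R * cint (fun z => ext f (r%:C *: z) * cj (ip z e) ^+ k) = r%:C ^+ k * hc f k e.
Proof.
move=> af e1 r01.
have h := @slice_rep f (fun k => hc f k e) e k r af e1 r01.
rewrite h; last first.
  by move=> s M s0 s1 hM N w ws; exact: (hc_taylor_unit af e1 s0 s1 hM).2.
transitivity (r%:C ^+ k * hc f k e * ((hom_dim k)%:R * moment k)); first by ring.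
by rewrite hom_dimE mulr1.
Qed.

Lemma unit_row z : exists2 e, en e = 1 & z = (en z)%:C *: e.
Proof.
have [->|z0] := eqVneq z 0.
  exists (delta_mx ord0 (Ordinal n0)); first exact: eucl_norm_delta.
  by rewrite eucl_norm0 scale0r.
have s0 : 0 < en z by rewrite lt_neqAle eucl_norm_ge0 andbT eq_sym eucl_norm_eq0.
exists ((en z)^-1%:C *: z).
  by rewrite eucl_normZr ?invr_ge0 ?eucl_norm_ge0// mulVf// gt_eqF.
by rewrite scalerA -real_complexM mulfV ?gt_eqF// scale1r.
Qed.

Lemma hc_taylor f (s M : R) : analytic f -> 0 < s -> s < 1 ->
  (forall z, en z <= s -> nc (ext f z) <= M) ->
  forall N z, en z < s -> nc (ext f z - \sum_(k < N) hc f k z) <=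
       M * (en z / s) ^+ N * (s / (s - en z)).
Proof.
move=> af s0 s1 hM N z zs; have [e e1 zE] := unit_row z.
have hM' (t : C) : nc t = s -> nc (ext f (t *: e)) <= M.
  by move=> ts; apply: hM; rewrite eucl_normZ e1 mulr1 ts.
have := (hc_taylor_unit af e1 s0 s1 hM').2 N (en z)%:C.
rewrite nc_real ger0_norm ?eucl_norm_ge0// => /(_ zs).
rewrite -zE; congr (nc (_ - _) <= _); apply: eq_bigr => k _.
by rewrite [in RHS]zE hc_hom// mulrC.
Qed.

Lemma dilation_taylor f (r : R) : analytic f -> 0 <= r < 1 -> exists K q : R,
  [/\ 0 <= K, 0 <= q < 1 & forall N z, en z <= 1 ->
    nc (ext f (r%:C *: z) - \sum_(k < N) r%:C ^+ k * hc f k z) <= K * q ^+ N].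
Proof.
move=> af /andP[r0 r1].
pose s := (1 + r) / 2; have s1 : s < 1 by rewrite /s; lra.
have rs : r < s by rewrite /s; lra.
have s0 : 0 < s by lra.
have [M M0 fM] := analytic_bounded af s1.
have sr : 0 < s - r by rewrite subr_gt0.
exists (M * (s / (s - r))), (r / s); split.
- by rewrite mulr_ge0// divr_ge0 ?ltW.
- by rewrite ltr_pdivrMr// mul1r rs andbT divr_ge0 ?(ltW s0).
move=> N z z1.
have rz : en (r%:C *: z) <= r by rewrite eucl_normZr// ler_piMr.
have := hc_taylor af s0 s1 fM N (le_lt_trans rz rs).
under eq_bigr do rewrite hc_hom//.
move=> h; apply: le_trans h _; rewrite [leRHS]mulrAC.
have sw : s - r <= s - en (r%:C *: z) by rewrite lerD2l lerN2.
apply: ler_pM.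
- by rewrite mulr_ge0// exprn_ge0// divr_ge0 ?eucl_norm_ge0 ?ltW.
- by rewrite divr_ge0 ?ltW// (lt_le_trans sr).
- by rewrite ler_wpM2l// pow_div_le ?eucl_norm_ge0.
- by rewrite ler_pM2l// lef_pV2 ?posrE// (lt_le_trans sr).
Qed.

Lemma hc_eq0 f : analytic f -> (forall k e, en e = 1 -> hc f k e = 0) -> f = 0.
Proof.
move=> af h; apply: zero_extP => z z1; rewrite zero_ext0.
have [e e1 zE] := unit_row z.
have r01 : 0 <= en z < 1 by rewrite eucl_norm_ge0.
have [K [q [K0 q01 hK]]] := dilation_taylor af r01.
apply: (@near_equal _ _ K q q01) => N N0; have := hK N e; rewrite e1 lexx -zE => /(_ isT).
by rewrite big1 ?subr0// => k _; rewrite h// mulr0.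
Qed.

Lemma nc_le_lin (x : C) (B : R) : (forall r : R, 0 < r -> r < 1 -> nc x <= B * r) -> x = 0.
Proof.
move=> h; apply: nc_le_eq0 => d d0.
have B0 : 0 < `|B| + d + 1 by rewrite -addrA ltr_wpDl// addr_gt0.
have r0 : 0 < d / (`|B| + d + 1) by rewrite divr_gt0.
have r1 : d / (`|B| + d + 1) < 1 by rewrite ltr_pdivrMr// mul1r; have := normr_ge0 B; lra.
apply: le_trans (h _ r0 r1) _; rewrite mulrA ler_pdivrMr// mulrC ler_pM2l//.
by have := ler_norm B; lra.
Qed.

(** On the sphere of radius r the reproducing formula bounds r^k |hc f k e| by a constant times r^N,
    and r^N is at most r^(k+1); then r tends to 0. *)
Lemma hc_low f (K : R) N k : analytic f -> (k < N)%N -> 0 <= K ->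
  (forall z, en z <= 2^-1 -> nc (ext f z) <= K * en z ^+ N) ->
  forall e, en e = 1 -> hc f k e = 0.
Proof.
move=> af kN K0 fK e e1; apply: (@nc_le_lin _ ((hom_dim k)%:R * K)) => d d0 d1.
apply: (@le_trans _ _ ((hom_dim k)%:R * K * (d / 2))); last first.
  by rewrite ler_wpM2l ?mulr_ge0//; lra.
have : 0 < d / 2 by lra. have : d / 2 <= 2^-1 by lra.
move: (d / 2) => r r2 r0 {d d0 d1}; have r1 : r < 1 by lra.
have r01 : 0 < r < 1 by rewrite r0.
have r01' : 0 <= r < 1 by rewrite ltW.
have rk : 0 < r ^+ k by rewrite exprn_gt0.
rewrite -(ler_pM2l rk).
have -> : r ^+ k * nc (hc f k e) = nc (r%:C ^+ k * hc f k e).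
  by rewrite ncM ncX nc_real ger0_norm ?ltW.
rewrite -(hc_rep k af e1 r01) ncM.
have -> : nc ((hom_dim k)%:R : C) = (hom_dim k)%:R.
  by rewrite (_ : (hom_dim k)%:R = ((hom_dim k)%:R : R)%:C) ?nc_real ?normr_nat//; rewrite rmorph_nat.
rewrite mulrCA -mulrA ler_wpM2l ?ler0n//.
apply: (cint_le (sbm_rep e k af r01')) => z z1.
have rz : en (r%:C *: z) = r by rewrite eucl_normZr ?(ltW r0)// z1 mulr1.
rewrite ncM ncX nc_cj; apply: (@le_trans _ _ (nc (ext f (r%:C *: z)))).
  rewrite ler_piMr ?nc_ge0// exprn_ile1 ?nc_ge0//.
  by have := cauchy_schwarz_ip z e; rewrite z1 e1 mulr1.
apply: le_trans (fK _ _) _; rewrite rz//.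
rewrite ler_wpM2l// -exprSr; apply: ler_wiXn2l => //; exact: ltW.
Qed.

End components.

(** * Limits as the radius tends to 1 *)

Section left_limit.
Implicit Types (F G : R -> C) (l : C).

Definition left_lim F l := forall e : R, 0 < e ->
  exists2 r0 : R, 0 <= r0 < 1 & forall r : R, r0 < r -> r < 1 -> nc (F r - l) <= e.

Lemma left_lim_cst l : left_lim (fun=> l) l.
Proof. by move=> e e0; exists 0; rewrite ?lexx ?ltr01// => r _ _; rewrite subrr nc0 ltW. Qed.

Lemma left_lim_near2 F G l l' (P : R -> Prop) (e e' : R) : left_lim F l -> left_lim G l' ->
  0 < e -> 0 < e' ->
  exists2 r0 : R, 0 <= r0 < 1 & forall r : R, r0 < r -> r < 1 -> nc (F r - l) <= e /\ nc (G r - l') <= e'.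
Proof.
move=> cF cG e0 e'0; have [a /andP[a0 a1] ha] := cF _ e0; have [b /andP[b0 b1] hb] := cG _ e'0.
exists (Num.max a b); first by rewrite le_max a0 gt_max a1.
by move=> r; rewrite gt_max => /andP[ar br] r1; split; [exact: ha|exact: hb].
Qed.

Lemma left_limD F G l l' : left_lim F l -> left_lim G l' -> left_lim (fun r => F r + G r) (l + l').
Proof.
move=> cF cG e e0; have e2 : 0 < e / 2 by rewrite divr_gt0.
have [r0 r01 h] := left_lim_near2 (fun=> True) cF cG e2 e2.
exists r0 => // r rr r1; have [h1 h2] := h r rr r1.
by rewrite opprD addrACA; apply: le_trans (ncD _ _) _; lra.
Qed.

Lemma left_limZ (c : C) F l : left_lim F l -> left_lim (fun r => c * F r) (c * l).
Proof.
move=> cF e e0; have c0 : 0 < nc c + 1 by rewrite ltr_wpDl ?nc_ge0.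
have [r0 r01 h] := cF _ (divr_gt0 e0 c0).
exists r0 => // r rr r1; rewrite -mulrBr ncM.
apply: (@le_trans _ _ (nc c * (e / (nc c + 1)))); first by rewrite ler_wpM2l ?nc_ge0 ?h.
by rewrite mulrCA ler_piMr ?(ltW e0)// ler_pdivrMr// mul1r lerDl.
Qed.

Lemma left_lim_cj F l : left_lim F l -> left_lim (fun r => cj (F r)) (cj l).
Proof.
move=> cF e e0; have [r0 r01 h] := cF _ e0.
by exists r0 => // r rr r1; rewrite -cjB nc_cj h.
Qed.

Lemma left_lim_uniq F l l' : left_lim F l -> left_lim F l' -> l = l'.
Proof.
move=> h h'; apply/eqP; rewrite -subr_eq0; apply/eqP/nc_le_eq0 => e e0.
have e2 : 0 < e / 2 by rewrite divr_gt0.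
have [r0 /andP[r00 r01] hr] := left_lim_near2 (fun=> True) h h' e2 e2.
have [h1 h2] := hr ((r0 + 1) / 2) ltac:(lra) ltac:(lra).
have -> : l - l' = (F ((r0 + 1) / 2) - l') - (F ((r0 + 1) / 2) - l) by ring.
by apply: le_trans (ncB _ _) _; lra.
Qed.

Lemma left_lim_le F l (B : R) : left_lim F l -> (forall r, 0 < r -> r < 1 -> nc (F r) <= B) -> nc l <= B.
Proof.
move=> cF FB; apply/ler_addgt0Pr => e e0; have [r0 /andP[r00 r01] h] := cF _ e0.
have := h ((r0 + 1) / 2) ltac:(lra) ltac:(lra); have := FB ((r0 + 1) / 2) ltac:(lra) ltac:(lra).
move=> h1 h2; rewrite -[l](subrK (F ((r0 + 1) / 2))).
by apply: le_trans (ncD _ _) _; rewrite ncBC; lra.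
Qed.

Lemma eq_left_lim F G l : (forall r, 0 < r -> r < 1 -> F r = G r) -> left_lim F l -> left_lim G l.
Proof.
move=> FG cF e e0; have [r0 /andP[r00 r01] h] := cF _ e0.
by exists r0; [rewrite r00|move=> r rr r1; rewrite -FG ?h//; exact: le_lt_trans rr].
Qed.

Lemma le_geo (x y K q : R) : 0 <= q < 1 -> (forall N, x <= y + K * q ^+ N) -> x <= y.
Proof.
move=> /andP[q0 q1] h; apply/ler_addgt0Pr => e e0.
have K0 : 0 < `|K| + 1 by rewrite ltr_wpDl.
have [N hN] := geo_small q0 q1 (divr_gt0 e0 K0).
apply: le_trans (h N) _; rewrite lerD2l.
have := hN N (leqnn _); rewrite ltr_pdivlMr// => /ltW; apply: le_trans.
by rewrite mulrC ler_wpM2l ?exprn_ge0// (le_trans (ler_norm K))// lerDl.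
Qed.

(** Take t = -s conj(c) with s = 1 / b, or with s large if b = 0. The case a = 0, where c must
    vanish, is the form in which first variations are exploited later. *)
Lemma cs_quadratic (a b : R) (c : C) : 0 <= a -> 0 <= b ->
  (forall t : C, 0 <= a + 2 * complex.Re (t * c) + nc t ^+ 2 * b) -> nc c ^+ 2 <= a * b.
Proof.
move=> a0 b0 h.
have E (s : R) : 0 <= a - 2 * s * nc c ^+ 2 + s ^+ 2 * nc c ^+ 2 * b.
  have := h (- s%:C * cj c).
  have -> : - s%:C * cj c * c = (- (s * nc c ^+ 2))%:C.
    rewrite -mulrA (mulrC (cj c)) mulcJ mulNr -real_complexM; exact/esym/rmorphN.
  rewrite ncM ncN nc_real nc_cj exprMn real_normK ?num_real//= => E.
  by apply: le_trans E _; rewrite le_eqVlt; apply/orP; left; apply/eqP; ring.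
have [bz|bn] := eqVneq b 0.
  rewrite bz mulr0; rewrite leNgt; apply/negP => cp.
  have := E ((a + 1) / (2 * nc c ^+ 2)); rewrite bz mulr0 addr0.
  have -> : 2 * ((a + 1) / (2 * nc c ^+ 2)) * nc c ^+ 2 = a + 1.
    by field; move: cp; rewrite exprn_even_gt0//= => /negbTE ->.
  lra.
have bp : 0 < b by rewrite lt_neqAle eq_sym bn.
have := E b^-1.
have -> : a - 2 * b^-1 * nc c ^+ 2 + b^-1 ^+ 2 * nc c ^+ 2 * b = (a * b - nc c ^+ 2) / b.
  by field.
by rewrite pmulr_lge0 ?invr_gt0// subr_ge0.
Qed.

Lemma sum_range_split (F : nat -> R) N M : (N <= M)%N ->
  \sum_(0 <= k < M) F k = \sum_(0 <= k < N) F k + \sum_(N <= k < M) F k.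
Proof. by move=> NM; rewrite (big_cat_nat _ (n := N)). Qed.

Lemma bernoulli_pow (d : R) m : 0 <= d <= 1 -> 1 - m%:R * d <= (1 - d) ^+ m.
Proof.
move=> /andP[d0 d1]; elim: m => [|m ih]; first by rewrite mul0r subr0 expr0.
rewrite exprS; apply: (@le_trans _ _ ((1 - d) * (1 - m%:R * d))); last by rewrite ler_wpM2l// subr_ge0.
rewrite -natr1; have : 0 <= m%:R * (d * d) by rewrite mulr_ge0// mulr_ge0.
lra.
Qed.

End left_limit.

Section cint_form.
Implicit Types (F G : Cn -> C).

Lemma ge0C (x : C) : 0 <= x -> x = (Re x)%:C /\ 0 <= Re x.
Proof. by rewrite lecE /= => /andP[/eqP h1 h2]; split=> //; case: x h1 {h2} => a b /= ->. Qed.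

Lemma mulcJ_ge0 (x : C) : 0 <= x * cj x.
Proof. by rewrite mulcJ lecR sqr_ge0. Qed.

Lemma cint_sqr F : sbm F ->
  cint (fun z => F z * cj (F z)) = (Re (cint (fun z => F z * cj (F z))))%:C /\
  0 <= Re (cint (fun z => F z * cj (F z))).
Proof.
move=> sF; apply: ge0C; apply: cint_ge0; first exact: (sbmM sF (sbm_cj sF)).1.
by move=> z _; exact: mulcJ_ge0.
Qed.

Lemma cint_CS F G : sbm F -> sbm G ->
  nc (cint (fun z => F z * cj (G z))) ^+ 2 <=
  Re (cint (fun z => F z * cj (F z))) * Re (cint (fun z => G z * cj (G z))).
Proof.
move=> sF sG; apply: cs_quadratic; [exact: (cint_sqr sF).2|exact: (cint_sqr sG).2|move=> t].
pose H z := F z + cj t * G z.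
have sH : sbm H := sbmD sF (sbmZ (cj t) sG).
have := (cint_sqr sH).2.
have FF := sbmM sF (sbm_cj sF); have FG := sbmM sF (sbm_cj sG).
have GF := sbmM sG (sbm_cj sF); have GG := sbmM sG (sbm_cj sG).
have -> : cint (fun z => H z * cj (H z)) = cint (fun z => F z * cj (F z)) +
  (t * cint (fun z => F z * cj (G z)) + (cj t * cint (fun z => G z * cj (F z)) +
   (t * cj t) * cint (fun z => G z * cj (G z)))).
  rewrite -(cintZ t FG) -(cintZ (cj t) GF) -(cintZ (t * cj t) GG).
  rewrite -(cintD (sbmZ _ GF) (sbmZ _ GG)) -(cintD (sbmZ _ FG) (sbmD (sbmZ _ GF) (sbmZ _ GG))).
  rewrite -(cintD FF (sbmD (sbmZ _ FG) (sbmD (sbmZ _ GF) (sbmZ _ GG)))).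
  by congr cint; apply/funext => z; rewrite /H cjD cjM cjK; ring.
have -> : cint (fun z => G z * cj (F z)) = cj (cint (fun z => F z * cj (G z))).
  by rewrite -(cint_cj FG); congr cint; apply/funext => z; rewrite cjM cjK mulrC.
rewrite -cjM mulcJ !cReD cRe_cj cReM /= mul0r subr0.
by rewrite (_ : forall a b c : R, a + (b + (b + c)) = a + 2 * b + c)// => a b c; ring.
Qed.

End cint_form.

(** * Norm and inner product of the Hardy space *)

Section h2.
Implicit Types (z w e : Cn) (f g h phi : Bn -> C).

Definition Ir f g (r : R) : C :=
  cint (fun z => ext f (r%:C *: z) * cj (ext g (r%:C *: z))).
Definition cdot k f g : C := cint (fun z => hc f k z * cj (hc g k z)).
Definition dsq k f : R := Re (cdot k f f).
Definition J f r : R := Re (Ir f f r).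

Lemma cdot_ff k f : analytic f -> cdot k f f = (dsq k f)%:C /\ 0 <= dsq k f.
Proof. by move=> af; exact: (cint_sqr (sbm_hc k af)). Qed.

Lemma Ir_ff f r : analytic f -> 0 <= r < 1 -> Ir f f r = (J f r)%:C /\ 0 <= J f r.
Proof. by move=> af r01; exact: (cint_sqr (sbm_dilation af r01)). Qed.

Lemma sum_orth (A B : nat -> Cn -> C) N M :
  (forall k, sbm (A k)) -> (forall k, sbm (B k)) ->
  (forall k (v : C) z, A k (v *: z) = v ^+ k * A k z) ->
  (forall k (v : C) z, B k (v *: z) = v ^+ k * B k z) ->
  cint (fun z => (\sum_(N <= k < M) A k z) * cj (\sum_(N <= k < M) B k z)) =
  \sum_(N <= k < M) cint (fun z => A k z * cj (B k z)).
Proof.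
move=> sA sB hA hB; rewrite (_ : (fun z => _) = (fun z => \sum_(N <= k < M)
    \sum_(N <= j < M) A k z * cj (B j z))); last first.
  by apply/funext => z; rewrite mulr_suml; apply: eq_bigr => k _; rewrite cj_sum mulr_sumr.
have sAB k j : sbm (fun z => A k z * cj (B j z)) := sbmM (sA k) (sbm_cj (sB j)).
rewrite (cint_sum); last by move=> k; apply: sbm_sum => j; exact: sAB.
rewrite [LHS]big_nat [RHS]big_nat; apply: eq_bigr => k kr.
rewrite (cint_sum); last by move=> j; exact: sAB.
rewrite (bigD1_seq k) ?mem_index_iota ?iota_uniq//= big1 ?addr0// => j jk.
by rewrite (cint_orth_deg _ (sA k) (sB j) (hA k) (hB j))// eq_sym.
Qed.

Lemma sbm_rhc f k (r : R) : analytic f -> sbm (fun z => r%:C ^+ k * hc f k z).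
Proof. by move=> af; exact: sbmZ (sbm_hc k af). Qed.

Lemma rhc_hom f k (r : R) (v : C) z : analytic f ->
  r%:C ^+ k * hc f k (v *: z) = v ^+ k * (r%:C ^+ k * hc f k z).
Proof. by move=> af; rewrite (hc_hom)// mulrCA. Qed.

Lemma sum_rhc f g (r : R) N M : analytic f -> analytic g ->
  cint (fun z => (\sum_(N <= k < M) r%:C ^+ k * hc f k z) *
             cj (\sum_(N <= k < M) r%:C ^+ k * hc g k z)) =
  \sum_(N <= k < M) (r ^+ (2 * k))%:C * cdot k f g.
Proof.
move=> af ag; rewrite (sum_orth N M (fun k => sbm_rhc k r af) (fun k => sbm_rhc k r ag)
  (fun k v z => rhc_hom k r v z af) (fun k v z => rhc_hom k r v z ag)).
apply: eq_bigr => k _.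
rewrite /cdot -(cintZ _ (sbmM (sbm_hc k af) (sbm_cj (sbm_hc k ag)))).
congr cint; apply/funext => z; rewrite cjM cjX cj_real mulnC exprM real_complexX real_complexX; ring.
Qed.

(** Parseval's formula at a radius r < 1: both dilations are uniformly close to their Taylor
    polynomials, and components of distinct degrees are orthogonal. *)
Lemma Ir_series f g r : analytic f -> analytic g -> 0 <= r < 1 -> exists K q : R,
  [/\ 0 <= K, 0 <= q < 1 & forall N,
   nc (Ir f g r - \sum_(0 <= k < N) (r ^+ (2 * k))%:C * cdot k f g) <= K * q ^+ N].
Proof.
move=> af ag r01; have /andP[r0 r1] := r01.
have [K1 [q1 [K10 /andP[q10 q11] h1]]] := dilation_taylor af r01.
have [K2 [q2 [K20 /andP[q20 q21] h2]]] := dilation_taylor ag r01.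
have [M1 M10 f1] := analytic_bounded af r1.
have [M2 M20 g2] := analytic_bounded ag r1.
pose q := Num.max q1 q2.
have q1q : q1 <= q by rewrite le_max lexx.
have q2q : q2 <= q by rewrite le_max lexx orbT.
exists (K1 * M2 + (M1 + K1) * K2), q; split.
- by rewrite addr_ge0// mulr_ge0// addr_ge0.
- by rewrite le_max q10 gt_max q11.
move=> N; rewrite -sum_rhc//.
pose A z := \sum_(0 <= k < N) r%:C ^+ k * hc f k z.
pose B z := \sum_(0 <= k < N) r%:C ^+ k * hc g k z.
have sA : sbm A by apply: sbm_sum => k; exact: sbm_rhc.
have sB : sbm B by apply: sbm_sum => k; exact: sbm_rhc.
have sf := sbm_dilation af r01; have sg := sbm_dilation ag r01.
rewrite -(cintB (sbmM sf (sbm_cj sg)) (sbmM sA (sbm_cj sB))).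
apply: (cint_le (sbmB (sbmM sf (sbm_cj sg)) (sbmM sA (sbm_cj sB)))) => z z1.
set F := ext f _; set G := ext g _.
have rz : en (r%:C *: z) <= r by rewrite eucl_normZr// z1 mulr1.
have FA : nc (F - A z) <= K1 * q1 ^+ N by rewrite /A big_mkord; apply: h1; rewrite z1.
have GB : nc (G - B z) <= K2 * q2 ^+ N by rewrite /B big_mkord; apply: h2; rewrite z1.
have Fb : nc F <= M1 := f1 _ rz. have Gb : nc G <= M2 := g2 _ rz.
have -> : F * cj G - A z * cj (B z) = (F - A z) * cj G + A z * cj (G - B z).
  by rewrite cjB; ring.
have q1N : q1 ^+ N <= q ^+ N by rewrite lerXn2r// nnegrE// (le_trans q10).
have q2N : q2 ^+ N <= q ^+ N by rewrite lerXn2r// nnegrE// (le_trans q10).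
have q1N0 : q1 ^+ N <= 1 by rewrite exprn_ile1// ltW.
have Ab : nc (A z) <= M1 + K1.
  have -> : A z = F - (F - A z) by ring.
  by apply: le_trans (ncB _ _) _; rewrite lerD// (le_trans FA)// ler_piMr.
apply: le_trans (ncD _ _) _; rewrite !ncM !nc_cj [leRHS]mulrDl; apply: lerD.
  rewrite mulrAC; apply: ler_pM => //; rewrite ?nc_ge0//.
  by apply: le_trans FA _; rewrite ler_wpM2l.
rewrite -mulrA; apply: ler_pM => //; rewrite ?nc_ge0//.
by apply: le_trans GB _; rewrite ler_wpM2l.
Qed.

Lemma Re_sum_real (N M : nat) (a b : nat -> R) :
  Re (\sum_(N <= k < M) (a k)%:C * (b k)%:C) = \sum_(N <= k < M) a k * b k.
Proof.
under eq_bigr do rewrite -real_complexM.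
by rewrite -(rmorph_sum (real_complex R)).
Qed.

Lemma J_series f r : analytic f -> 0 <= r < 1 -> exists K q : R,
  [/\ 0 <= K, 0 <= q < 1 & forall N,
   `|J f r - \sum_(0 <= k < N) r ^+ (2 * k) * dsq k f| <= K * q ^+ N].
Proof.
move=> af r01; have [K [q [K0 q01 h]]] := Ir_series af af r01.
exists K, q; split=> // N; apply: le_trans (h N); apply: le_trans (nc_Re _).
have -> : \sum_(0 <= k < N) (r ^+ (2 * k))%:C * cdot k f f = \sum_(0 <= k < N) (r ^+ (2 * k))%:C * (dsq k f)%:C.
  by apply: eq_bigr => k _; rewrite (cdot_ff k af).1.
by rewrite cReD cReN Re_sum_real.
Qed.

Lemma dsq_partial f N M : analytic f -> (N <= M)%N -> forall r, 0 <= r ->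
  \sum_(0 <= k < N) r ^+ (2 * k) * dsq k f <= \sum_(0 <= k < M) r ^+ (2 * k) * dsq k f.
Proof.
move=> af NM r r0; rewrite (sum_range_split _ NM) lerDl sumr_ge0// => k _.
by rewrite mulr_ge0 ?exprn_ge0// (cdot_ff _ af).2.
Qed.

Lemma J_partial f r N : analytic f -> 0 <= r < 1 ->
  \sum_(0 <= k < N) r ^+ (2 * k) * dsq k f <= J f r.
Proof.
move=> af r01; have /andP[r0 r1] := r01.
have [K [q [K0 q01 h]]] := J_series af r01.
have /andP[q0 q1] := q01.
apply: (@le_geo _ _ K q q01) => M.
apply: le_trans (dsq_partial af (leq_addr M N) r0) _.
have := h (N + M)%N; rewrite ler_distlC => /andP[_] h1.
rewrite -lerBlDr; apply: le_trans _ (_ : J f r + K * q ^+ (N + M) - K * q ^+ M <= _).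
  by rewrite lerD2r; move: (h (N + M)%N); rewrite ler_distl => /andP[]; lra.
rewrite -addrA gerDl subr_le0 ler_wpM2l// exprD ler_piMl ?exprn_ge0//.
by rewrite exprn_ile1// ltW.
Qed.

(** The means are series in r^(2k) with nonnegative coefficients. This is what turns the supremum in
    the Hardy norm into a limit. *)
Lemma J_mono f r s : analytic f -> 0 <= r -> r <= s -> s < 1 -> J f r <= J f s.
Proof.
move=> af r0 rs s1; have r01 : 0 <= r < 1 by rewrite r0 (le_lt_trans rs).
have s01 : 0 <= s < 1 by rewrite (le_trans r0 rs).
have [K [q [K0 q01 h]]] := J_series af r01.
apply: (@le_geo _ _ K q q01) => N.
have := h N; rewrite ler_distl => /andP[_] hN; apply: le_trans hN _; rewrite lerD2r.
apply: le_trans (J_partial N af s01); apply: ler_sum => k _.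
by rewrite ler_wpM2r ?(cdot_ff _ af).2// lerXn2r ?nnegrE// (le_trans r0).
Qed.

Lemma JE f r : analytic f -> 0 <= r < 1 ->
  (\int[sigma]_z (nc (ext f (r%:C *: z)) ^+ 2)%:E)%E = (J f r)%:E.
Proof.
move=> af r01; have sf := sbm_dilation af r01.
have E : (fun z : Cn => Re (ext f (r%:C *: z) * cj (ext f (r%:C *: z)))) =
    (fun z : Cn => nc (ext f (r%:C *: z)) ^+ 2).
  by apply/funext => z; rewrite mulcJ.
have [iR _] := sbm_cintegrable (sbmM sf (sbm_cj sf)).
rewrite /J /Ir /cint /= E /Rintegral fineK//.
apply: integrable_fin_num => //; move: iR; rewrite /comp.
by under eq_fun do rewrite mulcJ /=.
Qed.

Lemma hardyE f : analytic f -> hardy_sqnorm f = ereal_sup [set (J f r)%:E | r in [set r | 0 < r < 1]].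
Proof.
move=> af; rewrite /hardy_sqnorm; congr ereal_sup; apply/seteqP; split => _ [r /= /andP[r0 r1] <-];
  by exists r; rewrite /= ?r0 ?r1// JE// ltW.
Qed.

Lemma H2_intro f (B : R) : analytic f -> (forall r, 0 < r -> r < 1 -> J f r <= B) -> H2 f.
Proof.
move=> af JB; split=> //; rewrite hardyE//; apply: (@le_lt_trans _ _ B%:E); last exact: ltry.
by apply: ge_ereal_sup => _ [r /= /andP[r0 r1] <-]; rewrite lee_fin JB.
Qed.

Lemma H2_an f : H2 f -> analytic f. Proof. by case. Qed.

Lemma hardy_fin f : H2 f -> hardy_sqnorm f = (H2norm f ^+ 2)%:E.
Proof.
move=> [af foo].
have h0 : (0 <= hardy_sqnorm f)%E.
  have h1 : 0 <= (2^-1 : R) < 1 by rewrite invr_ge0 ler0n/= invf_lt1// ltr1n.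
  rewrite hardyE//; apply: le_trans (_ : (J f 2^-1)%:E <= _)%E.
    by rewrite lee_fin (Ir_ff af h1).2.
  by apply: ereal_sup_ubound; exists 2^-1 => //=; rewrite invr_gt0 ltr0n/= invf_lt1// ltr1n.
rewrite /H2norm sqr_sqrtr ?fine_ge0//.
by rewrite fineK// ge0_fin_numE.
Qed.

Lemma H2norm_ge0 f : 0 <= H2norm f. Proof. exact: sqrtr_ge0. Qed.

Lemma J_le f r : H2 f -> 0 <= r < 1 -> J f r <= H2norm f ^+ 2.
Proof.
move=> hf /andP[r0 r1]; have af := H2_an hf.
apply: (@le_trans _ _ (J f ((1 + r) / 2))); first by apply: J_mono => //; lra.
rewrite -lee_fin -hardy_fin// hardyE//; apply: ereal_sup_ubound.
by exists ((1 + r) / 2) => //=; apply/andP; split; lra.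
Qed.

Lemma H2norm_sqr_le f (B : R) : H2 f -> (forall r, 0 < r -> r < 1 -> J f r <= B) ->
  H2norm f ^+ 2 <= B.
Proof.
move=> hf JB; rewrite -lee_fin -hardy_fin// (hardyE (H2_an hf)).
by apply: ge_ereal_sup => _ [r /= /andP[r0 r1] <-]; rewrite lee_fin JB.
Qed.

Lemma J_near f (e : R) : H2 f -> 0 < e -> exists2 r0 : R, 0 <= r0 < 1 &
  forall r, r0 <= r -> r < 1 -> H2norm f ^+ 2 - e < J f r.
Proof.
move=> hf e0; have af := H2_an hf; apply: contrapT => hn.
have : H2norm f ^+ 2 <= H2norm f ^+ 2 - e.
  apply: H2norm_sqr_le => // r r0 r1; rewrite leNgt; apply/negP => hr; apply: hn.
  exists r; first by rewrite ltW.
  by move=> s rs s1; apply: lt_le_trans hr _; apply: J_mono => //; exact: ltW.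
by rewrite lerBrDr gerDl leNgt e0.
Qed.

Lemma J_lim f : H2 f -> left_lim (fun r => Ir f f r) (H2norm f ^+ 2)%:C.
Proof.
move=> hf e e0; have [r0 r01 h] := J_near hf e0.
have /andP[r00 _] := r01.
exists r0 => // r rr r1; have r01' : 0 <= r < 1 by rewrite (le_trans r00 (ltW rr)).
rewrite (Ir_ff (H2_an hf) r01').1 -real_complexB nc_real ler_distlC.
have := h r (ltW rr) r1; have := J_le hf r01'.
by move=> h1 h2; apply/andP; split; lra.
Qed.

Section forms.
Variable r : R.
Hypothesis r01 : 0 <= r < 1.

Lemma IrDl f g h : analytic f -> analytic g -> analytic h -> Ir (f + g) h r = Ir f h r + Ir g h r.
Proof.
move=> af ag ah; have [[sf sg] sh] := (sbm_dilation af r01, sbm_dilation ag r01, sbm_cj (sbm_dilation ah r01)).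
rewrite /Ir -(cintD (sbmM sf sh) (sbmM sg sh)).
by congr cint; apply/funext => z; rewrite zero_extD mulrDl.
Qed.

Lemma IrZl (a : C) f h : analytic f -> analytic h -> Ir (a *: f) h r = a * Ir f h r.
Proof.
move=> af ah; have [sf sh] := (sbm_dilation af r01, sbm_cj (sbm_dilation ah r01)).
rewrite /Ir -(cintZ a (sbmM sf sh)).
by congr cint; apply/funext => z; rewrite zero_extZ mulrA.
Qed.

Lemma Ir_cj f g : analytic f -> analytic g -> cj (Ir f g r) = Ir g f r.
Proof.
move=> af ag; have [sf sg] := (sbm_dilation af r01, sbm_cj (sbm_dilation ag r01)).
by rewrite /Ir -(cint_cj (sbmM sf sg)); congr cint; apply/funext => z; rewrite cjM cjK mulrC.
Qed.

Lemma Ir_quad f g (c : C) : analytic f -> analytic g -> Ir (f + c *: g) (f + c *: g) r =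
  Ir f f r + c * Ir g f r + cj c * Ir f g r + c * cj c * Ir g g r.
Proof.
move=> af ag; have acg := analyticZ c ag; have afg := analyticD af acg.
rewrite IrDl// IrZl// -(Ir_cj afg af) -(Ir_cj afg ag) IrDl// IrZl// IrDl// IrZl//.
by rewrite !cjD !cjM !Ir_cj//; ring.
Qed.

End forms.

Lemma parallelogram_bound (x y a b A B c : R) : x + y = 2 * a + 2 * c * b -> 0 <= y ->
  a <= A -> b <= B -> 0 <= c -> x <= 2 * A + 2 * c * B.
Proof. by move=> E y0 aA bB c0; have := ler_wpM2l c0 bB; lra. Qed.

(** The parallelogram law holds for the forms at each radius and bounds the mean of f + c g by those
    of f and g, uniformly in r. *)
Lemma H2_lin f g (c : C) : H2 f -> H2 g -> H2 (f + c *: g).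
Proof.
move=> hf hg; have [af ag] := (H2_an hf, H2_an hg).
apply: (@H2_intro _ (2 * H2norm f ^+ 2 + 2 * nc c ^+ 2 * H2norm g ^+ 2)).
  by apply: analyticD => //; exact: analyticZ.
move=> r r0 r1; have r01 : 0 <= r < 1 by rewrite ltW.
have h1 := Ir_quad r01 c af ag; have h2 := Ir_quad r01 (- c) af ag.
have ap := analyticD af (analyticZ c ag); have am := analyticD af (analyticZ (- c) ag).
have [e1 p1] := Ir_ff ap r01; have [e2 p2] := Ir_ff am r01.
have [ef pf] := Ir_ff af r01; have [eg pg] := Ir_ff ag r01.
have : (J (f + c *: g) r + J (f + - c *: g) r)%:C = (2 * J f r + 2 * nc c ^+ 2 * J g r)%:C.
  rewrite real_complexD -e1 -e2 h1 h2 real_complexD real_complexM -ef.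
  rewrite (real_complexM (2 * nc c ^+ 2)) -eg (real_complexM 2) -mulcJ cjN.
  rewrite (_ : (2 : R)%:C = 2); last exact: rmorph_nat.
  ring.
move=> /(congr1 Re) /= E.
have := J_le hf r01; have := J_le hg r01; have : 0 <= nc c ^+ 2 := sqr_ge0 _.
by move=> c0 Jg Jf; exact: parallelogram_bound E p2 Jf Jg c0.
Qed.

Lemma H2_cst0 : H2 (0 : Bn -> C).
Proof.
apply: (@H2_intro _ 0); first exact: analytic0.
move=> r r0 r1; rewrite /J /Ir (_ : (fun z => _) = (fun _ : Cn => (0 : C))) ?cint_cst//.
by apply/funext => z; rewrite zero_ext0 mul0r.
Qed.

Lemma H2Z (c : C) f : H2 f -> H2 (c *: f).
Proof. by move=> hf; rewrite -[_ *: _]add0r; apply: H2_lin => //; exact: H2_cst0. Qed.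
Lemma H2D f g : H2 f -> H2 g -> H2 (f + g).
Proof. by move=> hf hg; rewrite -[g]scale1r; exact: H2_lin. Qed.
Lemma H2B f g : H2 f -> H2 g -> H2 (f - g).
Proof. by move=> hf hg; rewrite -scaleN1r; exact: H2_lin. Qed.

(** Polarization is an exact identity for the sesquilinear forms [Ir] at each r < 1. In the limit it
    shows that the four norms in [H2dot] combine to the limit of [Ir f g], from which all its
    algebraic properties are inherited. *)
Lemma H2dot_lim f g : H2 f -> H2 g -> left_lim (fun r => Ir f g r) (H2dot f g).
Proof.
move=> hf hg; have [af ag] := (H2_an hf, H2_an hg).
pose ii : C := 'i.
pose T (k : nat) : C := ii ^+ k * (H2norm (f + ii ^+ k *: g) ^+ 2)%:C.
have sum4 (U : nat -> C) : \sum_(k < 4) U k = U 0%N + (U 1%N + (U 2%N + U 3%N)).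
  by rewrite !big_ord_recl big_ord0 addr0.
have -> : H2dot f g = 4^-1 * (T 0%N + (T 1%N + (T 2%N + T 3%N))) by rewrite -sum4.
have ii2 : ii * ii = -1 by rewrite -expr2 sqr_i.
have ii3 x : x * ii * ii = - x by rewrite -mulrA ii2 mulrN1.
have cii : cj ii = - ii by rewrite /ii /cj; simpc.
have L k := left_limZ (ii ^+ k) (J_lim (H2_lin (ii ^+ k) hf hg)).
have LL := left_limZ 4^-1 (left_limD (L 0%N) (left_limD (L 1%N) (left_limD (L 2%N) (L 3%N)))).
apply: eq_left_lim LL => r r0 r1.
have r01 : 0 <= r < 1 by rewrite ltW.
rewrite !Ir_quad// !cjX cii.
set a := Ir f f r; set b := Ir g f r; set c := Ir f g r; set d := Ir g g r.
rewrite !exprS !expr0 !mulr1.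
have -> : ii * (ii * ii) = - ii by rewrite ii2 mulrN1.
rewrite !(mulrDr, mulrA, mulNr, mulrN, opprK, ii2, ii3, mul1r, mulr1).
by field.
Qed.

End h2.

Opaque H2dot H2norm.

(** * Hilbert space structure, multipliers and tails *)

Section h2_theory.
Implicit Types (z w e : Cn) (f g h phi : Bn -> C).

Lemma r_01 (r : R) : 0 < r -> r < 1 -> 0 <= r < 1.
Proof. by move=> r0 ->; rewrite ltW. Qed.

Lemma dotDl f g h : H2 f -> H2 g -> H2 h -> H2dot (f + g) h = H2dot f h + H2dot g h.
Proof.
move=> hf hg hh; apply: (left_lim_uniq (H2dot_lim (H2D hf hg) hh)).
apply: eq_left_lim (left_limD (H2dot_lim hf hh) (H2dot_lim hg hh)) => r r0 r1.
by rewrite (IrDl (r_01 r0 r1) (H2_an hf) (H2_an hg) (H2_an hh)).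
Qed.

Lemma dotZl (a : C) f h : H2 f -> H2 h -> H2dot (a *: f) h = a * H2dot f h.
Proof.
move=> hf hh; apply: (left_lim_uniq (H2dot_lim (H2Z a hf) hh)).
apply: eq_left_lim (left_limZ a (H2dot_lim hf hh)) => r r0 r1.
by rewrite (IrZl (r_01 r0 r1) a (H2_an hf) (H2_an hh)).
Qed.

Lemma dot_cj f g : H2 f -> H2 g -> cj (H2dot f g) = H2dot g f.
Proof.
move=> hf hg; apply: (left_lim_uniq _ (H2dot_lim hg hf)).
apply: eq_left_lim (left_lim_cj (H2dot_lim hf hg)) => r r0 r1.
by rewrite (Ir_cj (r_01 r0 r1) (H2_an hf) (H2_an hg)).
Qed.

Lemma dotDr f g h : H2 f -> H2 g -> H2 h -> H2dot h (f + g) = H2dot h f + H2dot h g.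
Proof.
move=> hf hg hh; rewrite -(dot_cj (H2D hf hg) hh) dotDl// cjD.
exact: (congr2 +%R (dot_cj hf hh) (dot_cj hg hh)).
Qed.

Lemma dotZr (a : C) f h : H2 f -> H2 h -> H2dot h (a *: f) = cj a * H2dot h f.
Proof.
move=> hf hh; rewrite -(dot_cj (H2Z a hf) hh) dotZl// cjM.
by rewrite dot_cj.
Qed.

Lemma dotBl f g h : H2 f -> H2 g -> H2 h -> H2dot (f - g) h = H2dot f h - H2dot g h.
Proof.
by move=> hf hg hh; rewrite -scaleN1r (dotDl hf (H2Z _ hg) hh) dotZl// mulN1r.
Qed.

Lemma dotBr f g h : H2 f -> H2 g -> H2 h -> H2dot h (f - g) = H2dot h f - H2dot h g.
Proof.
by move=> hf hg hh; rewrite -scaleN1r (dotDr hf (H2Z _ hg) hh) dotZr// cjN cj1 mulN1r.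
Qed.

Lemma H2_sum (I : Type) (s : seq I) (F : I -> Bn -> C) : (forall i, H2 (F i)) ->
  H2 (\sum_(i <- s) F i).
Proof.
move=> hF; elim: s => [|i s ih]; rewrite ?big_nil ?big_cons; first exact: H2_cst0.
exact: H2D.
Qed.

Lemma dot0l h : H2 h -> H2dot 0 h = 0.
Proof. by move=> hh; rewrite -(scale0r (0 : Bn -> C)) dotZl ?mul0r//; exact: H2_cst0. Qed.

Lemma dot0r h : H2 h -> H2dot h 0 = 0.
Proof. by move=> hh; rewrite -dot_cj ?dot0l ?cj0//; exact: H2_cst0. Qed.

Lemma dot_suml (I : Type) (s : seq I) (F : I -> Bn -> C) h : (forall i, H2 (F i)) -> H2 h ->
  H2dot (\sum_(i <- s) F i) h = \sum_(i <- s) H2dot (F i) h.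
Proof.
move=> hF hh; elim: s => [|i s ih]; first by rewrite !big_nil dot0l.
by rewrite !big_cons (dotDl (hF i) (H2_sum s hF) hh) ih.
Qed.

Lemma dot_ff f : H2 f -> H2dot f f = (H2norm f ^+ 2)%:C.
Proof. by move=> hf; exact: left_lim_uniq (H2dot_lim hf hf) (J_lim hf). Qed.

Lemma norm_dot f : H2 f -> H2norm f = Num.sqrt (Re (H2dot f f)).
Proof. by move=> hf; rewrite dot_ff//= sqrtr_sqr ger0_norm ?H2norm_ge0. Qed.

Lemma H2normZ (a : C) f : H2 f -> H2norm (a *: f) = nc a * H2norm f.
Proof.
move=> hf; apply/eqP; rewrite -(@eqrXn2 _ 2)// ?mulr_ge0 ?nc_ge0 ?H2norm_ge0//; apply/eqP.
apply: complexI; have haf := H2Z a hf.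
rewrite -(dot_ff haf) (dotZl a hf haf) (dotZr a hf hf) (dot_ff hf) mulrA mulcJ.
by rewrite -real_complexM exprMn.
Qed.

Lemma dot_quad f g (t : C) : H2 f -> H2 g ->
  H2norm (f + cj t *: g) ^+ 2 = H2norm f ^+ 2 + 2 * Re (t * H2dot f g) + nc t ^+ 2 * H2norm g ^+ 2.
Proof.
move=> hf hg; apply: complexI; have htg := H2Z (cj t) hg.
rewrite -(dot_ff (H2D hf htg)) (dotDl hf htg (H2D hf htg)) (dotDr hf htg hf) (dotDr hf htg htg).
rewrite (dotZl _ hg hf) (dotZr _ hg hf) (dotZl _ hg htg) (dotZr _ hg hg) cjK.
rewrite (dot_ff hf) (dot_ff hg) !real_complexD [in RHS]real_complexM (real_complexM (nc t ^+ 2)) -mulcJ -(dot_cj hf hg) -cjM.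
have -> : (2 : R)%:C = 2 by exact: rmorph_nat.
by rewrite -(addcJ (t * H2dot f g)) conjcE; ring.
Qed.

Lemma dot_CS f g : H2 f -> H2 g -> nc (H2dot f g) <= H2norm f * H2norm g.
Proof.
move=> hf hg; rewrite -(@ler_pXn2r _ 2)// ?nnegrE ?nc_ge0 ?mulr_ge0 ?H2norm_ge0//.
rewrite exprMn; apply: cs_quadratic; rewrite ?sqr_ge0// => t.
by rewrite -dot_quad// sqr_ge0.
Qed.

(** All means over spheres of radius less than 1 vanish, and f is continuous there, so it vanishes
    at every point of each such sphere. *)
Lemma H2norm_eq0 f : H2 f -> H2norm f = 0 -> f = 0.
Proof.
move=> hf f0; have af := H2_an hf.
apply: zero_extP => z z1; rewrite zero_ext0.
pose r := (1 + en z) / 2.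
have r0 : 0 < r by rewrite /r; have := eucl_norm_ge0 z; lra.
have r1 : r < 1 by rewrite /r; lra.
have [e e1 zE] := unit_row z.
have van s y : 0 <= s < 1 -> en y = 1 -> ext f (s%:C *: y) = 0.
  move=> s01 y1; have /andP[s0 s1] := s01.
  have sF := sbm_dilation af s01.
  have J0 : Ir f f s = 0.
    have [-> h0] := Ir_ff af s01; have := J_le hf s01; rewrite f0 expr0n/= => h1.
    by rewrite (_ : J f s = 0)//; apply/eqP; rewrite eq_le h1 h0.
  have [M M0 fM] := analytic_bounded af s1.
  have : ext f (s%:C *: y) * cj (ext f (s%:C *: y)) = 0.
    apply: (cint_eq0 (sbmM sF (sbm_cj sF)) _ J0 y1) => [w _|d d0]; first exact: mulcJ_ge0.
    have M1 : 0 < 2 * M + 1 by lra.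
    have sy : en (s%:C *: y) < 1 by rewrite eucl_normZr// y1 mulr1.
    have [c c0 hc] := analytic_econt af sy (divr_gt0 d0 M1).
    exists c => // w w1 wy.
    have hw := hc (s%:C *: w) _.
    have {}hw : nc (ext f (s%:C *: w) - ext f (s%:C *: y)) < d / (2 * M + 1).
      apply: hw; rewrite -scalerBr eucl_normZr//; apply: le_lt_trans _ wy.
      by rewrite ler_piMl ?eucl_norm_ge0// ltW.
    have Fw : nc (ext f (s%:C *: w)) <= M by apply: fM; rewrite eucl_normZr// w1 mulr1.
    have Fy : nc (ext f (s%:C *: y)) <= M by apply: fM; rewrite eucl_normZr// y1 mulr1.
    move: hw Fw Fy; set a := ext f (s%:C *: w); set b := ext f (s%:C *: y) => hw Fw Fy.
    have -> : a * cj a - b * cj b = (a - b) * cj a + b * cj (a - b) by rewrite cjB; ring.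
    apply: le_lt_trans (ncD _ _) _; rewrite !ncM !nc_cj -/a -/b.
    rewrite ltr_pdivlMr// in hw; have := nc_ge0 (a - b); nra.
  by move=> /eqP; rewrite mulf_eq0 cj_eq0 orbb => /eqP.
by rewrite zE van// eucl_norm_ge0.
Qed.

Lemma H2_bounded f (B : R) : analytic f -> 0 <= B ->
  (forall z, en z < 1 -> nc (ext f z) <= B) -> H2 f /\ H2norm f <= B.
Proof.
move=> af B0 fB.
have JB (r : R) : 0 < r -> r < 1 -> J f r <= B ^+ 2.
  move=> r0 r1; have r01 := r_01 r0 r1; have sf := sbm_dilation af r01.
  apply: le_trans (Re_le_nc _) _; apply: (cint_le (sbmM sf (sbm_cj sf))) => z z1.
  rewrite ncM nc_cj -expr2 lerXn2r ?nnegrE ?nc_ge0// fB//.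
  by rewrite eucl_normZr ?(ltW r0)// z1 mulr1.
have hf := H2_intro af JB; split=> //.
rewrite -(@ler_pXn2r _ 2)// ?nnegrE ?H2norm_ge0//.
exact: (H2norm_sqr_le hf JB).
Qed.

Lemma H2_mult phi f (B : R) : analytic phi -> 0 <= B ->
  (forall z, en z < 1 -> nc (ext phi z) <= B) -> H2 f ->
  H2 (mult phi f) /\ H2norm (mult phi f) <= B * H2norm f.
Proof.
move=> ap B0 pB hf; have af := H2_an hf; have apf := analyticM ap af.
have JB (r : R) : 0 < r -> r < 1 -> J (mult phi f) r <= (B * H2norm f) ^+ 2.
  move=> r0 r1; have r01 := r_01 r0 r1.
  have sf := sbm_dilation af r01; have spf := sbm_dilation apf r01.
  apply: (@le_trans _ _ (B ^+ 2 * J f r)); last first.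
    by rewrite exprMn ler_wpM2l ?sqr_ge0// J_le.
  rewrite -subr_ge0.
  have s1 := sbmM sf (sbm_cj sf); have s2 := sbmM spf (sbm_cj spf).
  have -> : B ^+ 2 * J f r - J (mult phi f) r = Re (cint (fun z =>
    (B ^+ 2)%:C * (ext f (r%:C *: z) * cj (ext f (r%:C *: z))) -
    ext (mult phi f) (r%:C *: z) * cj (ext (mult phi f) (r%:C *: z)))).
    rewrite (cintB (sbmZ _ s1) s2) (cintZ _ s1) cReD cReN cReM /= mul0r subr0.
    by [].
  have sB := sbmB (sbmZ ((B ^+ 2)%:C) s1) s2.
  apply: (ge0C (cint_ge0 sB.1 _)).2 => z z1.
  rewrite zero_extM !mulcJ ncM exprMn -real_complexM -real_complexB lecR -mulrBl.
  rewrite mulr_ge0 ?sqr_ge0// subr_ge0 lerXn2r ?nnegrE ?nc_ge0// pB//.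
  by rewrite eucl_normZr ?(ltW r0)// z1 mulr1.
have hpf := H2_intro apf JB; split=> //.
rewrite -(@ler_pXn2r _ 2)// ?nnegrE ?mulr_ge0 ?H2norm_ge0//.
exact: (H2norm_sqr_le hpf JB).
Qed.

(** At radius 1 - d the partial sum is dominated by the norm, and Bernoulli's inequality bounds the
    loss from the powers of 1 - d by 2 N d times the sum. *)
Lemma dsq_sum_le f N : H2 f -> \sum_(0 <= k < N) dsq k f <= H2norm f ^+ 2.
Proof.
move=> hf; have af := H2_an hf; set S := \sum_(0 <= k < N) dsq k f.
have S0 : 0 <= S by apply: sumr_ge0 => k _; exact: (cdot_ff k af).2.
rewrite -subr_ge0 -oppr_le0 opprB.
have h (d : R) : 0 < d -> d < 1 -> S - H2norm f ^+ 2 <= (2 * N)%:R * S * d.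
  move=> d0 d1; have r01 : 0 <= 1 - d < 1 by apply/andP; split; lra.
  have := le_trans (J_partial N af r01) (J_le hf r01).
  have : (1 - (2 * N)%:R * d) * S <= \sum_(0 <= k < N) (1 - d) ^+ (2 * k) * dsq k f.
    rewrite mulr_sumr big_nat [leRHS]big_nat; apply: ler_sum => k /andP[_ kN].
    rewrite ler_wpM2r ?(cdot_ff k af).2//.
    apply: le_trans (bernoulli_pow (2 * N) (_ : 0 <= d <= 1)) _; first by rewrite !ltW.
    apply: ler_wiXn2l; [lra|lra|].
    by rewrite leq_mul2l/= ltnW.
  by move=> h1 h2; have := le_trans h1 h2; lra.
rewrite leNgt; apply/negP => p0.
have B0 : 0 < (2 * N)%:R * S + 1 + (S - H2norm f ^+ 2).
  by rewrite -addrA ltr_wpDl// ?mulr_ge0// addr_gt0.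
(* With p the supposed excess, d = p / (2 N S + 1 + p) is less than 1 and makes 2 N S d less than
   p. *)
set d := (S - H2norm f ^+ 2) / ((2 * N)%:R * S + 1 + (S - H2norm f ^+ 2)).
have d0 : 0 < d by rewrite divr_gt0.
have T0 : 0 <= (2 * N)%:R * S by rewrite mulr_ge0.
have d1 : d < 1 by rewrite ltr_pdivrMr// mul1r; lra.
have := h d d0 d1; have : d * ((2 * N)%:R * S + 1 + (S - H2norm f ^+ 2)) = S - H2norm f ^+ 2.
  by rewrite /d mulfVK// gt_eqF.
nra.
Qed.

(** Some mean [J f r] is within eps / 2 of the squared norm, and a partial sum of its series is
    within eps / 2 of that mean; what remains for the tail is at most eps. *)
Lemma dsq_tail f (eps : R) : H2 f -> 0 < eps ->
  exists N, forall M, \sum_(N <= k < M) dsq k f <= eps.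
Proof.
move=> hf e0; have af := H2_an hf; have e2 : 0 < eps / 2 by rewrite divr_gt0.
have [r r01 hr] := J_near hf e2; have /andP[r0 r1] := r01.
have Jr := hr r (lexx _) r1.
have [K [q [K0 /andP[q0 q1] h]]] := J_series af r01.
have K1 : 0 < K + 1 by rewrite ltr_wpDl.
have [N hN] := geo_small q0 q1 (divr_gt0 e2 K1).
exists N => M; have [MN|NM] := leqP M N; first by rewrite big_geq// ltW.
have := dsq_sum_le M hf; rewrite (sum_range_split _ (ltnW NM)).
have : \sum_(0 <= k < N) r ^+ (2 * k) * dsq k f <= \sum_(0 <= k < N) dsq k f.
  apply: ler_sum => k _; rewrite ler_piMl ?(cdot_ff k af).2//.
  by rewrite exprn_ile1// ltW.
have := h N; rewrite ler_distl => /andP[_].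
have : K * q ^+ N <= eps / 2.
  have := hN N (leqnn _); rewrite ltr_pdivlMr// => /ltW; apply: le_trans.
  by rewrite mulrC ler_wpM2l ?exprn_ge0// lerDl.
lra.
Qed.

(** If g has no components of degree below N, only the tail of f meets it, and Cauchy-Schwarz
    applies to the tail. This is the source of the decay of the backward shifts. *)
Lemma dot_tail f g N (tau : R) : H2 f -> H2 g -> 0 <= tau ->
  (forall M, \sum_(N <= k < M) dsq k f <= tau) ->
  (forall k e, (k < N)%N -> en e = 1 -> hc g k e = 0) ->
  nc (H2dot f g) ^+ 2 <= tau * H2norm g ^+ 2.
Proof.
move=> hf hg t0 ht hgN; have [af ag] := (H2_an hf, H2_an hg).
have B0 : 0 <= tau * H2norm g ^+ 2 by rewrite mulr_ge0// sqr_ge0.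
rewrite -[leRHS]sqr_sqrtr// lerXn2r ?nnegrE ?nc_ge0 ?sqrtr_ge0//.
apply: (left_lim_le (H2dot_lim hf hg)) => r r0 r1; have r01 := r_01 r0 r1.
have [K [q [K0 q01 h]]] := Ir_series af ag r01.
have /andP[q0 q1] := q01.
apply: (@le_geo _ _ K q q01) => M.
apply: (@le_trans _ _ (nc (\sum_(0 <= k < N + M) (r ^+ (2 * k))%:C * cdot k f g) + K * q ^+ (N + M))).
  rewrite addrC -lerBlDr; apply: le_trans (h (N + M)%N); exact: ncB_ge.
apply: lerD; last first.
  by rewrite ler_wpM2l// exprD ler_piMl ?exprn_ge0// exprn_ile1// ltW.
have -> : \sum_(0 <= k < N + M) (r ^+ (2 * k))%:C * cdot k f g =
    \sum_(N <= k < N + M) (r ^+ (2 * k))%:C * cdot k f g.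
  rewrite (big_cat_nat _ (n := N)) ?leq_addr//= big_nat big1 ?add0r// => k /andP[_ kN].
  rewrite /cdot (_ : cint _ = 0) ?mulr0//.
  have sg := sbm_hc k ag; have sf := sbm_hc k af.
  rewrite -[RHS](@cint_cst 0); apply: cint_eqS.
  - exact: (sbmM sf (sbm_cj sg)).1.
  - exact: measurable_cst.
  - by move=> z z1; rewrite hgN// cj0 mulr0.
rewrite -(sum_rhc r N (N + M) af ag).
set A := fun z : Cn => \sum_(N <= k < N + M) r%:C ^+ k * hc f k z.
set G := fun z : Cn => \sum_(N <= k < N + M) r%:C ^+ k * hc g k z.
have sA : sbm A by apply: sbm_sum => k; exact: sbm_rhc.
have sG : sbm G by apply: sbm_sum => k; exact: sbm_rhc.
rewrite -(@ler_pXn2r _ 2)// ?nnegrE ?nc_ge0 ?sqrtr_ge0// [leRHS]sqr_sqrtr//.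
apply: le_trans (cint_CS sA sG) _.
have EE u : analytic u -> Re (cint (fun z => (\sum_(N <= k < N + M) r%:C ^+ k * hc u k z) *
    cj (\sum_(N <= k < N + M) r%:C ^+ k * hc u k z))) = \sum_(N <= k < N + M) r ^+ (2 * k) * dsq k u.
  move=> au; rewrite sum_rhc//.
  have -> : \sum_(N <= k < N + M) (r ^+ (2 * k))%:C * cdot k u u =
      \sum_(N <= k < N + M) (r ^+ (2 * k))%:C * (dsq k u)%:C.
    by apply: eq_bigr => k _; rewrite (cdot_ff k au).1.
  by rewrite Re_sum_real.
have EA : Re (cint (fun z => A z * cj (A z))) =
  \sum_(N <= k < N + M) r ^+ (2 * k) * dsq k f := EE f af.
have EG : Re (cint (fun z => G z * cj (G z))) =
  \sum_(N <= k < N + M) r ^+ (2 * k) * dsq k g := EE g ag.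
clear EE; clearbody A G; rewrite EA EG.
have le1 (u : Bn -> C) : analytic u -> \sum_(N <= k < N + M) r ^+ (2 * k) * dsq k u <= \sum_(N <= k < N + M) dsq k u.
  move=> au; apply: ler_sum => k _; rewrite ler_piMl ?(cdot_ff k au).2//.
  by rewrite exprn_ile1// ltW.
have ge1 (u : Bn -> C) : analytic u -> 0 <= \sum_(N <= k < N + M) r ^+ (2 * k) * dsq k u.
  by move=> au; apply: sumr_ge0 => k _; rewrite mulr_ge0 ?exprn_ge0 ?(cdot_ff k au).2// ltW.
apply: ler_pM; rewrite ?ge1//; first exact: le_trans (le1 f af) (ht _).
apply: le_trans (le1 g ag) _; apply: le_trans _ (dsq_sum_le (N + M) hg).
rewrite (sum_range_split _ (leq_addr M N)) lerDr sumr_ge0// => k _.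
exact: (cdot_ff k ag).2.
Qed.

End h2_theory.

(** * The norms of L^1 and L^2 of the sphere *)

Section lebesgue_norms.
Implicit Types (z w : Cn) (F G : Cn -> C).

Lemma integrable_leS (f g : Cn -> R) : measurable_fun setT f ->
  sigma.-integrable setT (EFin \o g) -> (forall z, en z = 1 -> `|f z| <= g z) ->
  sigma.-integrable setT (EFin \o f).
Proof.
move=> mf ig fg; have mS := @measurable_sphere.
have mg := measurable_int sigma ig.
apply/(negligible_integrable (measurableC mS) _ _ (sphere_measure_off)) => //.
  exact/measurable_EFinP.
have : sigma.-integrable (setT `\` ~` [set z : Cn | en z = 1]) (EFin \o g).
  by apply/(negligible_integrable (measurableC mS) _ mg (sphere_measure_off)).
rewrite setDE setCK setTI => igS.
apply: (le_integrable _ _ _ igS) => //; first by apply/measurable_EFinP; exact: (measurable_funS _ _ mf).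
move=> z /= zS; rewrite lee_fin; apply: le_trans (fg _ zS) (ler_norm _).
Qed.

Lemma cintegrable_leS F (g : Cn -> R) : measurable_fun setT F ->
  sigma.-integrable setT (EFin \o g) -> (forall z, en z = 1 -> nc (F z) <= g z) ->
  cintegrable sigma setT F.
Proof.
move=> mF ig Fg; split; apply: (integrable_leS _ ig).
- exact: measurable_ReC.
- by move=> z z1; apply: le_trans (nc_Re _) (Fg _ z1).
- exact: measurable_ImC.
- by move=> z z1; apply: le_trans (nc_Im _) (Fg _ z1).
Qed.

Lemma nc_cint_leS F (g : Cn -> R) : measurable_fun setT F ->
  sigma.-integrable setT (EFin \o g) -> (forall z, en z = 1 -> nc (F z) <= g z) ->
  nc (cint F) <= \int[sigma]_z g z.
Proof.
move=> mF ig Fg; have iF := cintegrable_leS mF ig Fg.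
apply: le_trans (nc_cintegral _ iF) _ => //.
have iN := cintegrable_nc measurableT iF.
rewrite -subr_ge0 -RintegralB//; apply: Rintegral_ge0S => [|z z1].
  have mg := measurable_int sigma ig.
  by apply: measurable_funB; [exact/measurable_EFinP|exact: measurable_fun_nc].
by rewrite subr_ge0 Fg.
Qed.

Lemma cL1_le_cL2 F : measurable_fun setT F -> (cLnorm 1 F <= cLnorm 2%:E F)%E.
Proof.
move=> mF; have mN := measurable_fun_nc mF.
have := @hoelder _ _ _ sigma (fun z => nc (F z)) (cst 1) 2 2 mN (measurable_cst _) _ _ _.
have e2 : (2^-1 + 2^-1 = 1 :> R) by lra.
move=> /(_ (ltr0n _ 2) (ltr0n _ 2) e2).
have -> : ('N[sigma]_2%:E[EFin \o cst 1%R] = 1)%E.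
  have := @Lnorm_cst1 _ _ _ sigma 2; rewrite [X in (X `^ _)%E](@sphere_measure_setT R n) poweR1r.
  by apply: etrans; apply: eq_Lnorm.
rewrite mule1; apply: le_trans.
by rewrite le_eqVlt; apply/orP; left; apply/eqP/eq_Lnorm => z /=; rewrite mulr1.
Qed.

Lemma L2_integrable F : L2 F -> cintegrable sigma setT F.
Proof.
move=> [mF F2].
have h : sigma.-integrable setT (EFin \o (fun z => nc (F z))).
  apply/integrableP; split; first exact/measurable_EFinP/measurable_fun_nc.
  have := le_lt_trans (cL1_le_cL2 mF) F2.
  by rewrite /cLnorm Lnorm1.
by apply: (cintegrable_le _ _ _ h) => //; [exact: measurable_ReC|exact: measurable_ImC].
Qed.

Lemma cL1E F : measurable_fun setT F -> cintegrable sigma setT F ->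
  cLnorm 1 F = (\int[sigma]_z nc (F z))%:E.
Proof.
move=> mF iF; rewrite /cLnorm Lnorm1 /Rintegral fineK.
  by apply: eq_integral => z _ /=; rewrite ger0_norm ?nc_ge0.
apply: integrable_fin_num => //; exact: (cintegrable_nc measurableT iF).
Qed.

Lemma cL2E F : sbm F -> cLnorm 2%:E F = (Num.sqrt (Re (cint (fun z => F z * cj (F z)))))%:E.
Proof.
move=> sF; rewrite /cLnorm unlock /=.
have p0 := (cint_sqr sF).2.
have iF := (sbm_cintegrable (sbmM sF (sbm_cj sF))).1.
have E : (\int[sigma]_z (`|nc (F z)| `^ 2)%:E = (Re (cint (fun z => F z * cj (F z))))%:E)%E.
  rewrite /cint /= /Rintegral fineK; last exact: integrable_fin_num.
  apply: eq_integral => z _ /=; rewrite mulcJ /= ger0_norm ?nc_ge0//.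
  by rewrite powR_mulrn ?nc_ge0.
by rewrite E poweR_EFin powR12_sqrt.
Qed.

Lemma sbm_L2 F : sbm F -> L2 F.
Proof. by move=> sF; split; [exact: sF.1|rewrite cL2E// ltry]. Qed.

Lemma cL2_le F (B : R) : sbm F -> 0 <= B -> (forall z, en z = 1 -> nc (F z) <= B) ->
  (cLnorm 2%:E F <= B%:E)%E.
Proof.
move=> sF B0 FB; rewrite cL2E// lee_fin -[leRHS](ger0_norm B0) -sqrtr_sqr ler_sqrt ?sqr_ge0//.
apply: le_trans (Re_le_nc _) _; apply: (cint_le (sbmM sF (sbm_cj sF))) => z z1.
by rewrite ncM nc_cj -expr2 lerXn2r ?nnegrE ?nc_ge0// FB.
Qed.

Lemma cL1_sbm F : sbm F -> cLnorm 1 F = (\int[sigma]_z nc (F z))%:E.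
Proof. by move=> sF; apply: cL1E; [exact: sF.1|exact: sbm_cintegrable]. Qed.

End lebesgue_norms.

Opaque cint.

(** * Boundary values of ball algebra functions *)

Section boundary_values.
Implicit Types (z w e : Cn) (f g h : Bn -> C) (P : Cn -> C).

Lemma left_lim_cvg (F : R -> C) (l : C) : left_lim F l -> F r @[r --> (1 : R)^'-] --> l.
Proof.
move=> h; apply: cvgC_intro => e e0; have e2 : 0 < e / 2 by rewrite divr_gt0.
have [r0 /andP[r00 r01] hr] := h _ e2.
near=> r; apply: le_lt_trans (hr r _ _) _; [near: r; exact: nbhs_left_gt|near: r; exact: nbhs_left_lt|].
by lra.
Unshelve. all: by end_near.
Qed.

Lemma left_cauchy (F : R -> C) : (forall e : R, 0 < e -> exists2 r0 : R, 0 <= r0 < 1 &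
    forall r s, r0 < r -> r < 1 -> r0 < s -> s < 1 -> nc (F r - F s) <= e) ->
  exists l, left_lim F l.
Proof.
move=> h.
have re (u : R -> R) : (forall e : R, 0 < e -> exists2 r0 : R, 0 <= r0 < 1 &
    forall r s, r0 < r -> r < 1 -> r0 < s -> s < 1 -> `|u r - u s| <= e) ->
    exists l, forall e : R, 0 < e -> exists2 r0 : R, 0 <= r0 < 1 &
      forall r, r0 < r -> r < 1 -> `|u r - l| <= e.
  move=> hu; have : cvg (u r @[r --> (1 : R)^'-]).
    apply/cauchy_cvgP/cauchy_exP => e e0.
    have e2 : 0 < e / 2 by rewrite divr_gt0.
    have [r0 /andP[r00 r01] hr] := hu _ e2.
    exists (u ((r0 + 1) / 2)).
    suff : \forall r \near (1 : R)^'-, ball (u ((r0 + 1) / 2)) e (u r) by [].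
    near=> r; rewrite -ball_normE /=.
    have rr : r0 < r by near: r; exact: nbhs_left_gt.
    have r1 : r < 1 by near: r; exact: nbhs_left_lt.
    apply: le_lt_trans (hr ((r0 + 1) / 2) r _ _ rr r1) _; lra.
  move=> /cvg_ex[l /= hl]; exists l => e e0.
  have e2 : 0 < e / 2 by rewrite divr_gt0.
  have [r0 r01' hr] := hu _ e2; have /andP[r00 r01] := r01'.
  exists r0 => // r rr r1; apply/ler_addgt0Pr => d d0.
  have /cvgrPdist_lt/(_ _ d0) hd := hl.
  have : \forall s \near (1 : R)^'-, `|u r - l| <= e / 2 + d.
    near=> s; have hs : `|l - u s| < d by near: s.
    have hrs : `|u r - u s| <= e / 2.
      have rs : r0 < s by near: s; exact: nbhs_left_gt.
      have s1 : s < 1 by near: s; exact: nbhs_left_lt.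
      exact: hr.
    rewrite -(subrK (u s) (u r)) -addrA; apply: le_trans (ler_normD _ _) _.
    by rewrite distrC in hs; apply: lerD => //; exact: ltW.
  by move=> /(@filter_ex _ _ (at_left_proper_filter 1)) [s]; lra.
have [a ha] : exists l, forall e : R, 0 < e -> exists2 r0 : R, 0 <= r0 < 1 &
      forall r, r0 < r -> r < 1 -> `|Re (F r) - l| <= e.
  apply: re => e e0; have [r0 r01 hr] := h _ e0; exists r0 => // r s *.
  by rewrite -cReN -cReD; apply: le_trans (nc_Re _) (hr _ _ _ _ _ _).
have [b hb] : exists l, forall e : R, 0 < e -> exists2 r0 : R, 0 <= r0 < 1 &
      forall r, r0 < r -> r < 1 -> `|Im (F r) - l| <= e.
  apply: re => e e0; have [r0 r01 hr] := h _ e0; exists r0 => // r s *.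
  by rewrite -cImN -cImD; apply: le_trans (nc_Im _) (hr _ _ _ _ _ _).
exists (a +i* b) => e e0; have e2 : 0 < e / 2 by rewrite divr_gt0.
have [r0 /andP[r00 r01] h0] := ha _ e2; have [r1 /andP[r10 r11] h1] := hb _ e2.
exists (Num.max r0 r1); first by rewrite le_max r00 gt_max r01.
move=> r; rewrite gt_max => /andP[rr0 rr1] rl; apply: le_trans (nc_le_ReIm _) _.
by rewrite cReD cReN cImD cImN /=; have := h0 r rr0 rl; have := h1 r rr1 rl; lra.
Unshelve. all: by end_near.
Qed.

Lemma boundary_left_lim f z l : left_lim (fun r => ext f (r%:C *: z)) l -> bd f z = l.
Proof. by move=> /left_lim_cvg h; apply: cvg_lim => //; exact: norm_hausdorff. Qed.

Opaque boundary zero_ext eucl_norm Normc.normc ip.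

Lemma nc_triangle (a b c : C) : nc (a - c) <= nc (a - b) + nc (b - c).
Proof. by rewrite -(subrKA b) ncD. Qed.

(* The ball algebra, as uniform limits of polynomials. *)
Definition palg f := analytic f /\ forall e : R, 0 < e -> exists2 P, ispoly P &
  forall z, en z < 1 -> nc (ext f z - P z) <= e.

Lemma poly_lip P : ispoly P -> exists L M : R, [/\ 0 <= L, 0 <= M &
  forall z w, en z <= 1 -> en w <= 1 ->
    nc (P z) <= M /\ nc (P z - P w) <= L * en (z - w)].
Proof.
move: P; apply: (@mpoly_ind_closed (fun P => exists L M : R, [/\ 0 <= L, 0 <= M &
  forall z w, en z <= 1 -> en w <= 1 ->
    nc (P z) <= M /\ nc (P z - P w) <= L * en (z - w)])) => [c|i|F G [L [M [L0 M0 h]]] [L' [M' [L'0 M'0 h']]]|F G [L [M [L0 M0 h]]] [L' [M' [L'0 M'0 h']]]].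
- exists 0, (nc c); split => //; first exact: nc_ge0.
  by move=> z w _ _; rewrite subrr nc0 mul0r.
- exists 1, 1; split => // z w z1 w1; split; first exact: le_trans (nc_coord _ _) z1.
  rewrite mul1r; have -> : z ord0 i - w ord0 i = (z - w) ord0 i by rewrite !mxE.
  exact: nc_coord.
- exists (L + L'), (M + M'); split; rewrite ?addr_ge0// => z w z1 w1.
  have [a b] := h z w z1 w1; have [a' b'] := h' z w z1 w1.
  split; first by apply: le_trans (ncD _ _) _; rewrite lerD.
  by rewrite opprD addrACA; apply: le_trans (ncD _ _) _; rewrite mulrDl lerD.
- exists (L * M' + M * L'), (M * M'); split; rewrite ?addr_ge0 ?mulr_ge0// => z w z1 w1.
  have [a b] := h z w z1 w1; have [a' b'] := h' z w z1 w1; have [aw _] := h w z w1 z1.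
  split; first by rewrite ncM ler_pM ?nc_ge0.
  have -> : F z * G z - F w * G w = (F z - F w) * G z + F w * (G z - G w) by ring.
  apply: le_trans (ncD _ _) _; rewrite !ncM mulrDl; apply: lerD.
    by rewrite mulrAC ler_pM ?nc_ge0.
  by rewrite -mulrA ler_pM ?nc_ge0.
Qed.

Lemma dil_close z r : en z <= 1 -> 0 <= r < 1 ->
  en (r%:C *: z) <= 1 /\ en (r%:C *: z - z) <= 1 - r.
Proof.
move=> z1 /andP[r0 r1]; split; first by rewrite eucl_normZr// mulr_ile1 ?eucl_norm_ge0// ltW.
rewrite -eucl_normN opprB -{1}[z]scale1r -scalerBl.
rewrite -(_ : (1 - r)%:C = 1 - r%:C); last by rewrite real_complexB.
by rewrite eucl_normZr ?subr_ge0 ?(ltW r1)// ler_piMr// subr_ge0 ltW.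
Qed.

Lemma dil_in z r : en z <= 1 -> 0 <= r < 1 -> en (r%:C *: z) < 1.
Proof.
move=> z1 /andP[r0 r1]; rewrite eucl_normZr//; apply: le_lt_trans r1.
by rewrite ler_piMr.
Qed.

(** An approximating polynomial is Lipschitz on the closed ball, so its values at r z and z differ
    by at most L (1 - r); the bound d on 1 - r is chosen with L d at most e / 4. *)
Lemma palg_unif_cauchy f (e : R) : palg f -> 0 < e -> exists2 r0 : R, 0 <= r0 < 1 &
  forall r s z, r0 < r -> r < 1 -> r0 < s -> s < 1 -> en z <= 1 ->
    nc (ext f (r%:C *: z) - ext f (s%:C *: z)) <= e.
Proof.
move=> [af hf] e0; have e4 : 0 < e / 4 by rewrite divr_gt0.
have [P pP fP] := hf _ e4; have [L [M [L0 M0 h]]] := poly_lip pP.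
have D0 : 0 < 4 * (L + 1) + e by rewrite addr_gt0// mulr_gt0// ltr_wpDl.
have d0 : 0 < e / (4 * (L + 1) + e) by rewrite divr_gt0.
have d1 : e / (4 * (L + 1) + e) < 1 by rewrite ltr_pdivrMr// mul1r; lra.
have Ld : L * (e / (4 * (L + 1) + e)) <= e / 4.
  rewrite mulrA ler_pdivrMr//; nra.
move: (e / (4 * (L + 1) + e)) d0 d1 Ld => d d0 d1 Ld {D0}.
exists (1 - d); first by apply/andP; split; lra.
move=> r s z rr r1 ss s1 z1.
have r01 : 0 <= r < 1 by apply/andP; split; lra.
have s01 : 0 <= s < 1 by apply/andP; split; lra.
have key t : 0 <= t < 1 -> 1 - d < t -> nc (ext f (t%:C *: z) - P z) <= e / 2.
  move=> t01 td; have [c c'] := dil_close z1 t01.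
  have := fP _ (dil_in z1 t01); have [_] := h _ _ c z1.
  have : L * en (t%:C *: z - z) <= e / 4.
    have td' : 1 - t <= d by rewrite lerBlDl ltW// -ltrBlDr.
    exact: le_trans (ler_wpM2l L0 (le_trans c' td')) Ld.
  move=> h1 h2 h3.
  apply: le_trans (nc_triangle (ext f (t%:C *: z)) (P (t%:C *: z)) (P z)) _.
  apply: le_trans (lerD h3 (le_trans h2 h1)) _; clear; lra.
have := key r r01 rr; have := key s s01 ss => h1 h2.
apply: le_trans (nc_triangle _ (P z) _) _; rewrite (ncBC (P z)).
apply: le_trans (lerD h2 h1) _; clear; lra.
Qed.

Lemma boundary_in f z : analytic f -> en z < 1 ->
  left_lim (fun r => ext f (r%:C *: z)) (ext f z).
Proof.
move=> af z1 e e0; have [d d0 h] := analytic_econt af z1 e0.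
exists (Num.max 0 (1 - d)); first by rewrite le_max lexx gt_max ltr01 gtrDl oppr_lt0.
move=> r; rewrite gt_max => /andP[r0 rd] r1; apply/ltW/h.
have r01 : 0 <= r < 1 by rewrite ltW.
by apply: le_lt_trans (dil_close (ltW z1) r01).2 _; lra.
Qed.

Lemma boundary_out f z : 1 < en z -> left_lim (fun r => ext f (r%:C *: z)) 0.
Proof.
move=> z1 e e0; have z0 : 0 < en z by lra.
exists (en z)^-1; first by rewrite invr_ge0 ltW// invf_lt1.
move=> r rr r1; rewrite zero_ext_out ?subrr ?nc0 ?(ltW e0)//.
have rp : 0 < r by apply: lt_trans rr; rewrite invr_gt0.
rewrite eucl_normZr ?(ltW rp)// -(mulVf (lt0r_neq0 z0)) ler_pM2r//; exact: ltW.
Qed.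

Lemma palg_lim f z : palg f -> left_lim (fun r => ext f (r%:C *: z)) (bd f z).
Proof.
move=> pf; suff [l hl] : exists l, left_lim (fun r => ext f (r%:C *: z)) l.
  by rewrite (boundary_left_lim hl).
have [z1|z1] := leP (en z) 1; last by exists 0; exact: boundary_out.
apply: left_cauchy => e e0; have [r0 r01 h] := palg_unif_cauchy pf e0.
by exists r0 => // r s *; exact: h.
Qed.

Lemma palg_unif f (e : R) : palg f -> 0 < e -> exists2 r0 : R, 0 <= r0 < 1 &
  forall r z, r0 < r -> r < 1 -> en z <= 1 ->
    nc (ext f (r%:C *: z) - bd f z) <= e.
Proof.
move=> pf e0; have [r0 r01 h] := palg_unif_cauchy pf e0; have /andP[r00 r01'] := r01.
exists r0 => // r z rr r1 z1; apply/ler_addgt0Pr => d d0.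
have [s0 /andP[s00 s01] hs] := palg_lim z pf d0.
pose s := (Num.max r0 s0 + 1) / 2.
have m1 : Num.max r0 s0 < 1 by rewrite gt_max r01' s01.
have r0m : r0 <= Num.max r0 s0 by rewrite le_max lexx.
have s0m : s0 <= Num.max r0 s0 by rewrite le_max lexx orbT.
have sr : r0 < s by rewrite /s; lra.
have ss : s0 < s by rewrite /s; lra.
have s1 : s < 1 by rewrite /s; lra.
have := h r s z rr r1 sr s1 z1; have := hs s ss s1 => h1 h2.
by apply: le_trans (nc_triangle _ (ext f (s%:C *: z)) _) _; lra.
Qed.

Lemma palg_boundary_in f z : analytic f -> en z < 1 -> bd f z = ext f z.
Proof. by move=> af z1; exact: boundary_left_lim (boundary_in af z1). Qed.

Lemma palg_approx f (e : R) : palg f -> 0 < e -> exists2 P, ispoly P &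
  forall z, en z <= 1 -> nc (bd f z - P z) <= e.
Proof.
move=> pf e0; have e4 : 0 < e / 4 by rewrite divr_gt0.
have [P pP fP] := pf.2 _ e4; exists P => // z z1.
have [L [M [L0 M0 h]]] := poly_lip pP.
have [r0 /andP[r00 r01] hr] := palg_unif pf e4.
pose r := Num.max ((r0 + 1) / 2) (1 - e / (4 * (L + 1))).
have L1 : 0 < 4 * (L + 1) by rewrite mulr_gt0// ltr_wpDl.
have r1 : r < 1 by rewrite gt_max; apply/andP; split; [lra|rewrite gtrDl oppr_lt0 divr_gt0].
have rr : r0 < r by rewrite lt_max; apply/orP; left; lra.
have rL : 1 - e / (4 * (L + 1)) <= r by rewrite le_max lexx orbT.
have r01' : 0 <= r < 1 by rewrite r1 andbT (le_trans r00)// ltW.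
have [c c'] := dil_close z1 r01'; have [_ hz] := h _ _ c z1.
have h1 := hr r z rr r1 z1; have h2 := fP _ (dil_in z1 r01').
have h3 : L * en (r%:C *: z - z) <= e / 4.
  apply: (@le_trans _ _ (L * (e / (4 * (L + 1))))).
    by rewrite ler_wpM2l// (le_trans c')//; lra.
  rewrite mulrA ler_pdivrMr//; nra.
apply: le_trans (nc_triangle _ (ext f (r%:C *: z)) _) _; rewrite ncBC.
by have := nc_triangle (ext f (r%:C *: z)) (P (r%:C *: z)) (P z); lra.
Qed.

Lemma palg_cont f z : palg f -> en z <= 1 -> forall e : R, 0 < e ->
  exists2 d : R, 0 < d & forall w, en w <= 1 -> en (w - z) < d ->
    nc (bd f w - bd f z) < e.
Proof.
move=> pf z1 e e0; have e4 : 0 < e / 4 by rewrite divr_gt0.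
have [P pP fP] := palg_approx pf e4.
have [L [M [L0 M0 h]]] := poly_lip pP.
have L1 : 0 < 4 * (L + 1) by rewrite mulr_gt0// ltr_wpDl.
exists (e / (4 * (L + 1))); first by rewrite divr_gt0.
move=> w w1 wz; have [_ hz] := h _ _ w1 z1; have h1 := fP _ z1; have h2 := fP _ w1.
have h3 : L * en (w - z) <= e / 4.
  apply: (@le_trans _ _ (L * (e / (4 * (L + 1))))); first by rewrite ler_wpM2l// ltW.
  rewrite mulrA ler_pdivrMr//; nra.
apply: le_lt_trans (nc_triangle _ (P w) _) _; have := nc_triangle (P w) (P z) (bd f z).
by rewrite (ncBC (P z)); lra.
Qed.

Lemma palg_bounded f : palg f -> exists2 M : R, 0 <= M & forall z, en z <= 1 -> nc (bd f z) <= M.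
Proof.
move=> pf; have [P pP fP] := palg_approx pf ltr01; have [L [M [L0 M0 h]]] := poly_lip pP.
exists (1 + M); first by rewrite addr_ge0.
move=> z z1; rewrite -(subrK (P z) (bd f z)); apply: le_trans (ncD _ _) _.
by rewrite lerD ?fP//; case: (h z z z1 z1).
Qed.

Lemma sbm_boundary f : palg f -> sbm (bd f).
Proof.
move=> pf; split; last by have [M _ h] := palg_bounded pf; exists M => z z1; apply: h; rewrite z1.
pose rk (k : nat) : R := 1 - k.+2%:R^-1.
apply: (@measurable_funC_lim _ _ _ (fun k z => ext f ((rk k)%:C *: z))).
  by move=> k; apply: measurableT_comp; [exact: measurable_zero_ext pf.1|exact: measurable_rowZ].
move=> z; apply: cvgC_intro => e e0; have e2 : 0 < e / 2 by rewrite divr_gt0.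
have [r0 /andP[r00 r01] h] := palg_lim z pf e2.
have d0 : 0 < 1 - r0 by rewrite subr_gt0.
have /cvgrPdist_lt/(_ _ d0) := @cvg_harmonic R; apply: filterS => k.
rewrite sub0r normrN /harmonic ger0_norm ?invr_ge0//= => hk.
have kk : k.+2%:R^-1 <= k.+1%:R^-1 :> R by rewrite lef_pV2 ?posrE// ler_nat.
have rk0 : r0 < rk k by rewrite ltrBrDr -ltrBrDl (le_lt_trans kk).
have rk1 : rk k < 1 by rewrite gtrDl oppr_lt0.
apply: le_lt_trans (h (rk k) rk0 rk1) _; lra.
Qed.

Section ops.
Variables (f g : Bn -> C).
Hypotheses (pf : palg f) (pg : palg g).

Lemma palgD : palg (f + g).
Proof.
split; first exact: analyticD pf.1 pg.1.
move=> e e0; have e2 : 0 < e / 2 by rewrite divr_gt0.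
have [P pP hP] := pf.2 _ e2; have [Q pQ hQ] := pg.2 _ e2.
exists (fun z => P z + Q z); first exact: ispolyD.
move=> z z1; rewrite zero_extD opprD addrACA; apply: le_trans (ncD _ _) _.
by have := hP z z1; have := hQ z z1; lra.
Qed.

Lemma palgM : palg (mult f g).
Proof.
split; first exact: analyticM pf.1 pg.1.
move=> e e0; have [M M0 hM] := palg_bounded pf.
pose e2 := e / (2 * (M + 1)).
have M1 : 0 < 2 * (M + 1) by rewrite mulr_gt0// ltr_wpDl.
have e20 : 0 < e2 by rewrite divr_gt0.
have [Q pQ hQ] := pg.2 _ e20.
have [L [N [L0 N0 hN]]] := poly_lip pQ.
have N1 : 0 < 2 * (N + 1) by rewrite mulr_gt0// ltr_wpDl.
have e30 : 0 < e / (2 * (N + 1)) by rewrite divr_gt0.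
have [P pP hP] := pf.2 _ e30.
exists (fun z => P z * Q z); first exact: ispolyM.
move=> z z1; rewrite zero_extM.
have -> : ext f z * ext g z - P z * Q z =
  ext f z * (ext g z - Q z) + (ext f z - P z) * Q z by ring.
apply: le_trans (ncD _ _) _; rewrite !ncM.
have b1 : nc (ext f z) <= M by rewrite -(palg_boundary_in pf.1 z1) hM// ltW.
have [b2 _] := hN z z (ltW z1) (ltW z1).
have c1 : nc (ext f z) * nc (ext g z - Q z) <= M * e2 by rewrite ler_pM ?nc_ge0 ?hQ.
have c2 : nc (ext f z - P z) * nc (Q z) <= e / (2 * (N + 1)) * N by rewrite ler_pM ?nc_ge0 ?hP.
have c3 : M * e2 <= e / 2 by rewrite /e2 mulrA ler_pdivrMr//; nra.
have c4 : e / (2 * (N + 1)) * N <= e / 2 by rewrite mulrAC ler_pdivrMr//; nra.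
lra.
Qed.

Lemma boundaryD z : bd (f + g) z = bd f z + bd g z.
Proof.
apply: boundary_left_lim; apply: eq_left_lim (left_limD (palg_lim z pf) (palg_lim z pg)) => r _ _.
by rewrite zero_extD.
Qed.

Lemma boundaryZ (a : C) z : bd (a *: f) z = a * bd f z.
Proof.
apply: boundary_left_lim; apply: eq_left_lim (left_limZ a (palg_lim z pf)) => r _ _.
by rewrite zero_extZ.
Qed.

Lemma left_limM (F G : R -> C) (a b : C) : left_lim F a -> left_lim G b ->
  left_lim (fun r => F r * G r) (a * b).
Proof.
move=> hF hG e e0; have K0 : 0 < nc a + nc b + 1 by rewrite ltr_wpDl// addr_ge0 ?nc_ge0.
pose d := Num.min 1 (e / (nc a + nc b + 1)).
have d0 : 0 < d by rewrite lt_min ltr01 divr_gt0.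
have [r0 r01 h] := left_lim_near2 (fun=> True) hF hG d0 d0.
exists r0 => // r rr r1; have [h1 h2] := h r rr r1.
have d1 : d <= 1 by rewrite ge_min lexx.
have de : d * (nc a + nc b + 1) <= e.
  rewrite -ler_pdivlMr//; by rewrite ge_min lexx orbT.
have -> : F r * G r - a * b = (F r - a) * (G r - b) + a * (G r - b) + b * (F r - a) by ring.
apply: le_trans (ncD _ _) _; have := ncD ((F r - a) * (G r - b)) (a * (G r - b)).
rewrite !ncM; have := nc_ge0 a; have := nc_ge0 b; have := nc_ge0 (F r - a); have := nc_ge0 (G r - b); nra.
Qed.

Lemma boundaryM z : bd (mult f g) z = bd f z * bd g z.
Proof.
apply: boundary_left_lim; apply: eq_left_lim (left_limM (palg_lim z pf) (palg_lim z pg)) => r _ _.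
by rewrite zero_extM.
Qed.

End ops.

Definition pfun P : Bn -> C := fun z : Bn => P (val z).

Lemma zero_ext_pfun P z : en z < 1 -> ext (pfun P) z = P z.
Proof. by move=> z1; rewrite (zero_ext_in _ z1). Qed.

Lemma analytic_pfun P : ispoly P -> analytic (pfun P).
Proof.
move: P; apply: (@mpoly_ind_closed (fun P => analytic (pfun P))) => [c|i|F G aF aG|F G aF aG].
- exact: analytic_cst.
- exact: analytic_coord.
- exact: analyticD aF aG.
- exact: analyticM aF aG.
Qed.

Lemma palg_pfun P : ispoly P -> palg (pfun P).
Proof.
move=> pP; split; first exact: analytic_pfun.
by move=> e e0; exists P => // z z1; rewrite zero_ext_pfun// subrr nc0 ltW.
Qed.

Lemma boundary_pfun P z : ispoly P -> en z <= 1 -> bd (pfun P) z = P z.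
Proof.
move=> pP z1; apply/eqP; rewrite -subr_eq0; apply/eqP/nc_le_eq0 => e e0.
have pp := palg_pfun pP; have e2 : 0 < e / 2 by rewrite divr_gt0.
have [r0 /andP[r00 r01] h] := palg_unif pp e2.
have [L [M [L0 M0 hL]]] := poly_lip pP.
have L1 : 0 < 2 * (L + 1) by rewrite mulr_gt0// ltr_wpDl.
pose r := Num.max ((r0 + 1) / 2) (1 - e / (2 * (L + 1))).
have r1 : r < 1 by rewrite gt_max; apply/andP; split; [lra|rewrite gtrDl oppr_lt0 divr_gt0].
have rr : r0 < r by rewrite lt_max; apply/orP; left; lra.
have rL : 1 - e / (2 * (L + 1)) <= r by rewrite le_max lexx orbT.
have r01' : 0 <= r < 1 by rewrite r1 andbT (le_trans r00)// ltW.
have [c c'] := dil_close z1 r01'; have [_ hz] := hL _ _ c z1.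
have h1 := h r z rr r1 z1.
rewrite zero_ext_pfun in h1; last exact: dil_in.
have h3 : L * en (r%:C *: z - z) <= e / 2.
  apply: (@le_trans _ _ (L * (e / (2 * (L + 1))))).
    by rewrite ler_wpM2l// (le_trans c')//; lra.
  rewrite mulrA ler_pdivrMr//; nra.
by apply: le_trans (nc_triangle _ (P (r%:C *: z)) _) _; rewrite ncBC; lra.
Qed.

Lemma boundary_cst (c : C) z : en z <= 1 -> bd (cst c : Bn -> C) z = c.
Proof. exact: (boundary_pfun (ispoly_cst c)). Qed.

Lemma palg_cst (c : C) : palg (cst c : Bn -> C).
Proof. exact: (palg_pfun (ispoly_cst c)). Qed.

Lemma palg_coord i : palg (coord_fun i : Bn -> C).
Proof. exact: (palg_pfun (ispoly_coord i)). Qed.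

Lemma palgZ (a : C) f : palg f -> palg (a *: f).
Proof.
move=> pf; rewrite (_ : a *: f = mult (cst a) f)//; apply: palgM => //; exact: palg_cst.
Qed.

Lemma palgB f g : palg f -> palg g -> palg (f - g).
Proof. by move=> pf pg; rewrite -scaleN1r; apply: palgD => //; exact: palgZ. Qed.

Lemma palg0 : palg (0 : Bn -> C).
Proof. exact: (palg_cst 0). Qed.

Lemma palg_in_bound f z (M : R) : palg f -> (forall z, en z <= 1 -> nc (bd f z) <= M) ->
  en z < 1 -> nc (ext f z) <= M.
Proof. by move=> pf h z1; rewrite -(palg_boundary_in pf.1 z1) h// ltW. Qed.

Lemma palg_H2 f : palg f -> H2 f.
Proof.
move=> pf; have [M M0 h] := palg_bounded pf.
by have [] := H2_bounded pf.1 M0 (fun z => palg_in_bound pf h (z := z)).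
Qed.

(** Only one factor needs a boundary function: replacing g(r z) by its boundary value is a uniformly
    small change, and Cauchy-Schwarz with the norm of [a] controls the effect. This is how bounded
    multipliers without boundary values are paired with elements of Q. *)
Lemma dot_half a g : H2 a -> palg g ->
  left_lim (fun r => cint (fun z => ext a (r%:C *: z) * cj (bd g z))) (H2dot a g).
Proof.
move=> ha pg e e0; have aa := H2_an ha; have N1 : 0 < H2norm a + 1 by rewrite ltr_wpDl ?H2norm_ge0.
have e2 : 0 < e / 2 by rewrite divr_gt0.
have e3 : 0 < e / 2 / (H2norm a + 1) by rewrite divr_gt0.
have [r0 /andP[r00 r01] h0] := palg_unif pg e3.
have [r1 /andP[r10 r11] h1] := H2dot_lim ha (palg_H2 pg) e2.
exists (Num.max r0 r1); first by rewrite le_max r00 gt_max r01.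
move=> r; rewrite gt_max => /andP[rr0 rr1] rl.
have rp : 0 <= r < 1 by rewrite rl andbT (le_trans r00)// ltW.
have sa := sbm_dilation aa rp; have sg := sbm_boundary pg; have sgr := sbm_dilation pg.1 rp.
have := h1 r rr1 rl; move=> hI.
pose D z := ext g (r%:C *: z) - bd g z.
have sD : sbm D := sbmB sgr sg.
have E : cint (fun z => ext a (r%:C *: z) * cj (bd g z)) =
    Ir a g r - cint (fun z => ext a (r%:C *: z) * cj (D z)).
  rewrite /Ir -(cintB (sbmM sa (sbm_cj sgr)) (sbmM sa (sbm_cj sD))).
  by congr cint; apply/funext => z; rewrite /D cjB; ring.
rewrite E addrAC; apply: le_trans (ncB _ _) _.
suff : nc (cint (fun z => ext a (r%:C *: z) * cj (D z))) <= e / 2 by lra.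
rewrite -(@ler_pXn2r _ 2)// ?nnegrE ?nc_ge0 ?(ltW e2)//.
apply: le_trans (cint_CS sa sD) _.
have DB : Re (cint (fun z => D z * cj (D z))) <= (e / 2 / (H2norm a + 1)) ^+ 2.
  apply: le_trans (Re_le_nc _) _; apply: (cint_le (sbmM sD (sbm_cj sD))) => z z1.
  by rewrite ncM nc_cj -expr2 lerXn2r ?nnegrE ?nc_ge0 ?(ltW e3)// h0// z1.
apply: le_trans (ler_pM _ _ (J_le ha rp) DB) _.
- exact: (Ir_ff aa rp).2.
- exact: (cint_sqr sD).2.
rewrite -exprMn; apply: lerXn2r.
- by rewrite nnegrE mulr_ge0 ?H2norm_ge0// ltW.
- by rewrite nnegrE ltW.
by rewrite mulrCA ler_piMr ?(ltW e2)// ler_pdivrMr// mul1r lerDl.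
Qed.

Lemma palg_dot f g : palg f -> palg g ->
  H2dot f g = cint (fun z => bd f z * cj (bd g z)).
Proof.
move=> pf pg; apply: (left_lim_uniq (dot_half (palg_H2 pf) pg)) => e e0.
have [M M0 hM] := palg_bounded pg; have M1 : 0 < M + 1 by rewrite ltr_wpDl.
have e3 : 0 < e / (M + 1) by rewrite divr_gt0.
have [r0 r01 h0] := palg_unif pf e3; have /andP[r00 _] := r01.
exists r0 => // r rr r1.
have rp : 0 <= r < 1 by rewrite r1 andbT (le_trans r00)// ltW.
have sf := sbm_boundary pf; have sg := sbm_boundary pg; have sfr := sbm_dilation pf.1 rp.
rewrite -(cintB (sbmM sfr (sbm_cj sg)) (sbmM sf (sbm_cj sg))).
apply: (cint_le (sbmB (sbmM sfr (sbm_cj sg)) (sbmM sf (sbm_cj sg)))) => z z1.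
rewrite -mulrBl ncM nc_cj.
apply: (@le_trans _ _ (e / (M + 1) * M)).
  by apply: ler_pM; rewrite ?nc_ge0// ?h0 ?z1// hM// z1.
by rewrite mulrAC ler_pdivrMr// ler_wpM2l ?(ltW e0)// lerDl.
Qed.

Lemma H2S_boundary f : palg f -> H2S (bd f).
Proof.
move=> pf; have sf := sbm_boundary pf; split; first exact: sbm_L2.
move=> e e0; have e2 : 0 < e / 2 by rewrite divr_gt0.
have [_ [p ->] hp] := palg_approx pf e2; exists p.
have sp : sbm (poly_fun p) by apply: ispoly_sbm; exists p.
apply: (@le_lt_trans _ _ (e / 2)%:E); last by rewrite lte_fin; lra.
apply: (cL2_le (sbmB sf sp)) => [|z z1]; first exact: ltW.
by apply: hp; rewrite z1.
Qed.

End boundary_values.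

(** * Finite-dimensional subspaces: orthonormal bases and eigenvectors *)

Section finite_dimension.
Implicit Types (f g h : Bn -> C) (V : set (Bn -> C)) (b : nat -> Bn -> C).

Definition orthonormal b k := forall i j, (i < k)%N -> (j < k)%N -> H2dot (b i) (b j) = (i == j)%:R.

Lemma dependence k m (c : 'I_k -> 'I_m -> C) : (m < k)%N ->
  exists2 a : 'I_k -> C, (exists i, a i != 0) & forall j, \sum_i a i * c i j = 0.
Proof.
move=> mk; pose A : 'M[C]_(k, m) := \matrix_(i, j) c i j.
have : kermx A != 0.
  rewrite kermx_eq0 /row_free; apply: contraTneq mk => <-.
  by rewrite -leqNgt rank_leq_col.
move=> /matrix0Pn[i [j ij]]; exists (fun l => kermx A i l); first by exists j.
move=> l; have /matrixP/(_ i l) := mulmx_ker A; rewrite !mxE => h.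
by rewrite -[RHS]h; apply: eq_bigr => x _; congr (_ * _); rewrite [RHS]mxE.
Qed.

Section subspace.
Variables (V : set (Bn -> C)) (m : nat) (s : 'I_m -> Bn -> C).
Hypotheses (V2 : V `<=` H2) (V0 : V 0)
  (Vl : forall (a : C) f g, V f -> V g -> V (a *: f + g))
  (Vs : forall f, V f -> exists c : 'I_m -> C, f = \sum_k c k *: s k).

Lemma subspaceZ (a : C) f : V f -> V (a *: f).
Proof. by move=> Vf; rewrite -[_ *: _]addr0; exact: Vl. Qed.
Lemma subspaceD f g : V f -> V g -> V (f + g).
Proof. by move=> Vf Vg; rewrite -[f]scale1r; exact: Vl. Qed.
Lemma subspaceB f g : V f -> V g -> V (f - g).
Proof. by move=> Vf Vg; rewrite addrC -scaleN1r; exact: Vl. Qed.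
Lemma subspace_sum (I : Type) (r : seq I) (F : I -> Bn -> C) : (forall i, V (F i)) ->
  V (\sum_(i <- r) F i).
Proof.
by move=> VF; elim: r => [|i r ih]; rewrite ?big_nil ?big_cons//; exact: subspaceD.
Qed.
Lemma subspace_sumP (I : finType) (F : I -> Bn -> C) : (forall i, V (F i)) -> V (\sum_i F i).
Proof. exact: subspace_sum. Qed.

Lemma vectors_dependent k (u : 'I_k -> Bn -> C) : (forall i, V (u i)) -> (m < k)%N ->
  exists2 a : 'I_k -> C, (exists i, a i != 0) & \sum_i a i *: u i = 0.
Proof.
move=> Vu mk; have /choice[c hc] : forall i, exists c : 'I_m -> C, u i = \sum_j c j *: s j.
  by move=> i; exact: Vs.
have [a a0 ha] := dependence c mk; exists a => //.
under eq_bigr do rewrite hc scaler_sumr.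
rewrite exchange_big big1 //= => j _.
by under eq_bigr do rewrite scalerA; rewrite -scaler_suml ha scale0r.
Qed.

Lemma orthonormal_le b k : (forall i, (i < k)%N -> V (b i)) -> orthonormal b k -> (k <= m)%N.
Proof.
move=> Vb ob; rewrite leqNgt; apply/negP => mk.
have [a [i ai] ha] := vectors_dependent (u := fun i : 'I_k => b i) (fun i => Vb i (ltn_ord i)) mk.
move/eqP: ai; apply.
have Hb (j : 'I_k) : H2 (b j) by apply/V2/Vb.
have := congr1 (fun f => H2dot f (b i)) ha.
rewrite (dot_suml) ?(dot0l)// => [|j]; last exact: H2Z.
rewrite (bigD1 i)//= (dotZl)// ob// eqxx mulr1 big1 ?addr0// => j ji.
by rewrite (dotZl)// ob// (_ : _ == _ :> nat = false) ?mulr0//; apply: contraNF ji => /eqP/val_inj->.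
Qed.

(** A maximal orthonormal family exists since its size is bounded by the number of spanning vectors;
    a vector differing from its expansion would extend it. *)
Lemma orthonormal_basis : exists k b, [/\ forall i, (i < k)%N -> V (b i), orthonormal b k &
  forall f, V f -> f = \sum_(i < k) H2dot f (b i) *: b i].
Proof.
pose P k := `[< exists b, (forall i, (i < k)%N -> V (b i)) /\ orthonormal b k >].
have exP : exists k, P k by exists 0%N; apply/asboolP; exists (fun=> 0).
have ubP k : P k -> (k <= m)%N by move=> /asboolP[b [Vb ob]]; exact: orthonormal_le Vb ob.
case: (ex_maxnP exP ubP) => k /asboolP[b [Vb ob]] kmax.
exists k, b; split => // f Vf.
have Hb i : (i < k)%N -> H2 (b i) by move=> ik; exact/V2/Vb.
set p := \sum_(i < k) _; apply/eqP; rewrite -subr_eq0; apply/negPn/negP => fp.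
have Vp : V p by apply: subspace_sumP => i; apply/subspaceZ/Vb.
have Vg : V (f - p) by exact: subspaceB.
have Hf := V2 Vf; have Hp := V2 Vp; have Hg := V2 Vg.
have orth j : (j < k)%N -> H2dot (f - p) (b j) = 0.
  move=> jk; rewrite (dotBl Hf Hp (Hb j jk)) /p (dot_suml); last 2 first.
  - by move=> i; exact/(H2Z)/Hb.
  - exact: Hb.
  rewrite (bigD1 (Ordinal jk))//= (dotZl _ (Hb j jk) (Hb j jk)) ob// eqxx mulr1 big1 ?addr0 ?subrr//.
  move=> i ij; rewrite (dotZl _ (Hb i (ltn_ord i)) (Hb j jk)) ob//.
  by rewrite (_ : _ == _ :> nat = false) ?mulr0//; apply: contraNF ij => /eqP h; apply/eqP/val_inj.
have N0 : 0 < H2norm (f - p).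
  rewrite lt_neqAle H2norm_ge0 andbT eq_sym; apply: contra fp => /eqP h.
  by apply/eqP; exact: (H2norm_eq0 Hg h).
pose u := (H2norm (f - p))^-1%:C *: (f - p).
have Vu : V u by exact: subspaceZ.
have uu : H2dot u u = 1.
  rewrite (dot_ff (V2 Vu)) (H2normZ _ Hg) nc_real ger0_norm ?invr_ge0 ?H2norm_ge0//.
  by rewrite mulVf ?gt_eqF// expr1n.
have ub j : (j < k)%N -> H2dot u (b j) = 0.
  by move=> jk; rewrite (dotZl _ Hg (Hb j jk)) orth// mulr0.
pose b' i := if i == k then u else b i.
suff : P k.+1 by move=> /kmax; rewrite ltnn.
apply/asboolP; exists b'; split=> [i|i j]; rewrite /b' !ltnS.
  by rewrite leq_eqVlt; case: eqVneq => //= _ ik; exact: Vb.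
move=> ik jk; case: (eqVneq i k) => ek; case: (eqVneq j k) => fk.
- by rewrite uu ek fk eqxx.
- have jk' : (j < k)%N by rewrite ltn_neqAle fk.
  by rewrite (ub j jk') ek eq_sym (negbTE fk).
- have ik' : (i < k)%N by rewrite ltn_neqAle ek.
  by rewrite -(dot_cj (V2 Vu) (Hb i ik')) (ub i ik') cj0 fk (negbTE ek).
- have jk' : (j < k)%N by rewrite ltn_neqAle fk.
  have ik' : (i < k)%N by rewrite ltn_neqAle ek.
  exact: ob.
Qed.

(** The first m + 1 iterates of v are dependent, so some nonzero polynomial in T kills v, and it
    splits into linear factors. No matrix of T is formed. *)
Lemma eigenvector (T : (Bn -> C) -> (Bn -> C)) v :
  (forall f, V f -> V (T f)) -> (forall (a : C) f g, V f -> V g -> T (a *: f + g) = a *: T f + T g) ->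
  V v -> v <> 0 -> exists u (al : C), [/\ V u, u <> 0 & T u = al *: u].
Proof.
move=> VT Tl Vv v0.
have T0 : T 0 = 0.
  by have := Tl (-1) 0 0 V0 V0; rewrite !scaleN1r oppr0 addr0 addNr.
have TZ (a : C) f : V f -> T (a *: f) = a *: T f.
  by move=> Vf; rewrite -[a *: f]addr0 Tl// T0 addr0.
have TD f g : V f -> V g -> T (f + g) = T f + T g.
  by move=> Vf Vg; rewrite -[f in LHS]scale1r Tl// scale1r.
have Vit k f : V f -> V (iter k T f) by move=> Vf; elim: k => //= k; exact: VT.
pose ev (p : {poly C}) f : Bn -> C := \sum_(i < size p) p`_i *: iter i T f.
have evE (p : {poly C}) k f : (size p <= k)%N -> ev p f = \sum_(i < k) p`_i *: iter i T f.
  move=> pk; rewrite /ev (big_ord_widen k (fun i => p`_i *: iter i T f) pk) big_mkcond.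
  apply: eq_bigr => i _; case: ifP => // /negbT; rewrite -leqNgt => ip.
  by rewrite nth_default// scale0r.
have Vev p f : V f -> V (ev p f).
  by move=> Vf; apply: subspace_sumP => i; exact/subspaceZ/Vit.
have Tsum (I : Type) (r : seq I) (F : I -> Bn -> C) : (forall i, V (F i)) ->
    T (\sum_(i <- r) F i) = \sum_(i <- r) T (F i).
  move=> VF; elim: r => [|i r ih]; first by rewrite !big_nil.
  by rewrite !big_cons TD ?ih//; exact: subspace_sum.
have evX (p : {poly C}) a f : V f -> ev (p * ('X - a%:P)) f = T (ev p f) - a *: ev p f.
  move=> Vf; have sz : (size (p * ('X - a%:P))%R <= (size p).+1)%N.
    have [->|p0] := eqVneq p 0; first by rewrite mul0r size_poly0.
    by rewrite size_Mmonic ?monicXsubC// size_XsubC addn2.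
  rewrite (evE _ _ _ sz) /ev Tsum; last by move=> i; exact/subspaceZ/Vit.
  have -> : \sum_(i < size p) T (p`_i *: iter i T f) = \sum_(i < size p) p`_i *: iter i.+1 T f.
    by apply: eq_bigr => i _; rewrite TZ//; exact: Vit.
  rewrite mulrBr.
  under eq_bigr do rewrite coefB coefMX coefMC scalerBl.
  rewrite sumrB; congr (_ - _).
    rewrite big_ord_recl/= scale0r add0r; apply: eq_bigr => i _.
    by rewrite /bump.
  rewrite big_ord_recr/= nth_default// mul0r scale0r addr0 scaler_sumr.
  by apply: eq_bigr => i _; rewrite scalerA mulrC.
have [a [i ai] ha] := vectors_dependent (u := fun i : 'I_m.+1 => iter i T v) (fun i => Vit i v Vv) (ltnSn m).
pose p : {poly C} := \poly_(i < m.+1) a (inord i).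
have p0 : p != 0.
  apply/eqP => /(congr1 (fun q : {poly C} => q`_i)); rewrite coef0 coef_poly ltn_ord inord_val.
  exact/eqP.
have pv : ev p v = 0.
  rewrite (evE _ m.+1) ?size_poly// -[RHS]ha; apply: eq_bigr => j _.
  by rewrite coef_poly ltn_ord inord_val.
have [rs prs] := closed_field_poly_normal p.
(* The first factor of p that kills the vector yields an eigenvector. *)
have key : forall (l : seq C) (q : {poly C}), ev q v <> 0 ->
    ev (q * \prod_(z <- l) ('X - z%:P)) v = 0 ->
    exists u (al : C), [/\ V u, u <> 0 & T u = al *: u].
  elim=> [|z l ih] q q0; first by rewrite big_nil mulr1.
  rewrite big_cons mulrA => h; case: (pselect (ev (q * ('X - z%:P)) v = 0)) => hz; last exact: (ih _ hz).
  exists (ev q v), z; split => //; first exact: Vev.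
  by apply/eqP; rewrite -subr_eq0 -evX// hz.
apply: (key rs (lead_coef p)%:P); last by rewrite mul_polyC -prs.
have lp : lead_coef p != 0 by rewrite lead_coef_eq0.
rewrite (evE _ 1%N) ?size_polyC ?lp// big_ord1 coefC eqxx /= => h.
by apply: v0; rewrite -[v]scale1r -(mulVf lp) -scalerA h scaler0.
Qed.

End subspace.

End finite_dimension.

Section subspace_projection.

Lemma subspace_proj (V : set (Bn -> C)) m (s : 'I_m -> Bn -> C) : V `<=` H2 -> V 0 ->
  (forall (a : C) f g, V f -> V g -> V (a *: f + g)) ->
  (forall f, V f -> exists c : 'I_m -> C, f = \sum_k c k *: s k) ->
  forall f, H2 f -> exists2 p, V p & forall h, V h -> H2dot p h = H2dot f h.
Proof.
move=> V2 V0 Vl Vs f hf; have [k [b [Vb ob fb]]] := orthonormal_basis V2 V0 Vl Vs.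
have hb (i : 'I_k) : H2 (b i) by exact: (V2 _ (Vb i (ltn_ord i))).
pose g := \sum_(i < k) H2dot f (b i) *: b i.
have Vg : V g.
  by apply: (subspace_sum V0 Vl) => i; apply: (subspaceZ V0 Vl); exact: Vb.
exists g; first exact: Vg.
move=> h Vh; have hh := V2 _ Vh.
rewrite /g (dot_suml _ (fun i => H2Z _ (hb i)) hh).
have hZ (i : 'I_k) : H2 (H2dot h (b i) *: b i) := H2Z _ (hb i).
rewrite [in RHS](fb h Vh) -(dot_cj (H2_sum _ hZ) hf) (dot_suml _ hZ hf) cj_sum.
apply: eq_bigr => i _; apply: (etrans (dotZl _ (hb i) hh)).
apply: (etrans _ (congr1 cj (esym (dotZl _ (hb i) hf)))).
apply: (etrans (mulrC _ _)); apply: (etrans _ (esym (cjM _ _))).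
exact: (congr2 *%R (esym (dot_cj hh (hb i))) (esym (dot_cj (hb i) hf))).
Qed.

End subspace_projection.

(** * Finite-dimensional quotient modules *)

Section quotient_modules.
Variable Q : set (Bn -> C).
Hypotheses (qm : quotient_module Q) (fd : finite_dimensional Q).

(** * The binomial series *)

Section binomial_series.

Lemma le_powr (x y : R) N : 0 <= x -> x <= y -> x ^+ N <= y ^+ N.
Proof. by move=> x0 xy; rewrite lerXn2r// nnegrE// (le_trans x0). Qed.

Lemma bin_shift m k : 'C(m.+1 + k.+1, k.+1) = ('C(m + k.+1, k.+1) + 'C(m.+1 + k, k))%N.
Proof. by rewrite addSn binS addnS addSn. Qed.

Definition binsum (F : nzRingType) m N (y : F) : F := \sum_(k < N) 'C(m + k, k)%:R * y ^+ k.

Lemma binsum_rec (F : comNzRingType) m N (y : F) :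
  (1 - y) * binsum m.+1 N.+1 y = binsum m N.+1 y - 'C(m.+1 + N, N)%:R * y ^+ N.+1.
Proof.
have E M : binsum m.+1 M.+1 y = binsum m M.+1 y + y * binsum m.+1 M y.
  rewrite /binsum !big_ord_recl !bin0 !expr0 -addrA; congr (_ + _).
  rewrite mulr_sumr -big_split /=; apply: eq_bigr => i _.
  by rewrite /bump /= add1n bin_shift natrD mulrDl exprS; congr (_ + _); ring.
have L : binsum m.+1 N.+1 y = binsum m.+1 N y + 'C(m.+1 + N, N)%:R * y ^+ N.
  by rewrite /binsum big_ord_recr.
by rewrite mulrBl mul1r {1}E L exprS; ring.
Qed.

Lemma binsum0 (F : comNzRingType) N (y : F) : (1 - y) * binsum 0 N y = 1 - y ^+ N.
Proof.
rewrite /binsum; under eq_bigr do rewrite add0n binn mul1r.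
by have := subrX1 y N; rewrite -(opprB y 1) mulNr => <-; rewrite opprB.
Qed.

Lemma binsum_le m N (s : R) : 0 <= s -> s < 1 -> (1 - s) ^+ m.+1 * binsum m N s <= 1.
Proof.
move=> s0 s1; case: N => [|N]; first by rewrite /binsum big_ord0 mulr0.
have s1' : 0 <= 1 - s by rewrite subr_ge0 ltW.
elim: m => [|m ih]; first by rewrite expr1 binsum0 gerBl exprn_ge0.
rewrite exprSr -mulrA binsum_rec mulrBr; apply: le_trans ih.
by rewrite gerBl mulr_ge0 ?exprn_ge0// mulr_ge0 ?exprn_ge0.
Qed.

Lemma bin_le m k (s : R) : 0 <= s -> s < 1 -> 'C(m + k, k)%:R * s ^+ k <= (1 - s) ^- m.+1.
Proof.
move=> s0 s1; have p0 : 0 < (1 - s) ^+ m.+1 by rewrite exprn_gt0// subr_gt0.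
rewrite -(ler_pM2l p0) mulfV ?gt_eqF//; apply: le_trans (binsum_le m k.+1 s0 s1).
apply: ler_wpM2l; first exact: ltW.
rewrite /binsum big_ord_recr /= lerDr.
by apply: sumr_ge0 => i _; rewrite mulr_ge0 ?exprn_ge0.
Qed.

(** A term of the binomial series at s, chosen between q and 1, is bounded by its sum (1 -
    s)^(-m-1); passing from s to q leaves the ratio q / s. The polynomial growth of the dimensions
    is thus absorbed by a slightly larger ratio. *)
Lemma bin_geo m (q : R) : 0 <= q -> q < 1 -> exists K t : R, [/\ 0 <= K, 0 <= t < 1 &
  forall k, 'C(m + k, k)%:R * q ^+ k <= K * t ^+ k].
Proof.
move=> q0 q1; pose s := (1 + q) / 2.
have s0 : 0 < s by rewrite /s; lra. have s1 : s < 1 by rewrite /s; lra.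
have qs : q < s by rewrite /s; lra.
exists ((1 - s) ^- m.+1), (q / s); split.
- by rewrite invr_ge0 exprn_ge0// subr_ge0 ltW.
- by rewrite divr_ge0 ?(ltW s0)//= ltr_pdivrMr// mul1r.
move=> k; have := bin_le m k (ltW s0) s1.
have t0 : 0 <= (q / s) ^+ k by rewrite exprn_ge0// divr_ge0// ltW.
move=> /(ler_wpM2r t0); apply: le_trans.
by rewrite -mulrA -exprMn mulrCA mulfV ?gt_eqF// mulr1.
Qed.

(* (1 - y)^-(m+1) = sum_k 'C(m + k, k) y^k *)
Lemma binsum_lim m (y : C) : nc y < 1 -> exists K t : R, [/\ 0 <= K, 0 <= t < 1 &
  forall N, nc ((1 - y) ^+ m.+1 * binsum m N.+1 y - 1) <= K * t ^+ N].
Proof.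
move=> y1; elim: m => [|m [K [t [K0 /andP[t0 t1] h]]]].
  exists 1, (nc y); split; rewrite ?nc_ge0 ?y1// => N.
  rewrite expr1 binsum0 addrAC subrr add0r ncN ncX mul1r exprS ler_piMl ?exprn_ge0 ?nc_ge0//.
  exact: ltW.
have [K' [t' [K'0 /andP[t'0 t'1] h']]] := bin_geo m.+1 (nc_ge0 y) y1.
have yK : 0 <= nc ((1 - y) ^+ m.+1) by exact: nc_ge0.
exists (K + nc ((1 - y) ^+ m.+1) * K'), (Num.max t t'); split.
- by rewrite addr_ge0// mulr_ge0.
- by rewrite le_max t0 gt_max t1.
move=> N; rewrite exprSr -mulrA binsum_rec mulrBr addrAC.
apply: le_trans (ncB _ _) _; rewrite mulrDl; apply: lerD.
  apply: le_trans (h N) _; apply: ler_wpM2l => //; apply: le_powr => //.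
  by rewrite le_max lexx.
rewrite ncM -mulrA ler_wpM2l// ncM ncX.
have -> : nc ('C(m.+1 + N, N)%:R : C) = 'C(m.+1 + N, N)%:R.
  rewrite (_ : 'C(m.+1 + N, N)%:R = ('C(m.+1 + N, N)%:R : R)%:C); last by rewrite rmorph_nat.
  by rewrite nc_real normr_nat.
apply: (@le_trans _ _ (K' * t' ^+ N)).
  apply: le_trans (h' N); rewrite ler_wpM2l// exprS ler_piMl ?exprn_ge0 ?nc_ge0//.
  exact: ltW.
by apply: ler_wpM2l => //; apply: le_powr => //; rewrite le_max lexx orbT.
Qed.

End binomial_series.

(** * The backward shifts on Q *)

Section quotient.
Implicit Types (z w e : Cn) (f g h : Bn -> C).

Lemma qH2 f : Q f -> H2 f. Proof. exact: (qm_sub qm). Qed.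
Lemma q0 : Q 0. Proof. exact: qm_zero qm. Qed.
Lemma qZ (a : C) f : Q f -> Q (a *: f).
Proof. exact: (subspaceZ q0 (qm_linear qm)). Qed.
Lemma qD f g : Q f -> Q g -> Q (f + g).
Proof. exact: (subspaceD (qm_linear qm)). Qed.
Lemma qB f g : Q f -> Q g -> Q (f - g).
Proof. exact: (subspaceB (qm_linear qm)). Qed.
Lemma q_sum (I : Type) (r : seq I) (F : I -> Bn -> C) : (forall i, Q (F i)) -> Q (\sum_(i <- r) F i).
Proof. exact: (subspace_sum q0 (qm_linear qm)). Qed.

Lemma q_basis : exists k b, [/\ forall i, (i < k)%N -> Q (b i), orthonormal b k &
  forall f, Q f -> f = \sum_(i < k) H2dot f (b i) *: b i].
Proof.
have [m [s [Qs hs]]] := fd.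
exact: (orthonormal_basis qH2 q0 (qm_linear qm) hs).
Qed.

Lemma H2_1 : H2 (cst 1 : Bn -> C).
Proof. by apply: palg_H2; exact: palg_cst. Qed.

Lemma H2_coord i f : H2 f -> H2 (mult (coord_fun i) f).
Proof.
move=> hf; have [] // := @H2_mult (coord_fun i) f 1 (@analytic_coord i) ler01 _ hf.
by move=> z z1; rewrite zero_ext_coord//; apply: le_trans (nc_coord _ _) (ltW z1).
Qed.

(* The adjoint of multiplication by the i-th coordinate, restricted to Q. *)
Definition Aop (i : 'I_n) f : Bn -> C :=
  xget 0 [set g | Q g /\ adjoint_eq (mult (coord_fun i)) f g].

Lemma AopP i f : Q f -> Q (Aop i f) /\
  forall h, H2 h -> H2dot (mult (coord_fun i) h) f = H2dot h (Aop i f).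
Proof.
move=> Qf; have [g Qg ag] := qm_invariant qm i Qf.
have [] := @xgetPex _ 0 [set g | Q g /\ adjoint_eq (mult (coord_fun i)) f g]; first by exists g.
rewrite -/(Aop i f) => QA [_ hA]; split; [exact: QA|].
by move=> h hh; exact: (hA h hh).
Qed.

Opaque Aop H2.

Lemma dot_eq f g : H2 f -> H2 g -> (forall h, H2 h -> H2dot h f = H2dot h g) -> f = g.
Proof.
move=> hf hg hh; apply/eqP; rewrite -subr_eq0; apply/eqP.
have hfg : H2 (f - g) by exact: H2B.
apply: (H2norm_eq0 hfg); rewrite (norm_dot hfg).
by rewrite (dotBr hf hg hfg) hh// subrr /= sqrtr0.
Qed.

Lemma q_dot_eq f g : Q f -> Q g -> (forall h, Q h -> H2dot f h = H2dot g h) -> f = g.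
Proof.
move=> Qf Qg hh; have [hf hg] := (qH2 Qf, qH2 Qg).
apply/eqP; rewrite -subr_eq0; apply/eqP; have Qfg := qB Qf Qg.
apply: (H2norm_eq0 (qH2 Qfg)); rewrite (norm_dot (qH2 Qfg)).
by rewrite (dotBl hf hg (qH2 Qfg)) hh// subrr /= sqrtr0.
Qed.

Lemma multD phi f g : mult phi (f + g) = mult phi f + mult phi g.
Proof. by apply/funext => z; rewrite /mult !fctE mulrDr. Qed.
Lemma multZ phi (a : C) f : mult phi (a *: f) = a *: mult phi f.
Proof. by apply/funext => z; rewrite /mult !fctE mulrCA. Qed.
Lemma multB phi f g : mult phi (f - g) = mult phi f - mult phi g.
Proof. by apply/funext => z; rewrite /mult !fctE mulrBr. Qed.
Lemma multA phi f g : mult phi (mult f g) = mult (mult phi f) g.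
Proof. by apply/funext => z; rewrite /mult mulrA. Qed.
Lemma multC f g : mult f g = mult g f.
Proof. by apply/funext => z; rewrite /mult mulrC. Qed.
Lemma mult1 f : mult f (cst 1) = f.
Proof. by apply/funext => z; rewrite /mult mulr1. Qed.

Lemma Aop_lin i (a : C) f g : Q f -> Q g -> Aop i (a *: f + g) = a *: Aop i f + Aop i g.
Proof.
move=> Qf Qg; have Qfg := qm_linear qm a Qf Qg.
have [QA hA] := AopP i Qfg; have [QAf hAf] := AopP i Qf; have [QAg hAg] := AopP i Qg.
have [hf hg] := (qH2 Qf, qH2 Qg).
apply: dot_eq; [exact: qH2|exact/qH2/(qm_linear qm)|move=> h hh].
have hz := H2_coord i hh.
rewrite -(hA h hh) (dotDr (H2Z a hf) hg hz) (dotZr a hf hz).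
by rewrite (dotDr (H2Z a (qH2 QAf)) (qH2 QAg) hh) (dotZr a (qH2 QAf) hh) (hAf h hh) (hAg h hh).
Qed.

Lemma Aop_comm i j f : Q f -> Aop i (Aop j f) = Aop j (Aop i f).
Proof.
move=> Qf; have [Qi hi] := AopP i Qf; have [Qj hj] := AopP j Qf.
have [Qij hij] := AopP i Qj; have [Qji hji] := AopP j Qi.
apply: dot_eq; [exact: qH2|exact: qH2|move=> h hh].
apply: etrans (hji h hh); apply: etrans (hi _ (H2_coord j hh)).
apply: etrans (esym (hij h hh)) _; apply: etrans (esym (hj _ (H2_coord i hh))) _.
by rewrite multA multA (multC (coord_fun i)).
Qed.

Definition lin_fun e : Bn -> C := fun z : Bn => ip (val z) e.
(** The adjoint of multiplication by <., e>. The coefficients are not conjugated: they are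
    conjugated once in the Hermitian form and once more by the adjoint. *)
Definition Ae e f : Bn -> C := \sum_i (e ord0 i) *: Aop i f.

Opaque Ae.

Lemma lin_funE e : lin_fun e = \sum_i cj (e ord0 i) *: coord_fun i.
Proof.
rewrite /lin_fun; apply/funext => z; rewrite fct_sumE ipE; apply: eq_bigr => i _.
by rewrite mulrC.
Qed.

Lemma zero_ext_lin e z : en z < 1 -> ext (lin_fun e) z = ip z e.
Proof. by move=> z1; rewrite (zero_ext_in _ z1). Qed.

Lemma analytic_lin e : analytic (lin_fun e).
Proof. by have := analytic_ip e 1; rewrite /lin_fun; under eq_fun do rewrite expr1. Qed.

Lemma lin_bound e z : en e = 1 -> en z < 1 -> nc (ext (lin_fun e) z) <= en z.
Proof.
move=> e1 z1; rewrite zero_ext_lin//.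
by have := cauchy_schwarz_ip z e; rewrite e1 mulr1.
Qed.

Lemma H2_lin_mult e f : en e = 1 -> H2 f ->
  H2 (mult (lin_fun e) f) /\ H2norm (mult (lin_fun e) f) <= H2norm f.
Proof.
move=> e1 hf; rewrite -[X in _ <= X]mul1r.
apply: (H2_mult (analytic_lin e) ler01) hf => z z1.
exact: le_trans (lin_bound e1 z1) (ltW z1).
Qed.

Lemma AeP e f : Q f -> Q (Ae e f) /\
  forall h, H2 h -> H2dot (mult (lin_fun e) h) f = H2dot h (Ae e f).
Proof.
move=> Qf; have hA i := AopP i Qf; split.
  by apply: q_sum => i; exact: qZ (hA i).1.
move=> h hh; have hf := qH2 Qf.
have -> : mult (lin_fun e) h = \sum_i cj (e ord0 i) *: mult (coord_fun i) h.
  rewrite lin_funE; apply/funext => z; rewrite /mult fct_sumE.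
  rewrite fct_sumE mulr_suml; apply: eq_bigr => i _.
  exact: (esym (mulrA _ _ _)).
rewrite (dot_suml) => [|i|//]; last by apply: H2Z; exact: H2_coord.
rewrite -(dot_cj (qH2 (q_sum _ (fun i => qZ (e ord0 i) (hA i).1))) hh).
rewrite (dot_suml) => [|i|//]; last by apply: H2Z; exact: qH2 (hA i).1.
rewrite cj_sum; apply: eq_bigr => i _.
rewrite (dotZl _ (H2_coord i hh) hf) (dotZl _ (qH2 (hA i).1) hh) cjM.
by rewrite (dot_cj (qH2 (hA i).1) hh) (hA i).2.
Qed.

Definition lin_pow e k h : Bn -> C := iter k (mult (lin_fun e)) h.

Lemma lin_powP e k h : en e = 1 -> H2 h ->
  H2 (lin_pow e k h) /\ H2norm (lin_pow e k h) <= H2norm h.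
Proof.
move=> e1 hh; elim: k => [|k [hk nk]]; first by split.
have [h1 h2] := H2_lin_mult e1 hk; split; [exact: h1|exact: le_trans h2 nk].
Qed.

Lemma zero_ext_lin_pow e k h z : en z < 1 ->
  ext (lin_pow e k h) z = ip z e ^+ k * ext h z.
Proof.
move=> z1; elim: k => [|k ih]; first by rewrite expr0 mul1r.
by rewrite /lin_pow iterS -/(lin_pow e k h) zero_extM ih zero_ext_lin// exprS mulrA.
Qed.

Lemma Ae_iterP e k f : en e = 1 -> Q f -> Q (iter k (Ae e) f) /\
  forall h, H2 h -> H2dot (lin_pow e k h) f = H2dot h (iter k (Ae e) f).
Proof.
move=> e1 Qf; elim: k => [|k [Qk hk]]; first by split.
have [QA hA] := AeP e Qk; split; [exact: QA|move=> h hh].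
have -> : lin_pow e k.+1 h = lin_pow e k (mult (lin_fun e) h) by rewrite /lin_pow iterSr.
by rewrite (hk _ (H2_lin_mult e1 hh).1) (hA _ hh).
Qed.

Lemma Ae_norm e k f : en e = 1 -> Q f -> H2norm (iter k (Ae e) f) <= H2norm f.
Proof.
move=> e1 Qf; have [Qk hk] := Ae_iterP k e1 Qf.
set g := iter k (Ae e) f in Qk hk *.
have hg := qH2 Qk; have [hp np] := lin_powP k e1 hg.
have [g0|g0] := eqVneq (H2norm g) 0; first by rewrite g0 H2norm_ge0.
have gp : 0 < H2norm g by rewrite lt_neqAle eq_sym g0 H2norm_ge0.
rewrite -(ler_pM2l gp) -expr2.
have -> : H2norm g ^+ 2 = nc (H2dot g g) by rewrite (dot_ff hg) nc_real ger0_norm ?sqr_ge0.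
rewrite -hk//; apply: le_trans (dot_CS hp (qH2 Qf)) _.
by rewrite ler_wpM2r ?H2norm_ge0.
Qed.

Lemma left_lim_X k : left_lim (fun r => r%:C ^+ k : C) 1.
Proof.
elim: k => [|k ih]; first exact: left_lim_cst.
have idl : left_lim (fun r => r%:C : C) 1.
  move=> e e0; exists (Num.max 0 (1 - e)); first by rewrite le_max lexx gt_max ltr01 gtrDl oppr_lt0.
  move=> r; rewrite gt_max => /andP[r0 re] r1.
  rewrite (_ : r%:C - 1 = (r - 1)%:C); last by rewrite real_complexB.
  by rewrite nc_real distrC ger0_norm ?subr_ge0 ?(ltW r1)//; lra.
rewrite -[X in left_lim _ X](mulr1 (1 : C)).
by apply: eq_left_lim (left_limM idl ih) => r _ _; rewrite exprS.
Qed.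

End quotient.

Section geometric.

Lemma sqr_eq1 (x : R) : 0 <= x -> x ^+ 2 = 1 -> x = 1.
Proof. by move=> x0 /eqP; rewrite sqrp_eq1// => /eqP. Qed.

(** Halving every N steps gives the ratio q = 1 - 1 / (2 (N+1)), for which Bernoulli's inequality
    yields q^(N+1) >= 1/2. The factor 2 covers the first N steps, and N + 1 in place of N covers N =
    0. *)
Lemma half_decay (a : nat -> R) (N : nat) : (forall k, 0 <= a k) ->
  (forall k, a k.+1 <= a k) -> (forall k, a (k + N)%N <= 2^-1 * a k) ->
  forall k, a k <= 2 * (1 - (2 * N.+1%:R)^-1) ^+ k * a 0%N.
Proof.
move=> a0 amon ah; set q := 1 - _.
have N1 : 1 <= N.+1%:R :> R by rewrite ler1n.
have d0 : 0 < (2 * N.+1%:R)^-1 :> R by rewrite invr_gt0; lra.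
have d1 : (2 * N.+1%:R)^-1 <= 1 :> R by rewrite invf_le1; lra.
have q0 : 0 <= q by rewrite /q subr_ge0.
have q1 : q <= 1 by rewrite /q gerBl ltW.
have qN : 2^-1 <= q ^+ N.+1.
  apply: le_trans (bernoulli_pow N.+1 _); last by rewrite (ltW d0) d1.
  rewrite invfM mulrCA mulfV ?mulr1; last by lra.
  by lra.
have base k : (k <= N)%N -> a k <= 2 * q ^+ k * a 0%N.
  move=> kN; apply: (@le_trans _ _ (a 0%N)).
    elim: k {kN} => [|k ih]; [exact: lexx|exact: le_trans (amon k) ih].
  have h1 : q ^+ N.+1 <= q ^+ k by apply: ler_wiXn2l => //; exact: leqW.
  rewrite -[X in X <= _]mul1r; apply: ler_wpM2r; first exact: a0.
  by move: h1 qN; clear; move: (q ^+ _) (q ^+ _) => u v; lra.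
have aN k : a (k + N.+1)%N <= 2^-1 * a k.
  by rewrite addnS; apply: le_trans (amon _) (ah k).
move=> k; have [m] := ubnP k; elim: m k => // m ih k; rewrite ltnS => km.
have [kN|kN] := leqP k N; first exact: base.
have -> : k = (k - N.+1 + N.+1)%N by rewrite subnK.
apply: le_trans (aN _) _.
have /ih : (k - N.+1 < m)%N.
  by apply: leq_trans km; rewrite -subSn// subSS leq_subr.
move=> h; have -> : 2 * q ^+ (k - N.+1 + N.+1) * a 0%N = q ^+ N.+1 * (2 * q ^+ (k - N.+1) * a 0%N).
  by rewrite exprD; ring.
apply: (@le_trans _ _ (2^-1 * (2 * q ^+ (k - N.+1) * a 0%N))); first exact: ler_wpM2l.
by apply: ler_wpM2r qN; rewrite !mulr_ge0 ?exprn_ge0.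
Qed.

End geometric.

(** * Geometric decay of the components of functions of Q *)

Section quotient_decay.
Implicit Types (z w e : Cn) (f g h : Bn -> C).

Lemma lin_pow_dot e k f : en e = 1 -> H2 f ->
  (hom_dim k)%:R * H2dot f (lin_pow e k (cst 1)) = hc f k e.
Proof.
move=> e1 hf; have [hp _] := lin_powP k e1 (H2_1).
have L1 := left_limM (left_lim_cst (hom_dim k)%:R) (H2dot_lim hf hp).
have L2 : left_lim (fun r : R => r%:C ^+ k * r%:C ^+ k * hc f k e) (1 * 1 * hc f k e).
  apply: left_limM (left_lim_cst _); exact: left_limM (left_lim_X k) (left_lim_X k).
rewrite !mul1r in L2; apply: left_lim_uniq L1 _; apply: eq_left_lim L2 => r r0 r1.
have r01 : 0 <= r < 1 by rewrite (ltW r0) r1.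
have af := H2_an hf.
rewrite -mulrA -(hc_rep k af e1 _); last by rewrite r0 r1.
rewrite mulrCA; congr (_ * _).
have sP := sbm_rep e k af r01.
rewrite -(cintZ _ sP) /Ir; apply: cint_eqS.
- exact: (sbmZ _ sP).1.
- by have [] := sbmM (sbm_dilation af r01) (sbm_cj (sbm_dilation (H2_an hp) r01)).
move=> z z1; have rz : en (r%:C *: z) < 1.
  by rewrite eucl_normZ nc_real z1 mulr1 ger0_norm// ltW.
rewrite (zero_ext_lin_pow _ _ _ rz) zero_ext_cst// mulr1 ip_homX cjM cjX cjX.
by rewrite cj_real mulrCA.
Qed.

Lemma hc_Ae e k f : en e = 1 -> Q f ->
  hc f k e = (hom_dim k)%:R * H2dot (iter k (Ae e) f) (cst 1).
Proof.
move=> e1 Qf; have [QA hA] := Ae_iterP k e1 Qf.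
have [hp _] := lin_powP k e1 (H2_1).
rewrite -(lin_pow_dot k e1 (qH2 Qf)) -(dot_cj hp (qH2 Qf)) (hA _ (H2_1)).
by rewrite (dot_cj (H2_1) (qH2 QA)).
Qed.

Lemma lin_pow_low e e' N k g : H2 g -> en e = 1 -> en e' = 1 -> (k < N)%N ->
  hc (lin_pow e N g) k e' = 0.
Proof.
move=> hg e1 e1' kN; have [hp _] := lin_powP N e1 hg.
have h1 : (2^-1 : R) < 1 by lra.
have [M M0 hM] := analytic_bounded (H2_an hg) h1.
apply: (hc_low (K := M) (H2_an hp) kN M0) e1' => z z2.
have z1 : en z < 1 by apply: le_lt_trans h1.
rewrite (zero_ext_lin_pow _ _ _ z1) ncM ncX mulrC; apply: ler_pM.
- exact: nc_ge0.
- exact/exprn_ge0/nc_ge0.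
- exact: hM.
apply: le_powr; first exact: nc_ge0.
by have := cauchy_schwarz_ip z e; rewrite e1 mulr1.
Qed.

(** For g = A^N f one has |g|^2 = <f, l^N g> with l = <., e>, and l^N g vanishes to order N at 0. It
    pairs with each basis vector through the tail of that vector only. With tails of size [del], the
    k basis vectors contribute at most k [del] <= 1/2, for all directions e at once. *)
Lemma Ae_half : exists N, forall e f, en e = 1 -> Q f ->
  H2norm (iter N (Ae e) f) <= 2^-1 * H2norm f.
Proof.
have [k [b [Qb ob fb]]] := q_basis.
pose del : R := (2 * k.+1%:R)^-1.
have k1 : 1 <= k.+1%:R :> R by rewrite ler1n.
have del0 : 0 < del by rewrite /del invr_gt0; lra.
have del20 : 0 < del ^+ 2 by rewrite exprn_gt0.
have tails i : exists N, (i < k)%N -> forall M, \sum_(N <= j < M) dsq j (b i) <= del ^+ 2.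
  have [ik|ik] := ltnP i k; last by exists 0%N.
  by have [N hN] := dsq_tail (qH2 (Qb i ik)) del20; exists N => _; exact: hN.
have {tails} [N hN] := choice tails.
exists (\max_(i < k) N i)%N => e f e1 Qf; set N0 := (\max_(i < k) N i)%N.
have [QA hA] := Ae_iterP N0 e1 Qf.
move: QA hA; move: (iter N0 _ _) => g Qg hA.
have [hf hg] := (qH2 Qf, qH2 Qg).
have [hp np] := lin_powP N0 e1 hg.
have bnd i : (i < k)%N -> nc (H2dot (b i) (lin_pow e N0 g)) <= del * H2norm g.
  move=> ik; have hb := qH2 (Qb i ik).
  have low j e' : (j < N i)%N -> en e' = 1 -> hc (lin_pow e N0 g) j e' = 0.
    move=> jN e1'; apply: lin_pow_low hg e1 e1' _; apply: leq_trans jN _.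
    exact: (leq_bigmax (Ordinal ik)).
  have := dot_tail hb hp (ltW del20) (hN i ik) low.
  move: (H2dot (b i) _) (H2norm_ge0 (lin_pow e N0 g)) np (nc_ge0 (H2dot (b i) (lin_pow e N0 g))).
  move=> c; move: (H2norm (lin_pow e N0 g)) => x x0 xg c0; rewrite -exprMn => h.
  apply: (@le_trans _ _ (del * x)); last by apply: ler_wpM2l xg; exact: ltW.
  by move: h; rewrite ler_sqr ?nnegrE ?nc_ge0// mulr_ge0// ltW.
have [g0|g0] := eqVneq (H2norm g) 0.
  by rewrite g0 mulr_ge0 ?H2norm_ge0// invr_ge0.
have gp : 0 < H2norm g by rewrite lt_neqAle eq_sym g0 H2norm_ge0.
rewrite -(ler_pM2l gp) -expr2.
have -> : H2norm g ^+ 2 = nc (H2dot f (lin_pow e N0 g)).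
  rewrite -(dot_cj hp hf) nc_cj (hA _ hg) (dot_ff hg) nc_real ger0_norm//.
  by rewrite sqr_ge0.
have Qb' (i : 'I_k) : H2 (H2dot f (b i) *: b i) by apply: H2Z; exact: (qH2 (Qb i (ltn_ord i))).
rewrite {1}(fb f Qf) (dot_suml _ Qb' hp); apply: le_trans (nc_sum _ _ _) _.
apply: (@le_trans _ _ (\sum_(i < k) (H2norm f * (del * H2norm g)))).
  apply: ler_sum => i _; have hb := qH2 (Qb i (ltn_ord i)).
  rewrite (dotZl _ hb hp) ncM; apply: ler_pM; [exact: nc_ge0|exact: nc_ge0| |exact: bnd].
  apply: le_trans (dot_CS hf hb) _.
  have : H2norm (b i) ^+ 2 = 1.
    have /(congr1 Re) := dot_ff hb; rewrite ob// eqxx /= => <-; exact: erefl.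
  move=> /(sqr_eq1 (H2norm_ge0 (b i))) ->; rewrite mulr1.
  exact: lexx.
rewrite sumr_const card_ord.
have kd : k%:R * del <= 2^-1.
  by rewrite /del invfM mulrCA ler_piMr ?invr_ge0// ler_pdivrMr ?mul1r ?ler_nat//; lra.
have fg : 0 <= H2norm f * H2norm g by rewrite mulr_ge0 ?H2norm_ge0.
move: (H2norm f) (H2norm g) (ler_wpM2r fg kd) => x y; clear => h.
rewrite -[_ *+ k]mulr_natl (_ : k%:R * (x * (del * y)) = k%:R * del * (x * y)); last by ring.
by rewrite (_ : y * (2^-1 * x) = 2^-1 * (x * y))//; ring.
Qed.

Lemma Ae_decay : exists2 q : R, 0 <= q < 1 & forall e f k, en e = 1 -> Q f ->
  H2norm (iter k (Ae e) f) <= 2 * q ^+ k * H2norm f.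
Proof.
have [N hN] := Ae_half.
exists (1 - (2 * N.+1%:R)^-1).
  have N1 : 1 <= N.+1%:R :> R by rewrite ler1n.
  have d0 : 0 < (2 * N.+1%:R)^-1 :> R by rewrite invr_gt0; lra.
  have d1 : (2 * N.+1%:R)^-1 <= 1 :> R by rewrite invf_le1; lra.
  by rewrite subr_ge0 d1 gtrBl d0.
move=> e f k e1 Qf.
apply: (half_decay (a := fun k => H2norm (iter k (Ae e) f))) => {}k.
- exact: H2norm_ge0.
- have [Qk _] := Ae_iterP k e1 Qf.
  by have := Ae_norm 1 e1 Qk.
- have [Qk _] := Ae_iterP k e1 Qf.
  by rewrite addnC iterD; exact: hN.
Qed.

(** The component in direction e is [hom_dim k] times <A^k f, 1>; the geometric decay of A^k
    outweighs the polynomial growth of the dimension. *)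
Lemma hc_decay f : Q f -> exists K t : R, [/\ 0 <= K, 0 <= t < 1 &
  forall e k, en e = 1 -> nc (hc f k e) <= K * t ^+ k].
Proof.
move=> Qf; have [q /andP[q0 q1] hq] := Ae_decay.
have [K [t [K0 t01 h]]] := bin_geo n.-1 q0 q1.
pose L : R := 2 * H2norm f * H2norm (cst 1 : Bn -> C).
have L0 : 0 <= L by rewrite /L !mulr_ge0 ?H2norm_ge0.
exists (L * K), t; split; [exact: mulr_ge0|exact: t01|move=> e k e1].
have [Qk _] := Ae_iterP k e1 Qf.
rewrite (hc_Ae k e1 Qf) ncM.
have -> : nc ((hom_dim k)%:R : C) = (hom_dim k)%:R.
  rewrite (_ : (hom_dim k)%:R = ((hom_dim k)%:R : R)%:C); last by rewrite rmorph_nat.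
  by rewrite nc_real normr_nat.
apply: (@le_trans _ _ ((hom_dim k)%:R * (L * q ^+ k))).
  apply: ler_wpM2l; first exact: ler0n.
  apply: le_trans (dot_CS (qH2 Qk) (H2_1)) _.
  apply: le_trans (ler_wpM2r (H2norm_ge0 _) (hq e f k e1 Qf)) _.
  by rewrite le_eqVlt; apply/orP; left; apply/eqP; rewrite /L; ring.
rewrite mulrCA -mulrA; apply: ler_wpM2l => //.
have -> : hom_dim k = 'C(n.-1 + k, k).
  by rewrite /hom_dim -subn1 -[in RHS]subn1 addnC -addnBA// addnC.
exact: h.
Qed.

Lemma geo_sum_le (t : R) N M : 0 <= t -> t < 1 -> \sum_(N <= k < M) t ^+ k <= t ^+ N / (1 - t).
Proof.
move=> t0 t1; have t1' : 0 < 1 - t by rewrite subr_gt0.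
rewrite ler_pdivlMr//; have [MN|NM] := leqP M N.
  by rewrite big_geq// mul0r exprn_ge0.
rewrite (_ : _ * _ = t ^+ N - t ^+ M); first by rewrite gerBl exprn_ge0.
rewrite mulrC mulr_sumr; under eq_bigr do rewrite mulrBl mul1r -exprS -opprB.
by rewrite sumrN telescope_sumr ?(ltnW NM)// opprB.
Qed.

(** The homogeneous expansion converges uniformly on the whole ball, since the ratio of [hc_decay]
    does not depend on the direction. *)
Lemma q_palg f : Q f -> palg f.
Proof.
move=> Qf; have af := H2_an (qH2 Qf); split; first exact: af.
have [K [t [K0 /andP[t0 t1] h]]] := hc_decay Qf.
move=> eps eps0; have t1' : 0 < 1 - t by rewrite subr_gt0.
have [N hN] : exists N, K * (t ^+ N / (1 - t)) <= eps.
  have K1 : 0 < K + 1 by rewrite ltr_wpDl.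
  have [N hN] := geo_small t0 t1 (divr_gt0 (mulr_gt0 eps0 t1') K1).
  exists N; have := ltW (hN N (leqnn _)); rewrite ler_pdivlMr// mulrA ler_pdivrMr//.
  by apply: le_trans; rewrite mulrC ler_wpM2l ?exprn_ge0// lerDl.
exists (fun z => \sum_(k < N) hc f k z); first by apply: ispoly_sum => k; exact: hc_poly.
move=> z z1; have [e e1 ze] := unit_row z.
set r := en z in z1 ze; have r0 : 0 <= r := eucl_norm_ge0 z.
pose s := (1 + r) / 2.
have s0 : 0 < s by rewrite /s; lra.
have s1 : s < 1 by rewrite /s; lra.
have rs : r < s by rewrite /s; lra.
have [M M0 hM] := analytic_bounded af s1.
have q01 : 0 <= r / s < 1 by rewrite divr_ge0 ?(ltW s0)//= ltr_pdivrMr// mul1r.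
apply: (le_geo (K := M * (s / (s - r))) q01) => m.
have T := hc_taylor af s0 s1 hM (N + m)%N rs.
rewrite -(subrK (\sum_(k < N + m) hc f k z) (ext f z)) -addrA.
apply: le_trans (ncD _ _) _; rewrite [X in _ <= X]addrC; apply: lerD.
  apply: le_trans T _; rewrite -/r.
  rewrite (_ : M * (r / s) ^+ (N + m) * (s / (s - r)) = M * (s / (s - r)) * (r / s) ^+ (N + m)); last by rewrite mulrAC.
  apply: ler_wpM2l.
    by rewrite mulr_ge0// divr_ge0 ?subr_ge0 ?(ltW s0) ?(ltW rs).
  by case/andP: q01 => h1 h2; apply: ler_wiXn2l; rewrite ?(ltW h2)// leq_addl.
apply: le_trans hN; apply: (@le_trans _ _ (K * \sum_(N <= k < N + m) t ^+ k)); last first.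
  by apply: ler_wpM2l => //; exact: geo_sum_le.
rewrite -!(big_mkord predT (fun k => hc f k z)) (big_cat_nat (leq0n N) (leq_addr m N)) /=.
rewrite addrAC subrr add0r mulr_sumr; apply: le_trans (nc_sum _ _ _) _.
apply: ler_sum => k _; rewrite ze (hc_hom k _ _ af) ncM ncX nc_real ger0_norm//.
apply: le_trans (h e k e1); rewrite ler_piMl ?nc_ge0//.
by apply: exprn_ile1 => //; exact: ltW.
Qed.

End quotient_decay.

Section scalar_facts.
Implicit Types (x y z s : R) (t c d : R[i]).

Lemma eq_to_le x y : x = y -> x <= y. Proof. by move=> ->. Qed.
Lemma eq_le_trans x y z : x = y -> y <= z -> x <= z. Proof. by move=> ->. Qed.

Lemma nc_real_mulC x y : 0 <= x -> nc x%:C * y = y * x.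
Proof. by move=> x0; rewrite nc_real ger0_norm// mulrC. Qed.

Lemma Re_lincomb t c d s : Re (t * (s%:C * c - d)) = s * Re (t * c) - Re (t * d).
Proof. by case: t c d => [t1 t2] [c1 c2] [d1 d2] /=; ring. Qed.

Lemma quadratic_gap (s2 a b c x y q : R) :
  s2 * a + 2 * y + q * c <= s2 * (a + 2 * x + q * b) ->
  0 <= 0 + 2 * (s2 * x - y) + q * (s2 * b - c).
Proof. by move=> h; have : 0 <= s2 * (a + 2 * x + q * b) - (s2 * a + 2 * y + q * c); [rewrite subr_ge0|lra]. Qed.

End scalar_facts.

Lemma subr_addr2 (V : zmodType) (a b c d : V) : b = d -> (a + b) - (c + d) = a - c.
Proof. by move=> ->; rewrite opprD addrACA subrr addr0. Qed.

(** * The projection onto Q and its orthocomplement *)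

Section projection.
Implicit Types (z w e : Cn) (f g h u : Bn -> C).

Lemma projP f : H2 f -> Q (proj Q f) /\ forall h, Q h -> H2dot (proj Q f) h = H2dot f h.
Proof.
move=> hf; have [k [b [Qb ob fb]]] := q_basis.
have hb (i : 'I_k) : H2 (b i) by exact: (qH2 (Qb i (ltn_ord i))).
pose g := \sum_(i < k) H2dot f (b i) *: b i.
have Qg : Q g by apply: q_sum => i; apply: qZ; exact: Qb.
have hg := qH2 Qg.
have gE h : Q h -> H2dot g h = H2dot f h.
  move=> Qh; have hh := qH2 Qh.
  rewrite /g (dot_suml _ (fun i => H2Z _ (hb i)) hh).
  have hZ (i : 'I_k) : H2 (H2dot h (b i) *: b i) := H2Z _ (hb i).
  rewrite [in RHS](fb h Qh) -(dot_cj (H2_sum _ hZ) hf) (dot_suml _ hZ hf) cj_sum.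
  apply: eq_bigr => i _; apply: (etrans (dotZl _ (hb i) hh)).
  apply: (etrans _ (congr1 cj (esym (dotZl _ (hb i) hf)))).
  apply: (etrans (mulrC _ _)); apply: (etrans _ (esym (cjM _ _))).
  exact: (congr2 *%R (esym (dot_cj hh (hb i))) (esym (dot_cj (hb i) hf))).
have [|] := @xgetPex _ 0 [set g | Q g /\ forall h, Q h -> H2dot (f - g) h = 0].
  exists g; split; first exact: Qg.
  by move=> h Qh; rewrite (dotBl hf hg (qH2 Qh)) (gE h Qh) subrr.
rewrite -/(proj Q f) => Qp hp; split; first exact: Qp.
move=> h Qh; apply/esym/eqP; rewrite -subr_eq0; apply/eqP.
exact: (etrans (esym (dotBl hf (qH2 Qp) (qH2 Qh))) (hp h Qh)).
Qed.

Opaque Defs.proj.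

Lemma proj_eq f g : H2 f -> Q g -> (forall h, Q h -> H2dot g h = H2dot f h) -> proj Q f = g.
Proof.
move=> hf Qg gf; have [Qp hp] := projP hf.
by apply: (q_dot_eq Qp Qg) => h Qh; rewrite (hp h Qh) (gf h Qh).
Qed.

Lemma proj_congr f g : H2 f -> H2 g -> (forall h, Q h -> H2dot f h = H2dot g h) -> proj Q f = proj Q g.
Proof.
move=> hf hg fg; have [Qp hp] := projP hg; apply: (proj_eq hf Qp) => h Qh.
by rewrite (hp h Qh) (fg h Qh).
Qed.

Lemma proj_id f : Q f -> proj Q f = f.
Proof. by move=> Qf; apply: (proj_eq (qH2 Qf) Qf). Qed.

Lemma projD f g : H2 f -> H2 g -> proj Q (f + g) = proj Q f + proj Q g.
Proof.
move=> hf hg; have [Qf hpf] := projP hf; have [Qg hpg] := projP hg.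
apply: (proj_eq (H2D hf hg) (qD Qf Qg)) => h Qh; have hh := qH2 Qh.
rewrite (dotDl (qH2 Qf) (qH2 Qg) hh) (dotDl hf hg hh).
exact: (congr2 +%R (hpf h Qh) (hpg h Qh)).
Qed.

Lemma projZ (a : C) f : H2 f -> proj Q (a *: f) = a *: proj Q f.
Proof.
move=> hf; have [Qf hpf] := projP hf.
apply: (proj_eq (H2Z a hf) (qZ a Qf)) => h Qh; have hh := qH2 Qh.
by rewrite (dotZl a (qH2 Qf) hh) (dotZl a hf hh) (hpf h Qh).
Qed.

Lemma H2norm_triangle f g : H2 f -> H2 g -> H2norm (f + g) <= H2norm f + H2norm g.
Proof.
move=> hf hg; have := dot_quad 1 hf hg; rewrite cj1 scale1r mul1r nc1 expr1n mul1r => E.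
have := Re_le_nc (H2dot f g); have := dot_CS hf hg.
move: (H2norm_ge0 (f + g)) (H2norm_ge0 f) (H2norm_ge0 g) E.
move: (H2norm (f + g)) (H2norm f) (H2norm g) (H2dot f g) => x y z c x0 y0 z0 E h1 h2.
rewrite -ler_sqr ?nnegrE ?addr_ge0// E.
have h3 := le_trans h2 h1; clear -h3; rewrite sqrrD -mulr_natl; lra.
Qed.

Lemma proj_norm f : H2 f -> H2norm (proj Q f) <= H2norm f.
Proof.
move=> hf; have [Qp hp] := projP hf; have hpf := qH2 Qp.
have [g0|g0] := eqVneq (H2norm (proj Q f)) 0; first by rewrite g0 H2norm_ge0.
have gp : 0 < H2norm (proj Q f) by rewrite lt_neqAle eq_sym g0 H2norm_ge0.
rewrite -(ler_pM2r gp) -expr2.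
have -> : H2norm (proj Q f) ^+ 2 = nc (H2dot f (proj Q f)).
  by rewrite -(hp _ Qp) (dot_ff hpf) nc_real ger0_norm ?sqr_ge0.
exact: (dot_CS hf hpf).
Qed.

Definition perp u := H2 u /\ forall h, Q h -> H2dot u h = 0.

Lemma perp_proj f : H2 f -> perp (f - proj Q f).
Proof.
move=> hf; have [Qp hp] := projP hf; split; first exact: (H2B hf (qH2 Qp)).
by move=> h Qh; rewrite (dotBl hf (qH2 Qp) (qH2 Qh)) (hp h Qh) subrr.
Qed.

Lemma palg_mult_H2 phi u : palg phi -> H2 u -> H2 (mult phi u).
Proof.
move=> pp hu; have [M M0 hM] := palg_bounded pp.
by have [] := H2_mult pp.1 M0 (fun z => palg_in_bound pp hM (z := z)) hu.
Qed.

Lemma palg_poly_mult phi u (eps : R) : palg phi -> H2 u -> 0 < eps ->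
  exists2 P, ispoly P & H2norm (mult (phi - pfun P) u) <= eps * H2norm u.
Proof.
move=> pp hu e0; have [P pP hP] := pp.2 _ e0; exists P; first exact: pP.
have ad : analytic (phi - pfun P) := (palgB pp (palg_pfun pP)).1.
apply: (H2_mult ad (ltW e0) _ hu).2 => z z1.
by rewrite zero_extB zero_ext_pfun//; exact: hP.
Qed.

Lemma multBl phi u f : mult (phi - u) f = mult phi f - mult u f.
Proof. by apply/funext => z; rewrite /mult !fctE mulrBl. Qed.
Lemma multDl phi u f : mult (phi + u) f = mult phi f + mult u f.
Proof. by apply/funext => z; rewrite /mult !fctE mulrDl. Qed.

Lemma perp_coord i u : perp u -> perp (mult (coord_fun i) u).
Proof.
move=> [hu pu]; split; first exact: (H2_coord i hu).
by move=> h Qh; have [QA hA] := AopP i Qh; rewrite (hA u hu); exact: pu.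
Qed.

Lemma perp_pfun P u : ispoly P -> perp u -> perp (mult (pfun P) u).
Proof.
move=> pP; move: P pP u; apply: mpoly_ind_closed.
- move=> c u [hu pu].
  have -> : mult (pfun (fun=> c)) u = c *: u by [].
  split; first exact: H2Z.
  by move=> h Qh; rewrite (dotZl c hu (qH2 Qh)) (pu h Qh) mulr0.
- by move=> i u pu; exact: perp_coord.
- move=> F G hF hG u pu; have [h1 p1] := hF u pu; have [h2 p2] := hG u pu.
  have -> : mult (pfun (fun z => F z + G z)) u = mult (pfun F) u + mult (pfun G) u.
    exact: multDl.
  split; first exact: (H2D h1 h2).
  by move=> h Qh; rewrite (dotDl h1 h2 (qH2 Qh)) (p1 h Qh) (p2 h Qh) addr0.
- move=> F G hF hG u pu.
  have -> : mult (pfun (fun z => F z * G z)) u = mult (pfun F) (mult (pfun G) u).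
    by apply/funext => z; rewrite /mult /pfun mulrA.
  exact/hF/hG.
Qed.

Lemma nc_le_scale (c : C) (K : R) : 0 <= K -> (forall e : R, 0 < e -> nc c <= e * K) -> c = 0.
Proof.
move=> K0 h; apply: nc_le_eq0 => e e0; have K1 : 0 < K + 1 by rewrite ltr_wpDl.
apply: le_trans (h _ (divr_gt0 e0 K1)) _.
by rewrite mulrAC ler_pdivrMr// ler_pM2l// lerDl.
Qed.

Lemma perp_palg phi u : palg phi -> perp u -> perp (mult phi u).
Proof.
move=> pp pu; have [hu _] := pu; have hpu := palg_mult_H2 pp hu; split; first exact: hpu.
move=> h Qh; have hh := qH2 Qh.
apply: (@nc_le_scale _ (H2norm u * H2norm h)); first by rewrite mulr_ge0 ?H2norm_ge0.
move=> e e0; have [P pP hP] := palg_poly_mult pp hu e0.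
have [hPu pPu] := perp_pfun pP pu.
have -> : H2dot (mult phi u) h = H2dot (mult (phi - pfun P) u) h.
  by rewrite multBl (dotBl hpu hPu hh) (pPu h Qh) subr0.
have hd : H2 (mult (phi - pfun P) u) by rewrite multBl; exact: H2B.
apply: le_trans (dot_CS hd hh) _; rewrite mulrA.
by apply: ler_wpM2r hP; exact: H2norm_ge0.
Qed.

(** The orthocomplement of Q is invariant under the coordinates, hence under polynomials and under
    the ball algebra, so the part of u orthogonal to Q contributes nothing. In particular
    compressions by ball algebra functions are multiplicative. *)
Lemma proj_mult phi u : palg phi -> H2 u -> proj Q (mult phi (proj Q u)) = proj Q (mult phi u).
Proof.
move=> pp hu; have [Qp _] := projP hu; have hp := qH2 Qp.
apply: proj_congr => [||h Qh]; [exact: palg_mult_H2|exact: palg_mult_H2|].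
have [h1 h2] := perp_palg pp (perp_proj hu).
apply/eqP; rewrite eq_sym -subr_eq0; apply/eqP; rewrite -(h2 h Qh) multB.
by rewrite (dotBl (palg_mult_H2 pp hu) (palg_mult_H2 pp hp) (qH2 Qh)).
Qed.

End projection.

Opaque Defs.proj.

(** * Module maps and the functional on M_Q *)

Section module_maps.
Variable X : (Bn -> C) -> (Bn -> C).
Hypotheses (bX : bounded_operator Q X) (mX : module_map Q X).

(** * The operator norm, and the symbol of a module map *)

Section operator.
Implicit Types (z w e : Cn) (f g h u : Bn -> C).

Lemma op0 : X 0 = 0.
Proof.
have := bo_linear bX (-1) (q0) (q0).
by rewrite scaler0 add0r scaleN1r addNr.
Qed.
Lemma opD f g : Q f -> Q g -> X (f + g) = X f + X g.
Proof. by move=> Qf Qg; have := bo_linear bX 1 Qf Qg; rewrite !scale1r. Qed.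
Lemma opZ (a : C) f : Q f -> X (a *: f) = a *: X f.
Proof. by move=> Qf; have := bo_linear bX a Qf (q0); rewrite op0 !addr0. Qed.
Lemma opB f g : Q f -> Q g -> X (f - g) = X f - X g.
Proof. move=> Qf Qg; rewrite -[- g]scaleN1r (opD Qf (qZ (-1) Qg)) (opZ (-1) Qg).
by rewrite scaleN1r. Qed.

Definition onorm : R := fine (op_norm Q X).

Lemma H2norm0 : H2norm (0 : Bn -> C) = 0.
Proof.
have h0 := qH2 (q0).
have -> : (0 : Bn -> C) = 0 *: 0 by rewrite scaler0.
by rewrite (H2normZ 0 h0) nc0 mul0r.
Qed.

Lemma op_norm_ge0 : (0%:E <= op_norm Q X)%E.
Proof.
apply: ereal_sup_ubound; exists 0.
  by split; [exact: q0|rewrite H2norm0].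
by rewrite op0 H2norm0.
Qed.

Lemma op_normE : op_norm Q X = onorm%:E.
Proof.
rewrite /onorm fineK// fin_numElt (bo_bounded bX) andbT.
by apply: (lt_le_trans (ltNyr 0)); exact: op_norm_ge0.
Qed.

Lemma onorm_ge0 : 0 <= onorm.
Proof. by rewrite -lee_fin -op_normE; exact: op_norm_ge0. Qed.

Lemma normalize f : Q f -> f <> 0 -> 0 < H2norm f /\
  Q ((H2norm f)^-1%:C *: f) /\ H2norm ((H2norm f)^-1%:C *: f) = 1.
Proof.
move=> Qf f0; have hf := qH2 Qf.
have fp : 0 < H2norm f.
  by rewrite lt_neqAle H2norm_ge0 andbT eq_sym; apply/eqP => /(H2norm_eq0 hf).
split; [exact: fp|split; first exact: qZ].
by rewrite (H2normZ _ hf) nc_real ger0_norm ?invr_ge0 ?(ltW fp)// mulVf// gt_eqF.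
Qed.

Lemma op_normalize f : Q f -> f <> 0 ->
  exists g, [/\ Q g, H2norm g = 1, 0 < H2norm f & H2norm (X f) = H2norm (X g) * H2norm f].
Proof.
move=> Qf f0; have [fp [Qg g1]] := normalize Qf f0; set g := _ *: f in Qg g1.
exists g; split; [exact: Qg|exact: g1|exact: fp|].
have gf : (H2norm f)%:C *: g = f.
  rewrite /g scalerA (_ : (H2norm f)%:C * _ = 1) ?scale1r//.
  by rewrite -real_complexM mulfV// gt_eqF.
have XE := etrans (congr1 (fun f => H2norm (X f)) (esym gf)) (congr1 H2norm (opZ _ Qg)).
apply: (etrans XE); apply: (etrans (H2normZ _ (qH2 (bo_stable bX Qg)))).
exact: nc_real_mulC (ltW fp).
Qed.

Lemma onorm_le f : Q f -> H2norm (X f) <= onorm * H2norm f.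
Proof.
move=> Qf; have [->|f0] := pselect (f = 0); first by rewrite op0 H2norm0 mulr0.
have [g [Qg g1 fp ->]] := op_normalize Qf f0.
apply: ler_wpM2r; first exact: ltW.
rewrite -lee_fin -op_normE; apply: ereal_sup_ubound; exists g => //.
by split; [exact: Qg|rewrite g1].
Qed.

Lemma onorm_sup (s : R) : 0 <= s -> (forall f, Q f -> H2norm (X f) <= s * H2norm f) -> onorm <= s.
Proof.
move=> s0 h; rewrite -lee_fin -op_normE; apply: ub_ereal_sup => _ [f [Qf f1] <-].
by rewrite lee_fin; apply: le_trans (h f Qf) _; rewrite ler_piMr.
Qed.

(** In orthonormal coordinates the unit sphere of Q is a Euclidean sphere, which is compact, and the
    norm of X is Lipschitz there. *)
Lemma onorm_attained : exists2 f, Q f /\ f <> 0 & H2norm (X f) = onorm * H2norm f.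
Proof.
have [k [b [Qb ob fb]]] := q_basis.
have [f1 Qf1 f10] := qm_nonzero qm.
have Qbi (i : 'I_k) : Q (b i) by exact: (Qb i (ltn_ord i)).
have hb (i : 'I_k) : H2 (b i) by exact: (qH2 (Qbi i)).
pose F (c : 'rV[C]_k) : Bn -> C := \sum_(i < k) c ord0 i *: b i.
have QF c : Q (F c) by apply: q_sum => i; exact: qZ.
have hF c := qH2 (QF c).
have hXF c := qH2 (bo_stable bX (QF c)).
have FN c : H2norm (F c) = en c.
  apply/eqP; rewrite -(eqrXn2 (n := 2)) ?H2norm_ge0 ?eucl_norm_ge0//; apply/eqP.
  apply: complexI.
  rewrite -(dot_ff (hF c)) -ip_norm ipE.
  have hZ (i : 'I_k) : H2 (c ord0 i *: b i) := H2Z _ (hb i).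
  rewrite {1}/F (dot_suml _ hZ (hF c)); apply: eq_bigr => i _.
  rewrite (dotZl _ (hb i) (hF c)); congr (_ * _).
  rewrite -(dot_cj (hF c) (hb i)) /F (dot_suml _ hZ (hb i)) (bigD1 i)//=.
  rewrite (dotZl _ (hb i) (hb i)) ob// eqxx mulr1 big1 ?addr0// => j ji.
  by rewrite (dotZl _ (hb j) (hb i)) ob// val_eqE (negbTE ji) mulr0.
have FB c d : F (c - d) = F c - F d.
  rewrite /F -sumrB; apply: eq_bigr => i _; by rewrite !mxE scalerBl.
have Xlip c d : `|H2norm (X (F c)) - H2norm (X (F d))| <= onorm * en (c - d).
  have T c' d' : H2norm (X (F c')) - H2norm (X (F d')) <= onorm * en (c' - d').
    rewrite lerBlDr -FN; apply: le_trans (lerD (onorm_le (QF _)) (lexx _)).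
    rewrite FB (opB (QF c') (QF d')).
    rewrite -{1}[X (F c')](subrK (X (F d'))); apply: H2norm_triangle => //.
    exact: H2B.
  rewrite ler_norml T andbT lerNl opprB (_ : en (c - d) = en (d - c)) ?T//.
  by rewrite -opprB eucl_normN.
have K0 : [set c : 'rV[C]_k | en c = 1] !=set0.
  have [fp [Qg g1]] := normalize Qf1 f10; set g := _ *: f1 in Qg g1.
  exists (\row_i H2dot g (b i)) => /=; rewrite -FN -g1 [in RHS](fb g Qg).
  by congr H2norm; apply: eq_bigr => i _; rewrite mxE.
have [|||c c1 hc] := @eucl_compact_max R k [set c | en c = 1] 1 (fun c => H2norm (X (F c))) K0.
- exact: closed_sphere_eucl.
- by move=> c /= ->.
- move=> c _ e e0; have s1 : 0 < onorm + 1 by rewrite ltr_wpDl ?onorm_ge0.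
  exists (e / (onorm + 1)); first by rewrite divr_gt0.
  move=> d _; rewrite ltr_pdivlMr// => h; apply: le_lt_trans (Xlip d c) _.
  apply: le_lt_trans h; rewrite mulrC; apply: ler_wpM2l; first exact: eucl_norm_ge0.
  by rewrite lerDl.
have c1' : en c = 1 by [].
exists (F c).
  split; first exact: QF.
  by move=> F0; have := FN c; rewrite F0 H2norm0 c1' => /eqP; rewrite eq_sym oner_eq0.
apply/eqP; rewrite eq_le onorm_le//= FN c1' mulr1; apply: onorm_sup; first exact: H2norm_ge0.
move=> f Qf; have [->|f0] := pselect (f = 0); first by rewrite op0 H2norm0 mulr0.
have [g [Qg g1 fp ->]] := op_normalize Qf f0.
apply: ler_wpM2r; first exact: ltW.
have gF : g = F (\row_i H2dot g (b i)).
  by rewrite {1}(fb g Qg) /F; apply: eq_bigr => i _; rewrite mxE.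
by rewrite gF; apply: hc => /=; rewrite -FN -gF.
Qed.

(** The quantity s^2 |f + t h|^2 - |X(f + t h)|^2 is nonnegative for all t and vanishes at t = 0, so
    its linear term vanishes. *)
Lemma onorm_extremal f h : Q f -> Q h -> H2norm (X f) = onorm * H2norm f ->
  H2dot (X f) (X h) = (onorm ^+ 2)%:C * H2dot f h.
Proof.
move=> Qf Qh fE; have [hf hh] := (qH2 Qf, qH2 Qh).
have [hXf hXh] := (qH2 (bo_stable bX Qf), qH2 (bo_stable bX Qh)).
set s := onorm in fE *; pose D := (s ^+ 2)%:C * H2dot f h - H2dot (X f) (X h).
pose B := s ^+ 2 * H2norm h ^+ 2 - H2norm (X h) ^+ 2.
have sqr_le g : Q g -> H2norm (X g) ^+ 2 <= s ^+ 2 * H2norm g ^+ 2.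
  move=> Qg; rewrite -exprMn; apply: le_powr; [exact: H2norm_ge0|exact: onorm_le].
have B0 : 0 <= B by rewrite subr_ge0; exact: sqr_le.
have : nc D ^+ 2 <= 0 * B.
  apply: cs_quadratic => // t.
  have := sqr_le _ (qD Qf (qZ (cj t) Qh)).
  have XE : X (f + cj t *: h) = X f + cj t *: X h.
    by apply: (etrans (opD Qf (qZ _ Qh))); exact: (congr1 (+%R (X f)) (opZ _ Qh)).
  have e1 := etrans (congr1 (fun u => H2norm u ^+ 2) XE) (dot_quad t hXf hXh).
  move=> L; have {L} := le_trans (eq_le_trans (esym e1) L) (eq_to_le (congr1 ( *%R (s ^+ 2)) (dot_quad t hf hh))).
  rewrite fE.
  rewrite /D Re_lincomb.
  rewrite exprMn; exact: quadratic_gap.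
rewrite mul0r => D0; have : nc D = 0.
  by apply/eqP; rewrite -sqrf_eq0 eq_le D0 sqr_ge0.
by move=> /eqP; rewrite nc_eq0 /D subr_eq0 => /eqP/esym.
Qed.

Definition commutes u := [/\ palg u & forall h, Q h -> X (proj Q (mult u h)) = proj Q (mult u (X h))].

Lemma commutesD u v : commutes u -> commutes v -> commutes (u + v).
Proof.
move=> [pu hu] [pv hv]; split; first exact: palgD.
move=> h Qh; have QX := bo_stable bX Qh.
have [hh hX] := (qH2 Qh, qH2 QX).
have D g : H2 g -> proj Q (mult (u + v) g) = proj Q (mult u g) + proj Q (mult v g).
  move=> hg; rewrite multDl; apply: projD; exact: palg_mult_H2.
have E1 := D h hh; have E2 := D _ hX.
apply: (etrans (congr1 X E1)); apply: (etrans _ (esym E2)).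
have [Q1 _] := projP (palg_mult_H2 pu hh).
have [Q2 _] := projP (palg_mult_H2 pv hh).
by apply: (etrans (opD Q1 Q2)); exact: (congr2 +%R (hu h Qh) (hv h Qh)).
Qed.

Lemma commutesM u v : commutes u -> commutes v -> commutes (mult u v).
Proof.
move=> [pu hu] [pv hv]; split; first exact: palgM.
move=> h Qh; have QX := bo_stable bX Qh.
have [hh hX] := (qH2 Qh, qH2 QX).
have D g : H2 g -> proj Q (mult (mult u v) g) = proj Q (mult u (proj Q (mult v g))).
  by move=> hg; rewrite -multA (proj_mult pu (palg_mult_H2 pv hg)).
have [Q2 _] := projP (palg_mult_H2 pv hh).
apply: (etrans (congr1 X (D h hh))); apply: (etrans _ (esym (D _ hX))).
apply: (etrans (hu _ Q2)); exact: (congr1 (fun g => proj Q (mult u g)) (hv h Qh)).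
Qed.

Lemma commutes_cst (c : C) : commutes (cst c).
Proof.
split; first exact: palg_cst.
move=> h Qh; have QX := bo_stable bX Qh.
have E u : mult (cst c) u = c *: u by [].
by rewrite !E (proj_id (qZ c Qh)) (proj_id (qZ c QX)) (opZ _ Qh).
Qed.

Lemma commutes_pfun P : ispoly P -> commutes (pfun P).
Proof.
move: P; apply: mpoly_ind_closed.
- exact: commutes_cst.
- by move=> i; split; [exact: palg_coord|exact: (mX.2 i)].
- by move=> F G; exact: commutesD.
- by move=> F G; exact: commutesM.
Qed.

(** The polynomial case is the definition of a module map, and the commutator of X with a
    compression is small when the multiplier is uniformly small. As the functions of Q lie in the
    ball algebra, they may serve as multipliers. *)
Lemma commutes_palg u : palg u -> commutes u.
Proof.
move=> pu; split; first exact: pu.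
move=> h Qh; have QX := bo_stable bX Qh.
have [hh hX] := (qH2 Qh, qH2 QX).
have [Q1 _] := projP (palg_mult_H2 pu hh).
have [Q2 _] := projP (palg_mult_H2 pu hX).
have QX1 := bo_stable bX Q1; have Qd := qB QX1 Q2.
apply/eqP; rewrite -subr_eq0; apply/eqP/(H2norm_eq0 (qH2 Qd)).
have c0 : 0 <= onorm * H2norm h + H2norm (X h).
  by rewrite addr_ge0 ?mulr_ge0 ?H2norm_ge0 ?onorm_ge0.
suff : (H2norm (X (proj Q (mult u h)) - proj Q (mult u (X h))))%:C = 0 :> C.
  by move=> /complexI.
apply: (nc_le_scale c0) => e e0; rewrite nc_real ger0_norm ?H2norm_ge0//.
have [P pP hP] : exists2 P, ispoly P & forall g, H2 g -> H2norm (mult (u - pfun P) g) <= e * H2norm g.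
  have [P pP hP] := pu.2 _ e0; exists P; first exact: pP.
  have ad : analytic (u - pfun P) := (palgB pu (palg_pfun pP)).1.
  move=> g hg; apply: (H2_mult ad (ltW e0) _ hg).2 => z z1.
  by rewrite zero_extB zero_ext_pfun//; exact: hP.
have pd := palgB pu (palg_pfun pP); set d := u - pfun P in hP pd.
have [_ cP] := commutes_pfun pP.
have D g : H2 g -> proj Q (mult u g) = proj Q (mult d g) + proj Q (mult (pfun P) g).
  move=> hg; rewrite -(projD (palg_mult_H2 pd hg) (palg_mult_H2 (palg_pfun pP) hg)).
  by congr (proj Q _); rewrite -multDl /d subrK.
have [Q3 _] := projP (palg_mult_H2 pd hh).
have [Q4 _] := projP (palg_mult_H2 pd hX).
have [Q5 _] := projP (palg_mult_H2 (palg_pfun pP) hh).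
have -> : X (proj Q (mult u h)) - proj Q (mult u (X h)) = X (proj Q (mult d h)) - proj Q (mult d (X h)).
  apply: (etrans (congr2 (fun a b => a - b) (etrans (congr1 X (D h hh)) (opD Q3 Q5)) (D _ hX))).
  exact: (subr_addr2 _ _ (cP h Qh)).
rewrite -[- proj Q _]scaleN1r; have QX3 := bo_stable bX Q3.
apply: le_trans (H2norm_triangle (qH2 QX3) (qH2 (qZ (-1) Q4))) _.
rewrite (H2normZ _ (qH2 Q4)) ncN nc1 mul1r mulrDr; apply: lerD.
  apply: le_trans (onorm_le Q3) _; rewrite mulrCA; apply: ler_wpM2l; first exact: onorm_ge0.
  by apply: le_trans (proj_norm (palg_mult_H2 pd hh)) _; exact: hP.
by apply: le_trans (proj_norm (palg_mult_H2 pd hX)) _; exact: hP.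
Qed.

(** Since f itself is a multiplier, f is the compression of f applied to P_Q 1, and X passes through
    it. Thus X is determined by X(P_Q 1). *)
Lemma op_symbol f : Q f -> X f = proj Q (mult f (X (proj Q (cst 1)))).
Proof.
move=> Qf; have pf := q_palg Qf; have [_ cf] := commutes_palg pf.
have [Q1 _] := projP (H2_1).
apply: (etrans _ (cf _ Q1)); congr X.
by rewrite (proj_mult pf (H2_1)) mult1 (proj_id Qf).
Qed.

Lemma op_symbol_dot f g : Q f -> Q g ->
  H2dot (X f) g = H2dot (mult f (X (proj Q (cst 1)))) g.
Proof.
move=> Qf Qg; have pf := q_palg Qf.
have [Q1 _] := projP (H2_1).
rewrite (op_symbol Qf).
exact: ((projP (palg_mult_H2 pf (qH2 (bo_stable bX Q1)))).2 g Qg).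
Qed.

End operator.

(** * Integrable functions on the sphere *)

Section sphere_integrable_functions.
Implicit Types (F G a : Cn -> C).

(** Elements of M_Q are only square integrable and may be unbounded, so they fall outside [sbm];
    products with [sbm] functions stay in this class. *)
Definition sint F := measurable_fun [set: Cn] F /\ cintegrable sigma [set: Cn] F.

Transparent cint.
Lemma cintE F : cint F = cintegral sigma setT F. Proof. by []. Qed.
Opaque cint.

Lemma sint_L2 F : L2 F -> sint F.
Proof. by move=> LF; split; [exact: LF.1|exact: (L2_integrable LF)]. Qed.

Lemma sint_sbm F : sbm F -> sint F.
Proof. by move=> sF; split; [exact: sF.1|exact: (sbm_cintegrable sF)]. Qed.

Lemma sintD F G : sint F -> sint G -> sint (fun z => F z + G z).
Proof.
move=> [mF iF] [mG iG]; split; first exact: measurable_funCD.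
exact: (cintegrableD measurableT iF iG).
Qed.

Lemma cint_sintD F G : sint F -> sint G -> cint (fun z => F z + G z) = cint F + cint G.
Proof. by move=> [mF iF] [mG iG]; rewrite !cintE (cintegralD measurableT iF iG). Qed.

Lemma cint_sintZ (c : C) F : sint F -> cint (fun z => c * F z) = c * cint F.
Proof. by move=> [mF iF]; rewrite !cintE (cintegralZ measurableT c iF). Qed.

Lemma sint_mul F a : sbm a -> sint F -> sint (fun z => a z * F z).
Proof.
move=> [ma [B aB]] [mF iF]; split; first exact: measurable_funCM.
apply: (@cintegrable_leS _ (fun z => `|B| * nc (F z))).
- exact: measurable_funCM.
- by apply: integrableRZ => //; exact: (cintegrable_nc measurableT iF).
- by move=> z z1; rewrite ncM ler_wpM2r ?nc_ge0// (le_trans (aB _ z1))// ler_norm.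
Qed.

Lemma sint_bound F a (B : R) : sint F -> sbm a -> 0 <= B ->
  (forall z, en z = 1 -> nc (a z) <= B) ->
  nc (cint (fun z => a z * F z)) <= B * fine (cLnorm 1 F).
Proof.
move=> [mF iF] sa B0 aB; have iN := cintegrable_nc measurableT iF.
rewrite (cL1E mF iF) /= -RintegralZl//; apply: nc_cint_leS.
- exact: (measurable_funCM sa.1).
- exact: integrableRZ.
- by move=> z z1; rewrite ncM ler_wpM2r ?nc_ge0// aB.
Qed.

Transparent cint.
Lemma sint_ae F G : sint F -> sint G -> {ae sigma, forall z, F z = G z} -> cint F = cint G.
Proof.
move=> [mF iF] [mG iG] FG; rewrite /cint; congr (_ +i* _); rewrite /Rintegral; congr fine.
  apply: ae_eq_integral => //; [exact: measurable_int iF.1|exact: measurable_int iG.1|].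
  by apply: filterS FG => z /= + _; move=> ->.
apply: ae_eq_integral => //; [exact: measurable_int iF.2|exact: measurable_int iG.2|].
by apply: filterS FG => z /= + _; move=> ->.
Qed.
Opaque cint.

End sphere_integrable_functions.

(** * Dilations, and the annihilators of the ball algebra *)

Section dilation.
Implicit Types (z w e : Cn) (f g h u phi : Bn -> C).

Lemma hc0 f z : analytic f -> hc f 0 z = ext f 0.
Proof.
move=> af; have s0 : 0 < 2^-1 :> R by lra. have s1 : 2^-1 < 1 :> R by lra.
have [M M0 hM] := analytic_bounded af s1.
have z0 := @eucl_norm0 R n.
have := hc_taylor af s0 s1 hM 1 (z := 0); rewrite z0 => /(_ s0).
rewrite mul0r expr1 mulr0 mul0r big_ord_recl big_ord0 addr0 => h.
have /eqP : ext f 0 - hc f 0 0 = 0.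
  by apply/eqP; rewrite -nc_eq0 eq_le h nc_ge0.
rewrite subr_eq0 => /eqP ->; rewrite -(scale0r z) (hc_hom _ _ _ af) expr0 mul1r.
by [].
Qed.

Lemma H2dot_1 f : H2 f -> H2dot f (cst 1) = ext f 0.
Proof.
move=> hf; have [e e1 _] := unit_row (0 : Cn).
have := lin_pow_dot 0 e1 hf; rewrite (hc0 _ (H2_an hf)) /hom_dim addn0 bin0 mul1r.
by [].
Qed.

Lemma analytic_pfun_diff (F : Cn -> C) : (forall z, en z < 1 -> differentiable F z) ->
  analytic (pfun F).
Proof.
move=> dF; apply/analyticP => z z1.
rewrite (_ : ext (pfun F) = F * ext (cst 1 : Bn -> C)).
  by apply: differentiableM; [exact: dF|have /analyticP := @analytic_cst 1; exact].
apply/funext => w; rewrite fctE; have [h|h] := ltP (en w) 1.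
  by rewrite zero_ext_pfun// zero_ext_cst// mulr1.
by rewrite !zero_ext_out// mulr0.
Qed.

Lemma analytic_affine f (p : Cn) (t : C) : analytic f ->
  (forall z, en z < 1 -> en (p + t *: z) < 1) ->
  analytic (pfun (fun z => ext f (p + t *: z))).
Proof.
move=> /analyticP af h; apply: analytic_pfun_diff => z z1.
apply: (@differentiable_comp _ _ _ _ (fun z => p + t *: z) (ext f)); last exact/af/h.
by apply: differentiableD => //; apply: differentiableZ.
Qed.

Lemma analytic_quotient f g : analytic f -> analytic g ->
  (forall z, en z < 1 -> ext g z != 0) ->
  analytic (fun z : Bn => f z / g z).
Proof.
move=> /analyticP af /analyticP ag g0.
have -> : (fun z : Bn => f z / g z) = pfun (fun z => ext f z * (ext g z)^-1).
  by apply/funext => z; rewrite /pfun !zero_ext_val.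
apply: analytic_pfun_diff => z z1; apply: (@differentiableM _ _ (ext f)); first exact: af.
by apply: differentiableV; [exact: ag|exact: g0].
Qed.

Definition dil (r : R) f : Bn -> C := pfun (fun z => ext f (r%:C *: z)).

Lemma dil_palg (r : R) f : analytic f -> 0 <= r < 1 -> palg (dil r f).
Proof.
move=> af r01; have /andP[r0 r1] := r01; split.
  have E : dil r f = pfun (fun z => ext f (0 + r%:C *: z)).
    by apply/funext => z; rewrite /dil /pfun add0r.
  rewrite E; apply: analytic_affine => // z z1.
  rewrite add0r eucl_normZ nc_real ger0_norm//; apply: le_lt_trans r1.
  by rewrite ler_piMr// ltW.
have [K [q [K0 q01 h]]] := dilation_taylor af r01; have /andP[q0 q1] := q01.
move=> e e0; have K1 : 0 < K + 1 by rewrite ltr_wpDl.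
have [N hN] := geo_small q0 q1 (divr_gt0 e0 K1).
exists (fun z => \sum_(k < N) r%:C ^+ k * hc f k z).
  apply: ispoly_sum => k; apply: ispolyM; [exact: ispoly_cst|exact: hc_poly].
move=> z z1; rewrite (zero_ext_pfun _ z1); apply: le_trans (h N z (ltW z1)) _.
have := ltW (hN N (leqnn _)); rewrite ler_pdivlMr//; apply: le_trans.
by rewrite mulrC ler_wpM2l ?exprn_ge0// lerDl.
Qed.

Lemma dil_boundary (r : R) f z : analytic f -> 0 <= r < 1 -> en z <= 1 ->
  bd (dil r f) z = ext f (r%:C *: z).
Proof.
move=> af r01 z1; have /andP[r0 r1] := r01.
have rz : en (r%:C *: z) < 1.
  rewrite eucl_normZ nc_real ger0_norm//; apply: le_lt_trans r1.
  by rewrite ler_piMr.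
apply: boundary_left_lim; apply: eq_left_lim (boundary_in af rz) => s s0 s1.
have sz : en (s%:C *: z) < 1.
  rewrite eucl_normZ nc_real (ger0_norm (ltW s0)); apply: le_lt_trans s1.
  by rewrite ler_piMr// ltW.
by rewrite (zero_ext_pfun _ sz) !scalerA mulrC.
Qed.

Lemma cint_bd_dot f g h : palg f -> palg g -> palg h ->
  cint (fun z => bd f z * (bd g z * cj (bd h z))) = H2dot (mult f g) h.
Proof.
move=> pf pg ph; rewrite (palg_dot (palgM pf pg) ph); congr cint.
by apply/funext => z; rewrite boundaryM// mulrA.
Qed.

Lemma H2dot_1M f g : palg f -> palg g -> cint (fun z => bd f z * bd g z) =
  ext f 0 * ext g 0.
Proof.
move=> pf pg; rewrite -zero_extM -(H2dot_1 (palg_H2 (palgM pf pg))).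
rewrite (palg_dot (palgM pf pg) (palg_cst 1)); apply: cint_eqS.
- exact: (sbmM (sbm_boundary pf) (sbm_boundary pg)).1.
- exact: (sbmM (sbm_boundary (palgM pf pg)) (sbm_cj (sbm_boundary (palg_cst 1)))).1.
by move=> z z1; rewrite boundary_cst ?z1// cj1 mulr1 boundaryM.
Qed.

(** For a polynomial p the integral of f p is f(0) p(0), which is also the integral of f(0) p.
    Approximating F by p, the integral of f F is compared with f(0) times the integral of F, which
    is zero. *)
Lemma H2S0_annihilate f F : palg f -> H2S0 F -> cint (fun z => bd f z * F z) = 0.
Proof.
move=> pf [[LF hF] F0]; have sF := sint_L2 LF.
have sf := sbm_boundary pf; have [M M0 hM] := palg_bounded pf.
have f0 : nc (ext f 0) <= M.
  apply: (palg_in_bound pf hM); rewrite eucl_norm0.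
  exact: ltr01.
have iF0 : cint F = 0.
  rewrite -F0 /L2dot; congr cint; apply/funext => z.
  exact: (etrans (esym (mulr1 _)) (congr1 ( *%R (F z)) (esym cj1))).
apply: (@nc_le_scale _ (M + M)); first by rewrite addr_ge0.
move=> e e0; have [p hp] := hF e e0.
have ip : ispoly (poly_fun p) by exists p.
have pp := palg_pfun ip; have sp := ispoly_sbm ip.
have sm : sbm (fun z => - 1 * poly_fun p z) := sbmZ _ sp.
have sD : sint (F - poly_fun p).
  have := sintD sF (sint_sbm sm); congr sint; apply/funext => z.
  by rewrite mulN1r.
have D1 : fine (cLnorm 1 (F - poly_fun p)) <= e.
  rewrite (cL1E sD.1 sD.2) /= -lee_fin -(cL1E sD.1 sD.2).
  exact: le_trans (cL1_le_cL2 sD.1) (ltW hp).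
have B1 (a : Cn -> C) : sbm a -> (forall z, en z = 1 -> nc (a z) <= M) ->
    nc (cint (fun z => a z * (F - poly_fun p) z)) <= e * M.
  move=> sa aM; apply: le_trans (sint_bound sD sa M0 aM) _.
  by rewrite mulrC ler_wpM2r.
have split_ a : sbm a -> cint (fun z => a z * F z) =
    cint (fun z => a z * (F - poly_fun p) z) + cint (fun z => a z * poly_fun p z).
  move=> sa; rewrite -(cint_sintD (sint_mul sa sD) (sint_sbm (sbmM sa sp))).
  by congr cint; apply/funext => z; rewrite -mulrDr !fctE subrK.
have E1 : cint (fun z => bd f z * poly_fun p z) = ext f 0 * poly_fun p 0.
  rewrite -(@zero_ext_pfun (poly_fun p) 0); last first.
    by rewrite eucl_norm0.
  rewrite -(H2dot_1M pf pp); apply: cint_eqS.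
  - exact: (sbmM sf sp).1.
  - exact: (sbmM sf (sbm_boundary pp)).1.
  by move=> z z1; rewrite boundary_pfun ?z1.
have s1 : sbm (fun z : Cn => ext f 0) := sbm_cst _.
have E2 : cint (fun z => ext f 0 * poly_fun p z) = ext f 0 * poly_fun p 0.
  rewrite -(@zero_ext_pfun (poly_fun p) 0); last first.
    by rewrite eucl_norm0.
  rewrite -(H2dot_1 (palg_H2 pp)) (cintZ _ sp) (palg_dot pp (palg_cst 1)).
  congr (_ * _); apply: cint_eqS.
  - exact: sp.1.
  - exact: (sbmM (sbm_boundary pp) (sbm_cj (sbm_boundary (palg_cst 1)))).1.
  by move=> z z1; rewrite boundary_cst ?z1// cj1 mulr1 boundary_pfun ?z1.
have E3 := split_ _ s1; rewrite (cint_sintZ _ sF) iF0 mulr0 E2 in E3.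
rewrite (split_ _ sf) E1; have h1 := B1 _ sf (fun z (e1 : en z = 1) => hM z (eq_to_le e1)).
have h2 := B1 _ s1 (fun z (_ : en z = 1) => f0).
move/esym/eqP: E3; rewrite addr_eq0 => /eqP E3; rewrite E3 in h2.
apply: le_trans (ncD _ _) _; rewrite mulrDr; apply: lerD; first exact: h1.
by move: h2; rewrite ncN.
Qed.

(** The function conj(f) lies in the conjugate Hardy space, and orthogonality of F to it is the
    claim. The summand 0 only puts it in the shape of an element of the sum. *)
Lemma MS_annihilate f F : palg f -> MS F -> cint (fun z => bd f z * F z) = 0.
Proof.
move=> pf [LF hF]; pose G := (bd (0 : Bn -> C) + (fun z => cj (bd f z)) : Cn -> C).
have hG : add_set H2S (conj_set H2S) G.
  exists (bd (0 : Bn -> C)); first exact: (H2S_boundary palg0).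
  exists (fun z => cj (bd f z)) => //.
  by exists (bd f) => //; exact: (H2S_boundary pf).
rewrite -(hF G hG) /L2dot; congr cint; apply/funext => z.
have b0 : bd (0 : Bn -> C) z = 0.
  apply: boundary_left_lim; apply: eq_left_lim (left_lim_cst 0) => r _ _.
  have -> : (0 : Bn -> C) = 0 *: 0 by rewrite scaler0.
  by rewrite zero_extZ mul0r.
have E : cj (G z) = bd f z by rewrite /G fctE b0 add0r cjK.
exact: (etrans (mulrC _ _) (congr1 ( *%R (F z)) (esym E))).
Qed.

Lemma H2S_approx_cint (m : Cn -> C) F : sbm m -> H2S F ->
  (forall p, ispoly p -> cint (fun z => m z * p z) = 0) -> cint (fun z => m z * F z) = 0.
Proof.
move=> sm [LF hF] h; have sF := sint_L2 LF; have [_ [B hB]] := sm.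
have B0 : 0 <= `|B| by [].
have hB' z : en z = 1 -> nc (m z) <= `|B| by move=> z1; apply: le_trans (hB z z1) (ler_norm _).
apply: (nc_le_scale B0) => e e0; have [p hp] := hF e e0.
have ip : ispoly (poly_fun p) by exists p.
have sp := ispoly_sbm ip.
have sN : sbm (fun z => - 1 * poly_fun p z) := sbmZ _ sp.
have sD : sint (F - poly_fun p).
  have := sintD sF (sint_sbm sN); congr sint; apply/funext => z.
  by rewrite mulN1r.
have D1 : fine (cLnorm 1 (F - poly_fun p)) <= e.
  rewrite (cL1E sD.1 sD.2) /= -lee_fin -(cL1E sD.1 sD.2).
  exact: le_trans (cL1_le_cL2 sD.1) (ltW hp).
have -> : cint (fun z => m z * F z) =
    cint (fun z => m z * (F - poly_fun p) z) + cint (fun z => m z * poly_fun p z).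
  rewrite -(cint_sintD (sint_mul sm sD) (sint_sbm (sbmM sm sp))).
  by congr cint; apply/funext => z; rewrite -mulrDr !fctE subrK.
rewrite (h _ ip) addr0; apply: le_trans (sint_bound sD sm B0 hB') _.
by rewrite mulrC ler_wpM2r.
Qed.

Lemma H2S_approx_cint_cj (m : Cn -> C) F : sbm m -> H2S F ->
  (forall p, ispoly p -> cint (fun z => m z * cj (p z)) = 0) -> cint (fun z => m z * cj (F z)) = 0.
Proof.
move=> sm hF h.
have h' : cint (fun z => cj (m z) * F z) = 0.
  apply: (H2S_approx_cint (sbm_cj sm) hF) => p ip; have sp := ispoly_sbm ip.
  rewrite -[LHS]cjK -(cint_cj (sbmM (sbm_cj sm) sp)) -[RHS](cjK 0) cj0; congr cj.
  rewrite -(h p ip); congr cint; apply/funext => z; by rewrite cjM cjK.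
have sF := sint_L2 hF.1; have si := sint_mul (sbm_cj sm) sF.
rewrite -[RHS]cj0 -h' !cintE -(cintegral_cj measurableT si.2); congr cintegral.
by apply/funext => z; rewrite cjM cjK.
Qed.

End dilation.

(** * Membership in M_Q, and pairings with its elements *)

Section symbol.
Implicit Types (z w e : Cn) (f g h u phi : Bn -> C).

Lemma MQ_sint F : MQ Q F -> sint F.
Proof.
move=> [_ [F1 [LF1 _] <-]] [_ [m [Lm _]] [h [[Lh _] _] <-]] <-.
have s1 := sint_L2 LF1; have sm := sint_L2 Lm; have sh := sint_L2 Lh.
have s1c : sint (fun z => cj (F1 z)).
  split; first exact: measurable_funC_cj s1.1.
  exact: (cintegrable_cj measurableT s1.2).
exact: (sintD s1c (sintD sm sh)).
Qed.

(** The ball algebra annihilates the last two summands of M_Q, so it sees only the part conj(q). *)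
Lemma MQ_pair F : MQ Q F -> exists2 q, Q q &
  forall f, palg f -> cint (fun z => bd f z * F z) = H2dot f q.
Proof.
move=> [_ [F1 [LF1 [q Qq F1q]] <-]] [_ [m mM] [h hH] <-] <-; exists q; first exact: Qq.
move=> f pf; have pq := q_palg Qq.
have s1 := sint_L2 LF1; have sm := sint_L2 mM.1; have sh := sint_L2 hH.1.1.
have s1c : sint (fun z => cj (F1 z)).
  split; first exact: measurable_funC_cj s1.1.
  exact: (cintegrable_cj measurableT s1.2).
have sf := sbm_boundary pf.
have -> : cint (fun z => bd f z * ((fun z => (F1 z)^*) + (m + h)) z) =
   cint (fun z => bd f z * cj (F1 z)) + (cint (fun z => bd f z * m z) +
   cint (fun z => bd f z * h z)).
  rewrite -(cint_sintD (sint_mul sf sm) (sint_mul sf sh)).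
  rewrite -(cint_sintD (sint_mul sf s1c) (sintD (sint_mul sf sm) (sint_mul sf sh))).
  by congr cint; apply/funext => z; rewrite -!mulrDr.
rewrite (MS_annihilate pf mM) (H2S0_annihilate pf hH) !addr0 (palg_dot pf pq).
apply: (sint_ae (sint_mul sf s1c) (sint_sbm (sbmM sf (sbm_cj (sbm_boundary pq))))).
by apply: filterS F1q => z /= ->.
Qed.

(** The adjoint of multiplication maps Q into Q because the orthocomplement is invariant; its value
    on g is written out in an orthonormal basis. *)
Lemma mult_adjoint phi g : palg phi -> Q g ->
  exists2 q, Q q & forall h, H2 h -> H2dot (mult phi h) g = H2dot h q.
Proof.
move=> pp Qg; have [k [b [Qb ob fb]]] := q_basis; have hg := qH2 Qg.
have hb (i : 'I_k) : H2 (b i) by exact: (qH2 (Qb i (ltn_ord i))).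
have hpb (i : 'I_k) : H2 (mult phi (b i)) := palg_mult_H2 pp (hb i).
pose q := \sum_(i < k) cj (H2dot (mult phi (b i)) g) *: b i.
have Qq : Q q by apply: q_sum => i; apply: qZ; exact: Qb.
exists q; [exact: Qq|move=> h hh].
have [Qp hp] := projP hh; have hph := qH2 Qp.
have [_ pperp] := perp_palg pp (perp_proj hh).
have E : H2dot (mult phi h) g = H2dot (mult phi (Defs.proj Q h)) g.
  apply/eqP; rewrite -subr_eq0; apply/eqP.
  apply: (etrans (esym (dotBl (palg_mult_H2 pp hh) (palg_mult_H2 pp hph) hg))).
  by rewrite -multB; exact: pperp.
rewrite E; have qb (i : 'I_k) : H2 (cj (H2dot (mult phi (b i)) g) *: b i) := H2Z _ (hb i).
rewrite -(dot_cj (H2_sum _ qb) hh) /q (dot_suml _ qb hh) cj_sum.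
have -> : mult phi (Defs.proj Q h) = \sum_(i < k) H2dot (Defs.proj Q h) (b i) *: mult phi (b i).
  rewrite {1}(fb _ Qp); elim/big_ind2 : _ => [|x y x' y' <- <-|i _].
  - by apply/funext => z; rewrite /mult mulr0.
  - exact: multD.
  - exact: multZ.
rewrite (dot_suml _ (fun i => H2Z _ (hpb i)) hg); apply: eq_bigr => i _.
apply: (etrans (dotZl _ (hpb i) hg)).
apply: (etrans _ (esym (congr1 cj (dotZl _ (hb i) hh)))).
apply: (etrans _ (esym (cjM _ _))); apply: (etrans (mulrC _ _)).
apply: (congr2 *%R (esym (cjK _))).
exact: (etrans (hp _ (Qb i (ltn_ord i))) (esym (dot_cj (hb i) hh))).
Qed.

(** Put q1 = T_f^* g, q2 = T_g^* f and k = q2 - q2(0), all in the ball algebra. Then m = f conj(g) -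
    conj(q1) - k is orthogonal to polynomials and to their conjugates, hence lies in M(S), while q1
    + q lies in Q and k in H^2_0. *)
Lemma MQ_intro f g q : Q f -> Q g -> Q q ->
  MQ Q (fun z => bd f z * cj (bd g z) + cj (bd q z)).
Proof.
move=> Qf Qg Qq; have pf := q_palg Qf; have pg := q_palg Qg.
have pq := q_palg Qq; have h1 := H2_1 : H2 (cst 1 : Bn -> C).
have [q1 Q1 hq1] := mult_adjoint pf Qg; have [q2 Q2 hq2] := mult_adjoint pg Qf.
have p1 := q_palg Q1; have p2 := q_palg Q2.
have z0 : en (0 : Cn) < 1 by rewrite eucl_norm0.
set c := ext q2 0; pose k := q2 - cst c.
have pk : palg k := palgB p2 (palg_cst c).
have k0 : ext k 0 = 0 by rewrite /k zero_extB zero_ext_cst// subrr.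
(* Both q2(0) and conj(q1(0)) equal <f, g>; the constant is therefore counted once, in conj(q1). *)
have q10 : cj (ext q1 0) = c.
  rewrite /c -(H2dot_1 (qH2 Q1)) -(H2dot_1 (qH2 Q2)).
  rewrite (dot_cj (qH2 Q1) h1) -(hq1 _ h1) -(dot_cj h1 (qH2 Q2)) -(hq2 _ h1).
  by rewrite !mult1 (dot_cj (qH2 Qg) (qH2 Qf)).
pose F0 z := bd f z * cj (bd g z).
have [sf sg sq1 sk] := And4 (sbm_boundary pf) (sbm_boundary pg) (sbm_boundary p1) (sbm_boundary pk).
have sF0 : sbm F0 := sbmM sf (sbm_cj sg).
pose m z := F0 z - cj (bd q1 z) - bd k z.
have sm : sbm m := sbmB (sbmB sF0 (sbm_cj sq1)) sk.
have ma a : palg a -> cint (fun z => bd a z * m z) = 0.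
  move=> pa; have sa := sbm_boundary pa.
  have -> : cint (fun z => bd a z * m z) = cint (fun z => bd a z * F0 z)
      - cint (fun z => bd a z * cj (bd q1 z)) - cint (fun z => bd a z * bd k z).
    rewrite -(cintB (sbmM sa sF0) (sbmM sa (sbm_cj sq1))).
    rewrite -(cintB (sbmB (sbmM sa sF0) (sbmM sa (sbm_cj sq1))) (sbmM sa sk)).
    by congr cint; apply/funext => z; rewrite /m !mulrBr.
  rewrite (H2dot_1M pa pk) k0 mulr0 subr0 (cint_bd_dot pa pf pg) -(palg_dot pa p1).
  by rewrite multC (hq1 _ (palg_H2 pa)) subrr.
have mca a : palg a -> cint (fun z => m z * cj (bd a z)) = 0.
  move=> pa; have sa := sbm_cj (sbm_boundary pa).
  have -> : cint (fun z => m z * cj (bd a z)) = cint (fun z => F0 z * cj (bd a z))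
      - cint (fun z => cj (bd q1 z) * cj (bd a z)) - cint (fun z => bd k z * cj (bd a z)).
    rewrite -(cintB (sbmM sF0 sa) (sbmM (sbm_cj sq1) sa)).
    rewrite -(cintB (sbmB (sbmM sF0 sa) (sbmM (sbm_cj sq1) sa)) (sbmM sk sa)).
    by congr cint; apply/funext => z; rewrite /m !mulrBl.
  have -> : cint (fun z => F0 z * cj (bd a z)) = H2dot q2 a.
    rewrite -(dot_cj (palg_H2 pa) (qH2 Q2)) -(hq2 _ (palg_H2 pa)) multC.
    rewrite -(cint_bd_dot pa pg pf) -(cint_cj (sbmM (sbm_boundary pa) (sbmM sg (sbm_cj sf)))).
    by congr cint; apply/funext => z; rewrite /F0 !cjM cjK; ring.
  have -> : cint (fun z => cj (bd q1 z) * cj (bd a z)) = c * cj (ext a 0).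
    rewrite -q10 -cjM -(H2dot_1M p1 pa) -(cint_cj (sbmM sq1 (sbm_boundary pa))).
    by congr cint; apply/funext => z; rewrite cjM.
  rewrite -(palg_dot pk pa) /k (dotBl (qH2 Q2) (palg_H2 (palg_cst c)) (palg_H2 pa)).
  have -> : (cst c : Bn -> C) = c *: cst 1 by apply/funext => z; exact: (esym (mulr1 c)).
  rewrite (dotZl c h1 (palg_H2 pa)) -(dot_cj (palg_H2 pa) h1) (H2dot_1 (palg_H2 pa)).
  by ring.
have mMS : MS m.
  split; first exact: (sbm_L2 sm).
  move=> _ [G1 hG1 [_ [G2 hG2 <-] <-]]; rewrite /L2dot.
  have E1 : cint (fun z => m z * cj (G1 z)) = 0.
    apply: (H2S_approx_cint_cj sm hG1) => p ip.
    rewrite -(mca _ (palg_pfun ip)); apply: cint_eqS.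
    - exact: (sbmM sm (sbm_cj (ispoly_sbm ip))).1.
    - exact: (sbmM sm (sbm_cj (sbm_boundary (palg_pfun ip)))).1.
    by move=> z z1; rewrite boundary_pfun ?z1.
  have E2 : cint (fun z => m z * G2 z) = 0.
    apply: (H2S_approx_cint sm hG2) => p ip.
    rewrite -(ma _ (palg_pfun ip)); apply: cint_eqS.
    - exact: (sbmM sm (ispoly_sbm ip)).1.
    - exact: (sbmM (sbm_boundary (palg_pfun ip)) sm).1.
    by move=> z z1; rewrite boundary_pfun ?z1// mulrC.
  have s1 := sint_L2 hG1.1; have s2 := sint_L2 hG2.1.
  have s1c : sint (fun z => cj (G1 z)).
    split; first exact: measurable_funC_cj s1.1.
    exact: (cintegrable_cj measurableT s1.2).
  rewrite -[RHS]addr0 -{1}E1 -E2 -(cint_sintD (sint_mul sm s1c) (sint_mul sm s2)).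
  congr cint; apply/funext => z.
  have E : cj ((G1 + (fun z => cj (G2 z))) z) = cj (G1 z) + G2 z by rewrite fctE cjD cjK.
  exact: (etrans (congr1 ( *%R (m z)) E) (mulrDr _ _ _)).
exists (fun z => cj (bd (q1 + q) z)).
  exists (bd (q1 + q)) => //.
  split; first exact: (sbm_L2 (sbm_boundary (palgD p1 pq))).
  by exists (q1 + q); [exact: (qD Q1 Qq)|exact: aeW].
exists (m + bd k).
  exists m; first exact: mMS.
  exists (bd k) => //; split; first exact: (H2S_boundary pk).
  rewrite /L2dot -[RHS]k0 -(H2dot_1 (palg_H2 pk)) (palg_dot pk (palg_cst 1)).
  apply: cint_eqS.
  - exact: (sbmM sk (sbm_cj (sbm_cst 1))).1.
  - exact: (sbmM sk (sbm_cj (sbm_boundary (palg_cst 1)))).1.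
  by move=> z z1; rewrite boundary_cst ?z1.
apply/funext => z; rewrite !fctE (boundaryD p1 pq) cjD /m /F0.
by ring.
Qed.

(** The multiplier has no boundary function, so it is replaced by its dilations phi_r, which belong
    to the ball algebra and preserve the orthocomplement. The error phi_r (u_r - u) tends to 0
    uniformly because u extends continuously. *)
Lemma perp_bounded phi u (B : R) : analytic phi -> 0 <= B ->
  (forall z, en z < 1 -> nc (ext phi z) <= B) ->
  palg u -> perp u -> perp (mult phi u).
Proof.
move=> aphi B0 hB pu pQ; have [hu _] := pQ; have [hm _] := H2_mult aphi B0 hB hu.
split; first exact: hm.
move=> h Qh; have ph := q_palg Qh.
apply: (left_lim_uniq (dot_half hm ph)).
have [M M0 hM] := palg_bounded ph.
have BM0 : 0 <= B * M by exact: mulr_ge0.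
move=> e e0; have BM1 : 0 < B * M + 1 by rewrite ltr_wpDl.
have [r0 r01 hr] := palg_unif pu (divr_gt0 e0 BM1); exists r0; first exact: r01.
move=> r rr r1; rewrite subr0; have /andP[r00 _] := r01.
have r01' : 0 <= r < 1 by rewrite r1 (le_trans r00 (ltW rr)).
have pd := dil_palg aphi r01'.
have [_ /(_ h Qh) E] := perp_palg pd pQ.
have rz z : en z = 1 -> en (r%:C *: z) < 1.
  by move=> z1; rewrite eucl_normZ z1 mulr1 nc_real ger0_norm//; case/andP: r01'.
have su := sbm_boundary pu; have sh := sbm_cj (sbm_boundary ph); have sd := sbm_boundary pd.
have su' := sbm_dilation pu.1 r01'.
have -> : cint (fun z => ext (mult phi u) (r%:C *: z) * cj (bd h z)) =
    cint (fun z => bd (dil r phi) z * (ext u (r%:C *: z) - bd u z) * cj (bd h z)).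
  rewrite -[RHS]addr0 -[X in _ = _ + X]E (palg_dot (palgM pd pu) ph).
  rewrite -(cintD (sbmM (sbmM sd (sbmB su' su)) sh) (sbmM (sbm_boundary (palgM pd pu)) sh)).
  apply: cint_eqS.
  - exact: (sbmM (sbm_dilation hm.1 r01') sh).1.
  - exact: (sbmD (sbmM (sbmM sd (sbmB su' su)) sh) (sbmM (sbm_boundary (palgM pd pu)) sh)).1.
  move=> z z1; rewrite zero_extM (boundaryM pd pu) (dil_boundary aphi r01') ?z1//.
  by ring.
apply: le_trans (cint_le (M := B * (e / (B * M + 1)) * M) (sbmM (sbmM sd (sbmB su' su)) sh) _) _.
  move=> z z1; rewrite !ncM nc_cj; apply: ler_pM; rewrite ?mulr_ge0 ?nc_ge0//.
    apply: ler_pM; rewrite ?nc_ge0//.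
      by rewrite (dil_boundary aphi r01') ?z1//; exact: hB (rz z z1).
    by apply: hr => //; rewrite z1.
  by apply: hM; rewrite z1.
rewrite mulrAC mulrA ler_pdivrMr// mulrC ler_wpM2l ?(ltW e0)//.
by rewrite lerDl.
Qed.

End symbol.

Lemma mul_le_half_sqr (x y : R) : x * y <= 2^-1 * (x ^+ 2 + y ^+ 2).
Proof. by have := sqr_ge0 (x - y); rewrite sqrrB; lra. Qed.

(** * The norm of the functional *)

Section functional.
Implicit Types (z w e : Cn) (f g h u q phi : Bn -> C).

Transparent cint.
Lemma Re_cint (F : Cn -> C) : Re (cint F) = \int[sigma]_z Re (F z).
Proof. by []. Qed.
Opaque cint.

Lemma L1_le (F G : Cn -> C) : sbm F -> sbm G ->
  (forall z, en z = 1 -> nc (F z) <= Re (G z)) ->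
  (cLnorm 1 F <= (Re (cint G))%:E)%E.
Proof.
move=> sF sG FG; rewrite (cL1_sbm sF) lee_fin Re_cint.
have iF := cintegrable_nc measurableT (sbm_cintegrable sF).
have iG := (sbm_cintegrable sG).1.
rewrite -subr_ge0 -RintegralB//; apply: Rintegral_ge0S.
  apply: measurable_funB; last exact: measurable_fun_nc sF.1.
  exact: measurableT_comp (@measurable_Re R) sG.1.
by move=> z z1; rewrite subr_ge0; exact: FG.
Qed.

(* The function psi of the theorem. *)
Definition symbol : Bn -> C := X (proj Q (cst 1)).

Lemma symbol_in : Q symbol.
Proof. exact: (bo_stable bX (projP (H2_1)).1). Qed.

Definition mqf f g q z := bd f z * cj (bd g z) + cj (bd q z).

Lemma sbm_mqf f g q : Q f -> Q g -> Q q -> sbm (mqf f g q).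
Proof.
move=> /(q_palg)/sbm_boundary sf /(q_palg)/sbm_boundary sg.
move=> /(q_palg)/sbm_boundary sq.
exact: (sbmD (sbmM sf (sbm_cj sg)) (sbm_cj sq)).
Qed.

Lemma XQ_mqf f g q : Q f -> Q g -> Q q ->
  XQ Q X (mqf f g q) = H2dot (X f) g + H2dot symbol q.
Proof.
move=> Qf Qg Qq; have pf := q_palg Qf; have pg := q_palg Qg.
have pq := q_palg Qq; have ps := q_palg symbol_in.
rewrite (op_symbol_dot Qf Qg) -/symbol multC -(cint_bd_dot ps pf pg) (palg_dot ps pq).
have ss := sbm_boundary ps; have sf := sbm_boundary pf.
have sg := sbm_cj (sbm_boundary pg); have sq := sbm_cj (sbm_boundary pq).
rewrite -(cintD (sbmM ss (sbmM sf sg)) (sbmM ss sq)) /XQ -/symbol.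
by congr cint; apply/funext => z; rewrite /mqf mulrDr.
Qed.

(** Normalization of the test function to the unit ball of L^1. Division is by I + d with d > 0,
    since I may vanish, and the scalar is put on f and q so that the shape of the test function is
    kept. *)
Lemma XQ_mqf_le f g q (s I : R) : Q f -> Q g -> Q q ->
  (functional_norm (MQ Q) (XQ Q X) <= s%:E)%E ->
  (cLnorm 1 (mqf f g q) <= I%:E)%E ->
  nc (H2dot (X f) g + H2dot symbol q) <= s * I.
Proof.
move=> Qf Qg Qq hs hI; rewrite -(XQ_mqf Qf Qg Qq).
have sF := sbm_mqf Qf Qg Qq; have I0 : 0 <= I.
  rewrite -lee_fin; apply: le_trans hI; rewrite (cL1_sbm sF) lee_fin.
  apply: Rintegral_ge0 => z _; exact: nc_ge0.
have pf := q_palg Qf; have pq := q_palg Qq.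
have key (d : R) : 0 < d -> nc (XQ Q X (mqf f g q)) <= s * (I + d).
  move=> d0; have Ie : 0 < I + d by rewrite ltr_wpDl.
  pose t : C := ((I + d)^-1)%:C.
  have t0 : 0 <= (I + d)^-1 by rewrite invr_ge0 ltW.
  have Qtf := qZ t Qf; have Qtq := qZ t Qq.
  have E : mqf (t *: f) g (t *: q) = (fun z => t * mqf f g q z).
    apply/funext => z; rewrite /mqf (boundaryZ pf) (boundaryZ pq) cjM.
    by rewrite /t cj_real mulrDr mulrA.
  have N : (cLnorm 1 (mqf (t *: f) g (t *: q)) <= 1)%E.
    rewrite (cL1_sbm (sbm_mqf Qtf Qg Qtq)) lee_fin E.
    under eq_Rintegral do rewrite ncM nc_real (ger0_norm t0).
    rewrite RintegralZl//; last exact: (cintegrable_nc measurableT (sbm_cintegrable sF)).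
    rewrite mulrC ler_pdivrMr// mul1r; move: hI; rewrite (cL1_sbm sF) lee_fin.
    by move=> h; apply: (le_trans h); rewrite lerDl ltW.
  have M : MQ Q (mqf (t *: f) g (t *: q)) by exact: (MQ_intro Qtf Qg Qtq).
  have L0 : ((nc (XQ Q X (mqf (t *: f) g (t *: q))))%:E <= functional_norm (MQ Q) (XQ Q X))%E.
    by apply: ereal_sup_ubound; exists (mqf (t *: f) g (t *: q)).
  have := le_trans L0 hs; rewrite lee_fin => L; rewrite -ler_pdivrMr// mulrC; apply: le_trans L.
  rewrite (XQ_mqf Qf Qg Qq) (XQ_mqf Qtf Qg Qtq).
  have E2 : H2dot (X (t *: f)) g + H2dot symbol (t *: q) = t * (H2dot (X f) g + H2dot symbol q).
    have e1 := etrans (congr1 (fun u => H2dot u g) (opZ t Qf)) (dotZl t (qH2 (bo_stable bX Qf)) (qH2 Qg)).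
    have e2 := dotZr t (qH2 Qq) (qH2 symbol_in).
    apply: (etrans (congr2 +%R e1 e2)); rewrite {2}/t cj_real.
    exact: (esym (mulrDr t _ _)).
  apply: (le_trans _ (eq_to_le (congr1 nc (esym E2)))).
  by rewrite ncM nc_real (ger0_norm t0).
apply/ler_addgt0Pr => e e0.
have s1 : 0 < `|s| + 1 by rewrite ltr_wpDl.
apply: le_trans (key _ (divr_gt0 e0 s1)) _; rewrite mulrDr lerD2l mulrCA.
rewrite ler_piMr ?(ltW e0)// ler_pdivrMr// mul1r; apply: le_trans (ler_norm s) _.
by rewrite lerDl.
Qed.

Hypothesis ncX : nonconstant Q X.

Lemma onorm_gt0 : 0 < onorm.
Proof.
rewrite lt_neqAle (onorm_ge0) andbT eq_sym; apply/eqP => s0; apply: ncX.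
exists 0 => f Qf; rewrite scale0r.
have := onorm_le Qf; rewrite s0 mul0r => h.
apply: (H2norm_eq0 (qH2 (bo_stable bX Qf))).
by apply/eqP; rewrite eq_le h H2norm_ge0.
Qed.

(** With f and g = X f / s of norm 1, the bound |f g| <= (|f|^2 + |g|^2) / 2 places f conj(g) in the
    unit ball of L^1, and the functional takes the value s there. *)
Lemma onorm_le_functional : ((onorm)%:E <= functional_norm (MQ Q) (XQ Q X))%E.
Proof.
have [f1 [Qf1 f10] Xf1] := onorm_attained; set s := onorm in Xf1 *.
have s0 : 0 < s := onorm_gt0.
have [fp [Qf nf]] := normalize Qf1 f10; set f := _ *: f1 in Qf nf.
have Xf : H2norm (X f) = s.
  rewrite /f (opZ _ Qf1) (H2normZ _ (qH2 (bo_stable bX Qf1))) nc_real.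
  rewrite ger0_norm ?invr_ge0 ?(ltW fp)// Xf1 mulrCA mulVf ?mulr1//.
  by rewrite gt_eqF.
have QX := bo_stable bX Qf; have hX := qH2 QX; have hf := qH2 Qf.
pose g := (s^-1)%:C *: X f; have Qg : Q g := qZ _ QX; have hg := qH2 Qg.
have ng : H2norm g = 1.
  rewrite /g (H2normZ _ hX) nc_real ger0_norm ?invr_ge0 ?(ltW s0)// Xf mulVf//.
  by rewrite gt_eqF.
have Q0 := q0.
have pf := q_palg Qf; have pg := q_palg Qg.
have sf := sbm_boundary pf; have sg := sbm_boundary pg.
have b0 z : bd (0 : Bn -> C) z = 0.
  have -> : (0 : Bn -> C) = 0 *: 0 by rewrite scaler0.
  by rewrite (boundaryZ palg0) mul0r.
apply: ereal_sup_ubound; exists (mqf f g 0); last first.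
  rewrite (XQ_mqf Qf Qg Q0).
  have -> : H2dot symbol 0 = 0 by exact: (dot0r (qH2 symbol_in)).
  rewrite addr0 /g (dotZr _ hX hX) (dot_ff hX) Xf cj_real -real_complexM nc_real expr2.
  by rewrite mulrA mulVf ?mul1r ?gt_eqF// gtr0_norm.
split; first exact: (MQ_intro Qf Qg Q0).
pose G z := 2^-1 * (bd f z * cj (bd f z) + bd g z * cj (bd g z)).
have sff := sbmM sf (sbm_cj sf); have sgg := sbmM sg (sbm_cj sg).
have sG : sbm G := sbmZ _ (sbmD sff sgg).
apply: le_trans (L1_le (sbm_mqf Qf Qg Q0) sG _) _.
  move=> z z1; rewrite /mqf b0 cj0 addr0 ncM nc_cj /G !mulcJ.
  rewrite (_ : 2^-1 = (2^-1 : R)%:C); last by rewrite rmorphV ?unitfE//= rmorph_nat.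
  rewrite -real_complexD -real_complexM /=.
  exact: mul_le_half_sqr.
rewrite /G (cintZ _ (sbmD sff sgg)) (cintD sff sgg) -(palg_dot pf pf) -(palg_dot pg pg).
rewrite (dot_ff hf) (dot_ff hg) nf ng expr1n.
rewrite (_ : 2^-1 = (2^-1 : R)%:C); last by rewrite rmorphV ?unitfE//= rmorph_nat.
have e2 : (2^-1 : R) * (1 + 1) = 1 by rewrite mulVf ?pnatr_eq0.
by rewrite -real_complexD -real_complexM e2 lee_fin.
Qed.

(** Since phi preserves the orthocomplement of Q, the symbol and phi pair equally with Q, so X_Q F =
    <phi, q> with q the part of F in Q. Replacing phi by phi_r in this pairing gives the integral of
    phi_r F, which is bounded by s ||F||_1. *)
Lemma lift_functional phi : analytic phi -> (forall z, en z < 1 -> nc (ext phi z) <= onorm) ->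
  (forall f, Q f -> X f = compression Q phi f) ->
  (functional_norm (MQ Q) (XQ Q X) <= (onorm)%:E)%E.
Proof.
move=> aphi hphi hX; set s := onorm in hphi *; have s0 : 0 <= s := onorm_ge0.
have h1 := H2_1 : H2 (cst 1 : Bn -> C).
have [hphi2 _] := H2_bounded aphi s0 hphi.
apply: ub_ereal_sup => _ [F [FM F1] <-]; have sF := MQ_sint FM.
have [q Qq hq] := MQ_pair FM; have pq := q_palg Qq.
have ps := q_palg symbol_in.
have F1' : fine (cLnorm 1 F) <= 1 by rewrite (cL1E sF.1 sF.2) /= -lee_fin -(cL1E sF.1 sF.2).
rewrite lee_fin; apply: (@le_trans _ _ (s * fine (cLnorm 1 F))); last by rewrite ler_piMr.
have -> : XQ Q X F = H2dot phi q.
  rewrite /XQ (hq _ ps) /symbol.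
  have [Q1 hp1] := projP h1; have pp1 := q_palg Q1.
  rewrite (hX _ Q1) /compression.
  have [hm _] := H2_mult aphi s0 hphi (qH2 Q1).
  have [hm1 _] := H2_mult aphi s0 hphi h1.
  rewrite ((projP hm).2 q Qq).
  have [_ pperp] := perp_bounded aphi s0 hphi (palgB (palg_cst 1) pp1) (perp_proj h1).
  apply/esym/eqP; rewrite -subr_eq0; apply/eqP.
  rewrite -{1}(mult1 phi) -(dotBl hm1 hm (qH2 Qq)) -multB.
  exact: (pperp q Qq).
apply: (left_lim_le (dot_half hphi2 pq)) => r r0 r1.
have r01 : 0 <= r < 1 by rewrite r1 ltW.
have pd := dil_palg aphi r01; have sd := sbm_boundary pd.
have dE z : en z = 1 -> bd (dil r phi) z = ext phi (r%:C *: z).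
  by move=> z1; rewrite (dil_boundary aphi r01) ?z1.
have -> : cint (fun z => ext phi (r%:C *: z) * cj (bd q z)) = cint (fun z => bd (dil r phi) z * F z).
  rewrite (hq _ pd) (palg_dot pd pq); apply: cint_eqS.
  - exact: (sbmM (sbm_dilation aphi r01) (sbm_cj (sbm_boundary pq))).1.
  - exact: (sbmM sd (sbm_cj (sbm_boundary pq))).1.
  by move=> z z1; rewrite dE.
apply: (sint_bound sF sd s0) => z z1; rewrite dE//; apply: hphi.
by rewrite eucl_normZ z1 mulr1 nc_real ger0_norm// ltW.
Qed.

Lemma sup_norm_le phi (s : R) : (sup_norm phi <= s%:E)%E -> forall z, en z < 1 -> nc (ext phi z) <= s.
Proof.
move=> h z z1; rewrite -lee_fin; apply: le_trans h; apply: ereal_sup_ubound.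
by exists (Sub z z1) => //; rewrite (zero_ext_in _ z1).
Qed.

Lemma lift_norm_eq : (exists phi : Bn -> C, [/\ schur_class phi,
    forall f, Q f -> X f = compression Q phi f & op_norm Q X = sup_norm phi]) ->
  op_norm Q X = functional_norm (MQ Q) (XQ Q X).
Proof.
move=> [phi [[aphi _] hX hn]]; rewrite (op_normE).
apply/eqP; rewrite eq_le onorm_le_functional /=; apply: (lift_functional aphi _ hX).
by apply: sup_norm_le; rewrite -hn (op_normE).
Qed.

End functional.

(** * Maximum principles and the identity theorem *)

Section local_analysis.
Implicit Types (p z w : Cn) (f g h u : Bn -> C).

(** A Hilbert space proof: <u, 1> = u(0) and ||u|| <= |u(0)|, so ||u - u(0)||^2 = ||u||^2 - |u(0)|^2
    <= 0. *)
Lemma strict_max u z : analytic u -> (forall w, en w < 1 -> nc (ext u w) <= nc (ext u 0)) ->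
  en z < 1 -> ext u z = ext u 0.
Proof.
move=> au hu z1; set c := ext u 0 in hu *.
have [h2 hn] := H2_bounded au (nc_ge0 c) hu.
have hc : H2 (cst c : Bn -> C) := palg_H2 (palg_cst c).
have h1 : H2 (cst 1 : Bn -> C) := H2_1.
have E1 : H2dot u (cst c) = c * cj c.
  have -> : (cst c : Bn -> C) = c *: cst 1 by apply/funext => w; exact: (esym (mulr1 c)).
  by rewrite (dotZr c h1 h2) (H2dot_1 h2) mulrC.
have z0 : en (0 : Cn) < 1 by rewrite eucl_norm0.
have E2 : H2dot (cst c : Bn -> C) (cst c : Bn -> C) = c * cj c.
  have E : (cst c : Bn -> C) = c *: cst 1 by apply/funext => w; exact: (esym (mulr1 c)).
  apply: (etrans (congr1 (H2dot (cst c : Bn -> C)) E)); apply: (etrans (dotZr c h1 hc)).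
  by rewrite (H2dot_1 hc) (zero_ext_cst _ z0) mulrC.
have hd : H2 (u - cst c) := H2B h2 hc.
have N0 : Re (H2dot (u - cst c) (u - cst c)) <= 0.
  have e1 : H2dot (u - (cst c : Bn -> C)) (u - (cst c : Bn -> C)) =
      H2dot u u - H2dot u (cst c) - (H2dot (cst c) u - H2dot (cst c : Bn -> C) (cst c)).
    apply: (etrans (dotBl h2 hc hd)); congr (_ - _); [exact: (dotBr h2 hc h2)|exact: (dotBr h2 hc hc)].
  rewrite e1 -(dot_cj h2 hc) E1 E2 cjM cjK (mulrC (cj c)) subrr subr0 (dot_ff h2) mulcJ.
  rewrite -real_complexB /= subr_le0; apply: le_powr hn; exact: H2norm_ge0.
have d0 : u - cst c = 0.
  apply: (H2norm_eq0 hd); rewrite (norm_dot hd).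
  by rewrite ler0_sqrtr.
have -> : u = (u - cst c) + cst c by rewrite subrK.
by rewrite d0 add0r zero_ext_cst.
Qed.

Lemma palg_ucont f (e : R) : palg f -> 0 < e -> exists2 d : R, 0 < d &
  forall z w, en z <= 1 -> en w <= 1 -> en (z - w) < d ->
    nc (bd f z - bd f w) <= e.
Proof.
move=> pf e0; have e4 : 0 < e / 4 by rewrite divr_gt0.
have [P pP fP] := palg_approx pf e4; have [L [M [L0 M0 h]]] := poly_lip pP.
have L1 : 0 < 4 * (L + 1) by rewrite mulr_gt0// ltr_wpDl.
exists (e / (4 * (L + 1))); first by rewrite divr_gt0.
move=> z w hz hw wz; have [_ hP] := h _ _ hz hw.
have h1 := fP _ hz; have h2 := fP _ hw.
have h3 : L * en (z - w) <= e / 4.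
  apply: (@le_trans _ _ (L * (e / (4 * (L + 1))))); first by rewrite ler_wpM2l// ltW.
  rewrite mulrA ler_pdivrMr//; nra.
apply: le_trans (nc_triangle _ (P z) _) _.
have := nc_triangle (P z) (P w) (bd f w).
by rewrite (ncBC (P w)); lra.
Qed.

Lemma cdiff_quotient f g (a b : Cn) (t : C) : analytic f -> analytic g ->
  en (a + t *: b) < 1 -> ext f (a + t *: b) != 0 ->
  cdiff (fun s => ext g (a + s *: b) * (ext f (a + s *: b))^-1) t.
Proof.
move=> /analyticP af /analyticP ag ab fab.
apply: (@derivable_cdiff R _ (fun z => ext g z * (ext f z)^-1) a b t).
apply: diff_derivable; apply: (@differentiableM _ _ (ext g)); first exact: ag.
by apply: differentiableV; [exact: af|exact: fab].
Qed.

(** Cauchy's estimate for g / f on the circle of radius rho - d, with its values there compared to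
    those on the boundary of the disc by uniform continuity of f and g. The factor in rho is the
    price of a bound off centre. *)
Lemma disc_bound f g (p w : Cn) (t0 : C) (rho s m : R) : palg f -> palg g -> en w = 1 ->
  nc t0 < rho -> 0 <= s -> 0 < m ->
  (forall t : C, nc t < rho -> en (p + t *: w) < 1) ->
  (forall t : C, nc t <= rho -> en (p + t *: w) <= 1) ->
  (forall t : C, nc t < rho -> m <= nc (ext f (p + t *: w))) ->
  (forall t : C, nc t = rho -> nc (bd g (p + t *: w)) <= s * nc (bd f (p + t *: w))) ->
  nc (ext g (p + t0 *: w)) <= s * nc (ext f (p + t0 *: w)) * (rho / ((rho - nc t0) / 2)).
Proof.
move=> pf pg w1 t0r s0 m0 in1 le1 fm gf; have n00 := nc_ge0 t0.
have rho0 : 0 < rho by apply: le_lt_trans t0r.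
have f0 t : nc t < rho -> ext f (p + t *: w) != 0.
  by move=> /fm h; rewrite -nc_gt0; exact: lt_le_trans h.
pose kap := (rho - nc t0) / 2.
have kap0 : 0 < kap by rewrite divr_gt0// subr_gt0.
pose v t := ext g (p + t *: w) * (ext f (p + t *: w))^-1.
have [a ha] := @taylor_disc R v rho (fun t ht => cdiff_quotient pf.1 pg.1 (in1 t ht) (f0 t ht)) rho0.
have fp0 : 0 < nc (ext f (p + t0 *: w)) by rewrite nc_gt0; exact: f0.
have key (e : R) : 0 < e -> nc (v t0) <= (s + (1 + s) * e / m) * (rho / kap).
  move=> e0; have [d1 d10 h1] := palg_ucont pf e0; have [d2 d20 h2] := palg_ucont pg e0.
  pose d := Num.min kap (Num.min (d1 / 2) (d2 / 2)).
  have d0 : 0 < d by rewrite /d !lt_min kap0 !divr_gt0.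
  have dr : d <= kap by rewrite /d ge_min lexx.
  have dd1 : d < d1 by rewrite /d !gt_min; apply/orP; right; apply/orP; left; clear -n0 qm fd bX mX d10; lra.
  have dd2 : d < d2 by rewrite /d !gt_min; apply/orP; right; apply/orP; right; clear -n0 qm fd bX mX d20; lra.
  have r2 : kap <= rho - d - nc t0 by move: dr; rewrite /kap; lra.
  have r0 : 0 < rho - d by apply: lt_le_trans kap0 _; apply: (le_trans r2); rewrite gerBl.
  have r1 : rho - d < rho by rewrite gtrBl.
  have [|an ex] := ha (rho - d) (s + (1 + s) * e / m) r0 r1.
    move=> t tr; have tr' : nc t < rho by rewrite tr.
    (* The radial projection of t to the boundary circle, at distance d from t. *)
    pose t' := (rho / (rho - d))%:C * t.
    have q0 : 0 <= rho / (rho - d) by rewrite divr_ge0 ?ltW.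
    have nt' : nc t' = rho by rewrite /t' ncM nc_real ger0_norm// tr divfK// gt_eqF.
    have dist : en ((p + t *: w) - (p + t' *: w)) = d.
      rewrite opprD addrACA subrr add0r -scalerBl eucl_normZ w1 mulr1.
      have -> : t - t' = (1 - rho / (rho - d))%:C * t by rewrite real_complexB mulrBl mul1r.
      rewrite ncM nc_real tr.
      have -> : 1 - rho / (rho - d) = - (d / (rho - d)).
        by apply: (mulIf (lt0r_neq0 r0)); rewrite mulrBl mulNr !divfK ?gt_eqF// mul1r; ring.
      by rewrite normrN ger0_norm ?divfK ?gt_eqF// divr_ge0 ?ltW.
    have B1 := le1 t (ltW tr'); have B2 := le1 t' (eq_to_le nt').
    have Df := h1 _ _ B1 B2; have Dg := h2 _ _ B1 B2; rewrite dist in Df Dg.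
    have {}Df := Df dd1; have {}Dg := Dg dd2.
    rewrite (palg_boundary_in pf.1 (in1 t tr')) in Df.
    rewrite (palg_boundary_in pg.1 (in1 t tr')) in Dg.
    have G := gf t' nt'; have Fm := fm t tr'.
    rewrite /v ncM ncV ler_pdivrMr; last exact: lt_le_trans Fm.
    have g1 : nc (ext g (p + t *: w)) <= nc (bd g (p + t' *: w)) + e.
      by have := ncB_ge (ext g (p + t *: w)) (bd g (p + t' *: w)); clear -n0 qm fd bX mX Dg; lra.
    have f1 : nc (bd f (p + t' *: w)) <= nc (ext f (p + t *: w)) + e.
      by have := ncB_ge (bd f (p + t' *: w)) (ext f (p + t *: w)); rewrite ncBC; clear -n0 qm fd bX mX Df; lra.
    move: g1 f1 G Fm; move: (nc (ext g _)) (nc (bd g _)) (nc (bd f _)) (nc (ext f _)).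
    move=> x1 x2 x3 x4 g1 f1 G Fm.
    apply: (@le_trans _ _ (s * x4 + (1 + s) * e)).
      by have := ler_wpM2l s0 f1; clear -n0 qm fd bX mX g1 G; lra.
    rewrite [X in _ <= X]mulrDl lerD2l -[X in _ <= X]mulrA; apply: ler_peMr; first by rewrite mulr_ge0 ?addr_ge0// ltW.
    by rewrite mulrC ler_pdivlMr// mul1r.
  have h0 : nc t0 < rho - d by rewrite -subr_gt0; exact: lt_le_trans r2.
  (* With no terms subtracted, the Taylor remainder estimate is a bound for the value itself. *)
  have := ex 0%N t0 h0; rewrite big_ord0 subr0 expr0 mulr1 => L; apply: (le_trans L).
  apply: ler_wpM2l.
    by rewrite addr_ge0// divr_ge0 ?(ltW m0)// mulr_ge0 ?(ltW e0)// addr_ge0.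
  apply: ler_pM; [exact: ltW|by rewrite invr_ge0 subr_ge0 ltW|exact: ltW|].
  by rewrite lef_pV2 ?posrE// (lt_le_trans kap0).
have : nc (v t0) <= s * (rho / kap).
  apply/ler_addgt0Pr => e e0.
  have s1 : 0 < 1 + s by apply: lt_le_trans ltr01 _; rewrite lerDl.
  have k0 : 0 < (1 + s) / m * (rho / kap) := mulr_gt0 (divr_gt0 s1 m0) (divr_gt0 rho0 kap0).
  have := key _ (divr_gt0 e0 k0); congr (_ <= _).
  rewrite mulrDl; congr (_ + _).
  rewrite (_ : (1 + s) * (e / ((1 + s) / m * (rho / kap))) / m * (rho / kap) =
    e * (((1 + s) / m * (rho / kap)) / ((1 + s) / m * (rho / kap)))); last by ring.
  by rewrite mulfV ?mulr1// gt_eqF.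
by rewrite /v ncM ncV ler_pdivrMr// mulrAC.
Qed.

Lemma pow_le_bound (x y K : R) : 0 <= x -> 0 <= y -> (forall k, x ^+ k <= y ^+ k * K) -> x <= y.
Proof.
move=> x0 y0 h; rewrite leNgt; apply/negP => yx.
have xp : 0 < x := le_lt_trans y0 yx.
have q0 : 0 <= y / x by exact: divr_ge0.
have q1 : y / x < 1 by rewrite ltr_pdivrMr// mul1r.
have Ki : 0 < (`|K| + 1)^-1 by rewrite invr_gt0.
have [N /(_ N (leqnn N)) hN] := geo_small q0 q1 Ki.
have xN : 0 < x ^+ N by rewrite exprn_gt0.
have h1 : 1 <= (y / x) ^+ N * K.
  by rewrite expr_div_n mulrAC ler_pdivlMr// mul1r; exact: h.
have h2 : (y / x) ^+ N * K <= (y / x) ^+ N * (`|K| + 1).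
  by apply: ler_wpM2l; [exact: exprn_ge0|rewrite (le_trans (ler_norm K))// lerDl].
have h3 : (y / x) ^+ N * (`|K| + 1) < 1 by rewrite -ltr_pdivlMr// mul1r.
by have := le_lt_trans (le_trans h1 h2) h3; rewrite ltxx.
Qed.

Definition fpow f k : Bn -> C := iter k (mult f) (cst 1).

Lemma palg_fpow f k : palg f -> palg (fpow f k).
Proof. by move=> pf; elim: k => [|k ih]; [exact: palg_cst|exact: palgM]. Qed.

Lemma zero_ext_fpow f k z : en z < 1 -> ext (fpow f k) z = ext f z ^+ k.
Proof.
move=> z1; elim: k => [|k ih]; first by rewrite zero_ext_cst.
by rewrite /fpow iterS -/(fpow f k) zero_extM ih exprS.
Qed.

Lemma boundary_fpow f k z : palg f -> en z <= 1 -> bd (fpow f k) z = bd f z ^+ k.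
Proof.
move=> pf z1; elim: k => [|k ih].
  exact: (@boundary_pfun (fun=> 1) z (ispoly_cst _) z1).
by rewrite /fpow iterS -/(fpow f k) (boundaryM pf (palg_fpow k pf)) ih exprS.
Qed.

(* Applying the crude Cauchy bound to the powers of the quotient removes the constant. *)
Lemma disc_max f g (p w : Cn) (t0 : C) (rho s m : R) : palg f -> palg g -> en w = 1 ->
  nc t0 < rho -> 0 <= s -> 0 < m ->
  (forall t : C, nc t < rho -> en (p + t *: w) < 1) ->
  (forall t : C, nc t <= rho -> en (p + t *: w) <= 1) ->
  (forall t : C, nc t < rho -> m <= nc (ext f (p + t *: w))) ->
  (forall t : C, nc t = rho -> nc (bd g (p + t *: w)) <= s * nc (bd f (p + t *: w))) ->
  nc (ext g (p + t0 *: w)) <= s * nc (ext f (p + t0 *: w)).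
Proof.
move=> pf pg w1 t0r s0 m0 in1 le1 fm gf.
apply: (pow_le_bound (nc_ge0 _) (mulr_ge0 s0 (nc_ge0 _)) (K := rho / ((rho - nc t0) / 2))) => k.
rewrite exprMn -!ncX -!zero_ext_fpow ?in1//.
apply: (disc_bound (m := m ^+ k) (palg_fpow k pf) (palg_fpow k pg) w1 t0r) => //.
- exact: exprn_ge0.
- exact: exprn_gt0.
- by move=> t tr; rewrite zero_ext_fpow ?in1// ncX; apply: le_powr (fm t tr); exact: ltW.
move=> t tr; rewrite !boundary_fpow ?le1 ?tr// !ncX -exprMn.
by apply: le_powr (gf t tr); exact: nc_ge0.
Qed.

Lemma orthogonal_unit p : (1 < n)%N -> exists2 w, en w = 1 & ip w p = 0.
Proof.
move=> n1; pose i0 := Ordinal n0; pose i1 := Ordinal n1.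
pose e0 : Cn := delta_mx ord0 i0; pose e1 : Cn := delta_mx ord0 i1.
have ipe i : ip (delta_mx ord0 i) p = cj (p ord0 i).
  rewrite ipE (bigD1 i)//= mxE !eqxx mul1r big1 ?addr0// => j ji.
  by rewrite mxE eqxx (negbTE ji) mul0r.
have [p0|p0] := eqVneq (p ord0 i0) 0.
  by exists e0; [exact: eucl_norm_delta|rewrite ipe p0 cj0].
pose w := cj (p ord0 i1) *: e0 - cj (p ord0 i0) *: e1.
have wp : ip w p = 0.
  by rewrite /w ipDl -scaleNr !ipZl !ipe; ring.
have w0 : en w != 0.
  rewrite eucl_norm_eq0; apply/eqP => /rowP /(_ i1).
  rewrite /w /e0 /e1 !mxE /= ?eqxx /= ?mulr0n ?mulr1n mulr0 mulr1 sub0r => /eqP.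
  rewrite oppr_eq0 => /eqP /(congr1 cj); rewrite cjK cj0 => /eqP.
  by rewrite (negbTE p0).
exists ((en w)^-1%:C *: w); last by rewrite ipZl wp mulr0.
by rewrite eucl_normZ nc_real ger0_norm ?invr_ge0 ?eucl_norm_ge0// mulVf.
Qed.

Lemma eucl_norm_orthogonal p w (t : C) : en w = 1 -> ip w p = 0 ->
  en (p + t *: w) ^+ 2 = en p ^+ 2 + nc t ^+ 2.
Proof.
move=> w1 wp; apply: complexI; rewrite real_complexD -!ip_norm -mulcJ.
have pw : ip p w = 0.
  rewrite -[RHS]cj0 -wp !ipE cj_sum; apply: eq_bigr => i _.
  by rewrite cjM cjK mulrC.
rewrite !ipDl !ipDr !ipZl !ipZr wp pw (ip_norm w) w1 expr1n.
by rewrite (_ : (1 : R)%:C = 1)//; ring.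
Qed.

(** For n > 1 there is a unit vector w orthogonal to p, and the disc p + t w of radius sqrt(1 -
    |p|^2) has its boundary on the sphere. For p near [ze] the whole disc is near [ze], where f and
    g are bounded away from zero, so the maximum principle applies to g / f and to f / g. *)
Lemma local_modulus f g (s : R) (ze : Cn) : (1 < n)%N -> palg f -> palg g -> 0 < s ->
  (forall z, en z = 1 -> nc (bd g z) = s * nc (bd f z)) ->
  en ze = 1 -> bd f ze != 0 ->
  exists2 d : R, 0 < d & forall p, en p < 1 -> en (p - ze) < d ->
    ext f p != 0 /\ nc (ext g p) = s * nc (ext f p).
Proof.
move=> n1 pf pg s0 gf ze1 fz.
pose m := nc (bd f ze) / 2.
have m0 : 0 < m by rewrite /m divr_gt0// nc_gt0.
have sm0 : 0 < s * m by rewrite mulr_gt0.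
have [d1 d10 h1] := palg_cont pf (eq_to_le ze1) m0.
have [d2 d20 h2] := palg_cont pg (eq_to_le ze1) sm0.
pose d0 := Num.min 1 (Num.min d1 d2).
have d00 : 0 < d0 by rewrite /d0 !lt_min ltr01 d10 d20.
have d01 : d0 <= d1 by rewrite /d0 !ge_min lexx !orbT.
have d02 : d0 <= d2 by rewrite /d0 !ge_min lexx !orbT.
have d03 : d0 <= 1 by rewrite /d0 ge_min lexx.
have fm w : en w <= 1 -> en (w - ze) < d0 -> m <= nc (bd f w).
  move=> w1 wz; have := h1 w w1 (lt_le_trans wz d01).
  have := ncB_ge (bd f ze) (bd f w); rewrite ncBC /m; lra.
have gm w : en w <= 1 -> en (w - ze) < d0 -> s * m <= nc (bd g w).
  move=> w1 wz; have := h2 w w1 (lt_le_trans wz d02).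
  have := ncB_ge (bd g ze) (bd g w); rewrite ncBC (gf _ ze1) /m; lra.
(* Then rho^2 <= 2 (1 - |p|) <= (d0 / 2)^2, so the disc stays within d0 of [ze]. *)
exists (d0 ^+ 2 / 8); first by rewrite divr_gt0// exprn_gt0.
move=> p p1 pz; have [w w1 wp] := orthogonal_unit p n1.
have pn0 := eucl_norm_ge0 p.
pose rho := Num.sqrt (1 - en p ^+ 2).
have p2 : en p ^+ 2 < 1 by rewrite expr_lt1.
have rho2 : rho ^+ 2 = 1 - en p ^+ 2 by rewrite sqr_sqrtr// subr_ge0 ltW.
have rho0 : 0 < rho by rewrite sqrtr_gt0 subr_gt0.
have pd : 1 - en p <= en (p - ze).
  have := eucl_normD p (ze - p); rewrite addrC subrK ze1 -opprB eucl_normN; lra.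
have rhod : rho <= d0 / 2.
  rewrite -ler_sqr ?nnegrE ?ltW ?divr_gt0// rho2.
  by move: pd pz d00 d03 pn0; clear -n0 qm fd bX mX p1; move: (en p) (en (p - ze)) p1 => x y *; nra.
have pd0 : en (p - ze) < d0 / 2.
  by apply: (lt_le_trans pz); move: d00 d03; clear -n0 qm fd bX mX; nra.
have in1 t : nc t < rho -> en (p + t *: w) < 1.
  move=> tr; rewrite -(@ltr_pXn2r _ 2) ?nnegrE ?eucl_norm_ge0// expr1n eucl_norm_orthogonal//.
  have : nc t ^+ 2 < rho ^+ 2 by rewrite ltr_pXn2r ?nnegrE ?nc_ge0 ?ltW.
  by rewrite rho2; lra.
have le1 t : nc t <= rho -> en (p + t *: w) <= 1.
  move=> tr; rewrite -ler_sqr ?nnegrE ?eucl_norm_ge0// expr1n eucl_norm_orthogonal//.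
  have : nc t ^+ 2 <= rho ^+ 2 by apply: le_powr; rewrite ?nc_ge0.
  by rewrite rho2; lra.
have eq1 t : nc t = rho -> en (p + t *: w) = 1.
  move=> tr; apply: sqr_eq1; rewrite ?eucl_norm_ge0// eucl_norm_orthogonal// tr rho2.
  by ring.
have near t : nc t <= rho -> en (p + t *: w - ze) < d0.
  move=> tr; rewrite addrAC; apply: le_lt_trans (eucl_normD _ _) _.
  rewrite eucl_normZ w1 mulr1; lra.
have fin t : nc t < rho -> m <= nc (ext f (p + t *: w)).
  move=> tr; rewrite -(palg_boundary_in pf.1 (in1 t tr)).
  by apply: fm; [exact/ltW/in1|exact/near/ltW].
have gin t : nc t < rho -> s * m <= nc (ext g (p + t *: w)).
  move=> tr; rewrite -(palg_boundary_in pg.1 (in1 t tr)).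
  by apply: gm; [exact/ltW/in1|exact/near/ltW].
have nr0 : nc (0 : C) < rho by rewrite nc0.
have p0 : p + 0 *: w = p by rewrite scale0r addr0.
split.
  by rewrite -nc_gt0; have := fin 0 nr0; rewrite p0; exact: lt_le_trans.
apply/eqP; rewrite eq_le; apply/andP; split.
  rewrite -p0; apply: (disc_max pf pg w1 nr0 (ltW s0) m0 in1 le1 fin) => t tr.
  by rewrite (gf _ (eq1 t tr)).
have si : 0 <= s^-1 by rewrite invr_ge0 ltW.
rewrite mulrC -ler_pdivlMr// mulrC -p0.
apply: (disc_max pg pf w1 nr0 si sm0 in1 le1 gin) => t tr.
by rewrite (gf _ (eq1 t tr)) mulrA mulVf ?mul1r// gt_eqF.
Qed.

(** In the largest ball about p inside the unit ball, h is rescaled to the unit ball; its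
    homogeneous components vanish by uniqueness of expansions near the centre. *)
Lemma vanish_ball h p (d : R) : analytic h -> en p < 1 -> 0 < d ->
  (forall z, en (z - p) < d -> ext h z = 0) ->
  forall z, en (z - p) < 1 - en p -> ext h z = 0.
Proof.
move=> ah p1 d0 hd; set r := 1 - en p; have r0 : 0 < r by rewrite subr_gt0.
have inB z : en z < 1 -> en (p + r%:C *: z) < 1.
  move=> z1; apply: le_lt_trans (eucl_normD _ _) _.
  rewrite eucl_normZ nc_real (ger0_norm (ltW r0)).
  have : r * en z < r by rewrite gtr_pMr.
  by rewrite /r; lra.
pose H : Bn -> C := pfun (fun z => ext h (p + r%:C *: z)).
have aH : analytic H by exact: analytic_affine.
have HE z : en z < 1 -> ext H z = ext h (p + r%:C *: z).
  by move=> z1; rewrite zero_ext_pfun.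
suff H0 : H = 0.
  move=> z zr; have z1 : en (r^-1%:C *: (z - p)) < 1.
    by rewrite eucl_normZ nc_real ger0_norm ?invr_ge0 ?(ltW r0)// mulrC ltr_pdivrMr// mul1r.
  have := HE _ z1; rewrite scalerA -real_complexM mulfV ?gt_eqF// scale1r (addrC p) subrK => <-.
  rewrite H0; have -> : (0 : Bn -> C) = 0 *: 0 by rewrite scaler0.
  by rewrite zero_extZ mul0r.
apply: (hc_eq0 aH) => k e e1.
have s0 : 0 < 2^-1 :> R by lra.
have s1 : 2^-1 < 1 :> R by lra.
have [M M0 hM] := analytic_bounded aH s1.
have hM' (t : C) : nc t = 2^-1 -> nc (ext H (t *: e)) <= M.
  by move=> te; apply: hM; rewrite eucl_normZ e1 mulr1 te.
have [_ ex] := hc_taylor_unit aH e1 s0 s1 hM'.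
pose del := Num.min (4^-1) (d / r).
have del0 : 0 < del by rewrite /del lt_min divr_gt0// andbT; lra.
apply: (@expansion_unique _ (fun t => ext H (t *: e)) (hc H ^~ e) (fun=> 0) del
  (fun N => M * 2 ^+ N * 2) (fun=> 0) del0).
  move=> N t tdel; have t4 : nc t < 4^-1 by move: tdel; rewrite /del lt_min => /andP[].
  have t2 : nc t < 2^-1 by clear -n0 qm fd bX mX t4; lra.
  apply: le_trans (ex N t t2) _; rewrite invrK exprMn.
  rewrite (_ : M * 2 ^+ N * 2 * nc t ^+ N = M * (nc t ^+ N * 2 ^+ N) * 2); last by ring.
  apply: ler_wpM2l; first by rewrite !mulr_ge0 ?exprn_ge0 ?nc_ge0.
  by rewrite ler_pdivrMr; clear -n0 qm fd bX mX t4; lra.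
move=> N t tdel; rewrite big1 => [|i _]; last by rewrite mul0r.
rewrite subr0 mul0r.
have tr : nc t * r < d.
  by rewrite -ltr_pdivlMr//; move: tdel; rewrite /del lt_min => /andP[].
have t1 : en (t *: e) < 1.
  rewrite eucl_normZ e1 mulr1; move: tdel; rewrite /del lt_min => /andP[h4 _].
  by clear -n0 qm fd bX mX h4; lra.
rewrite HE// hd ?nc0// addrAC subrr add0r !eucl_normZ e1 mulr1 nc_real (ger0_norm (ltW r0)).
by rewrite mulrC.
Qed.

(** A chain of balls with centres on the segment from [ze] to 0. Vanishing on the ball of radius 1 -
    t about t [ze] allows the centre to move inwards by (1 - t) / 2, which multiplies 1 - t by 3/2.
    Hence N steps with (2/3)^N <= 1 - t reach the origin. *)
Lemma identity_theorem h (ze : Cn) (t d : R) : analytic h -> en ze = 1 -> 0 <= t -> t < 1 ->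
  0 < d -> (forall z, en (z - t%:C *: ze) < d -> ext h z = 0) -> h = 0.
Proof.
move=> ah ze1 t0 t1.
have e1 : 0 < 1 - t by rewrite subr_gt0.
have q0 : 0 <= 2 / 3 :> R by lra.
have q1 : 2 / 3 < 1 :> R by lra.
have [N /(_ N (leqnn N)) /ltW hN] := geo_small q0 q1 e1.
elim: N t d t0 t1 e1 hN => [|N ih] t d t0 t1 e1 hN d0 hd.
  have {}t0 : t = 0 by rewrite expr0 in hN; clear -n0 qm fd bX mX t0 hN; lra.
  apply: zero_extP => z z1.
  have zN := @eucl_norm0 R n.
  have -> : (0 : Bn -> C) = 0 *: 0 by rewrite scaler0.
  rewrite zero_extZ mul0r.
  apply: (@vanish_ball h 0 d ah _ d0); rewrite ?zN ?subr0 ?subr0//.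
  by move=> w; rewrite subr0 => wd; apply: hd; rewrite t0 scale0r subr0.
have tn : en (t%:C *: ze) = t by rewrite eucl_normZ nc_real ger0_norm// ze1 mulr1.
have tlt : en (t%:C *: ze) < 1 by rewrite tn.
have V := vanish_ball ah tlt d0 hd; rewrite tn in V.
pose t' := Num.max 0 (t - (1 - t) / 2).
have t'0 : 0 <= t' by rewrite /t' le_max lexx.
have t'1 : t - (1 - t) / 2 <= t' by rewrite /t' le_max lexx orbT.
have t't : t' <= t by rewrite /t' ge_max t0 /=; clear -n0 qm fd bX mX e1; lra.
have h1 : (2 / 3) ^+ N <= 1 - t'.
  rewrite /t' lerBrDl -lerBrDr ge_max; apply/andP; split.
    by rewrite subr_ge0; apply: exprn_ile1; [exact: q0|exact: ltW].
  by move: hN; rewrite exprS; clear -n0 qm fd bX mX; lra.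
have d'0 : 0 < (1 - t) / 2 by rewrite divr_gt0.
apply: (ih t' ((1 - t) / 2)) => //.
- by clear -n0 qm fd bX mX t't t1; lra.
- by clear -n0 qm fd bX mX t't t1; lra.
move=> z zt; apply: V.
rewrite -(subrK (t'%:C *: ze) z) -addrA; apply: le_lt_trans (eucl_normD _ _) _.
rewrite -scalerBl -real_complexB eucl_normZ nc_real ze1 mulr1 ler0_norm ?subr_le0//.
by clear -n0 qm fd bX mX zt t'1; lra.
Qed.

Lemma scaleB1 (a : R) z : a%:C *: z - z = (a - 1)%:C *: z.
Proof. by apply/rowP => i; rewrite !mxE real_complexB mulrBl mul1r. Qed.

(** Near a boundary point where f does not vanish, g / f is analytic of constant modulus on a small
    ball, hence constant there; the identity theorem carries g = c f to the whole ball. *)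
Lemma modulus_proportional f g (s : R) : (1 < n)%N -> palg f -> palg g -> 0 < s -> f <> 0 ->
  (forall z, en z = 1 -> nc (bd g z) = s * nc (bd f z)) ->
  exists2 c : C, nc c = s & g = c *: f.
Proof.
move=> n1 pf pg s0 f0 gf.
have [ze ze1 fz] : exists2 ze : Cn, en ze = 1 & bd f ze != 0.
  apply: contrapT => hn; apply: f0.
  have hf := palg_H2 pf; apply: (H2norm_eq0 hf); rewrite (norm_dot hf) (palg_dot pf pf).
  have sf := sbm_boundary pf.
  rewrite (cint_eqS (sbmM sf (sbm_cj sf)).1 (sbm_cst (0 : C)).1) ?(@cint_cst)//=.
    by rewrite sqrtr0.
  move=> z z1; have [->|zn] := eqVneq (bd f z) 0; first by rewrite mul0r.
  by exfalso; apply: hn; exists z.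
have [d d0 hd] := local_modulus n1 pf pg s0 gf ze1 fz.
(* The ball of radius [et] about (1 - et) [ze] lies in the unit ball and within 2 [et] < d of
   [ze]. *)
pose et := Num.min 2^-1 (d / 3).
have et0 : 0 < et by rewrite /et lt_min divr_gt0// andbT; lra.
have et2 : et <= 2^-1 by rewrite /et ge_min lexx.
have etd : et <= d / 3 by rewrite /et ge_min lexx orbT.
pose t := 1 - et; pose p : Cn := t%:C *: ze.
have t0 : 0 <= t by rewrite /t; clear -n0 qm fd bX mX et2; lra.
have t1 : t < 1 by rewrite /t; clear -n0 qm fd bX mX et0; lra.
have tn : en p = t by rewrite /p eucl_normZ nc_real ger0_norm// ze1 mulr1.
have inB z : en z < 1 -> en (p + et%:C *: z) < 1.
  move=> z1; apply: le_lt_trans (eucl_normD _ _) _.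
  rewrite eucl_normZ nc_real (ger0_norm (ltW et0)) tn.
  have : et * en z < et by rewrite gtr_pMr.
  by rewrite /t; clear -n0 qm fd bX mX; lra.
have near z : en z < 1 -> en (p + et%:C *: z - ze) < d.
  move=> z1; rewrite addrAC; apply: le_lt_trans (eucl_normD _ _) _.
  rewrite eucl_normZ nc_real (ger0_norm (ltW et0)).
  have pz : p - ze = (t - 1)%:C *: ze.
    exact: scaleB1.
  rewrite pz eucl_normZ ze1 mulr1 nc_real ler0_norm ?subr_le0 ?ltW//.
  have : et * en z < et by rewrite gtr_pMr.
  by rewrite /t; clear -n0 qm fd bX mX etd d0; lra.
have loc z (z1 : en z < 1) := hd _ (inB z z1) (near z z1).
pose F : Bn -> C := pfun (fun z => ext f (p + et%:C *: z)).
pose G : Bn -> C := pfun (fun z => ext g (p + et%:C *: z)).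
have aF : analytic F := analytic_affine pf.1 inB.
have aG : analytic G := analytic_affine pg.1 inB.
have FE z : en z < 1 -> ext F z = ext f (p + et%:C *: z) by move=> z1; rewrite zero_ext_pfun.
have GE z : en z < 1 -> ext G z = ext g (p + et%:C *: z) by move=> z1; rewrite zero_ext_pfun.
have F0 z : en z < 1 -> ext F z != 0 by move=> z1; rewrite FE//; exact: (loc z z1).1.
pose U : Bn -> C := fun z : Bn => G z / F z.
have aU : analytic U := analytic_quotient aG aF F0.
have UE z : en z < 1 -> ext U z = ext G z / ext F z.
  by move=> z1; rewrite !(zero_ext_in _ z1).
have Us z : en z < 1 -> nc (ext U z) = s.
  move=> z1; have [h1 h2] := loc z z1; rewrite (UE z z1) (FE z z1) (GE z z1) ncM ncV h2 mulfK//.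
  by rewrite nc_eq0.
have z0 : en (0 : Cn) < 1 by rewrite eucl_norm0.
set c := ext U 0; exists c; first exact: Us.
have Uc z : en z < 1 -> ext U z = c.
  by move=> z1; apply: strict_max => // w w1; rewrite !Us.
apply/eqP; rewrite -subr_eq0; apply/eqP.
have pd : palg (g - c *: f) := palgB pg (palgZ c pf).
apply: (@identity_theorem _ ze t et pd.1 ze1 t0 t1 et0) => z zt.
pose w := et^-1%:C *: (z - p).
have w1 : en w < 1.
  by rewrite eucl_normZ nc_real ger0_norm ?invr_ge0 ?(ltW et0)// mulrC ltr_pdivrMr// mul1r.
have zE : z = p + et%:C *: w.
  by rewrite /w scalerA -real_complexM mulfV ?gt_eqF// scale1r addrC subrK.
have := Uc w w1; rewrite (UE w w1) (FE w w1) (GE w w1) -zE => E.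
rewrite zero_extB zero_extZ -E divfK ?subrr//.
by have := F0 w w1; rewrite (FE w w1) -zE.
Qed.

End local_analysis.

(** * Continuity along the sphere, and the scalar inequalities of the first variation *)

Section sphere_continuity.
Implicit Types (F G : Cn -> C) (z w : Cn).

Definition scont F z := forall e : R, 0 < e -> exists2 d : R, 0 < d &
  forall w, en w = 1 -> en (w - z) < d -> nc (F w - F z) < e.

Lemma scontM F G z : scont F z -> scont G z -> scont (fun z => F z * G z) z.
Proof.
move=> cF cG e e0; pose B := nc (F z) + nc (G z) + 1.
have Fz := nc_ge0 (F z); have Gz := nc_ge0 (G z).
have B0 : 0 < B by rewrite /B; clear -n0 qm fd bX mX Fz Gz; lra.
have e1 : 0 < Num.min 1 (e / (2 * B)) by rewrite lt_min ltr01 divr_gt0// mulr_gt0.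
have [d1 d10 h1] := cF _ e1; have [d2 d20 h2] := cG _ e1.
exists (Num.min d1 d2); first by rewrite lt_min d10.
move=> w w1; rewrite lt_min => /andP[/(h1 w w1) + /(h2 w w1)].
rewrite !lt_min => /andP[f1 f2] /andP[g1 g2].
have -> : F w * G w - F z * G z = (F w - F z) * G w + F z * (G w - G z) by ring.
apply: le_lt_trans (ncD _ _) _; rewrite !ncM.
have gw : nc (G w) <= B.
  by have := ncB_ge (G w) (G z); rewrite /B; clear -n0 qm fd bX mX g1 Fz; lra.
have fz : nc (F z) <= B by rewrite /B; clear -n0 qm fd bX mX Gz; lra.
rewrite ltr_pdivlMr ?mulr_gt0// in f2; rewrite ltr_pdivlMr ?mulr_gt0// in g2.
have h3 : nc (F w - F z) * nc (G w) <= nc (F w - F z) * B by apply: ler_wpM2l gw; exact: nc_ge0.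
have h4 : nc (F z) * nc (G w - G z) <= B * nc (G w - G z) by apply: ler_wpM2r fz; exact: nc_ge0.
by clear -n0 qm fd bX mX h3 h4 f2 g2; lra.
Qed.

Lemma sbm_nc F : sbm F -> sbm (fun z => (nc (F z))%:C).
Proof.
move=> [mF [B hB]]; split.
  apply: measurable_fun_complex; first exact: measurable_fun_nc.
  exact: measurable_cst.
by exists B => z z1; rewrite nc_real ger0_norm ?nc_ge0//; exact: hB.
Qed.

End sphere_continuity.

Lemma half_midpoint (r : R) : 0 <= r -> r < 1 ->
  [/\ 0 < (1 + r) / 2, (1 + r) / 2 < 1 & r < (1 + r) / 2].
Proof. by move=> r0 r1; split; lra. Qed.

Lemma Re_gap (s a b : R) (c : R[i]) :
  Re (s%:C ^+ 2 * a%:C + b%:C - (2 * s)%:C * c) = s ^+ 2 * a + b - 2 * s * Re c.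
Proof. by case: c => x y; rewrite expr2 /=; ring. Qed.

Lemma double_gap (x s I : R) : x <= s * I -> x + x - 2 * s * I <= 0.
Proof. lra. Qed.

(** The expansion of |a + b| at a > 0 to first order in b, with the remainder |b|^2 / (2 m^2)
    uniform over a >= m^2. It will be used with a = |v|^2 and b = conj(q). *)
Lemma nc_add_le (a m : R) (b : R[i]) : 0 < m -> m ^+ 2 <= a ->
  nc (a%:C + b) <= Re (a%:C + b + (2^-1 * m ^- 2)%:C * (nc b ^+ 2)%:C).
Proof.
move=> m0 ma; set K := 2^-1 * m ^- 2.
have m2 : 0 < m ^+ 2 by rewrite exprn_gt0.
have aK : 1 <= 2 * a * K.
  rewrite /K mulrACA mulfV ?mul1r ?pnatr_eq0//.
  by rewrite ler_pdivlMr// mul1r.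
rewrite !cReD -real_complexM /=; set y := nc b ^+ 2; set x := Re b.
have xy : x ^+ 2 <= y by rewrite /y normc2E lerDl sqr_ge0.
have y0 : 0 <= y := sqr_ge0 _.
have a0 : 0 < a by exact: lt_le_trans ma.
have aKy : y <= 2 * a * (K * y) by rewrite mulrA ler_peMl.
have R0 : 0 <= a + x + K * y.
  rewrite -(pmulr_rge0 _ a0); move: aKy xy; move: (K * y) => z; clear -n0 qm fd bX mX.
  by have := sqr_ge0 (a + x); have := sqr_ge0 a; nra.
rewrite -ler_sqr ?nnegrE ?nc_ge0// nc_sqrD nc_real ger0_norm ?(ltW a0)//.
have -> : Re (a%:C * cj b) = a * x by rewrite /x; case: (b) => b1 b2 /=; ring.
rewrite -/y; have := sqr_ge0 (x + K * y).
by move: aKy; move: (K * y) => z; clear -n0 qm fd bX mX; nra.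
Qed.

Lemma lincomb_scale (F : comNzRingType) (c d t x y : F) :
  c * (t * x) - d * (t * y) = t * (c * x - d * y).
Proof. by ring. Qed.

Lemma scale_sqr (F : comNzRingType) (s m a b : F) :
  s ^+ 2 * (m * (a * b) ^+ 2) = a ^+ 2 * (s ^+ 2 * (m * b ^+ 2)).
Proof. by ring. Qed.

(** Multiply by |c| = |conj(c)| and bound the modulus on the left below by the real part; the terms
    |c|^2 N then cancel. *)
Lemma variation_scalar (c P w : R[i]) (N K q : R) :
  nc (c * N%:C + P) <= nc c * Re (N%:C + w + (2^-1 * K)%:C * q%:C) ->
  0 <= 2 * Re (c * cj c * w - cj c * P) + nc c ^+ 2 * (K * q).
Proof.
move=> h; have := ler_wpM2l (nc_ge0 c) h.
rewrite -{1}(nc_cj c) -ncM mulrA -expr2 => L.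
have := le_trans (Re_le_nc _) L; rewrite mulrDr mulrA [cj c * c]mulrC mulcJ.
rewrite !cReD !cReN -!real_complexM /=.
move: (nc c ^+ 2) => s; case: (cj c * P) => p1 p2; case: w {h L} => w1 w2 /=.
by move=> h; nra.
Qed.

Section sphere_continuity_more.
Implicit Types (F G : Cn -> C) (z w : Cn).

Lemma scont_boundary (f : unit_ball R n -> C) z : palg f -> en z = 1 -> scont (bd f) z.
Proof.
move=> pf z1 e e0; have [d d0 h] := palg_cont pf (eq_to_le z1) e0.
by exists d => // w w1; exact: (h w (eq_to_le w1)).
Qed.

Lemma scont_cj F z : scont F z -> scont (fun z => cj (F z)) z.
Proof.
move=> cF e e0; have [d d0 h] := cF e e0; exists d => // w w1 wz.
by rewrite -cjB nc_cj; exact: h.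
Qed.

Lemma scont_cst (c : C) z : scont (fun=> c) z.
Proof. by move=> e e0; exists 1 => // w _ _; rewrite subrr nc0. Qed.

Lemma scontB F G z : scont F z -> scont G z -> scont (fun z => F z - G z) z.
Proof.
move=> cF cG e e0; have e2 : 0 < e / 2 by rewrite divr_gt0.
have [d1 d10 h1] := cF _ e2; have [d2 d20 h2] := cG _ e2.
exists (Num.min d1 d2); first by rewrite lt_min d10.
move=> w w1; rewrite lt_min => /andP[/(h1 w w1) a1 /(h2 w w1) a2].
have -> : F w - G w - (F z - G z) = (F w - F z) - (G w - G z) by ring.
by apply: le_lt_trans (ncB _ _) _; clear -a1 a2; lra.
Qed.

End sphere_continuity_more.

(** * Extremal vectors, joint eigenvectors and the first variation *)

Section extremal.
Implicit Types (z w e : Cn) (f g h u v q : Bn -> C).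

Lemma nc_dist_scont f g (s : R) z : palg f -> palg g -> 0 <= s -> en z = 1 ->
  scont (fun z => (s * nc (bd f z) - nc (bd g z))%:C) z.
Proof.
move=> pf pg s0 z1 e e0; have e1 : 0 < e / (s + 1) / 2 by rewrite !divr_gt0// ltr_wpDl.
have e2 : 0 < e / 2 by rewrite divr_gt0.
have [d1 d10 h1] := palg_cont pf (eq_to_le z1) e1.
have [d2 d20 h2] := palg_cont pg (eq_to_le z1) e2.
exists (Num.min d1 d2); first by rewrite lt_min d10.
move=> w w1; rewrite lt_min => /andP[/(h1 w (eq_to_le w1)) a1 /(h2 w (eq_to_le w1)) a2].
rewrite -real_complexB nc_real.
move: (nc_dist (bd f w) (bd f z)) (nc_dist (bd g w) (bd g z)) a1 a2.
move: (nc (bd f w)) (nc (bd f z)) (nc (bd g w)) (nc (bd g z)).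
move: (nc (bd f w - _)) (nc (bd g w - _)) => x y a b c d h3 h4 h5 h6.
have s1 : 0 < s + 1 by rewrite ltr_wpDl.
have h7 : s * x <= e / 2.
  apply: (@le_trans _ _ ((s + 1) * x)).
    by rewrite mulrDl mul1r lerDl; apply: le_trans h3.
  by rewrite mulrC -ler_pdivlMr//; rewrite mulrAC; apply: ltW.
have -> : s * a - c - (s * b - d) = s * (a - b) - (c - d) by ring.
apply: le_lt_trans (ler_normB _ _) _; rewrite normrM (ger0_norm s0).
have h8 : s * `|a - b| <= s * x by exact: ler_wpM2l.
by clear -n0 qm fd bX mX h8 h7 h4 h6; lra.
Qed.

Lemma symbol0 : H2dot (symbol) 0 = 0.
Proof. exact: (dot0r (qH2 (symbol_in))). Qed.

Lemma boundary0 z : bd (0 : Bn -> C) z = 0.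
Proof.
have -> : (0 : Bn -> C) = 0 *: 0 by rewrite scaler0.
by rewrite (boundaryZ palg0) mul0r.
Qed.

(** Testing the functional on f conj(g) gives ||g||^2 <= s times the integral of |f| |g|. As ||g|| =
    s ||f||, the integral of (s |f| - |g|)^2 is then at most 0, and its integrand is continuous. *)
Lemma extremal_modulus f : Q f -> H2norm (X f) = onorm * H2norm f ->
  (functional_norm (MQ Q) (XQ Q X) <= (onorm)%:E)%E ->
  forall z, en z = 1 -> nc (bd (X f) z) = onorm * nc (bd f z).
Proof.
move=> Qf nf hfn z z1; set s := onorm in nf hfn *; have s0 : 0 <= s := onorm_ge0.
have Qg := bo_stable bX Qf; set g := X f in Qg nf *.
have pf := q_palg Qf; have pg := q_palg Qg.
have sf := sbm_boundary pf; have sg := sbm_boundary pg.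
have sH := sbmM (sbm_nc sf) (sbm_nc sg).
set H := (fun w => _ * _) in sH.
have hH : (cLnorm 1 (mqf f g (0 : Bn -> C)%R) <= (Re (cint H))%:E)%E.
  apply: (L1_le (sbm_mqf Qf Qg (q0)) sH) => w w1.
  rewrite /mqf boundary0 cj0 addr0 ncM nc_cj /H -real_complexM.
  exact: lexx.
have := XQ_mqf_le Qf Qg (q0) hfn hH.
rewrite symbol0 addr0 -/g (dot_ff (qH2 Qg)) nc_real ger0_norm ?sqr_ge0// => L.
pose d w := (s * nc (bd f w) - nc (bd g w))%:C : C.
pose F w := d w * d w.
have sd : sbm d.
  have := sbmB (sbmZ s%:C (sbm_nc sf)) (sbm_nc sg); congr sbm; apply/funext => w.
  by rewrite /d real_complexB real_complexM.
have sF : sbm F := sbmM sd sd.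
have sff := sbmM sf (sbm_cj sf); have sgg := sbmM sg (sbm_cj sg).
have FE : cint F = s%:C ^+ 2 * H2dot f f + H2dot g g - (2 * s)%:C * cint H.
  rewrite (palg_dot pf pf) (palg_dot pg pg) -(cintZ _ sff) -(cintZ _ sH).
  rewrite -(cintD (sbmZ _ sff) sgg) -(cintB (sbmD (sbmZ _ sff) sgg) (sbmZ _ sH)).
  congr cint; apply/funext => w; rewrite !mulcJ /F /d /H expr2 -!real_complexM -real_complexD -real_complexB.
  by congr (_%:C); ring.
have F0 w : 0 <= F w by rewrite /F /d -real_complexM lecR -expr2 sqr_ge0.
have F1 : 0 <= cint F by apply: (cint_ge0 sF.1) => w _.
have ReF : Re (cint F) <= 0.
  rewrite FE (dot_ff (qH2 Qf)) (dot_ff (qH2 Qg)) Re_gap nf.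
  by rewrite nf exprMn in L; rewrite exprMn; exact: double_gap L.
have F00 : cint F = 0.
  move: F1; rewrite lecE /= => /andP[/eqP h1 h2].
  apply/eqP; rewrite eq_complex /= h1 eqxx andbT; apply/eqP/le_anti.
  by rewrite ReF h2.
have := cint_eq0 sF (fun w _ => F0 w) F00 z1 (scontM (nc_dist_scont pf pg s0 z1) (nc_dist_scont pf pg s0 z1)).
rewrite /F -expr2 => /eqP; rewrite sqrf_eq0 => /eqP /complexI /eqP.
by rewrite subr_eq0 => /eqP.
Qed.

(** Induction over the coordinates: the joint eigenspace for those already treated is invariant
    under the next backward shift because the shifts commute. *)
Lemma joint_eigenvector (V : set (Bn -> C)) v : V `<=` Q ->
  (forall (a : C) f g, V f -> V g -> V (a *: f + g)) ->
  (forall i f, V f -> V (Aop i f)) -> V v -> v <> 0 ->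
  exists u (al : 'I_n -> C), [/\ V u, u <> 0 & forall i, Aop i u = al i *: u].
Proof.
move=> VQ Vlin VA Vv v0; have [m [s [Qs hs]]] := fd.
have V0 : V 0.
  by have := Vlin (-1) v v Vv Vv; rewrite scaleN1r addNr.
suff [u [al [Vu u0 hu]]] : exists u (al : 'I_n -> C),
    [/\ V u, u <> 0 & forall i, i \in enum 'I_n -> Aop i u = al i *: u].
  by exists u, al; split=> // i; apply: hu; rewrite mem_enum.
elim: (enum 'I_n) => [|j r [u [al [Vu u0 hu]]]].
  by exists v, (fun=> 0); split.
pose W := [set f | V f /\ forall i, i \in r -> Aop i f = al i *: f].
have WV f : W f -> V f by case.
have W0 : W 0.
  split; first exact: V0.
  by move=> i _; have := Aop_lin i (-1) (VQ _ Vv) (VQ _ Vv); rewrite !scaleN1r !addNr scaler0.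
have Wl (a : C) f g : W f -> W g -> W (a *: f + g).
  move=> [Vf hf] [Vg hg]; split; first exact: Vlin.
  move=> i ir; apply: (etrans (Aop_lin i a (VQ _ Vf) (VQ _ Vg))).
  by rewrite (hf i ir) (hg i ir) scalerDr !scalerA mulrC.
have WA f : W f -> W (Aop j f).
  move=> [Vf hf]; split; first exact: VA.
  move=> i ir; apply: (etrans (Aop_comm i j (VQ _ Vf))).
  rewrite (hf i ir).
  have := Aop_lin j (al i) (VQ _ Vf) (q0).
  have -> : Aop j 0 = 0.
    by have := Aop_lin j (-1) (VQ _ Vv) (VQ _ Vv); rewrite !scaleN1r !addNr.
  by rewrite !addr0.
have Wu : W u by [].
have [u' [a [Wu' u'0 hu']]] := eigenvector W0 Wl (fun f Wf => hs f (VQ _ (WV f Wf))) WA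
  (fun a f g Wf Wg => Aop_lin j a (VQ _ (WV f Wf)) (VQ _ (WV g Wg))) Wu u0.
exists u', (fun i => if i == j then a else al i); split; [exact: WV|exact: u'0|].
move=> i; rewrite inE; case: eqVneq => [-> //|ij] /= ir.
exact: (Wu'.2 i ir).
Qed.

Transparent Ae.
Lemma AeE e f : Ae e f = \sum_i e ord0 i *: Aop i f. Proof. by []. Qed.
Opaque Ae.

Lemma ispolyX (F : Cn -> C) k : ispoly F -> ispoly (fun w => F w ^+ k).
Proof.
move=> pF; elim: k => [|k ih]; first by under eq_fun do rewrite expr0; exact: ispoly_cst.
by under eq_fun do rewrite exprS; exact: ispolyM.
Qed.

Lemma eigenvector_hc v (al : 'I_n -> C) e k : Q v -> (forall i, Aop i v = al i *: v) ->
  en e = 1 ->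
  hc v k e = (hom_dim k)%:R * ((\sum_i e ord0 i * al i) ^+ k * ext v 0).
Proof.
move=> Qv hv e1; set b := \sum_i _.
have AE : Ae e v = b *: v.
  rewrite AeE /b scaler_suml; apply: eq_bigr => i _.
  by rewrite hv scalerA.
have AeZ (a : C) : Ae e (a *: v) = a *: Ae e v.
  rewrite !AeE scaler_sumr; apply: eq_bigr => i _.
  have A0 : Aop i 0 = 0.
    by have := Aop_lin i (-1) Qv Qv; rewrite !scaleN1r !addNr.
  have := Aop_lin i a Qv (q0); rewrite A0 !addr0 => ->.
  by rewrite !scalerA mulrC.
have AkE j : iter j (Ae e) v = b ^+ j *: v.
  elim: j => [|j ih]; first by rewrite expr0 scale1r.
  by rewrite iterS ih AeZ AE scalerA exprSr.
rewrite (hc_Ae k e1 Qv) AkE; congr (_ * _).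
rewrite (dotZl _ (qH2 Qv) (H2_1)) (H2dot_1 (qH2 Qv)).
by [].
Qed.

Lemma eigenvector_bound v (al : 'I_n -> C) e : Q v -> v <> 0 -> (forall i, Aop i v = al i *: v) ->
  en e = 1 -> nc (\sum_i e ord0 i * al i) <= 1.
Proof.
move=> Qv v0 hv e1; have := Ae_norm 1 e1 Qv; rewrite /= .
have -> : Ae e v = (\sum_i e ord0 i * al i) *: v.
  by rewrite AeE scaler_suml; apply: eq_bigr => i _; rewrite hv scalerA.
have hv2 := qH2 Qv; rewrite (H2normZ _ hv2).
have vp : 0 < H2norm v.
  by rewrite lt_neqAle H2norm_ge0 andbT eq_sym; apply/eqP => /(H2norm_eq0 hv2).
by rewrite -[X in _ <= X]mul1r ler_pM2r.
Qed.

(** The component of degree k on e is v(0) 'C(n-1+k, k) b^k with b = sum_i al_i e_i, so the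
    expansion is the binomial series of (1 - b)^(-n). The product form needs no division and extends
    to the closed ball. *)
Lemma eigenvector_formula v (al : 'I_n -> C) z : Q v -> v <> 0 -> (forall i, Aop i v = al i *: v) ->
  en z <= 1 ->
  bd v z * (1 - \sum_i z ord0 i * al i) ^+ n = ext v 0.
Proof.
move=> Qv v0 hv z1; have pv := q_palg Qv.
pose L w : C := 1 - \sum_i w ord0 i * al i.
have pL : ispoly (fun w => L w ^+ n).
  apply: ispolyX.
  have -> : L = (fun w => (fun=> 1) w + \sum_i (fun w => (- al i) * w ord0 i) w).
    apply/funext => w; rewrite /L -sumrN; congr (_ + _); apply: eq_bigr => i _.
    by rewrite mulNr mulrC.
  apply: ispolyD; first exact: ispoly_cst.
  apply: ispoly_sum => i; apply: ispolyM; [exact: ispoly_cst|exact: ispoly_coord].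
have E : mult v (pfun (fun w => L w ^+ n)) = cst (ext v 0).
  apply: zero_extP => w w1; rewrite zero_extM zero_ext_pfun// zero_ext_cst//.
  have [e e1 we] := unit_row w; set r := en w in w1 we.
  have r0 : 0 <= r := eucl_norm_ge0 w.
  pose b := \sum_i e ord0 i * al i; pose y := r%:C * b.
  have Lw : L w = 1 - y.
    rewrite /L /y /b mulr_sumr we; congr (_ - _); apply: eq_bigr => i _.
    by rewrite mxE mulrA.
  have y1 : nc y < 1.
    rewrite /y ncM nc_real ger0_norm//; apply: le_lt_trans w1.
    by apply: ler_piMr => //; exact: eigenvector_bound Qv v0 hv e1.
  have av := pv.1; rewrite Lw.
  have [K [t [K0 /andP[t0 t1] hK]]] := binsum_lim n.-1 y1.
  pose s := (1 + r) / 2.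
  have [s0 s1 rs] : [/\ 0 < s, s < 1 & r < s] := half_midpoint r0 w1.
  have [M M0 hM] := analytic_bounded av s1.
  have q0 : 0 <= r / s by rewrite divr_ge0// ltW.
  have q1 : r / s < 1 by rewrite ltr_pdivrMr// mul1r.
  pose q := Num.max (r / s) t.
  have q01 : 0 <= q < 1 by rewrite le_max q0 gt_max q1 t1.
  pose S N := binsum n.-1 N.+1 y.
  have SE N : \sum_(k < N.+1) hc v k w = S N * ext v 0.
    rewrite /S /binsum mulr_suml; apply: eq_bigr => k _.
    rewrite we (hc_hom k r%:C e av) (eigenvector_hc k Qv hv e1) -/b /y exprMn.
    have -> : hom_dim k = 'C(n.-1 + k, k).
      by rewrite /hom_dim -subn1 -[in RHS]subn1 addnC -addnBA// addnC.
    by ring.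
  pose A := M * (s / (s - r)) * nc ((1 - y) ^+ n).
  have a1 : 0 <= s / (s - r) by rewrite divr_ge0 ?subr_ge0 ?(ltW s0) ?(ltW rs).
  have Ms : 0 <= M * (s / (s - r)) by exact: mulr_ge0.
  apply: (@near_equal _ _ (A + nc (ext v 0) * K) q q01) => N _.
  have T := hc_taylor av s0 s1 hM N.+1 (z := w); rewrite we eucl_normZ e1 mulr1 nc_real (ger0_norm r0) -we in T.
  have {}T := T rs; rewrite (SE N) in T.
  have -> : ext v w * (1 - y) ^+ n - ext v 0 =
    (ext v w - S N * ext v 0) * (1 - y) ^+ n + ext v 0 * ((1 - y) ^+ n * S N - 1) by ring.
  apply: le_trans (ncD _ _) _; rewrite !ncM mulrDl; apply: lerD.
    rewrite /A mulrAC; apply: ler_wpM2r; first exact: nc_ge0.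
    apply: (le_trans T); rewrite mulrAC; apply: ler_wpM2l; first exact: Ms.
    apply: (@le_trans _ _ ((r / s) ^+ N)); first by rewrite exprS ler_piMl ?exprn_ge0// ltW.
    by apply: le_powr => //; rewrite le_max lexx.
  rewrite -mulrA; apply: ler_wpM2l; first exact: nc_ge0.
  have := hK N; rewrite prednK// => h; apply: (le_trans h); apply: ler_wpM2l => //.
  by apply: le_powr => //; rewrite le_max lexx orbT.
have := boundaryM pv (palg_pfun pL) z; rewrite E.
have -> : bd (cst (ext v 0) : Bn -> C) z = ext v 0.
  exact: (@boundary_pfun (fun=> ext v 0) z (ispoly_cst _) z1).
by rewrite (boundary_pfun pL z1) => <-.
Qed.

Lemma module_map_coord i h : Q h ->
  X (proj Q (mult (coord_fun i) h)) = proj Q (mult (coord_fun i) (X h)).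
Proof. exact: (mX.2 i h). Qed.

(** The adjoint of X commutes with the backward shifts: <X h, A v> = <z X h, v> = <X P_Q(z h),
    v>. *)
Lemma eigenspace_A (c : C) i v : Q v -> (forall h, Q h -> H2dot (X h) v = c * H2dot h v) ->
  forall h, Q h -> H2dot (X h) (Aop i v) = c * H2dot h (Aop i v).
Proof.
move=> Qv hv h Qh; have QX := bo_stable bX Qh; have [hh hX] := (qH2 Qh, qH2 QX).
have [QA hA] := AopP i Qv.
have [Q1 p1] := projP (H2_coord i hh).
have [Q2 p2] := projP (H2_coord i hX).
apply: (etrans (esym (hA _ hX))); apply: (etrans (esym (p2 v Qv))).
apply: (etrans (congr1 (fun u => H2dot u v) (esym (module_map_coord i Qh)))).
apply: (etrans (hv _ Q1)).
exact: (congr1 ( *%R c) (etrans (p1 v Qv) (hA _ hh))).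
Qed.

(** The linear factor of [eigenvector_formula] is at most D on the sphere, so |v| >= |v(0)| / D^n
    there; v(0) = 0 would make all components of v vanish. *)
Lemma eigenvector_below v (al : 'I_n -> C) : Q v -> v <> 0 -> (forall i, Aop i v = al i *: v) ->
  exists2 m : R, 0 < m & forall z, en z = 1 -> m <= nc (bd v z).
Proof.
move=> Qv v0 hv.
have z0 : ext v 0 != 0.
  apply/eqP => z0; apply: v0; apply: (hc_eq0 (H2_an (qH2 Qv))) => k e e1.
  by rewrite (eigenvector_hc k Qv hv e1) z0 !mulr0.
pose D : R := 1 + \sum_i nc (al i).
have D1 : 1 <= D by rewrite /D lerDl; apply: sumr_ge0 => i _; exact: nc_ge0.
have D0 : 0 < D ^+ n by rewrite exprn_gt0// (lt_le_trans ltr01).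
exists (nc (ext v 0) / D ^+ n); first by rewrite divr_gt0// nc_gt0.
move=> z z1; rewrite ler_pdivrMr// -(eigenvector_formula Qv v0 hv (eq_to_le z1)) ncM ncX.
apply: ler_wpM2l; first exact: nc_ge0.
apply: le_powr; first exact: nc_ge0.
apply: le_trans (ncB _ _) _; rewrite nc1 lerD2l; apply: le_trans (nc_sum _ _ _) _.
apply: ler_sum => i _; rewrite ncM ler_piMl ?nc_ge0//.
by rewrite -z1; exact: nc_coord.
Qed.

(** The test function is |v|^2 + conj(q). At q = 0 the functional takes the value c ||v||^2, which
    attains its norm on |v|^2, so the first-order terms in q obey an inequality with a quadratic
    error; m bounds that error. *)
Lemma variation (c : C) v (m : R) q : nc c = onorm -> 0 < onorm ->
  (functional_norm (MQ Q) (XQ Q X) <= (onorm)%:E)%E ->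
  Q v -> H2dot (X v) v = c * H2dot v v -> 0 < m ->
  (forall z, en z = 1 -> m <= nc (bd v z)) -> Q q ->
  0 <= 2 * Re (c * cj c * H2dot (cst 1) q - cj c * H2dot (symbol) q) +
    onorm ^+ 2 * (m ^- 2 * H2norm q ^+ 2).
Proof.
move=> nc_c s0 hfn Qv hv m0 vm Qq; set s := onorm in nc_c s0 hfn *.
have pv := q_palg Qv; have pq := q_palg Qq.
have p1 : palg (cst 1 : Bn -> C) := palg_cst 1.
have sv := sbm_boundary pv; have sq := sbm_boundary pq; have s1 := sbm_boundary p1.
have svv := sbmM sv (sbm_cj sv); have sqq := sbmM sq (sbm_cj sq); have s1q := sbmM s1 (sbm_cj sq).
pose K : R := 2^-1 * m ^- 2.
pose G z := bd v z * cj (bd v z) + bd (cst 1 : Bn -> C) z * cj (bd q z)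
  + K%:C * (bd q z * cj (bd q z)).
have sG : sbm G := sbmD (sbmD svv s1q) (sbmZ _ sqq).
have hG : (cLnorm 1 (mqf v v q) <= (Re (cint G))%:E)%E.
  apply: (L1_le (sbm_mqf Qv Qv Qq) sG) => z z1.
  have -> : G z = (nc (bd v z) ^+ 2)%:C + cj (bd q z) + K%:C * (nc (bd q z) ^+ 2)%:C.
    rewrite /G !mulcJ; congr (_ + _ + _).
    by rewrite (@boundary_pfun (fun=> 1) z (ispoly_cst _) (eq_to_le z1)) mul1r.
  rewrite /mqf mulcJ -(nc_cj (bd q z)).
  by apply: (nc_add_le _ m0); exact: le_powr (ltW m0) (vm z z1).
have := XQ_mqf_le Qv Qv Qq hfn hG.
have -> : cint G = H2dot v v + H2dot (cst 1) q + K%:C * H2dot q q.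
  rewrite (palg_dot pv pv) (palg_dot pq pq) (palg_dot p1 pq) -(cintZ _ sqq).
  by rewrite -(cintD svv s1q) -(cintD (sbmD svv s1q) (sbmZ _ sqq)).
rewrite hv (dot_ff (qH2 Qv)) (dot_ff (qH2 Qq)).
rewrite -nc_c; exact: variation_scalar.
Qed.

Lemma norm_eq_dimension : nonconstant Q X ->
  (functional_norm (MQ Q) (XQ Q X) <= (onorm)%:E)%E -> n = 1%N.
Proof.
move=> ncX hfn; apply/eqP/negPn/negP => n1.
have n2 : (1 < n)%N by rewrite ltn_neqAle eq_sym n1.
have s0 := onorm_gt0 ncX; set s := onorm in hfn s0.
have [f [Qf f0] Xf] := onorm_attained.
have pf := q_palg Qf; have pg := q_palg (bo_stable bX Qf).
have [c nc_c Xfc] := modulus_proportional n2 pf pg s0 f0 (extremal_modulus Qf Xf hfn).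
have c0 : c != 0 by rewrite -nc_gt0 nc_c.
(* The eigenspace of the adjoint of X for conj(c). It contains f because f is extremal and X f = c
   f. *)
pose V := [set v | Q v /\ forall h, Q h -> H2dot (X h) v = c * H2dot h v].
have Vf : V f.
  split; first exact: Qf.
  move=> h Qh; have hXh := qH2 (bo_stable bX Qh); have hf := qH2 Qf.
  have E := onorm_extremal Qf Qh Xf.
  have E2 : c * H2dot f (X h) = c * cj c * H2dot f h.
    rewrite -(dotZl c hf hXh) -Xfc mulcJ nc_c; exact: E.
  have /(congr1 cj) : H2dot f (X h) = cj c * H2dot f h.
    by apply: (mulfI c0); exact: (etrans E2 (esym (mulrA _ _ _))).
  rewrite cjM cjK => E3; apply: (etrans (esym (dot_cj hf hXh))); apply: (etrans E3).
  exact: (congr1 ( *%R c) (dot_cj hf (qH2 Qh))).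
have Vl (a : C) g h : V g -> V h -> V (a *: g + h).
  move=> [Qg hg] [Qh hh]; split; first exact: (qm_linear qm).
  move=> k Qk; have hk := qH2 Qk; have hXk := qH2 (bo_stable bX Qk).
  have [h1 h2] := (qH2 Qg, qH2 Qh).
  apply: (etrans (dotDr (H2Z a h1) h2 hXk)).
  apply: (etrans (congr2 +%R (etrans (dotZr a h1 hXk) (congr1 ( *%R (cj a)) (hg k Qk))) (hh k Qk))).
  apply: (etrans _ (congr1 ( *%R c) (esym (dotDr (H2Z a h1) h2 hk)))).
  apply: (etrans _ (esym (mulrDr c _ _))); congr (_ + _).
  apply: (etrans (mulrCA _ _ _)); exact: (congr1 ( *%R c) (esym (dotZr a h1 hk))).
have VA i g : V g -> V (Aop i g).
  by move=> [Qg hg]; split; [exact: (AopP i Qg).1|exact: eigenspace_A].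
have VQ : V `<=` Q by move=> g [].
have [v [al [[Qv hv] v0 hal]]] := joint_eigenvector VQ Vl VA Vf f0.
have [m m0 vm] := eigenvector_below Qv v0 hal.
have [Q1 hp1] := projP (H2_1); have h1 := H2_1 : H2 (cst 1 : Bn -> C).
have Qs := symbol_in.
(* Applied to all multiples of q, the variation inequality is a nonnegative quadratic with zero
   constant term, so its linear part vanishes. *)
have sym q : Q q -> H2dot (symbol) q = c * H2dot (cst 1) q.
  move=> Qq; have hq := qH2 Qq.
  pose D := c * cj c * H2dot (cst 1) q - cj c * H2dot (symbol) q.
  have D0 : nc D ^+ 2 <= 0 * (s ^+ 2 * (m ^- 2 * H2norm q ^+ 2)).
    apply: cs_quadratic => [//||t].
      have m2 : 0 <= m ^- 2 by rewrite invr_ge0 sqr_ge0.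
      exact: mulr_ge0 (sqr_ge0 _) (mulr_ge0 m2 (sqr_ge0 _)).
    have := variation nc_c s0 hfn Qv (hv v Qv) m0 vm (qZ (cj t) Qq).
    rewrite (H2normZ _ hq) nc_cj add0r.
    have e1 := dotZr (cj t) hq h1; have e2 := dotZr (cj t) hq (qH2 Qs).
    rewrite cjK in e1 e2.
    move=> L; apply: (le_trans L); apply: eq_to_le; congr (_ + _).
      apply: (congr1 (fun x => 2 * Re x)).
      apply: (etrans (congr2 (fun x y => c * cj c * x - cj c * y) e1 e2)).
      exact: lincomb_scale.
    exact: scale_sqr.
  have : D = 0.
    by apply/eqP; rewrite -nc_eq0 -sqrf_eq0 eq_le sqr_ge0 andbT; rewrite mul0r in D0.
  move/eqP; rewrite /D -mulrA [c * (cj c * _)]mulrCA -mulrBr mulf_eq0.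
  have /negbTE -> : cj c != 0 by rewrite -nc_eq0 nc_cj nc_eq0.
  by rewrite subr_eq0 => /eqP.
have symE : symbol = c *: proj Q (cst 1).
  apply: (q_dot_eq Qs (qZ c Q1)) => q Qq.
  apply: (etrans (sym q Qq)); apply: (etrans _ (esym (dotZl c (qH2 Q1) (qH2 Qq)))).
  exact: (congr1 ( *%R c) (esym (hp1 q Qq))).
apply: ncX; exists c => g Qg; have pg' := q_palg Qg.
apply: (etrans (op_symbol Qg)); rewrite -/(symbol) symE multZ.
rewrite (projZ c (palg_mult_H2 pg' (qH2 Q1))).
by rewrite (proj_mult pg' h1) mult1 (proj_id Qg).
Qed.

End extremal.

End module_maps.
End quotient_modules.
End hardy_space.

(** * Lifting on the disc *)

Section disc.
Context {R : realType}.
Local Notation C := R[i].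
Local Notation C1 := 'rV[R[i]]_1.
Local Notation nc := (@Normc.normc R).
Local Notation Re := (@complex.Re R).
Local Notation D1 := (unit_ball R 1).

Let n0 : (0 < 1)%N := isT.

(** * The disc as the ball of dimension 1 *)

Section one_variable.
Local Notation pt := (fun t : C => t *: (delta_mx ord0 ord0 : 'rV[R[i]]_1)).
Implicit Types (f g h u v : D1 -> C) (p q : {poly C}) (t a : C).

Definition u1 : 'rV[R[i]]_1 := delta_mx ord0 ord0.

Lemma u1_norm : en u1 = 1. Proof. exact: eucl_norm_delta. Qed.

Lemma u1_coord t : (t *: u1) ord0 ord0 = t. Proof. by rewrite !mxE eqxx mulr1. Qed.

Lemma u1_scale (z : 'rV[R[i]]_1) : z = z ord0 ord0 *: u1.
Proof. by apply/rowP => i; rewrite (ord1 i) u1_coord. Qed.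

Lemma u1_eucl t : en (t *: u1) = nc t.
Proof. by rewrite eucl_normZ u1_norm mulr1. Qed.

Lemma eucl_norm1 (z : 'rV[R[i]]_1) : en z = nc (z ord0 ord0).
Proof. by rewrite {1}(u1_scale z) u1_eucl. Qed.

Definition xfun : D1 -> C := lin_fun u1.

Lemma xfunE (z : 'rV[R[i]]_1) : en z < 1 -> ext xfun z = z ord0 ord0.
Proof. by move=> z1; rewrite (zero_ext_lin _ z1) ip_delta. Qed.

Lemma xfun_coord : xfun = coord_fun ord0.
Proof.
by apply: zero_extP => z z1; rewrite (xfunE z1) zero_ext_coord.
Qed.

Lemma palg_xfun : palg xfun. Proof. by rewrite xfun_coord; exact: palg_coord. Qed.

Definition hfun p : D1 -> C := pfun (fun z => p.[z ord0 ord0]).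

Lemma ispoly_horner p : ispoly (fun z : 'rV[R[i]]_1 => p.[z ord0 ord0]).
Proof.
elim/poly_ind: p => [|p c ih]; first by under eq_fun do rewrite horner0; exact: ispoly_cst.
under eq_fun do rewrite hornerMXaddC.
by apply: ispolyD (ispoly_cst c); apply: ispolyM (ispoly_coord _).
Qed.

Lemma palg_hfun p : palg (hfun p). Proof. exact: palg_pfun (ispoly_horner p). Qed.

Lemma hfunE p t : nc t < 1 -> ext (hfun p) (t *: u1) = p.[t].
Proof. by move=> t1; rewrite zero_ext_pfun ?u1_coord// u1_eucl. Qed.

Lemma boundary_hfun p t : nc t <= 1 -> bd (hfun p) (t *: u1) = p.[t].
Proof. by move=> t1; rewrite (boundary_pfun (ispoly_horner p)) ?u1_coord// u1_eucl. Qed.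

Lemma ispoly_is_horner (P : 'rV[R[i]]_1 -> C) : ispoly P -> exists p, forall z, P z = p.[z ord0 ord0].
Proof.
move: P; apply: mpoly_ind_closed.
- by move=> c; exists c%:P => z; rewrite hornerC.
- by move=> i; exists 'X => z; rewrite hornerX (ord1 i).
- by move=> F G [p hp] [q hq]; exists (p + q) => z; rewrite hornerD hp hq.
- by move=> F G [p hp] [q hq]; exists (p * q) => z; rewrite hornerM hp hq.
Qed.

Lemma zero_extP1 f g : (forall t, nc t < 1 -> ext f (t *: u1) = ext g (t *: u1)) -> f = g.
Proof.
move=> h; apply: zero_extP => z z1; rewrite (u1_scale z); apply: h.
by rewrite -eucl_norm1.
Qed.

End one_variable.

(** * Polynomials and rational functions on the disc *)

Section disc_polynomials.
Implicit Types (f g h e : D1 -> C) (p q : {poly C}) (t a : C).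

Lemma palg_punctured h a : palg h -> nc a < 1 ->
  (forall t, nc t < 1 -> t != a -> ext h (t *: u1) = 0) -> ext h (a *: u1) = 0.
Proof.
move=> ph a1 h0; apply: nc_le_eq0 => e e0.
have aB : en (a *: u1) < 1 by rewrite u1_eucl.
have [d d0 hd] := palg_cont ph (ltW aB) e0.
pose r := Num.min (d / 2) ((1 - nc a) / 2).
have r0 : 0 < r by rewrite lt_min !divr_gt0// subr_gt0.
have rd : r < d by rewrite gt_min; apply/orP; left; lra.
have ra : r < 1 - nc a by rewrite gt_min; apply/orP; right; lra.
have t1 : nc (a + r%:C) < 1.
  by apply: le_lt_trans (ncD _ _) _; rewrite nc_real gtr0_norm//; lra.
have tB : en ((a + r%:C) *: u1) < 1 by rewrite u1_eucl.
have ta : a + r%:C != a.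
  rewrite -subr_eq0 addrAC subrr add0r -nc_eq0 nc_real gtr0_norm//.
  exact: lt0r_neq0.
have := hd _ (ltW tB).
rewrite -scalerBl u1_eucl addrAC subrr add0r nc_real gtr0_norm// => /(_ rd).
rewrite (palg_boundary_in ph.1 tB) (palg_boundary_in ph.1 aB) (h0 _ t1 ta) sub0r ncN.
exact: ltW.
Qed.

(** Continuity along the circle: [a] is approached by the points a [cis] th, which differ from [a]
    for 0 < th < 1. *)
Lemma circle_punctured p q a (s : R) : nc a = 1 -> 0 <= s ->
  (forall t, nc t = 1 -> t != a -> nc q.[t] = s * nc p.[t]) -> nc q.[a] = s * nc p.[a].
Proof.
move=> a1 s0 h; apply/eqP; rewrite -subr_eq0; apply/eqP.
suff : (nc q.[a] - s * nc p.[a])%:C = 0 :> C by move=> /complexI.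
have s1 : 0 <= 1 + s by rewrite addr_ge0.
apply: (nc_le_scale s1) => e e0; rewrite nc_real.
have aB : en (a *: u1) <= 1 by rewrite u1_eucl a1.
have [d1 d10 h1] := palg_cont (palg_hfun q) aB e0.
have [d2 d20 h2] := palg_cont (palg_hfun p) aB e0.
have pi0 : 0 < 2 * pi :> R by rewrite mulr_gt0// pi_gt0.
pose th : R := Num.min (2^-1) (Num.min d1 d2 / (2 * pi) / 2).
have dm0 : 0 < Num.min d1 d2 by rewrite lt_min d10.
have th0 : 0 < th by rewrite lt_min !divr_gt0// invr_gt0 ltr0n.
have th1 : th < 1 by rewrite gt_min; apply/orP; left; lra.
have thd : 2 * pi * th < Num.min d1 d2.
  rewrite mulrC -ltr_pdivlMr// gt_min; apply/orP; right.
  by rewrite ltr_pdivrMr// ltr_pMr ?divr_gt0//; lra.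
pose w := a * cis th.
have w1 : nc w = 1 by rewrite ncM a1 nc_cis mulr1.
have a0 : a != 0 by rewrite -nc_eq0 a1 oner_eq0.
have wa : w != a.
  have := @cis_eq1 R th; rewrite th0 th1 => /(_ isT); apply: contra => /eqP E.
  by apply/eqP/(mulfI a0); rewrite mulr1.
have wB : en (w *: u1) <= 1 by rewrite u1_eucl w1.
have wd : en (w *: u1 - a *: u1) < Num.min d1 d2.
  rewrite -scalerBl u1_eucl; apply: le_lt_trans thd.
  rewrite /w -[X in _ - X]mulr1 -mulrBr ncM a1 mul1r -(@cis_0 R).
  apply: le_trans (cis_lipschitz 0 th) _; rewrite subr0 gtr0_norm//.
move: wd; rewrite lt_min => /andP[/(h1 _ wB) A /(h2 _ wB) B].
rewrite !boundary_hfun ?w1 ?a1// in A B.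
have E := h w w1 wa; have C1 := nc_dist q.[w] q.[a]; have C2 := nc_dist p.[w] p.[a].
have -> : nc q.[a] - s * nc p.[a] = s * (nc p.[w] - nc p.[a]) - (nc q.[w] - nc q.[a]) by rewrite E; ring.
apply: le_trans (ler_normB _ _) _; rewrite normrM (ger0_norm s0) mulrDr mulr1 addrC.
apply: lerD; first exact: le_trans C1 (ltW A).
by rewrite mulrC; apply: ler_wpM2r => //; exact: le_trans C2 (ltW B).
Qed.

Lemma horner_below p : (forall t, nc t <= 1 -> p.[t] != 0) ->
  exists2 m : R, 0 < m & forall t, nc t <= 1 -> m <= nc p.[t].
Proof.
move=> p0.
have [||||c c1 hc] := @eucl_compact_max R 1 [set z | en z <= 1] 1
    (fun z : 'rV[R[i]]_1 => - nc p.[z ord0 ord0]).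
- by exists 0; rewrite /= eucl_norm0.
- exact: closed_ball_eucl.
- by [].
- move=> z /= z1 e e0; have [d d0 hd] := palg_cont (palg_hfun p) z1 e0.
  exists d => // w w1 wz; have := hd w w1 wz.
  rewrite (u1_scale w) (u1_scale z) !boundary_hfun -?eucl_norm1// !u1_coord => h.
  rewrite -opprD normrN; apply: le_lt_trans h; exact: nc_dist.
exists (nc p.[c ord0 ord0]); first by rewrite nc_gt0 p0// -eucl_norm1.
move=> t t1; have := hc (t *: u1); rewrite /= u1_eucl u1_coord lerN2.
by apply.
Qed.

(** The function [e] may vanish on the circle, so g / e is replaced by q / p and the degree of p is
    lowered. A root of p inside the disc is a root of q since [e] does not vanish there, and a root
    on the circle is one since |q| = s |p|. When no root is left in the closed disc, the maximum
    principle for q / p applies. *)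
Lemma rational_max p q e g (s : R) : p != 0 -> palg e -> palg g -> 0 <= s ->
  (forall t, nc t < 1 -> ext e (t *: u1) != 0) ->
  (forall t, nc t < 1 -> p.[t] * ext g (t *: u1) = q.[t] * ext e (t *: u1)) ->
  (forall t, nc t = 1 -> nc q.[t] = s * nc p.[t]) ->
  forall t, nc t < 1 -> nc (ext g (t *: u1)) <= s * nc (ext e (t *: u1)).
Proof.
move=> p0 pe pg s0 e0; have [m] := ubnP (size p).
elim: m p q p0 => // m ih p q p0; rewrite ltnS => pm hd hc.
have [[a [a1 pa]]|noroot] := pselect (exists a, nc a <= 1 /\ root p a); last first.
  have pn t : nc t <= 1 -> p.[t] != 0.
    by move=> t1; apply/negP => pt; apply: noroot; exists t.
  have [k k0 hk] := horner_below pn.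
  move=> t t1; have tB : en (0 + t *: u1) < 1 by rewrite add0r u1_eucl.
  have := @disc_max R 1 (hfun p) (hfun q) 0 u1 t 1 s k (palg_hfun p) (palg_hfun q) (@u1_norm) t1 s0 k0.
  have b1 (w : C) : nc w < 1 -> en (0 + w *: u1) < 1 by rewrite add0r u1_eucl.
  have b2 (w : C) : nc w <= 1 -> en (0 + w *: u1) <= 1 by rewrite add0r u1_eucl.
  have b3 (w : C) : nc w < 1 -> k <= nc (ext (hfun p) (0 + w *: u1)).
    by move=> w1; rewrite add0r hfunE//; exact/hk/ltW.
  have b4 (w : C) : nc w = 1 -> nc (bd (hfun q) (0 + w *: u1)) <= s * nc (bd (hfun p) (0 + w *: u1)).
    by move=> w1; rewrite add0r !boundary_hfun ?w1// hc.
  move=> /(_ b1 b2 b3 b4); rewrite add0r !hfunE// => L.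
  have pt : 0 < nc p.[t] by rewrite nc_gt0 pn// ltW.
  rewrite -(ler_pM2l pt) -ncM (hd t t1) ncM mulrCA mulrA.
  by apply: ler_wpM2r L; exact: nc_ge0.
have qa : root q a.
  apply/eqP; have pa0 : p.[a] = 0 by apply/eqP.
  have [a1'|a1'] := ltP (nc a) 1.
    have := hd a a1'; rewrite pa0 mul0r => /esym/eqP; rewrite mulf_eq0 (negbTE (e0 a a1')) orbF.
    by move/eqP.
  have ea : nc a = 1 by apply/le_anti; rewrite a1 a1'.
  have := hc a ea; rewrite pa0 nc0 mulr0 => /eqP.
  by rewrite nc_eq0 => /eqP.
have [p1 pE] := factor_theorem p a pa; have [q1 qE] := factor_theorem q a qa.
have p10 : p1 != 0 by apply: contraNneq p0 => z; rewrite pE z mul0r.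
have x0 t : t != a -> t - a != 0 by rewrite subr_eq0.
apply: (ih p1 q1 p10).
- apply: leq_trans pm; rewrite pE size_Mmonic ?monicXsubC// size_XsubC addn2 /=.
  by rewrite ltnS.
- have hd' t : nc t < 1 -> t != a -> p1.[t] * ext g (t *: u1) = q1.[t] * ext e (t *: u1).
    move=> t1 ta; apply: (mulfI (x0 t ta)); have := hd t t1.
    rewrite pE qE !hornerM !hornerXsubC => E.
    by rewrite mulrA [(t - a) * _]mulrC E; ring.
  move=> t t1; have [ta|/hd' -> //] := eqVneq t a.
  pose h := mult (hfun p1) g - mult (hfun q1) e.
  have ph : palg h := palgB (palgM (palg_hfun p1) pg) (palgM (palg_hfun q1) pe).
  have hE w : nc w < 1 -> ext h (w *: u1) = p1.[w] * ext g (w *: u1) - q1.[w] * ext e (w *: u1).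
    by move=> w1; rewrite zero_extB !zero_extM !hfunE.
  rewrite ta in t1 *; apply/eqP; rewrite -subr_eq0 -hE//; apply/eqP.
  apply: (palg_punctured ph t1) => w w1 wa; rewrite hE// hd'// subrr.
  by [].
- have hc' t : nc t = 1 -> t != a -> nc q1.[t] = s * nc p1.[t].
    move=> t1 ta; have n1 : nc (t - a) != 0 by rewrite nc_eq0 x0.
    apply: (mulIf n1); rewrite -ncM -mulrA -ncM.
    by have := hc t t1; rewrite pE qE !hornerM !hornerXsubC.
  move=> t t1; have [ta|/hc' -> //] := eqVneq t a.
  by rewrite ta in t1 *; exact: circle_punctured.
Qed.

(** The Szego kernel at a. *)
Definition kern a : D1 -> C := pfun (fun z => (1 - cj a * z ord0 ord0)^-1).

Lemma kern_neq0 a t : nc a < 1 -> nc t <= 1 -> 1 - cj a * t != 0.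
Proof.
move=> a1 t1; rewrite -nc_gt0; apply: lt_le_trans (ncB_ge _ _).
rewrite nc1 subr_gt0 ncM nc_cj; apply: le_lt_trans a1.
by rewrite ler_piMr ?nc_ge0.
Qed.

Lemma kernE a t : nc t < 1 -> ext (kern a) (t *: u1) = (1 - cj a * t)^-1.
Proof. by move=> t1; rewrite zero_ext_pfun ?u1_eucl// u1_coord. Qed.

Lemma palg_kern a : nc a < 1 -> palg (kern a).
Proof.
move=> a1; split.
  have -> : kern a = (fun z : D1 => (cst 1 : D1 -> C) z / hfun (1 - (cj a)%:P * 'X) z).
    apply/funext => z; rewrite /kern /hfun /pfun hornerD hornerN hornerM !hornerC hornerX.
    by rewrite mul1r.
  apply: analytic_quotient; [exact: analytic_cst|exact: (palg_hfun _).1|].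
  move=> z z1; rewrite (u1_scale z) hfunE -?eucl_norm1//.
  rewrite hornerD hornerN hornerM !hornerC hornerX; apply: kern_neq0 => //.
  by rewrite -eucl_norm1 ltW.
move=> e e0; have a0 := nc_ge0 a; have a2 : 0 < 1 - nc a by rewrite subr_gt0.
have [N /(_ N (leqnn N)) /ltW hN] := geo_small a0 a1 (mulr_gt0 e0 a2).
exists (fun z : 'rV[R[i]]_1 => (\sum_(k < N) (cj a ^+ k) *: 'X^k).[z ord0 ord0]).
  exact: ispoly_horner.
move=> z z1; rewrite (u1_scale z) u1_coord; move: (z ord0 ord0) (eucl_norm1 z) => t zt.
have t1 : nc t < 1 by rewrite -zt.
rewrite (kernE _ t1) horner_sum.
under eq_bigr do rewrite hornerZ hornerXn -exprMn.
set y := cj a * t; have y1 : nc y <= nc a by rewrite ncM nc_cj ler_piMr ?nc_ge0// ltW.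
have yn := kern_neq0 a1 (ltW t1); rewrite -/y in yn.
have -> : (1 - y)^-1 - \sum_(k < N) y ^+ k = y ^+ N / (1 - y).
  apply: (mulIf yn); rewrite mulrBl mulVf// divfK//.
  have := subrX1 y N; rewrite -(opprB 1 y) mulNr => /(congr1 -%R); rewrite opprK opprB => E.
  by rewrite mulrC -E; ring.
rewrite ncM ncX ncV ler_pdivrMr ?nc_gt0//.
apply: (@le_trans _ _ (nc a ^+ N)); first by apply: le_powr => //; exact: nc_ge0.
apply: (le_trans hN); apply: ler_wpM2l; first exact: ltW.
by have := ncB_ge 1 y; rewrite nc1; move: y1; clear; lra.
Qed.

End disc_polynomials.

(** * Blaschke factors *)

Section blaschke_factors.
Implicit Types (f g h e u v : D1 -> C) (p q : {poly C}) (t a c : C).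

Lemma blaschke_circle a t : nc t = 1 -> nc (t - a) = nc (1 - cj a * t).
Proof.
move=> t1; have -> : 1 - cj a * t = t * cj (t - a).
  by rewrite cjB mulrBr mulcJ t1 expr1n mulrC.
by rewrite ncM t1 mul1r nc_cj.
Qed.

Lemma blaschke_disc a t : nc a <= 1 -> nc t <= 1 -> nc (t - a) <= nc (1 - cj a * t).
Proof.
move=> a1 t1; rewrite -ler_sqr ?nnegrE ?nc_ge0// -subr_ge0.
have -> : nc (1 - cj a * t) ^+ 2 - nc (t - a) ^+ 2 = (1 - nc a ^+ 2) * (1 - nc t ^+ 2).
  by rewrite !normc2E; case: (a) (t) => [x y] [z w] /=; ring.
by rewrite mulr_ge0// subr_ge0 expr_le1// nc_ge0.
Qed.

Definition blaschke a : D1 -> C := mult (hfun ('X - a%:P)) (kern a).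

Lemma palg_blaschke a : nc a < 1 -> palg (blaschke a).
Proof. by move=> a1; exact: palgM (palg_hfun _) (palg_kern a1). Qed.

Lemma boundary_kern a t : nc a < 1 -> nc t <= 1 -> bd (kern a) (t *: u1) = (1 - cj a * t)^-1.
Proof.
move=> a1 t1; have k0 := kern_neq0 a1 t1; apply: (mulIf k0); rewrite mulVf//.
have E : mult (kern a) (hfun (1 - (cj a)%:P * 'X)) = hfun 1.
  apply: zero_extP1 => w w1; rewrite zero_extM kernE// !hfunE//.
  rewrite !(hornerD, hornerN, hornerM, hornerC, hornerX) mulVf//.
  by apply: kern_neq0 => //; exact: ltW.
have := boundaryM (palg_kern a1) (palg_hfun (1 - (cj a)%:P * 'X)) (t *: u1).
by rewrite E !boundary_hfun// !(hornerD, hornerN, hornerM, hornerC, hornerX) => <-.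
Qed.

Lemma blaschkeE a t : nc t < 1 -> ext (blaschke a) (t *: u1) = (t - a) / (1 - cj a * t).
Proof. by move=> t1; rewrite zero_extM kernE// hfunE// hornerXsubC. Qed.

Lemma boundary_blaschke a t : nc a < 1 -> nc t = 1 -> nc (bd (blaschke a) (t *: u1)) = 1.
Proof.
move=> a1 t1; have t1' : nc t <= 1 by rewrite t1.
rewrite (boundaryM (palg_hfun _) (palg_kern a1)) boundary_kern// boundary_hfun// hornerXsubC.
by rewrite ncM ncV blaschke_circle// mulfV// nc_eq0 kern_neq0.
Qed.

End blaschke_factors.

(** * Real functions on the circle that annihilate the disc algebra *)

Section circle_moments.
Implicit Types (f g : D1 -> C) (p q : {poly C}).

Variable D : C1 -> C.
Hypotheses (sD : sbm D) (Dreal : forall z, cj (D z) = D z).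
Hypothesis Dmom : forall f, palg f -> cint (fun z => bd f z * D z) = 0.

(** On the circle z conj(z) = 1, so z^i conj(z)^j is a power of z or the conjugate of one; reality
    of D handles the latter. This is where dimension 1 enters. *)
Lemma moment_monomial i j : cint (fun z => D z * z ord0 ord0 ^+ i * cj (z ord0 ord0 ^+ j)) = 0.
Proof.
have sx k : sbm (fun z : C1 => z ord0 ord0 ^+ k).
  by have := ispoly_sbm (ispolyX k (ispoly_coord ord0)).
have sL : sbm (fun z => D z * z ord0 ord0 ^+ i * cj (z ord0 ord0 ^+ j)) := sbmM (sbmM sD (sx i)) (sbm_cj (sx j)).
have bE k (z : C1) : en z = 1 -> bd (hfun 'X^k) z = z ord0 ord0 ^+ k.
  by move=> z1; rewrite {1}(u1_scale z) boundary_hfun ?hornerXn// -eucl_norm1 z1.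
have unit_z (z : C1) k : en z = 1 -> z ord0 ord0 ^+ k * cj (z ord0 ord0 ^+ k) = 1.
  by move=> z1; rewrite mulcJ ncX -eucl_norm1 z1 !expr1n.
have sb k : sbm (bd (hfun ('X^k : {poly C}))) := sbm_boundary (palg_hfun _).
have [ij|/ltnW ij] := leqP j i.
  rewrite -(Dmom (palg_hfun 'X^(i - j))); apply: (cint_eqS n0).
  - exact: sL.1.
  - exact: (sbmM (sb _) sD).1.
  move=> z z1; rewrite (bE _ _ z1) -{1}(subnK ij) exprD.
  rewrite (_ : D z * (z ord0 ord0 ^+ (i - j) * z ord0 ord0 ^+ j) * cj (z ord0 ord0 ^+ j) =
    z ord0 ord0 ^+ (i - j) * D z * (z ord0 ord0 ^+ j * cj (z ord0 ord0 ^+ j))); last by ring.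
  by rewrite unit_z// mulr1.
have E := congr1 cj (Dmom (palg_hfun 'X^(j - i))).
rewrite cj0 -(cint_cj n0 (sbmM (sb _) sD)) in E.
rewrite -E; apply: (cint_eqS n0).
- exact: sL.1.
- exact: (sbm_cj (sbmM (sb _) sD)).1.
move=> z z1; rewrite (bE _ _ z1) cjM Dreal -{1}(subnK ij) exprD cjM.
rewrite (_ : D z * z ord0 ord0 ^+ i * (cj (z ord0 ord0 ^+ (j - i)) * cj (z ord0 ord0 ^+ i)) =
    cj (z ord0 ord0 ^+ (j - i)) * D z * (z ord0 ord0 ^+ i * cj (z ord0 ord0 ^+ i))); last by ring.
by rewrite unit_z// mulr1.
Qed.

Lemma moment_poly (P S : C1 -> C) : ispoly P -> ispoly S -> cint (fun z => D z * P z * cj (S z)) = 0.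
Proof.
move=> /ispoly_is_horner[p hp] /ispoly_is_horner[q hq].
have sx k : sbm (fun z : C1 => z ord0 ord0 ^+ k).
  by have := ispoly_sbm (ispolyX k (ispoly_coord ord0)).
have sL i j : sbm (fun z => D z * z ord0 ord0 ^+ i * cj (z ord0 ord0 ^+ j)) := sbmM (sbmM sD (sx i)) (sbm_cj (sx j)).
pose T (i : 'I_(size p)) (j : 'I_(size q)) z := p`_i * cj q`_j * (D z * z ord0 ord0 ^+ i * cj (z ord0 ord0 ^+ j)).
have sT i j : sbm (T i j) := sbmZ _ (sL i j).
have -> : (fun z => D z * P z * cj (S z)) = (fun z => \sum_i (fun z => \sum_j T i j z) z).
  apply/funext => z; rewrite hp hq !horner_coef cj_sum -mulrA mulr_suml mulr_sumr.
  apply: eq_bigr => i _; rewrite !mulr_sumr; apply: eq_bigr => j _.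
  by rewrite /T cjM; ring.
rewrite (cint_sum n0) => [|i]; last first.
  elim: (index_enum _) => [|j r ih]; first by under eq_fun do rewrite big_nil; exact: sbm_cst.
  by under eq_fun do rewrite big_cons; exact: sbmD.
rewrite big1 // => i _; rewrite (cint_sum n0) => [|j]; last exact: sT.
by rewrite big1 // => j _; rewrite /T (cintZ n0 _ (sL i j)) moment_monomial mulr0.
Qed.

(** It will be applied with D a combination of squared moduli of boundary values, to conclude that
    the integral of D^2 is zero. *)
Lemma moment_boundary f g : palg f -> palg g -> cint (fun z => D z * bd f z * cj (bd g z)) = 0.
Proof.
move=> pf pg; have sf := sbm_boundary pf.
apply: (H2S_approx_cint_cj n0 (sbmM sD sf) (H2S_boundary n0 pg)) => S pS.
have sS := sbm_cj (ispoly_sbm pS).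
have -> : (fun z => D z * bd f z * cj (S z)) = (fun z => D z * cj (S z) * bd f z).
  by apply/funext => z; ring.
apply: (H2S_approx_cint n0 (sbmM sD sS) (H2S_boundary n0 pf)) => P pP.
rewrite -(moment_poly pP pS); congr cint; apply/funext => z.
by ring.
Qed.

End circle_moments.

Section disc_quotient_modules.
Variable Q : set (D1 -> C).
Hypotheses (qm : quotient_module Q) (fd : finite_dimensional Q).

(** * The backward shift on the disc *)

Section shifts.
Implicit Types (f g h u v : D1 -> C) (p q : {poly C}) (t a : C).
Definition shift f := Ae Q u1 f.

Lemma shiftP f : Q f -> Q (shift f) /\ forall h, H2 h -> H2dot (mult xfun h) f = H2dot h (shift f).
Proof. exact: (AeP n0 qm u1). Qed.

Lemma shift_norm f : Q f -> H2norm (shift f) <= H2norm f.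
Proof. by move=> Qf; have := Ae_norm n0 qm 1 u1_norm Qf. Qed.

Lemma shift_lin a f g : Q f -> Q g -> shift (a *: f + g) = a *: shift f + shift g.
Proof.
move=> Qf Qg; have AE h : shift h = u1 ord0 ord0 *: Aop Q ord0 h by rewrite /shift AeE big_ord1.
apply: (etrans (AE _)).
apply: (etrans (congr1 (fun h => u1 ord0 ord0 *: h) (Aop_lin n0 qm ord0 a Qf Qg))).
rewrite scalerDr scalerA mulrC -scalerA.
exact: (congr2 +%R (congr1 (fun h => a *: h) (esym (AE f))) (esym (AE g))).
Qed.

Lemma hc_shift f k : Q f -> hc f k u1 = H2dot (iter k shift f) (cst 1).
Proof.
move=> Qf; rewrite (hc_Ae n0 qm k u1_norm Qf) /hom_dim /=.
by rewrite add0n binn mul1r.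
Qed.

(** The k-th coefficient of the shift is the (k+1)-st of f, both being pairings of iterated shifts
    with 1; the two sides have the same expansion. *)
Lemma shift_eq f : Q f -> f = cst (ext f 0) + mult xfun (shift f).
Proof.
move=> Qf; have Qs := (shiftP Qf).1; apply: zero_extP1 => t t1.
have tB : en (t *: u1) < 1 by rewrite u1_eucl.
rewrite zero_extD zero_extM (zero_ext_cst _ tB) (xfunE tB) u1_coord.
have af := H2_an (qH2 qm Qf); have as_ := H2_an (qH2 qm Qs).
have r0 := nc_ge0 t; pose s := (1 + nc t) / 2.
have [s0 s1 rs] : [/\ 0 < s, s < 1 & nc t < s] := half_midpoint r0 t1.
have [M M0 hM] := analytic_bounded af s1; have [N N0 hN] := analytic_bounded as_ s1.
have bM (w : C) : nc w = s -> nc (ext f (w *: u1)) <= M by move=> ws; apply: hM; rewrite u1_eucl ws.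
have bN (w : C) : nc w = s -> nc (ext (shift f) (w *: u1)) <= N by move=> ws; apply: hN; rewrite u1_eucl ws.
have [_ exf] := hc_taylor_unit n0 af u1_norm s0 s1 bM.
have [_ exs] := hc_taylor_unit n0 as_ u1_norm s0 s1 bN.
have q01 : 0 <= nc t / s < 1 by rewrite divr_ge0 ?(ltW s0)//= ltr_pdivrMr// mul1r.
have h0 : ext f 0 = hc f 0 u1 by rewrite (hc0 n0 u1 af).
apply: (@near_equal _ _ _ ((M + N) * (s / (s - nc t))) _ q01) => k _.
have Ef := exf k.+1 t rs; have Es := exs k t rs.
have sumE : \sum_(j < k.+1) hc f j u1 * t ^+ j = ext f 0 + t * \sum_(j < k) hc (shift f) j u1 * t ^+ j.
  rewrite big_ord_recl expr0 mulr1 h0 mulr_sumr; congr (_ + _); apply: eq_bigr => j _.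
  rewrite lift0 exprS (hc_shift j.+1 Qf) (hc_shift j Qs) iterSr.
  by rewrite mulrCA.
have -> : ext f (t *: u1) - (ext f 0 + t * ext (shift f) (t *: u1)) =
    (ext f (t *: u1) - \sum_(j < k.+1) hc f j u1 * t ^+ j) -
    t * (ext (shift f) (t *: u1) - \sum_(j < k) hc (shift f) j u1 * t ^+ j).
  by rewrite sumE; ring.
apply: le_trans (ncB _ _) _; rewrite ncM.
have K0 : 0 <= s / (s - nc t) by rewrite divr_ge0 ?subr_ge0 ?(ltW s0) ?(ltW rs).
have -> : (M + N) * (s / (s - nc t)) * (nc t / s) ^+ k =
   M * (nc t / s) ^+ k * (s / (s - nc t)) + N * (nc t / s) ^+ k * (s / (s - nc t)) by ring.
apply: lerD.
  apply: (le_trans Ef); apply: (ler_wpM2r K0); apply: ler_wpM2l => //.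
  by case/andP: q01 => h1 h2; rewrite exprS ler_piMl ?exprn_ge0 ?(ltW h2).
apply: (le_trans _ Es); rewrite ler_piMl ?nc_ge0//; exact: ltW.
Qed.

Lemma shift_ext f t : Q f -> nc t < 1 ->
  ext f (t *: u1) = ext f 0 + t * ext (shift f) (t *: u1).
Proof.
move=> Qf t1; have tB : en (t *: u1) < 1 by rewrite u1_eucl.
by rewrite {1}(shift_eq Qf) zero_extD zero_extM (zero_ext_cst _ tB) (xfunE tB) u1_coord.
Qed.

Lemma iter_shift_in f k : Q f -> Q (iter k shift f).
Proof. by move=> Qf; elim: k => // k ih; exact: (shiftP ih).1. Qed.

Lemma shift_expand f k t : Q f -> nc t < 1 ->
  ext f (t *: u1) = (\sum_(i < k) ext (iter i shift f) 0 * t ^+ i) +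
    t ^+ k * ext (iter k shift f) (t *: u1).
Proof.
move=> Qf t1; elim: k => [|k ih]; first by rewrite big_ord0 add0r mul1r.
rewrite ih big_ord_recr /= -addrA; congr (_ + _).
by rewrite (shift_ext (iter_shift_in k Qf) t1) exprSr; ring.
Qed.

(** The first m + 1 iterated shifts of f satisfy a relation with coefficients c_j. Since t^j S^j f
    is f minus a polynomial, multiplying the relation by t^m turns it into (sum_j c_j t^(m-j)) f =
    polynomial. *)
Lemma shift_rational f : Q f -> exists d p : {poly C}, d != 0 /\
  forall t, nc t < 1 -> d.[t] * ext f (t *: u1) = p.[t].
Proof.
move=> Qf; have [m [s [Qs hs]]] := fd.
have [c [i ci] c0] := vectors_dependent hs (fun j : 'I_m.+1 => iter_shift_in j Qf) (ltnSn m).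
exists (\sum_(j < m.+1) c j *: 'X^(m - j)).
exists (\sum_(j < m.+1) c j *: ('X^(m - j) * \sum_(l < j) (ext (iter l shift f) 0) *: 'X^l)).
split.
  apply/eqP => /(congr1 (fun p : {poly C} => p`_(m - i))).
  rewrite coef0 coef_sum (bigD1 i)//= coefZ coefXn eqxx mulr1 big1 => [|j ji].
    by rewrite addr0 => /eqP; rewrite (negbTE ci).
  rewrite coefZ coefXn; case: eqP => [E|_]; last by rewrite mulr0.
  exfalso; move/eqP: ji; apply; apply: ord_inj.
  by have := ltn_ord i; have := ltn_ord j; rewrite !ltnS => h1 h2; rewrite -(subKn h1) -E subKn.
move=> t t1; rewrite !horner_sum mulr_suml.
have Z : \sum_(j < m.+1) c j * ext (iter j shift f) (t *: u1) = 0.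
  have := congr1 (fun u => ext u (t *: u1)) c0; rewrite zero_ext_sum.
  under eq_bigr do rewrite zero_extZ.
  move=> ->; have -> : (0 : D1 -> C) = 0 *: 0 by rewrite scaler0.
  by rewrite zero_extZ mul0r.
have Z2 : \sum_(j < m.+1) t ^+ m * (c j * ext (iter j shift f) (t *: u1)) = 0.
  by rewrite -mulr_sumr Z mulr0.
rewrite -[RHS]addr0 -[X in _ = _ + X]Z2 -big_split /=.
apply: eq_bigr => j _; rewrite !hornerZ hornerM hornerXn horner_sum.
under [in RHS]eq_bigr do rewrite hornerZ hornerXn.
have jm : (j <= m)%N by rewrite -ltnS.
have tm : t ^+ m = t ^+ (m - j) * t ^+ j by rewrite -exprD subnK.
rewrite tm (shift_expand j Qf t1).
move: (ext (iter j shift f) _) (\sum_(_ < j) _) (t ^+ (m - j)) (t ^+ j) (c j).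
by move=> x y v w b; ring.
Qed.

End shifts.

(** * Division by Blaschke factors within Q *)

Section blaschke_division.
Implicit Types (f g h e u v : D1 -> C) (p q : {poly C}) (t a c : C).

(** Let d be the component of S f orthogonal to the range of 1 - a S. Then <d, d - a S d> = 0, so
    ||d||^2 <= |a| ||d||^2 and d = 0. *)
Lemma resolvent f a : Q f -> nc a < 1 -> exists2 u, Q u & u - a *: shift u = shift f.
Proof.
move=> Qf a1; have [m [s [Qs hs]]] := fd.
pose W := [set w | exists2 v, Q v & w = v - a *: shift v].
have WQ w : W w -> Q w.
  by move=> [v Qv ->]; apply: (qB qm Qv); apply: (qZ qm); exact: (shiftP Qv).1.
have S0 : shift 0 = 0.
  by have := shift_lin (-1) Qf Qf; rewrite !scaleN1r !addNr.
have W0 : W 0 by exists 0; [exact: q0 qm|rewrite S0 scaler0 subr0].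
have Wl (c : C) g h : W g -> W h -> W (c *: g + h).
  move=> [v Qv ->] [w Qw ->]; exists (c *: v + w); first exact: (qm_linear qm).
  rewrite (shift_lin c Qv Qw) scalerBr scalerDr opprD !scalerA (mulrC a).
  by rewrite addrACA.
have Qsf := (shiftP Qf).1.
have [p Wp hp] := subspace_proj n0 (fun w Ww => qH2 qm (WQ w Ww)) W0 Wl (fun w Ww => hs w (WQ w Ww)) (qH2 qm Qsf).
have Qp := WQ _ Wp; pose d := shift f - p; have Qd : Q d := qB qm Qsf Qp.
have Qsd := (shiftP Qd).1; have hd := qH2 qm Qd.
have Wd : W (d - a *: shift d) by exists d.
have E : H2dot d (d - a *: shift d) = 0.
  have e1 := dotBl n0 (qH2 qm Qsf) (qH2 qm Qp) (qH2 qm (WQ _ Wd)).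
  by apply: (etrans e1); rewrite (hp _ Wd) subrr.
have E2 : H2dot d d = cj a * H2dot d (shift d).
  have e2 := dotBr n0 hd (H2Z n0 a (qH2 qm Qsd)) hd.
  apply/eqP; rewrite -subr_eq0 -(dotZr n0 a (qH2 qm Qsd) hd) -e2; apply/eqP.
  exact: E.
have d0 : d = 0.
  apply: (H2norm_eq0 n0 hd); apply/eqP/negPn/negP => dn.
  have dp : 0 < H2norm d ^+ 2 by rewrite exprn_gt0// lt_neqAle eq_sym dn H2norm_ge0.
  have L : H2norm d ^+ 2 <= nc a * H2norm d ^+ 2.
    have := congr1 nc E2; rewrite (dot_ff n0 hd) nc_real ger0_norm ?sqr_ge0// ncM nc_cj => {1}->.
    apply: ler_wpM2l; first exact: nc_ge0.
    apply: le_trans (dot_CS n0 hd (qH2 qm Qsd)) _; rewrite expr2; apply: ler_wpM2l.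
      exact: H2norm_ge0.
    exact: (shift_norm Qd).
  by move: L; rewrite -subr_ge0 -{2}[H2norm d ^+ 2]mul1r -mulrBl pmulr_lge0// subr_ge0 leNgt a1.
move/eqP: d0; rewrite subr_eq0 => /eqP ->.
by have [u Qu ->] := Wp; exists u.
Qed.

(** The vector v = (1 - a S)^(-1) S f is f / (z - a), as f(a) = 0. The quotient f (1 - conj(a) z) /
    (z - a) is (1 - |a|^2) v - conj(a) f, hence stays in Q. *)
Lemma blaschke_divide f a : Q f -> nc a < 1 -> ext f (a *: u1) = 0 ->
  exists2 u, Q u & forall t, nc t < 1 -> (1 - cj a * t) * ext f (t *: u1) = (t - a) * ext u (t *: u1).
Proof.
move=> Qf a1 fa; have [v Qv hv] := resolvent Qf a1; have Qsv := (shiftP Qv).1.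
have H t : nc t < 1 -> (t - a) * ext v (t *: u1) + a * ext v 0 = ext f (t *: u1) - ext f 0.
  move=> t1; rewrite (shift_ext Qf t1) -hv zero_extB zero_extZ.
  rewrite [in LHS]mulrBl (shift_ext Qv t1).
  by move: (ext v 0) (ext f 0) (ext (shift v) _) => x y w; ring.
have Ha := H a a1; rewrite subrr mul0r add0r fa sub0r in Ha.
have Ht t : nc t < 1 -> (t - a) * ext v (t *: u1) = ext f (t *: u1).
  by move=> t1; have := H t t1; rewrite Ha => /addIr.
exists ((1 - cj a * a) *: v - cj a *: f).
  by apply: (qB qm); exact: (qZ qm).
move=> t t1; rewrite zero_extB !zero_extZ -(Ht t t1).
by move: (ext v _) => x; ring.
Qed.

End blaschke_division.

Section disc_module_maps.
Variable X : (D1 -> C) -> (D1 -> C).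
Hypotheses (bX : bounded_operator Q X) (mX : module_map Q X).
Local Notation s := (onorm Q X).

(** * The space of extremal vectors *)

Section extremal_vectors.
Implicit Types (f g h e u v : D1 -> C) (p q : {poly C}) (t a c : C).

(** Here f is u times a Blaschke factor, which is unimodular on the circle, so the norms of f and u
    agree. Since X f is the compression of the factor applied to X u, ||X f|| <= ||X u||, and
    extremality passes from f to u. *)
Lemma blaschke_factor f u a : Q f -> Q u -> nc a < 1 ->
  (forall t, nc t < 1 -> (1 - cj a * t) * ext f (t *: u1) = (t - a) * ext u (t *: u1)) ->
  H2norm u = H2norm f /\ (H2norm (X f) = s * H2norm f -> H2norm (X u) = s * H2norm u).
Proof.
move=> Qf Qu a1 fu; have pf := q_palg n0 qm fd Qf; have pu := q_palg n0 qm fd Qu.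
have pb := palg_blaschke a1; have sb := sbm_boundary pb; have su := sbm_boundary pu.
have fE : f = mult (blaschke a) u.
  apply: zero_extP1 => t t1; rewrite zero_extM blaschkeE//.
  have k0 := kern_neq0 a1 (ltW t1); apply: (mulfI k0); rewrite fu// mulrA.
  by rewrite [(1 - _) * _]mulrC divfK.
have N : H2norm u = H2norm f.
  rewrite (norm_dot n0 (qH2 qm Qu)) (norm_dot n0 (qH2 qm Qf)) (palg_dot n0 pu pu) (palg_dot n0 pf pf).
  congr (Num.sqrt (Re _)); apply: (cint_eqS n0).
  - exact: (sbmM su (sbm_cj su)).1.
  - by have [] := sbmM (sbm_boundary pf) (sbm_cj (sbm_boundary pf)).
  move=> z z1; rewrite fE (boundaryM pb pu) !mulcJ ncM.
  by rewrite {2}(u1_scale z) boundary_blaschke ?mul1r// -eucl_norm1.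
split; first exact: N.
move=> Xf; have QX := bo_stable bX Qu; have hX := qH2 qm QX.
have bz (z : 'rV[R[i]]_1) : en z < 1 -> nc (ext (blaschke a) z) <= 1.
  move=> z1; rewrite (u1_scale z) blaschkeE -?eucl_norm1// ncM ncV.
  have t1 : nc (z ord0 ord0) <= 1 by rewrite -eucl_norm1 ltW.
  by rewrite ler_pdivrMr ?nc_gt0 ?kern_neq0// mul1r blaschke_disc// ltW.
have [hm nm] := H2_mult n0 pb.1 ler01 bz hX.
have [_ cb] := commutes_palg n0 qm fd bX mX pb.
have L : H2norm (X f) <= H2norm (X u).
  have e1 : X f = proj Q (mult (blaschke a) (X u)).
    apply: (etrans _ (cb u Qu)); congr X.
    by rewrite -fE (proj_id n0 qm fd Qf).
  apply: le_trans (eq_to_le (congr1 H2norm e1)) _.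
  apply: le_trans (proj_norm n0 qm fd hm) _; by rewrite mul1r in nm.
apply/le_anti; rewrite (onorm_le n0 qm bX Qu) /= N -Xf.
exact: L.
Qed.

Definition extremal f := Q f /\ H2norm (X f) = s * H2norm f.

(** The kernel of s^2 - X^* X: a description of the extremal vectors in which linearity is
    visible. *)
Definition extremal_space := [set f | Q f /\ forall h, Q h -> H2dot (X f) (X h) = (s ^+ 2)%:C * H2dot f h].

Lemma extremal_spaceP f : extremal f <-> extremal_space f.
Proof.
split=> [[Qf Xf]|[Qf hf]]; split; try exact: Qf.
  by move=> h Qh; exact: (onorm_extremal n0 qm bX Qf Qh Xf).
have hQ := qH2 qm Qf; have hX := qH2 qm (bo_stable bX Qf).
have := hf f Qf; rewrite (dot_ff n0 hQ) (dot_ff n0 hX) -real_complexM => /complexI.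
rewrite -exprMn => /eqP; rewrite eqrXn2 ?H2norm_ge0 ?mulr_ge0 ?H2norm_ge0 ?(onorm_ge0 n0 qm bX)//.
by move=> /eqP.
Qed.

Lemma extremal_linear (c : C) f g : extremal_space f -> extremal_space g -> extremal_space (c *: f + g).
Proof.
move=> [Qf hf] [Qg hg]; split; first exact: (qm_linear qm).
move=> h Qh; have QXh := bo_stable bX Qh; have QXf := bo_stable bX Qf; have QXg := bo_stable bX Qg.
have hh := qH2 qm Qh; have hXh := qH2 qm QXh.
have e1 := congr1 (fun v => H2dot v (X h)) (bo_linear bX c Qf Qg).
apply: (etrans e1); apply: (etrans (dotDl n0 (H2Z n0 c (qH2 qm QXf)) (qH2 qm QXg) hXh)).
apply: (etrans (congr2 +%R (etrans (dotZl n0 c (qH2 qm QXf) hXh) (congr1 ( *%R c) (hf h Qh))) (hg h Qh))).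
apply: (etrans _ (congr1 ( *%R (s ^+ 2)%:C) (esym (dotDl n0 (H2Z n0 c (qH2 qm Qf)) (qH2 qm Qg) hh)))).
apply: (etrans _ (esym (mulrDr _ _ _))); congr (_ + _).
apply: (etrans (mulrCA _ _ _)).
exact: (congr1 ( *%R (s ^+ 2)%:C) (esym (dotZl n0 c (qH2 qm Qf) hh))).
Qed.

Lemma zero_free_extremal : exists2 e, extremal e /\ e <> 0 &
  forall t, nc t < 1 -> ext e (t *: u1) != 0.
Proof.
have [m [b [Qb hb]]] := fd; have h1 := H2_1 n0 : H2 (cst 1 : D1 -> C).
have V0 : extremal_space 0.
  by apply/extremal_spaceP; split; [exact: q0 qm|rewrite (op0 qm bX) (H2norm0 n0 qm) mulr0].
have VQ f : extremal_space f -> Q f by case.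
have [e Ve he] := subspace_proj n0 (fun f Vf => qH2 qm (VQ f Vf)) V0 extremal_linear (fun f Vf => hb f (VQ f Vf)) h1.
have Qe := VQ _ Ve; have hQe := qH2 qm Qe.
have e_dot f : extremal_space f -> H2dot e f = cj (ext f 0).
  move=> Vf; rewrite (he f Vf) -(H2dot_1 n0 (qH2 qm (VQ f Vf))).
  by rewrite (dot_cj n0 (qH2 qm (VQ f Vf)) h1).
have e_neq0 : e <> 0.
  (* If e = 0, all extremal vectors vanish at 0. Their shifts are then extremal too, by division by
     z, and so vanish at 0 as well; every Taylor coefficient of f is zero. *)
  move=> e0; have [f [Qf f0] Xf] := onorm_attained n0 qm fd bX.
  have Vf : extremal_space f by apply/extremal_spaceP.
  have z0 g : extremal_space g -> ext g 0 = 0.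
    move=> Vg; have := e_dot g Vg; rewrite e0.
    have e2 : H2dot (0 : D1 -> C) g = 0 by exact: (dot0l n0 (qH2 qm (VQ g Vg))).
    by rewrite e2 => /(congr1 cj); rewrite cjK cj0.
  have Vs g : extremal_space g -> extremal_space (shift g).
    move=> Vg; have Qg := VQ _ Vg; apply/extremal_spaceP; split; first exact: (shiftP Qg).1.
    have a0 : nc (0 : C) < 1 by rewrite nc0.
    apply: (blaschke_factor Qg (shiftP Qg).1 a0 _).2; last by have /extremal_spaceP[] := Vg.
    move=> t t1; rewrite cj0 mul0r subr0 mul1r subr0 (shift_ext Qg t1) (z0 g Vg) add0r.
    by [].
  have Vk k : extremal_space (iter k shift f) by elim: k => [|k ih]; [exact: Vf|exact: Vs].
  apply: f0; apply: (hc_eq0 n0 (H2_an (qH2 qm Qf))) => k w w1.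
  rewrite (u1_scale w) (hc_hom n0 k _ _ (H2_an (qH2 qm Qf))) (hc_shift k Qf).
  by rewrite (H2dot_1 n0 (qH2 qm (VQ _ (Vk k)))) (z0 _ (Vk k)) mulr0.
exists e; first by split=> //; apply/extremal_spaceP.
move=> a a1; apply/eqP => ea; have [u Qu hu] := blaschke_divide Qe a1 ea.
have [Nu Xu] := blaschke_factor Qe Qu a1 hu.
have Vu : extremal_space u.
  by apply/extremal_spaceP; split=> //; apply: Xu; have /extremal_spaceP[] := Ve.
have t0 : nc (0 : C) < 1 by rewrite nc0.
have E0 : ext e 0 = - a * ext u 0.
  have := hu 0 t0; rewrite mulr0 subr0 mul1r sub0r (_ : 0 *: u1 = 0)//.
  by rewrite scale0r.
have e0 : 0 < H2norm e ^+ 2.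
  rewrite exprn_gt0// lt_neqAle H2norm_ge0 andbT eq_sym; apply/eqP => /(H2norm_eq0 n0 hQe).
  exact: e_neq0.
(* From e(0) = -a u(0) one gets ||e||^2 = |a| |u(0)|, while |u(0)| = |<e, u>| <= ||e||^2; this
   contradicts |a| < 1. *)
have h2 : H2norm e ^+ 2 = nc a * nc (ext u 0).
  have := congr1 nc (e_dot e Ve); rewrite (dot_ff n0 hQe) nc_real ger0_norm ?sqr_ge0// nc_cj E0 ncM ncN.
  by [].
have h3 : nc (ext u 0) <= H2norm e ^+ 2.
  rewrite -nc_cj -(e_dot u Vu); apply: le_trans (dot_CS n0 hQe (qH2 qm Qu)) _.
  by rewrite Nu expr2.
have := ler_wpM2l (nc_ge0 a) h3; rewrite -h2 -subr_ge0 -{2}[H2norm e ^+ 2]mul1r -mulrBl.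
by rewrite pmulr_lge0// subr_ge0 leNgt a1.
Qed.

End extremal_vectors.

(** * Construction of the lift *)

Section lifting.
Implicit Types (f g h e u v d : D1 -> C) (p q : {poly C}) (t a c : C).

(** X carries the compression of f at e to that at X e, and extremality of e compares the two inner
    products. *)
Lemma extremal_moment e f : extremal e -> palg f ->
  H2dot (mult f (X e)) (X e) = (s ^+ 2)%:C * H2dot (mult f e) e.
Proof.
move=> Ve pf; have Qe := Ve.1; have Qg := bo_stable bX Qe.
have /extremal_spaceP[_ hV] := Ve.
have hme := palg_mult_H2 n0 pf (qH2 qm Qe); have hmg := palg_mult_H2 n0 pf (qH2 qm Qg).
have [Q1 h1] := projP n0 qm fd hme; have [Q2 h2] := projP n0 qm fd hmg.
have [_ cf] := commutes_palg n0 qm fd bX mX pf.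
have hX1 := qH2 qm (bo_stable bX Q1).
have E := congr1 cj (hV _ Q1).
have E1 : H2dot (X (proj Q (mult f e))) (X e) = (s ^+ 2)%:C * H2dot (proj Q (mult f e)) e.
  apply: (etrans (esym (dot_cj n0 (qH2 qm Qg) hX1))); apply: (etrans E).
  rewrite cjM cj_real; congr (_ * _); exact: (dot_cj n0 (qH2 qm Qe) (qH2 qm Q1)).
apply: (etrans (esym (h2 _ Qg))).
apply: (etrans (congr1 (fun v => H2dot v (X e)) (esym (cf e Qe)))); apply: (etrans E1).
exact: (congr1 ( *%R (s ^+ 2)%:C) (h1 _ Qe)).
Qed.

(** No information on X_Q is available in this direction. Instead D = |X e|^2 - s^2 |e|^2 is real
    and annihilates the disc algebra by [extremal_moment], so it integrates to zero against |X e|^2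
    and |e|^2, hence against itself. *)
Lemma extremal_circle e : extremal e ->
  forall z, en z = 1 -> nc (bd (X e) z) = s * nc (bd e z).
Proof.
move=> Ve z z1; have Qe := Ve.1; have Qg := bo_stable bX Qe.
have s0 := onorm_ge0 n0 qm bX.
have pe := q_palg n0 qm fd Qe; have pg := q_palg n0 qm fd Qg.
have se := sbm_boundary pe; have sg := sbm_boundary pg.
have see := sbmM se (sbm_cj se); have sgg := sbmM sg (sbm_cj sg).
pose D w := bd (X e) w * cj (bd (X e) w) - (s ^+ 2)%:C * (bd e w * cj (bd e w)).
have sD : sbm D := sbmB sgg (sbmZ _ see).
have DE w : D w = (nc (bd (X e) w) ^+ 2 - s ^+ 2 * nc (bd e w) ^+ 2)%:C.
  by rewrite /D !mulcJ -real_complexM -real_complexB.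
have Dreal w : cj (D w) = D w by rewrite DE cj_real.
have Dmom f : palg f -> cint (fun w => bd f w * D w) = 0.
  move=> pf; have sf := sbm_boundary pf.
  have -> : (fun w => bd f w * D w) = (fun w => bd f w * (bd (X e) w * cj (bd (X e) w)) -
      (s ^+ 2)%:C * (bd f w * (bd e w * cj (bd e w)))).
    by apply/funext => w; rewrite /D mulrBr [X in _ - X = _]mulrCA.
  rewrite (cintB n0 (sbmM sf sgg) (sbmZ _ (sbmM sf see))) (cintZ n0 _ (sbmM sf see)).
  rewrite (cint_bd_dot n0 pf pg pg) (cint_bd_dot n0 pf pe pe).
  by apply/eqP; rewrite subr_eq0; apply/eqP; exact: extremal_moment.
have m1 := moment_boundary sD Dreal Dmom pg pg; have m2 := moment_boundary sD Dreal Dmom pe pe.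
have DD0 : cint (fun w => D w * D w) = 0.
  have -> : (fun w => D w * D w) = (fun w => D w * bd (X e) w * cj (bd (X e) w) -
      (s ^+ 2)%:C * (D w * bd e w * cj (bd e w))).
    by apply/funext => w; rewrite {2}/D mulrBr !mulrA [D w * (s ^+ 2)%:C]mulrC.
  rewrite (cintB n0 (sbmM (sbmM sD sg) (sbm_cj sg)) (sbmZ _ (sbmM (sbmM sD se) (sbm_cj se)))).
  by rewrite (cintZ n0 _ (sbmM (sbmM sD se) (sbm_cj se))) m1 m2 mulr0 subr0.
have cD : scont D z.
  have ce := scont_boundary pe z1; have cg := scont_boundary pg z1.
  exact: (scontB (scontM cg (scont_cj cg)) (scontM (scont_cst _ z) (scontM ce (scont_cj ce)))).
have pos w : en w = 1 -> 0 <= D w * D w by move=> _; rewrite DE -real_complexM lecR -expr2 sqr_ge0.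
have := cint_eq0 n0 (sbmM sD sD) pos DD0 z1 (scontM cD cD).
rewrite -expr2 => /eqP; rewrite sqrf_eq0 DE => /eqP /complexI /eqP.
rewrite subr_eq0 -exprMn eqrXn2 ?nc_ge0 ?mulr_ge0 ?nc_ge0//.
by move=> /eqP.
Qed.

(** With d1 e = p1 and d2 X e = p2, the quotient X e / e is p2 d1 / (p1 d2), and these identities
    persist on the circle, where they give |p2 d1| = s |p1 d2|. *)
Lemma extremal_quotient_bound e : extremal e -> e <> 0 ->
  (forall t, nc t < 1 -> ext e (t *: u1) != 0) ->
  forall t, nc t < 1 -> nc (ext (X e) (t *: u1)) <= s * nc (ext e (t *: u1)).
Proof.
move=> Ve e_neq0 ez; have Qe := Ve.1; have Qg := bo_stable bX Qe.
have s0 := onorm_ge0 n0 qm bX.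
have pe := q_palg n0 qm fd Qe; have pg := q_palg n0 qm fd Qg.
have [d1 [p1 [d10 h1]]] := shift_rational Qe.
have [d2 [p2 [d20 h2]]] := shift_rational Qg.
(* Otherwise d1 would vanish on the whole disc, as e has no zeros there, for instance at more points
   1 / (i + 2) than its degree allows. *)
have p10 : p1 != 0.
  apply/eqP => p10; move/eqP: d10; apply; apply/eqP/negPn/negP => d1n.
  have [t t1 dt] : exists2 t, nc t < 1 & d1.[t] != 0.
    apply: contrapT => hn; have z t : nc t < 1 -> root d1 t.
      by move=> t1; apply/negPn/negP => rt; apply: hn; exists t.
    pose r (i : nat) : C := (i.+2%:R^-1 : R)%:C.
    have ri : injective r.
      by move=> i j /complexI /invr_inj /eqP; rewrite eqr_nat => /eqP [].
    have ha : all (root d1) [seq r i | i <- iota 0 (size d1)].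
      apply/allP => _ /mapP[i _ ->]; apply: z.
      by rewrite nc_real gtr0_norm ?invr_gt0// invf_lt1// ltr1n.
    have hu : uniq [seq r i | i <- iota 0 (size d1)] by rewrite map_inj_uniq// iota_uniq.
    by have := max_poly_roots d1n ha hu; rewrite size_map size_iota ltnn.
  by have := h1 t t1; rewrite p10 horner0 => /eqP; rewrite mulf_eq0 (negbTE dt) (negbTE (ez t t1)).
have bd_id (f : D1 -> C) (d' p' : {poly C}) (t : C) : palg f -> (forall t, nc t < 1 -> d'.[t] * ext f (t *: u1) = p'.[t]) ->
    nc t <= 1 -> d'.[t] * bd f (t *: u1) = p'.[t].
  move=> pf hf t1; have E : mult (hfun d') f = hfun p'.
    by apply: zero_extP1 => w w1; rewrite zero_extM !hfunE// hf.
  by have := boundaryM (palg_hfun d') pf (t *: u1); rewrite E !boundary_hfun.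
apply: (@rational_max (d2 * p1) (p2 * d1) e (X e) s).
- by rewrite mulf_neq0.
- exact: pe.
- exact: pg.
- exact: s0.
- exact: ez.
- by move=> t t1; rewrite !hornerM -(h1 t t1) -(h2 t t1); move: (ext _ _) (ext _ _) => x y; ring.
move=> t t1; have t1' : nc t <= 1 by rewrite t1.
rewrite !hornerM -(bd_id _ _ _ t pe h1 t1') -(bd_id _ _ _ t pg h2 t1') !ncM.
rewrite (extremal_circle Ve) ?u1_eucl//.
by move: (nc _) (nc _) (nc _) => x y w; ring.
Qed.

Lemma mul_quot (x y z : C) : x != 0 -> x * (y / x * z) = z * y.
Proof. by move=> x0; rewrite mulrA mulrCA divff// mulr1 mulrC. Qed.

(** The kernel of the compression of e is invariant under the compression of z. If nonzero, it
    contains an eigenvector u of the latter with eigenvalue al, and then 0 = P_Q(e u) = e(al) u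
    although e has no zero in the disc. *)
Lemma proj_mult_injective e d : palg e -> (forall t, nc t < 1 -> ext e (t *: u1) != 0) ->
  Q d -> proj Q (mult e d) = 0 -> d = 0.
Proof.
move=> pe ez Qd ed; apply: contrapT => d0; have [m [b [Qb hb]]] := fd.
pose N := [set f | Q f /\ proj Q (mult e f) = 0].
pose T f := proj Q (mult xfun f).
have NQ f : N f -> Q f by case.
have hx f : H2 f -> H2 (mult xfun f) by exact: (palg_mult_H2 n0 (@palg_xfun)).
have he f : H2 f -> H2 (mult e f) by exact: (palg_mult_H2 n0 pe).
have p0 : proj Q (0 : D1 -> C) = 0 by rewrite (proj_id n0 qm fd (q0 qm)).
have TQ f : Q f -> Q (T f) by move=> Qf; exact: (projP n0 qm fd (hx _ (qH2 qm Qf))).1.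
have Tl (c : C) f g : Q f -> Q g -> T (c *: f + g) = c *: T f + T g.
  move=> Qf Qg; have h1 := hx _ (qH2 qm Qf); have h2 := hx _ (qH2 qm Qg).
  rewrite /T multD multZ (projD n0 qm fd (H2Z n0 c h1) h2).
  by rewrite (projZ n0 qm fd c h1).
have N0 : N 0.
  split; first exact: q0 qm.
  have -> : mult e (0 : D1 -> C) = 0 by apply/funext => z; rewrite /mult mulr0.
  exact: p0.
have Nl (c : C) f g : N f -> N g -> N (c *: f + g).
  move=> [Qf hf] [Qg hg]; split; first exact: (qm_linear qm).
  have h1 := he _ (qH2 qm Qf); have h2 := he _ (qH2 qm Qg).
  rewrite multD multZ (projD n0 qm fd (H2Z n0 c h1) h2) (projZ n0 qm fd c h1) hf hg.
  by rewrite scaler0 addr0.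
have NT f : N f -> N (T f).
  move=> [Qf hf]; split; first exact: TQ.
  have hf2 := qH2 qm Qf.
  rewrite /T (proj_mult n0 qm fd pe (hx _ hf2)) multA (multC e) -multA.
  rewrite -(proj_mult n0 qm fd (@palg_xfun) (he _ hf2)) hf.
  have -> : mult xfun (0 : D1 -> C) = 0 by apply/funext => z; rewrite /mult mulr0.
  exact: p0.
have [u [al [[Qu hu] un0 Tu]]] := eigenvector N0 Nl (fun f Nf => hb f (NQ f Nf)) NT
  (fun c f g Nf Ng => Tl c f g (NQ f Nf) (NQ g Ng)) (conj Qd ed) d0.
have hu2 := qH2 qm Qu.
have up : 0 < H2norm u by rewrite lt_neqAle H2norm_ge0 andbT eq_sym; apply/eqP => /(H2norm_eq0 n0 hu2).
have up2 : 0 < H2norm u ^+ 2 by rewrite exprn_gt0.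
have Tk k : H2 (lin_pow u1 k u) /\ proj Q (lin_pow u1 k u) = al ^+ k *: u.
  elim: k => [|k [hk ih]]; first by rewrite expr0 scale1r; split; [exact: hu2|exact: (proj_id n0 qm fd Qu)].
  split; first exact: hx.
  rewrite /lin_pow iterS -/(lin_pow u1 k u).
  apply: (etrans (esym (proj_mult n0 qm fd (@palg_xfun) hk))).
  apply: (etrans (congr1 (fun v => proj Q (mult xfun v)) ih)).
  rewrite multZ (projZ n0 qm fd _ (hx _ hu2)).
  apply: (etrans (congr1 (fun v => al ^+ k *: v) Tu)).
  by rewrite scalerA exprSr.
have [q /andP[q_ge0 q1] hq] := Ae_decay n0 qm fd.
(* From al^k ||u||^2 = <u, S^k u> and the decay of S^k, |al|^k <= 2 q^k for all k, hence |al| <=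
   q. *)
have al1 : nc al < 1.
  apply: le_lt_trans q1; apply: (@pow_le_bound _ _ _ 2 (nc_ge0 al) q_ge0) => k.
  have [hk pk] := Tk k; have [QA hA] := Ae_iterP n0 qm k (@u1_norm) Qu.
  have E : al ^+ k * H2dot u u = H2dot u (iter k (Ae Q u1) u).
    apply: (etrans (esym (dotZl n0 (al ^+ k) hu2 hu2))).
    apply: (etrans (congr1 (fun v => H2dot v u) (esym pk))).
    apply: (etrans ((projP n0 qm fd hk).2 u Qu)); exact: (hA _ hu2).
  have := congr1 nc E; rewrite (dot_ff n0 hu2) ncM ncX nc_real ger0_norm ?(ltW up2)// => E2.
  have := dot_CS n0 hu2 (qH2 qm QA); rewrite -E2 => L.
  have L2 := le_trans L (ler_wpM2l (H2norm_ge0 u) (hq _ _ k (@u1_norm) Qu)).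
  rewrite -(ler_pM2r up2); apply: (le_trans L2); apply: eq_to_le.
  by rewrite expr2; move: (H2norm u) (q ^+ k) => x y; ring.
(* Polynomials act on the eigenvector by evaluation at al, since compressions are multiplicative. *)
have hp P : ispoly P -> proj Q (mult (pfun P) u) = P (al *: u1) *: u.
  move=> pP; suff [_ _ E] : [/\ palg (pfun P), H2 (mult (pfun P) u) & proj Q (mult (pfun P) u) = P (al *: u1) *: u] by exact: E.
  move: P pP; apply: mpoly_ind_closed.
  - move=> c; have -> : mult (pfun (fun=> c)) u = c *: u by [].
    by split; [exact: palg_cst|exact: (H2Z n0)|rewrite (projZ n0 qm fd c hu2) (proj_id n0 qm fd Qu)].
  - move=> i; rewrite (ord1 i) u1_coord; split; [exact: palg_coord|exact: (H2_coord n0)|].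
    by apply: (etrans _ Tu); rewrite /T xfun_coord.
  - move=> F G [p1 h1 e1] [p2 h2 e2].
    have -> : mult (pfun (fun z => F z + G z)) u = mult (pfun F) u + mult (pfun G) u by exact: multDl.
    by split; [exact: palgD|exact: (H2D n0)|rewrite (projD n0 qm fd h1 h2) e1 e2 scalerDl].
  - move=> F G [p1 h1 e1] [p2 h2 e2].
    have -> : mult (pfun (fun z => F z * G z)) u = mult (pfun F) (mult (pfun G) u) by rewrite multA.
    split; [exact: palgM|exact: (palg_mult_H2 n0 p1 h2)|].
    apply: (etrans (esym (proj_mult n0 qm fd p1 h2))).
    apply: (etrans (congr1 (fun v => proj Q (mult (pfun F) v)) e2)).
    rewrite multZ (projZ n0 qm fd _ h1) e1 scalerA; congr (_ *: u); exact: mulrC.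
have /eqP[] := ez al al1; apply: (@nc_le_scale _ _ 2) => // eps eps0.
have [P pP hP] := pe.2 _ eps0.
have aeP := palgB pe (palg_pfun pP).
have [hm nm] : H2 (mult (e - pfun P) u) /\ H2norm (mult (e - pfun P) u) <= eps * H2norm u.
  apply: (H2_mult n0 aeP.1 (ltW eps0) _ hu2) => z z1.
  by rewrite zero_extB zero_ext_pfun//; exact: hP.
have z01 : en (al *: u1) < 1 by rewrite u1_eucl.
have E : P (al *: u1) *: u = - proj Q (mult (e - pfun P) u).
  rewrite -(hp P pP) -sub0r -hu multBl -[- mult (pfun P) u]scaleN1r.
  have h1 := palg_mult_H2 n0 pe hu2; have h2 := palg_mult_H2 n0 (palg_pfun pP) hu2.
  rewrite (projD n0 qm fd h1 (H2Z n0 (-1) h2)) (projZ n0 qm fd (-1) h2) scaleN1r.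
  by rewrite opprD opprK addNKr.
have b1 : nc (P (al *: u1)) <= eps.
  rewrite -(ler_pM2r up) -(H2normZ n0 _ hu2) E -scaleN1r.
  rewrite (H2normZ n0 _ (qH2 qm (projP n0 qm fd hm).1)) ncN nc1 mul1r.
  exact: le_trans (proj_norm n0 qm fd hm) nm.
have -> : ext e (al *: u1) = (ext e (al *: u1) - P (al *: u1)) + P (al *: u1) by rewrite subrK.
apply: le_trans (ncD _ _) _; rewrite mulr_natr mulr2n; exact: lerD (hP _ z01) b1.
Qed.

Lemma norm_preserving_lift : nonconstant Q X -> (op_norm Q X <= 1)%E ->
  exists phi : D1 -> C, [/\ schur_class phi, forall f, Q f -> X f = compression Q phi f & op_norm Q X = sup_norm phi].
Proof.
move=> ncX X1; have s0 := onorm_gt0 n0 qm bX ncX.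
have [e [Ve e_neq0] ez] := zero_free_extremal.
have Qe := Ve.1; have Qg := bo_stable bX Qe; set g := X e in Qg.
have pe := q_palg n0 qm fd Qe; have pg := q_palg n0 qm fd Qg.
have ez' z : en z < 1 -> ext e z != 0.
  by move=> z1; rewrite (u1_scale z); apply: ez; rewrite -eucl_norm1.
pose phi : D1 -> C := fun z => g z / e z.
have aphi : analytic phi := analytic_quotient pg.1 pe.1 ez'.
have phiE z : en z < 1 -> ext phi z = ext g z / ext e z.
  by move=> z1; rewrite !(zero_ext_in _ z1).
have phib z : en z < 1 -> nc (ext phi z) <= s.
  move=> z1; rewrite (phiE z z1) ncM ncV ler_pdivrMr ?nc_gt0 ?ez'//.
  rewrite (u1_scale z); apply: (extremal_quotient_bound Ve e_neq0 ez).
  by rewrite -eucl_norm1.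
have sup_le : (sup_norm phi <= s%:E)%E.
  apply: ub_ereal_sup => _ [z _ <-]; rewrite lee_fin -zero_ext_val; apply: phib.
  exact: (valP z).
have hphi : forall f, Q f -> X f = compression Q phi f.
  move=> f Qf; have pf := q_palg n0 qm fd Qf; have hf := qH2 qm Qf.
  have [hm _] := H2_mult n0 aphi (ltW s0) phib hf.
  have [Qp _] := projP n0 qm fd hm; have QX := bo_stable bX Qf.
  apply/eqP; rewrite -subr_eq0; apply/eqP; rewrite /compression.
  (* It suffices to compare after compression by e: P_Q(e X f) = X P_Q(e f) = P_Q(f X e) = P_Q(e phi
     f). *)
  apply: (proj_mult_injective pe ez (qB qm QX Qp)).
  have [_ ce] := commutes_palg n0 qm fd bX mX pe; have [_ cf] := commutes_palg n0 qm fd bX mX pf.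
  have E1 : proj Q (mult e (X f)) = proj Q (mult f g).
    by apply: (etrans (esym (ce f Qf))); rewrite (multC e); exact: (cf e Qe).
  have E2 : proj Q (mult e (proj Q (mult phi f))) = proj Q (mult f g).
    apply: (etrans (proj_mult n0 qm fd pe hm)); congr (proj Q _).
    apply/funext => w; have := ez' (val w) (valP w); rewrite zero_ext_val => ew.
    exact: (mul_quot (g w) (f w) ew).
  rewrite multB -[- mult e _]scaleN1r.
  have h1 := palg_mult_H2 n0 pe (qH2 qm QX); have h2 := palg_mult_H2 n0 pe (qH2 qm Qp).
  rewrite (projD n0 qm fd h1 (H2Z n0 (-1) h2)) (projZ n0 qm fd (-1) h2) E1 E2.
  by rewrite scaleN1r subrr.
have supE : sup_norm phi = s%:E.
  apply/le_anti; rewrite sup_le /=.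
  have sup_ge0 : (0%:E <= sup_norm phi)%E.
    have z0 : en (0 : C1) < 1 by rewrite eucl_norm0.
    apply: (@le_trans _ _ (nc (phi (Sub 0 z0)))%:E); first by rewrite lee_fin nc_ge0.
    by apply: ereal_sup_ubound; exists (Sub 0 z0).
  have fin : sup_norm phi \is a fin_num.
    rewrite fin_numElt (lt_le_trans (ltNyr 0) sup_ge0) /=.
    exact: le_lt_trans sup_le (ltry _).
  rewrite -(fineK fin) lee_fin; set B := fine (sup_norm phi).
  have B0 : 0 <= B by rewrite -lee_fin /B fineK.
  apply: (onorm_sup n0 qm bX B0) => f Qf; rewrite (hphi f Qf) /compression.
  have phiB : forall z, en z < 1 -> nc (ext phi z) <= B.
    by apply: sup_norm_le; rewrite /B fineK.
  have [hm nm] := H2_mult n0 aphi B0 phiB (qH2 qm Qf).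
  exact: le_trans (proj_norm n0 qm fd hm) nm.
exists phi; split; [|exact: hphi|by rewrite (op_normE n0 qm bX) supE].
by split; [exact: aphi|rewrite supE -(op_normE n0 qm bX)].
Qed.

End lifting.

End disc_module_maps.
End disc_quotient_modules.
End disc.

Theorem theorem6 (R : realType) (n : nat) (Q : set (unit_ball R n -> R[i]))
  (X : (unit_ball R n -> R[i]) -> (unit_ball R n -> R[i])) :
  (1 <= n)%N ->
  quotient_module Q ->
  finite_dimensional Q ->
  operator_ball Q X ->
  module_map Q X ->
  nonconstant Q X ->
  [<-> (exists phi : unit_ball R n -> R[i],
          [/\ schur_class phi,
              forall f, Q f -> X f = compression Q phi f
            & op_norm Q X = sup_norm phi]);
       op_norm Q X = functional_norm (MQ Q) (XQ Q X);
       n = 1%N].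
Proof.
move=> n0 qm fd [bX X1] mX ncX; split.
  exact: (lift_norm_eq n0 qm fd bX mX ncX).
split=> [hn|n1].
  apply: (norm_eq_dimension n0 qm fd bX mX ncX).
  by rewrite -hn (op_normE n0 qm bX).
by subst n; exact: (norm_preserving_lift qm fd bX mX ncX X1).
Qed.
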